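(* Let $\sigma_0,\delta,\nu\in(0,1)$, $\kappa\ge1$, $K_0\ge1$ and $\varepsilon\in(0,1)$. Let $\xi$ be a $\kappa$-spread complex random variable with mean zero and variance one. Let $\Sigma=(\sigma_{ij})$ be a deterministic $n\times n$ matrix with entries $\sigma_{ij}\in[0,1]$ that is $(\sigma_0,\delta,\nu)$-broadly connected, let $Z=(z_{ij})$ be a deterministic $n\times n$ complex matrix, let $X=(\xi_{ij})$ be an $n\times n$ matrix with i.i.d. entries distributed as $\xi$, and put $M=\Sigma\circ X+Z=(\sigma_{ij}\xi_{ij}+z_{ij})$. There are constants $a_0,a_1,a_2>0$ depending (polynomially) only on $\kappa,\sigma_0,\delta,\nu,K_0$, and a constant $C>0$ depending only on $\kappa,\sigma_0,\delta,\nu,K_0$ and $\varepsilon$, such that $$\mathbb{P}\Big(\exists\, k\in[n^{2\varepsilon},a_1n]\cap\mathbb{Z}:\ s_{n-k}(M)<a_2\frac{k}{\sqrt n}\,,\ \text{ and }\ \|M\|\le K_0\sqrt n\Big)\le C\exp(-a_0n^{\varepsilon}).$$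
   Context: $\circ$ is the entrywise (Hadamard) product; $\|M\|$ is the $\ell^2\to\ell^2$ operator norm; $s_1(M)\ge\dots\ge s_n(M)$ are the ordered singular values of $M$. The constants are uniform over $n$, $\xi$, $\Sigma$ and $Z$ satisfying the stated hypotheses with the given parameters. A complex random variable $\xi$ is $\kappa$-spread ($\kappa\ge1$) if $\mathrm{Var}\big[\xi\,\mathbb{1}(|\xi-\mathbb{E}\xi|\le\kappa)\big]\ge 1/\kappa$. For a non-negative $n\times m$ matrix $\Sigma=(\sigma_{ij})$ and $\sigma_0>0$, let $\Sigma(\sigma_0)=(\sigma_{ij}1_{\sigma_{ij}\ge\sigma_0})$. For a non-negative matrix $\Sigma$ with rows indexed by $[n]$ and columns by $[m]$, put $\mathcal{N}_\Sigma(i)=\{j\in[m]:\sigma_{ij}>0\}$ for $i\in[n]$, so that $\mathcal{N}_{\Sigma^{\mathsf T}}(j)=\{i\in[n]:\sigma_{ij}>0\}$ for $j\in[m]$. For $J\subset[m]$ and $\delta\in(0,1)$ put $\mathcal{N}^{(\delta)}_{\Sigma^{\mathsf T}}(J)=\{i\in[n]:|\mathcal{N}_\Sigma(i)\cap J|\ge\delta|J|\}$. An $n\times m$ matrix $\Sigma$ with entries in $[0,1]$ is $(\sigma_0,\delta,\nu)$-broadly connected if: (1) $|\mathcal{N}_{\Sigma(\sigma_0)}(i)|\ge\delta m$ for all $i\in[n]$; (2) $|\mathcal{N}_{\Sigma(\sigma_0)^{\mathsf T}}(j)|\ge\delta n$ for all $j\in[m]$; (3) $|\mathcal{N}^{(\delta)}_{\Sigma(\sigma_0)^{\mathsf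 T}}(J)|\ge\min(n,(1+\nu)|J|)$ for all $J\subset[m]$. Here this is used with $m=n$.
   Formalization: The constants a_0, a_1, a_2 are shown to be polynomial in κ, σ_0, K_0 only, with coefficient and exponent depending arbitrarily on δ, ν; joint polynomial dependence on δ, ν as well is false, as Gaussian matrices with a block-Hessenberg Σ show. *)

(* Defs.v *)
From HB Require Import structures.
From mathcomp Require Import all_boot all_order all_algebra.
From mathcomp Require Import complex.
From mathcomp Require Import all_classical all_reals all_analysis.

Set Implicit Arguments.
Unset Strict Implicit.
Unset Printing Implicit Defensive.
Import Order.TTheory GRing.Theory Num.Theory.
Local Open Scope classical_set_scope.
Local Open Scope ring_scope.

(* Complex random variables are functions X : T -> R[i]; the Borel structure  *)
(* on R[i] is that of the measurable type R * R, transported along [cpair].   *)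

Definition cpair (R : realType) (z : R[i]) : R * R :=
  (complex.Re z, complex.Im z).

Definition cmeasurable d (T : measurableType d) (R : realType)
    (X : T -> R[i]) : Prop :=
  measurable_fun setT (@cpair R \o X).

Definition same_law d (T : measurableType d) d' (T' : measurableType d')
    (R : realType) (P : probability T R) (P' : probability T' R)
    (X : T -> R[i]) (Y : T' -> R[i]) : Prop :=
  forall A : set (R * R), measurable A ->
    P ((@cpair R \o X) @^-1` A) = P' ((@cpair R \o Y) @^-1` A).

Definition cindependent d (T : measurableType d) (R : realType)
    (P : probability T R) (I : finType) (X : I -> T -> R[i]) : Prop :=
  forall (J : {set I}) (A : I -> set (R * R)), (forall i, measurable (A i)) ->
    P (\bigcap_(i in [set` J]) (@cpair R \o X i) @^-1` A i) =
    (\prod_(i in J) P ((@cpair R \o X i) @^-1` A i))%E.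

Definition cmean d (T : measurableType d) (R : realType)
    (P : probability T R) (X : T -> R[i]) : R[i] :=
  (fine 'E_P[fun w => complex.Re (X w)] +i*
   fine 'E_P[fun w => complex.Im (X w)])%C.

(* Extended-real valued: for measurable X, a finite value forces X to be      *)
(* square-integrable, so that [cmean] is then the genuine mean.               *)
Definition cvar d (T : measurableType d) (R : realType)
    (P : probability T R) (X : T -> R[i]) : \bar R :=
  'E_P[fun w => ComplexField.Normc.normc (X w - cmean P X) ^+ 2].

Definition spread d (T : measurableType d) (R : realType)
    (P : probability T R) (kappa : R) (X : T -> R[i]) : Prop :=
  ((kappa^-1)%:E <= cvar P (fun w =>
     if ComplexField.Normc.normc (X w - cmean P X)%R <= kappa
     then X w else 0)%R)%E.

Definition l2norm (R : realType) n (v : 'cV[R[i]]_n) : R :=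
  Num.sqrt (\sum_(i < n) ComplexField.Normc.normc (v i 0) ^+ 2).

Definition opnorm (R : realType) m n (M : 'M[R[i]]_(m, n)) : R :=
  sup [set l2norm (M *m v) | v in [set v : 'cV[R[i]]_n | l2norm v <= 1]].

(* Square roots of the eigenvalues of M^* M, with multiplicity, in            *)
(* nonincreasing order.                                                       *)
Definition singular_values (R : realType) n (M : 'M[R[i]]_n) : seq R :=
  sort (fun x y : R => y <= x)
    [seq Num.sqrt (complex.Re (spectral_diag (M ^t* *m M)%sesqui 0 i))
       | i <- enum 'I_n].

(* s_k(M) for 1 <= k <= n: the indexing is 1-based.                           *)
Definition singular_value (R : realType) n (M : 'M[R[i]]_n) (k : nat) : R :=
  nth 0 (singular_values M) k.-1.

Definition threshold (R : realType) n m (sigma0 : R) (S : 'M[R]_(n, m)) :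
    'M[R]_(n, m) :=
  \matrix_(i, j) (if sigma0 <= S i j then S i j else 0).

Definition nbhd (R : realType) n m (S : 'M[R]_(n, m)) (i : 'I_n) : {set 'I_m} :=
  [set j | 0 < S i j]%SET.

(* The set N^(delta)_{S^T}(J) of rows of S.                                   *)
Definition dnbhd (R : realType) n m (delta : R) (S : 'M[R]_(n, m))
    (J : {set 'I_m}) : {set 'I_n} :=
  [set i | delta * #|J|%:R <= #|nbhd S i :&: J|%:R]%SET.

Definition broadly_connected (R : realType) n m (sigma0 delta nu : R)
    (S : 'M[R]_(n, m)) : Prop :=
  let S0 := threshold sigma0 S in
  [/\ forall i j, 0 <= S i j <= 1,
      forall i : 'I_n, delta * m%:R <= #|nbhd S0 i|%:R,
      forall j : 'I_m, delta * n%:R <= #|nbhd S0^T j|%:R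
    & forall J : {set 'I_m},
        Num.min n%:R ((1 + nu) * #|J|%:R) <= #|dnbhd delta S0 J|%:R].

Definition structured (R : realType) n m (S : 'M[R]_(n, m))
    (X Z : 'M[R[i]]_(n, m)) : 'M[R[i]]_(n, m) :=
  \matrix_(i, j) ((S i j)%:C%C * X i j + Z i j).

(* Main.v *)
(** If s_(n-k)(M) < t there is a (k+1)-dimensional space of left vectors on which M is
    at most t. Cutting it down to the first n - k/2 coordinates and testing it, for each
    row i, against an isometric frame U_i of k/2 + 1 vectors in the kernel of the other
    of these rows, one gets sum_i t^2 / |R_i U_i|^2 >= k/2. Since R_i is independent of
    U_i, the small ball estimate P(|R_i U_i|^2 <= c rho k) <= exp (- c rho k) holds as soon
    as the frame has mass at least rho k on the neighbours of i, and this contradicts the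
    previous bound for t of order k / sqrt n.

    It remains to show that with probability 1 - exp(-cn) no k-frame almost annihilated by
    M is concentrated on (1 - delta/2) n coordinates. This goes by increasing the support:
    very sparse vectors are excluded by a net, and if a frame lives on a set J but on no
    smaller one then by broad connectivity at least (1 + nu)|J| rows see a fixed proportion
    of its mass. A random vector of the frame is then, for most of these rows, a genuinely
    two-dimensional small ball problem with small coefficients, with probability of order
    r^2 at scale r; since the net has real dimension 2|J| and there are (1 + nu)|J| rows,
    the union bound succeeds. The support grows by a factor 1 + delta/4 per step, so that
    the number of steps depends on delta only and the constants stay polynomial.

    All this is done on a finite product space, after rounding the entries to a fine grid:
    the events are open or closed in the matrix entries, hence measurable and stable. *)
Require Import Defs.
From HB Require Import structures.
From mathcomp Require Import all_boot all_order all_algebra.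
From mathcomp Require Import complex.
From mathcomp Require Import boolp reals sequences exp trigo.
From mathcomp Require classical_sets topology normedtype derive realfun.
From mathcomp Require Import ring lra zify.

Set Implicit Arguments.
Unset Strict Implicit.
Unset Printing Implicit Defensive.
Import Order.TTheory GRing.Theory Num.Theory.
Local Open Scope ring_scope.

(** * Complex matrices *)

(** The obstacle is the entropy of nets of complex vectors: a lattice of mesh r on m complex
    coordinates costs r^(-2m), so each of the slightly more than m available rows must pay a factor
    r^2. A fixed vector may fail this: with real coefficients and real entries a row sum stays on a
    line and pays only r. A combination of the k columns of a frame with random fourth roots of
    unity has pseudo-variance of order k^(1/2) against a mass of order k, so it is two-dimensional
    on most rows once k exceeds a constant. The surplus of nu |J| rows pays for the constants: the
    scale r is g^(-e) up to parameters, with e of order 1/nu, so that the surplus gains a fixed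
    power of g for each coordinate. Finiteness of the probability space lets kernel frames be picked
    by choice, since every predicate is an event. Unbounded entries are cut at a level exponential
    in n, whose tail is negligible. *)

Definition sqn (R : realType) (z : R[i]) : R :=
  complex.Re z ^+ 2 + complex.Im z ^+ 2.

Definition nrm2 (R : realType) m n (A : 'M[R[i]]_(m, n)) : R :=
  \sum_(i < m) \sum_(j < n) sqn (A i j).

(** The columns are orthonormal, so [U] is an n-frame of m-dimensional space. The form by norms
    composes at once and passes to products [U *m V]. *)
Definition isometric (R : realType) m n (U : 'M[R[i]]_(m, n)) : Prop :=
  forall g : 'cV_n, nrm2 (U *m g) = nrm2 g.

Section Squares.
Variable R : realType.
Implicit Types z w : R[i].

Lemma sqn_ge0 z : 0 <= sqn z.
Proof. by rewrite addr_ge0 ?sqr_ge0. Qed.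

Lemma sqn0 : sqn (0 : R[i]) = 0.
Proof. by rewrite /sqn /= expr0n addr0. Qed.

Lemma sqn1 : sqn (1 : R[i]) = 1.
Proof. by rewrite /sqn /= expr0n addr0 expr1n. Qed.

Lemma sqnM z w : sqn (z * w) = sqn z * sqn w.
Proof. case: z w => [a b] [c d]; rewrite /sqn /=; ring. Qed.

Lemma sqnN z : sqn (- z) = sqn z.
Proof. case: z => [a b]; rewrite /sqn /=; ring. Qed.

Lemma sqn_conj z : sqn z^*%C = sqn z.
Proof. case: z => [a b]; rewrite /sqn /=; ring. Qed.

Lemma sqn_real (a : R) : sqn a%:C%C = a ^+ 2.
Proof. by rewrite /sqn /= expr0n addr0. Qed.

Lemma sqn_eq0 z : sqn z = 0 -> z = 0.
Proof.
case: z => a b /eqP; rewrite /sqn /= paddr_eq0 ?sqr_ge0 // !sqrf_eq0.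
by case/andP => /eqP -> /eqP ->.
Qed.

Lemma normc_sqr z : ComplexField.Normc.normc z ^+ 2 = sqn z.
Proof. by case: z => a b; rewrite /= sqr_sqrtr // addr_ge0 ?sqr_ge0. Qed.

Lemma normcE z : ComplexField.Normc.normc z = Num.sqrt (sqn z).
Proof. by case: z. Qed.

Lemma sqnD_le z w : sqn (z + w) <= 2 * sqn z + 2 * sqn w.
Proof.
rewrite -subr_ge0 (_ : _ - _ = sqn (z - w)) ?sqn_ge0 //.
by case: z w => [a b] [c d]; rewrite /sqn /=; ring.
Qed.

Lemma mul_conjC z : z * z^*%C = (sqn z)%:C%C.
Proof. by case: z => a b; apply/eqP; rewrite eq_complex /sqn /=; apply/andP; split; apply/eqP; ring. Qed.

Lemma Re_add z w : complex.Re (z + w) = complex.Re z + complex.Re w.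
Proof. by case: z w => [a b] [c d]. Qed.

Lemma Im_add z w : complex.Im (z + w) = complex.Im z + complex.Im w.
Proof. by case: z w => [a b] [c d]. Qed.

Lemma Re_sum (I : Type) (r : seq I) (P : pred I) (F : I -> R[i]) :
  complex.Re (\sum_(i <- r | P i) F i) = \sum_(i <- r | P i) complex.Re (F i).
Proof. by apply: (big_morph _ Re_add). Qed.

Lemma conj_sum (I : Type) (r : seq I) (P : pred I) (F : I -> R[i]) :
  (\sum_(i <- r | P i) F i)^*%C = \sum_(i <- r | P i) (F i)^*%C.
Proof.
apply: (big_morph (fun z : R[i] => z^*%C)).
  by move=> x y; rewrite rmorphD.
by rewrite conjc0.
Qed.

Lemma nrm2_ge0 m n (A : 'M[R[i]]_(m, n)) : 0 <= nrm2 A.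
Proof. by apply: sumr_ge0 => i _; apply: sumr_ge0 => j _; exact: sqn_ge0. Qed.

Lemma nrm2_eq0 m n (A : 'M[R[i]]_(m, n)) : nrm2 A = 0 -> A = 0.
Proof.
move=> h; apply/matrixP => i j; rewrite mxE; apply: sqn_eq0.
have h1 : \sum_(j < n) sqn (A i j) = 0.
  by apply: (psumr_eq0P _ h) => // l _; apply: sumr_ge0 => *; exact: sqn_ge0.
by apply: (psumr_eq0P _ h1) => // l _; exact: sqn_ge0.
Qed.

(** With [A], [B] the two square sums and [z] the pairing, the sum of the [sqn] of A b_i - conj(a_i)
    z is nonnegative and equals A (A B - sqn z). The case A = 0 is separate. *)
Lemma cauchy_schwarz (I : finType) (P : pred I) (a b : I -> R[i]) :
  sqn (\sum_(i | P i) a i * b i) <=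
  (\sum_(i | P i) sqn (a i)) * (\sum_(i | P i) sqn (b i)).
Proof.
set z := \sum_(i | P i) _; set A := \sum_(i | P i) sqn (a i).
set B := \sum_(i | P i) sqn (b i).
have A0 : 0 <= A by apply: sumr_ge0 => i _; exact: sqn_ge0.
have key : 0 <= A * (A * B - sqn z).
  have : 0 <= \sum_(i | P i) sqn (A%:C%C * b i - (a i)^*%C * z).
    by apply: sumr_ge0 => i _; exact: sqn_ge0.
  rewrite (eq_bigr (fun i => A ^+ 2 * sqn (b i) + sqn z * sqn (a i)
     - 2 * A * complex.Re (a i * b i * z^*%C))); last first.
    move=> i _; case: (a i) (b i) z => [a1 a2] [b1 b2] [z1 z2].
    by rewrite /sqn /=; ring.
  rewrite sumrB big_split /= -!mulr_sumr -/A -/B -Re_sum -mulr_suml -/z mul_conjC /=.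
  by move=> h; apply: le_trans h _; lra.
have [A00|A1] := eqVneq A 0; last first.
  by move: key; rewrite pmulr_rge0 ?subr_ge0 // lt_neqAle eq_sym A1.
suff -> : z = 0 by rewrite sqn0 A00 mul0r.
apply: big1 => i Pi; have/eqP := A00.
rewrite psumr_eq0; last by move=> j _; exact: sqn_ge0.
move=> /allP /(_ i (mem_index_enum _)); rewrite Pi => /eqP /sqn_eq0 ->.
by rewrite mul0r.
Qed.

Lemma nrm2_mul m n p (A : 'M[R[i]]_(m, n)) (B : 'M[R[i]]_(n, p)) :
  nrm2 (A *m B) <= nrm2 A * nrm2 B.
Proof.
rewrite /nrm2 mulr_suml; apply: ler_sum => i _.
rewrite [X in _ * X]exchange_big /= mulr_sumr; apply: ler_sum => j _.
by rewrite mxE; apply: cauchy_schwarz.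
Qed.

Lemma nrm20 m n : nrm2 (0 : 'M[R[i]]_(m, n)) = 0.
Proof. by rewrite /nrm2 big1 // => i _; rewrite big1 // => j _; rewrite mxE sqn0. Qed.

Lemma nrm2Z m n (c : R[i]) (A : 'M[R[i]]_(m, n)) : nrm2 (c *: A) = sqn c * nrm2 A.
Proof.
rewrite /nrm2 mulr_sumr; apply: eq_bigr => i _; rewrite mulr_sumr.
by apply: eq_bigr => j _; rewrite mxE sqnM.
Qed.

Lemma nrm2N m n (A : 'M[R[i]]_(m, n)) : nrm2 (- A) = nrm2 A.
Proof. by apply: eq_bigr => i _; apply: eq_bigr => j _; rewrite mxE sqnN. Qed.

Lemma nrm2_tr m n (A : 'M[R[i]]_(m, n)) : nrm2 A^T = nrm2 A.
Proof.
rewrite /nrm2 exchange_big; apply: eq_bigr => i _; apply: eq_bigr => j _.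
by rewrite mxE.
Qed.

Lemma nrm2_conj m n (A : 'M[R[i]]_(m, n)) : nrm2 (map_mx conjc A) = nrm2 A.
Proof. by apply: eq_bigr => i _; apply: eq_bigr => j _; rewrite mxE sqn_conj. Qed.

Lemma nrm2D_le m n (A B : 'M[R[i]]_(m, n)) :
  nrm2 (A + B) <= 2 * nrm2 A + 2 * nrm2 B.
Proof.
rewrite /nrm2 !mulr_sumr -big_split /=; apply: ler_sum => i _.
rewrite !mulr_sumr -big_split /=; apply: ler_sum => j _.
by rewrite mxE sqnD_le.
Qed.

Lemma nrm2_cV n (v : 'cV[R[i]]_n) : nrm2 v = \sum_i sqn (v i 0).
Proof. by apply: eq_bigr => i _; rewrite big_ord1. Qed.

Lemma nrm2_rV n (v : 'rV[R[i]]_n) : nrm2 v = \sum_i sqn (v 0 i).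
Proof. by rewrite /nrm2 big_ord1. Qed.

Lemma nrm2_adj n p (A : 'M[R[i]]_(n, p)) : (nrm2 A)%:C%C = \tr (A^T *m map_mx conjc A).
Proof.
rewrite /nrm2 /mxtrace exchange_big /= (big_morph (real_complex R) (rmorphD _) (rmorph0 _)).
apply: eq_bigr => i _; rewrite mxE (big_morph (real_complex R) (rmorphD _) (rmorph0 _)).
by apply: eq_bigr => j _; rewrite !mxE mul_conjC.
Qed.

Lemma isometricP m n (U : 'M[R[i]]_(m, n)) :
  U^T *m map_mx conjc U = 1%:M -> isometric U.
Proof.
move=> h g; apply: complexI; rewrite !nrm2_adj map_mxM trmx_mul mulmxA.
by rewrite -(mulmxA g^T) h mulmx1.
Qed.

Lemma isometric_mul m n p (U : 'M[R[i]]_(m, n)) (V : 'M[R[i]]_(n, p)) :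
  isometric U -> isometric V -> isometric (U *m V).
Proof. by move=> hU hV g; rewrite -mulmxA hU hV. Qed.

Lemma isometric_mulmx m n p (U : 'M[R[i]]_(m, n)) (V : 'M[R[i]]_(n, p)) :
  isometric U -> nrm2 (U *m V) = nrm2 V.
Proof.
move=> hU; rewrite -[LHS]nrm2_tr -[RHS]nrm2_tr /nrm2; apply: eq_bigr => i _.
have := hU (col i V); rewrite !nrm2_cV => h.
transitivity (\sum_j sqn ((U *m col i V) j 0)).
  by apply: eq_bigr => j _; rewrite !mxE; congr sqn; apply: eq_bigr => a _; rewrite !mxE.
by rewrite h; apply: eq_bigr => j _; rewrite !mxE.
Qed.

Lemma isometric_nrm2 m n (U : 'M[R[i]]_(m, n)) : isometric U -> nrm2 U = n%:R.
Proof.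
move=> hU; rewrite -[U]mulmx1 isometric_mulmx // /nrm2.
transitivity (\sum_(i < n) (1 : R)); last by rewrite sumr_const card_ord.
apply: eq_bigr => i _; rewrite (bigD1 i) //= !mxE eqxx sqn1 big1 ?addr0 // => j ji.
by rewrite !mxE eq_sym (negbTE ji) sqn0.
Qed.

Definition rown m n (U : 'M[R[i]]_(m, n)) (j : 'I_m) : R := \sum_a sqn (U j a).

Lemma rown_ge0 m n (U : 'M[R[i]]_(m, n)) j : 0 <= rown U j.
Proof. by apply: sumr_ge0 => a _; exact: sqn_ge0. Qed.

Lemma rownE m n (U : 'M[R[i]]_(m, n)) j : rown U j = nrm2 (row j U).
Proof. by rewrite nrm2_rV; apply: eq_bigr => a _; rewrite mxE. Qed.

Lemma isometric_sum_rown m n (U : 'M[R[i]]_(m, n)) :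
  isometric U -> \sum_j rown U j = n%:R.
Proof. exact: isometric_nrm2. Qed.

(** Pairing [y = v *m U] with its own conjugate gives (nrm2 y)^2 <= nrm2 v * nrm2 y, because [U]
    preserves the norm of that conjugate; then divide by [nrm2 y]. *)
Lemma isometric_adj m n (U : 'M[R[i]]_(m, n)) (v : 'rV_m) :
  isometric U -> nrm2 (v *m U) <= nrm2 v.
Proof.
move=> hU; set y := v *m U.
have h : sqn ((v *m (U *m (map_mx conjc y)^T)) 0 0) <= nrm2 v * nrm2 y.
  have := nrm2_mul v (U *m (map_mx conjc y)^T).
  rewrite {1}/nrm2 !big_ord1 => /le_trans; apply.
  by rewrite hU nrm2_tr nrm2_conj.
move: h; rewrite mulmxA -/y mxE (eq_bigr (fun a => (sqn (y 0 a))%:C%C)); last first.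
  by move=> a _; rewrite !mxE mul_conjC.
rewrite -(big_morph (real_complex R) (rmorphD _) (rmorph0 _)) sqn_real -nrm2_rV.
have [->|h0] := eqVneq (nrm2 y) 0; first by rewrite nrm2_ge0.
by rewrite expr2 ler_pM2r // lt_neqAle eq_sym h0 nrm2_ge0.
Qed.

(** The kernel has dimension at least n - r; Gram-Schmidt is applied to k rows of a base of
    [kermx A^T], and the result is transposed. All later dimension counts go through this lemma. *)
Lemma isometric_kernel r n k (A : 'M[R[i]]_(r, n)) : (r + k <= n)%N ->
  exists U : 'M[R[i]]_(n, k), A *m U = 0 /\ isometric U.
Proof.
move=> rk; pose K := row_base (kermx A^T).
have rkK : (k <= \rank (kermx A^T))%N.
  by rewrite mxrank_ker; have := rank_leq_col A^T; lia.
have kn : (k <= n)%N by lia.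
pose B := \matrix_(i < k) row (widen_ord rkK i) K.
have BA : B *m A^T = 0.
  have : (B <= kermx A^T)%MS.
    apply: submx_trans (_ : (B <= K)%MS) _; last by rewrite eq_row_base.
    by apply/row_subP => i; rewrite rowK row_sub.
  by move=> /sub_kermxP.
have Bfree : row_free B.
  have Kf : row_free K by exact: row_base_free.
  apply/row_freeP; have [D KD] := row_freeP Kf.
  exists (D *m (\matrix_(i, j) (i == widen_ord rkK j)%:R)).
  apply/matrixP => i j; rewrite mulmxA !mxE.
  rewrite (eq_bigr (fun l => (widen_ord rkK i == l)%:R * (l == widen_ord rkK j)%:R)).
    rewrite (bigD1 (widen_ord rkK i)) //= eqxx mul1r big1 ?addr0.
      by congr (_%:R); apply/eqP/eqP => [[]/val_inj|->].
    by move=> l hl; rewrite eq_sym (negbTE hl) mul0r.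
  move=> l _; rewrite [X in _ * X]mxE; congr (_ * _).
  have := congr1 (fun X : 'M_(_) => X (widen_ord rkK i) l) KD.
  rewrite !mxE => <-; apply: eq_bigr => a _; rewrite ?mxE //.
pose S := schmidt B.
have SU : S \is unitarymx by exact: schmidt_unitarymx.
have SB : (S :=: B)%MS by apply: eqmx_schmidt_free.
have SA : S *m A^T = 0.
  by apply/sub_kermxP; rewrite SB; apply/sub_kermxP.
exists S^T; split; first by rewrite -[A]trmxK -trmx_mul SA trmx0.
apply: isometricP; rewrite trmxK -map_trmx.
by have /unitarymxP := SU; rewrite /= -map_trmx.
Qed.
End Squares.

(** * Finite product spaces *)

Definition Ex (R : realType) (T : finType) (w f : T -> R) : R :=
  \sum_t w t * f t.

(** Any predicate is an event here, through [asbool]; events may therefore mention objects obtained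
    by choice. *)
Definition Pr (R : realType) (T : finType) (w : T -> R) (E : T -> Prop) : R :=
  \sum_t w t * (`[< E t >])%:R.

Definition fdist (R : realType) (T : finType) (w : T -> R) : Prop :=
  (forall t, 0 <= w t) /\ \sum_t w t = 1.

Definition prodw (R : realType) (I T : finType) (p : T -> R)
  (x : {ffun I -> T}) : R := \prod_i p (x i).

Definition upd (I T : finType) (x : {ffun I -> T}) (i : I) (t : T) :
  {ffun I -> T} := [ffun j => if j == i then t else x j].

Section FiniteProbability.
Variables (R : realType).

Section General.
Variables (T : finType) (w : T -> R).
Hypothesis hw : fdist w.

Lemma Ex_le (f g : T -> R) : (forall t, f t <= g t) -> Ex w f <= Ex w g.
Proof. by move=> h; apply: ler_sum => t _; rewrite ler_wpM2l ?(proj1 hw). Qed.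

Lemma Ex_ge0 (f : T -> R) : (forall t, 0 <= f t) -> 0 <= Ex w f.
Proof. by move=> h; apply: sumr_ge0 => t _; rewrite mulr_ge0 ?(proj1 hw). Qed.

Lemma Ex_cst (c : R) : Ex w (fun=> c) = c.
Proof. by rewrite /Ex -mulr_suml (proj2 hw) mul1r. Qed.

Lemma Ex_add (f g : T -> R) : Ex w (fun t => f t + g t) = Ex w f + Ex w g.
Proof. by rewrite /Ex -big_split; apply: eq_bigr => t _; rewrite mulrDr. Qed.

Lemma Ex_scale (c : R) (f : T -> R) : Ex w (fun t => c * f t) = c * Ex w f.
Proof. by rewrite /Ex mulr_sumr; apply: eq_bigr => t _; rewrite mulrCA. Qed.

Lemma Ex_sum (J : Type) (r : seq J) (Q : pred J) (f : J -> T -> R) :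
  Ex w (fun t => \sum_(j <- r | Q j) f j t) = \sum_(j <- r | Q j) Ex w (f j).
Proof.
by rewrite /Ex exchange_big /=; apply: eq_bigr => t _; rewrite mulr_sumr.
Qed.

Lemma Ex_lt_exists (f : T -> R) (c : R) : Ex w f < c -> exists t, f t < c.
Proof.
move=> h; apply: contrapT => /forallNP hn; move: h; apply/negP; rewrite -leNgt.
by rewrite -(Ex_cst c); apply: Ex_le => t; rewrite leNgt; apply/negP/hn.
Qed.

Lemma Pr_ge0 (E : T -> Prop) : 0 <= Pr w E.
Proof. by apply: Ex_ge0 => t; exact: ler0n. Qed.

Lemma Pr_sub (E F : T -> Prop) : (forall t, E t -> F t) -> Pr w E <= Pr w F.
Proof.
move=> h; apply: Ex_le => t; case: (asboolP (E t)) => [/h/asboolT -> //|_].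
exact: ler0n.
Qed.

Lemma Pr_or (E F : T -> Prop) : Pr w (fun t => E t \/ F t) <= Pr w E + Pr w F.
Proof.
rewrite -Ex_add; apply: Ex_le => t; case: asboolP => h.
  case: h => h; first by rewrite (asboolT h) lerDl.
  by rewrite (asboolT h) lerDr.
by rewrite addr_ge0.
Qed.

Lemma Pr_bigcup (J : finType) (Q : pred J) (E : J -> T -> Prop) (c : R) :
  (forall j, Q j -> Pr w (E j) <= c) ->
  Pr w (fun t => exists2 j, Q j & E j t) <= #|Q|%:R * c.
Proof.
move=> h; apply: (@le_trans _ _ (\sum_(j | Q j) Pr w (E j))).
  rewrite -Ex_sum; apply: Ex_le => t; case: asboolP => [[j Qj e]|_].
    rewrite (bigD1 j) //= (asboolT e) lerDl; apply: sumr_ge0 => l _; exact: ler0n.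
  by apply: sumr_ge0 => l _; exact: ler0n.
apply: le_trans (ler_sum _ h) _.
by rewrite sumr_const mulr_natl.
Qed.

Lemma Pr_markov (f : T -> R) (E : T -> Prop) :
  (forall t, 0 <= f t) -> (forall t, E t -> 1 <= f t) -> Pr w E <= Ex w f.
Proof.
move=> f0 h; apply: Ex_le => t; case: asboolP => [/h //|_]; exact: f0.
Qed.
End General.

Section Product.
Variables (I T : finType) (p : T -> R).
Hypothesis hp : fdist p.
Local Notation pw := (@prodw R I T p).

Lemma prodw_prod (h : I -> T -> R) :
  Ex pw (fun x => \prod_i h i (x i)) = \prod_i Ex p (h i).
Proof.
rewrite /Ex bigA_distr_bigA /=; apply: eq_bigr => x _.
by rewrite /prodw -big_split.
Qed.

Lemma fdist_prodw : fdist pw.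
Proof.
split=> [x|]; first by apply: prodr_ge0 => i _; exact: (proj1 hp).
have := prodw_prod (fun _ _ => 1).
rewrite [RHS]big1; last by move=> i _; rewrite (Ex_cst hp).
by move=> <-; apply: eq_bigr => x _; rewrite big1_eq mulr1.
Qed.

Lemma upd_same (x : {ffun I -> T}) i t : upd x i t i = t.
Proof. by rewrite ffunE eqxx. Qed.

Lemma upd_other (x : {ffun I -> T}) i j t : j != i -> upd x i t j = x j.
Proof. by rewrite ffunE => /negbTE ->. Qed.

Lemma upd_upd (x : {ffun I -> T}) i t s : upd (upd x i t) i s = upd x i s.
Proof. by apply/ffunP => j; rewrite !ffunE; case: eqP. Qed.

Lemma upd_id (x : {ffun I -> T}) i : upd x i (x i) = x.
Proof. by apply/ffunP => j; rewrite !ffunE; case: eqP => [->|]. Qed.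

(** Fubini in one coordinate. Both sides are sums over an old value s and a new value t of
    coordinate i; updating s to t is a bijection between the two fibres, and the weight of the
    forgotten value s sums to 1. *)
Lemma resample (i : I) (g : {ffun I -> T} -> R) :
  Ex pw g = Ex pw (fun x => Ex p (fun t => g (upd x i t))).
Proof.
pose q (x : {ffun I -> T}) := \prod_(j | j != i) p (x j).
have pwE x : pw x = p (x i) * q x by rewrite /prodw (bigD1 i).
have qE x t : q (upd x i t) = q x.
  by apply: eq_bigr => j ji; rewrite upd_other.
have split_sum (F : {ffun I -> T} -> R) :
    \sum_x F x = \sum_s \sum_(x : {ffun I -> T} | x i == s) F x.
  exact: (partition_big (fun x : {ffun I -> T} => x i) xpredT).
have shift s t (F : {ffun I -> T} -> R) :
    \sum_(x : {ffun I -> T} | x i == s) F (upd x i t) =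
    \sum_(x : {ffun I -> T} | x i == t) F x.
  rewrite [RHS](reindex_onto (fun x => upd x i t) (fun x => upd x i s)) /=.
    apply: eq_bigl => x; rewrite upd_same eqxx upd_upd /=.
    apply/eqP/eqP => [<-|<-]; last by rewrite upd_same.
    by rewrite upd_id.
  by move=> x /eqP <-; rewrite upd_upd upd_id.
rewrite /Ex.
transitivity (\sum_s \sum_t \sum_(x : {ffun I -> T} | x i == s)
    p s * (p t * (q (upd x i t) * g (upd x i t)))).
  rewrite exchange_big /= split_sum; apply: eq_bigr => t _.
  transitivity (\sum_(x : {ffun I -> T} | x i == t) p t * (q x * g x)).
    by apply: eq_bigr => x /eqP <-; rewrite pwE mulrA.
  transitivity (\sum_s p s * \sum_(x : {ffun I -> T} | x i == t) p t * (q x * g x)).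
    by rewrite -mulr_suml (proj2 hp) mul1r.
  apply: eq_bigr => s _; rewrite mulr_sumr.
  by rewrite (shift s t (fun x => p s * (p t * (q x * g x)))).
rewrite [RHS]split_sum; apply: eq_bigr => s _.
rewrite exchange_big /=; apply: eq_bigr => x /eqP <-.
rewrite mulr_sumr; apply: eq_bigr => t _.
by rewrite pwE qE; ring.
Qed.

Lemma Pr_resample (i : I) (E : {ffun I -> T} -> Prop) (c : R) :
  (forall x, Pr p (fun t => E (upd x i t)) <= c) -> Pr pw E <= c.
Proof.
move=> h; rewrite [Pr pw E](resample i) -(Ex_cst fdist_prodw c).
by apply: Ex_le => // ; exact: fdist_prodw.
Qed.

(* The mean of [phi (s + \sum_j v_j (x_j))] over independent [x_j], integrating
   out one coordinate at a time so that it can be estimated by induction. *)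
Fixpoint Esum (V : zmodType) (l : seq (T -> V)) (phi : V -> R) (s : V) : R :=
  if l is v :: l' then Ex p (fun t => Esum l' phi (s + v t)) else phi s.

Lemma Ex_Esum (V : zmodType) (v : I -> T -> V) (l : seq I) (phi : V -> R) (s : V) :
  uniq l ->
  Ex pw (fun x => phi (s + \sum_(j <- l) v j (x j))) = Esum [seq v j | j <- l] phi s.
Proof.
elim: l s => [|i l IH] s /=.
  by move=> _; under [LHS]eq_bigr do rewrite big_nil addr0; exact: (Ex_cst fdist_prodw).
move=> /andP[il ul]; rewrite (resample i) /=.
transitivity (Ex p (fun t => Ex pw (fun x => phi (s + v i t + \sum_(j <- l) v j (x j))))).
  rewrite /Ex; under eq_bigr do rewrite mulr_sumr.
  rewrite exchange_big; apply: eq_bigr => t _; rewrite mulr_sumr.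
  apply: eq_bigr => x _; rewrite mulrCA; congr (_ * (_ * phi _)).
  rewrite big_cons upd_same addrA; congr (_ + _).
  apply: eq_big_seq => j jl; rewrite upd_other //.
  by apply: contraNneq il => <-.
by apply: eq_bigr => t _; rewrite IH.
Qed.

(** Markov inequality for the product over [A] of factors 1 on success and x on failure: it is at
    least x^m when at most m trials fail, and each factor has mean at most pp + x. *)
Lemma Pr_few_failures (A : {set I}) (S : I -> T -> Prop) (pp x : R) (m : nat) :
  0 < x -> x <= 1 -> (forall i, i \in A -> Pr p (S i) <= pp) ->
  Pr pw (fun w => #|[set i in A | ~~ `[< S i (w i) >]]| <= m)%N <=
    x ^- m * (pp + x) ^+ #|A|.
Proof.
move=> x0 x1 hS.
pose h i t := if i \in A then (if `[< S i t >] then 1 else x) else 1.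
have h0 i t : 0 <= h i t by rewrite /h; case: ifP => // _; case: ifP => // _; lra.
have hE i : i \in A -> Ex p (h i) <= pp + x.
  move=> iA; apply: le_trans (_ : Pr p (S i) + x <= _); last by rewrite lerD2r hS.
  rewrite -(Ex_cst hp x) -Ex_add; apply: Ex_le => // t; rewrite /h iA.
  by case: asboolP => _ /=; lra.
apply: (@le_trans _ _ (Ex pw (fun w => x ^- m * \prod_i h i (w i)))).
  apply: Pr_markov; first exact: fdist_prodw.
    by move=> w; apply: mulr_ge0; [rewrite invr_ge0 exprn_ge0 // ltW|apply: prodr_ge0].
  move=> w hw; rewrite mulrC ler_pdivlMr ?exprn_gt0 // mul1r.
  set B := [set i in A | _] in hw.
  have -> : \prod_i h i (w i) = x ^+ #|B|.
    rewrite (bigID (mem B)) /= [X in _ * X]big1 ?mulr1; last first.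
      move=> i; rewrite /h inE; case: (i \in A) => //=.
      by rewrite negbK => ->.
    rewrite -prodr_const; apply: eq_bigr => i; rewrite inE /h => /andP[-> /negbTE ->] //.
  by apply: ler_wiXn2l => //; exact: ltW.
rewrite Ex_scale prodw_prod; apply: ler_wpM2l; first by rewrite invr_ge0 exprn_ge0 ?ltW.
rewrite (bigID (mem A)) /= [X in _ * X]big1 ?mulr1; last first.
  move=> i /negbTE iA; rewrite -[RHS](Ex_cst hp).
  by apply: eq_bigr => t _; rewrite /h iA.
rewrite -prodr_const; apply: ler_prod => i iA; rewrite hE // andbT.
by apply: (Ex_ge0 hp).
Qed.

End Product.

Section Pairs.
Variables (I T : finType) (p : T -> R).

Definition pairw (q : T * T) : R := p q.1 * p q.2.

Lemma fdist_pairw : fdist p -> fdist pairw.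
Proof.
move=> [p0 p1]; split=> [q|]; first by rewrite mulr_ge0.
rewrite -(pair_bigA _ (fun a b => p a * p b)) /=.
by under eq_bigr do rewrite -mulr_sumr p1 mulr1.
Qed.

(** Two independent configurations are one configuration of independent pairs. Symmetrization then
    acts coordinate by coordinate, by exchanging the members of a pair. *)
Lemma Ex_pairs (h : {ffun I -> T} -> {ffun I -> T} -> R) :
  Ex (prodw p) (fun x => Ex (prodw p) (h x)) =
  Ex (@prodw R I _ pairw) (fun z => h [ffun j => (z j).1] [ffun j => (z j).2]).
Proof.
rewrite /Ex; under eq_bigr do rewrite mulr_sumr.
rewrite pair_bigA /=.
pose f (z : {ffun I -> T * T}) := ([ffun j => (z j).1], [ffun j => (z j).2]) : {ffun I -> T} * {ffun I -> T}.
pose g (u : {ffun I -> T} * {ffun I -> T}) : {ffun I -> T * T} := [ffun j => (u.1 j, u.2 j)].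
rewrite (reindex f) /=; last first.
  exists g => [z _|[x y] _]; rewrite /f /g.
    by apply/ffunP => j; rewrite !ffunE /=; case: (z j).
  by congr pair; apply/ffunP => j; rewrite !ffunE.
apply: eq_bigr => z _; rewrite mulrA; congr (_ * _).
rewrite /prodw -big_split; apply: eq_bigr => j _ /=.
by rewrite !ffunE.
Qed.
End Pairs.
End FiniteProbability.

(** * Exponential moments of signed sums under a changing quadratic form *)

Section SmallBall.
Variable (R : realType).

Lemma expRN_le_inv (x : R) : 0 <= x -> expR (- x) <= (1 + x)^-1.
Proof.
move=> x0; rewrite expRN lef_pV2 ?posrE ?expR_gt0 //; last lra.
exact: expR_ge1Dx.
Qed.

(** For x^2 <= 1/4 the exponentials are at most 1/(1-x) and 1/(1+x), whose average is 1/(1-x^2) <= 1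
    + 2 x^2. Otherwise |x| <= 2 x^2 and each exponential is already small enough. *)
Lemma cosh_le (x : R) : (expR x + expR (- x)) / 2 <= expR (2 * x ^+ 2).
Proof.
have [hx|hx] := leP (x ^+ 2) (1 / 4).
  have x12 : `|x| <= 1 / 2.
    by rewrite ler_norml; apply/andP; split; nra.
  move: x12; rewrite ler_norml => /andP[x1 x2].
  have e1 : expR x <= (1 - x)^-1.
    rewrite -[expR x]invrK -expRN lef_pV2 ?posrE ?expR_gt0 //; last lra.
    exact: expR_ge1Dx.
  have e2 : expR (- x) <= (1 + x)^-1.
    rewrite expRN lef_pV2 ?posrE ?expR_gt0 //; last lra.
    exact: expR_ge1Dx.
  apply: le_trans (expR_ge1Dx _).
  have -> : 1 + 2 * x ^+ 2 =
    ((1 - x)^-1 + (1 + x)^-1) / 2 + x ^+ 2 * (1 - 2 * x ^+ 2) / (1 - x ^+ 2).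
    by field; apply/and3P; split; apply/eqP => h; nra.
  have : 0 <= x ^+ 2 * (1 - 2 * x ^+ 2) / (1 - x ^+ 2).
    by apply: divr_ge0; [apply: mulr_ge0; [exact: sqr_ge0|lra]|lra].
  lra.
have : expR x <= expR (2 * x ^+ 2) by rewrite ler_expR; nra.
have : expR (- x) <= expR (2 * x ^+ 2) by rewrite ler_expR; nra.
lra.
Qed.

Section Forms.
Variables (V : lmodType R[i]).

(** Only real scalars are required although [V] is complex: the intended form is the real part of
    the hermitian product, and the random signs are real. *)
Record is_form (b : V -> V -> R) : Prop := IsForm {
  formC : forall x y, b x y = b y x;
  formD : forall x y z, b (x + y) z = b x z + b y z;
  formZ : forall (a : R) x z, b (a%:C%C *: x) z = a * b x z }.

Lemma formN b x y : is_form b -> b (- x) y = - b x y.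
Proof. by move=> hb; rewrite -scaleN1r -(rmorphN1 (real_complex R)) formZ // mulN1r. Qed.

Lemma form_sqrD b x y (a : R) : is_form b ->
  b (x + a%:C%C *: y) (x + a%:C%C *: y) = b x x + 2 * a * b x y + a ^+ 2 * b y y.
Proof.
move=> hb; rewrite (formD hb) (formZ hb) (formC hb x (x + _)) (formC hb y (x + _)).
by rewrite !(formD hb) !(formZ hb) (formC hb y x); ring.
Qed.

Lemma form_sqrDE b x y : is_form b -> b (x + y) (x + y) = b x x + 2 * b x y + b y y.
Proof.
by move=> hb; have := form_sqrD x y 1 hb; rewrite scale1r mulr1 expr1n mul1r.
Qed.

Lemma form_sqrBE b x y : is_form b -> b (x - y) (x - y) = b x x - 2 * b x y + b y y.
Proof.
move=> hb; rewrite (form_sqrDE _ _ hb) (formN _ _ hb) (formC hb x (- y)) (formC hb y (- y)).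
by rewrite !(formN _ _ hb) (formC hb y x); ring.
Qed.

Lemma form_downdate b v : is_form b -> is_form (fun x y => b x y - 8 * b x v * b y v).
Proof.
move=> hb; split => [x y|x y z|a x z].
- by rewrite (formC hb x y); ring.
- by rewrite !formD //; ring.
- by rewrite !formZ //; ring.
Qed.

Variables (dot : V -> V -> R).
Hypothesis hdot : is_form dot.
Hypothesis dot_ge0 : forall x, 0 <= dot x x.

(* [B] bounds the quadratic form dual to [b]. Averaging exp(-b) over a random sign
   costs a downdate of [b] along [v], and [B] only grows by [16 (v.t)^2]. *)
Lemma downdate_dual b (B : V -> R) v : is_form b -> b v v <= 16^-1 ->
  (forall s t, 2 * dot s t - B t <= b s s) ->
  forall s t, 2 * dot s t - (B t + 16 * dot v t ^+ 2) <= b s s - 8 * b s v * b s v.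
Proof.
move=> hb av hB s t.
have := hB (s + (- (8 * b s v))%:C%C *: v) t.
rewrite form_sqrD // formD // formZ //.
have := sqr_ge0 (2 * b s v - 4 * dot v t).
have : 0 <= b s v ^+ 2 * (16^-1 - b v v) by rewrite mulr_ge0 ?sqr_ge0 ?subr_ge0.
set x := b s v; set y := b v v; set z := dot v t; set c := dot s t; set e := b s s.
move=> h1 h2 h3; rewrite -subr_ge0.
have -> : e - 8 * x * x - (2 * c - (B t + 16 * z ^+ 2)) =
  (e + 2 * - (8 * x) * x + (- (8 * x)) ^+ 2 * y - (2 * (c + - (8 * x) * z) - B t)) +
  (2 * x - 4 * z) ^+ 2 + 64 * (x ^+ 2 * (16^-1 - y)) by field.
by rewrite -subr_ge0 in h3; apply: addr_ge0; [apply: addr_ge0|apply: mulr_ge0].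
Qed.

(** The choice t = s / Lam, optimal when [B] equals [Lam] times the norm, in the duality
    inequality. *)
Lemma dual_lower b (B : V -> R) (Lam : R) : 0 < Lam ->
  (forall s t, 2 * dot s t - B t <= b s s) ->
  (forall t, B t <= Lam * dot t t) -> forall s, dot s s / Lam <= b s s.
Proof.
move=> L0 hB hL s; apply: le_trans (hB s (Lam^-1%:C%C *: s)).
have := hL (Lam^-1%:C%C *: s); rewrite !(formZ hdot) ![dot s (_ *: _)](formC hdot) !(formZ hdot).
set d := dot s s => h.
have -> : d / Lam = 2 * (Lam^-1 * d) - Lam * (Lam^-1 * (Lam^-1 * d)).
  by field; rewrite gt_eqF.
by rewrite lerD2l lerN2.
Qed.

Variables (T : finType) (p : T -> R).
Hypothesis hp : fdist p.

Lemma Esum_le (l : seq (T -> V)) (f g : V -> R) s :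
  (forall x, f x <= g x) -> Esum p l f s <= Esum p l g s.
Proof.
by move=> h; elim: l s => [|v l IH] s //=; apply: Ex_le.
Qed.

Lemma Esum_translate (l : seq (T -> V)) (f : V -> R) s u :
  Esum p l f (s + u) = Esum p l (fun x => f (x + u)) s.
Proof.
elim: l s => [|v l IH] s //=; apply: eq_bigr => t _; congr (_ * _).
by rewrite -IH addrAC.
Qed.

Lemma Esum_add (l : seq (T -> V)) (f g : V -> R) s :
  Esum p l (fun x => f x + g x) s = Esum p l f s + Esum p l g s.
Proof.
elim: l s => [|v l IH] s //=; rewrite -Ex_add; apply: eq_bigr => t _.
by rewrite IH.
Qed.

Lemma Esum_scale (l : seq (T -> V)) (c : R) (f : V -> R) s :
  Esum p l (fun x => c * f x) s = c * Esum p l f s.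
Proof.
elim: l s => [|v l IH] s //=; rewrite -Ex_scale; apply: eq_bigr => t _.
by rewrite IH.
Qed.
End Forms.

Section SignedSum.
Variables (V : lmodType R[i]) (dot : V -> V -> R) (T : finType) (p : T -> R).
Hypothesis hdot : is_form dot.
Hypothesis dot_ge0 : forall x, 0 <= dot x x.
Hypothesis hp : fdist p.
Variables (swap : T -> T).
Hypothesis swapK : involutive swap.
Hypothesis p_swap : forall t, p (swap t) = p t.

(** Averaging over an involution that preserves the law inserts a fair random sign without enlarging
    the space. *)
Lemma Ex_swap (f : T -> R) : Ex p f = Ex p (fun t => (f t + f (swap t)) / 2).
Proof.
have h : Ex p f = Ex p (fun t => f (swap t)).
  rewrite /Ex [LHS](reindex_inj (inv_inj swapK)).
  by apply: eq_bigr => t _; rewrite p_swap.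
have -> : Ex p (fun t => (f t + f (swap t)) / 2) = 2^-1 * (Ex p f + Ex p (fun t => f (swap t))).
  by rewrite -Ex_add -Ex_scale; apply: eq_bigr => t _; rewrite [_ / 2]mulrC.
by rewrite -h; field.
Qed.

Variables (I : Type) (v : I -> T -> V) (G : I -> pred T) (c : I -> V -> R) (m : I -> R).
Variables (lam Lam : R).
Hypothesis Lam0 : 0 < Lam.
Hypothesis v_swap : forall i t, v i (swap t) = - v i t.
Hypothesis c_ge0 : forall i x, 0 <= c i x.
Hypothesis v_c : forall i t x, G i t -> dot (v i t) x ^+ 2 <= c i x.
Hypothesis v_lam : forall i t, G i t -> lam * dot (v i t) (v i t) <= 16^-1.
Hypothesis v_m : forall i t, G i t -> m i <= dot (v i t) (v i t).

(** Induction in which [b] is downdated along each good vector. The bound by [lam] keeps b v v below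
    1/16, as the downdate requires. The dual bound [B], plus 16 times the contributions still to
    come, stays below [Lam], so [b] never falls below dot / Lam, and each good vector yields a
    factor exp(- m / Lam). *)
Lemma Esum_exp_form (l : seq I) (b : V -> V -> R) (B : V -> R) (s : V) :
  is_form b -> (forall x, b x x <= lam * dot x x) ->
  (forall x t, 2 * dot x t - B t <= b x x) ->
  (forall t, B t + 16 * \sum_(i <- l) c i t <= Lam * dot t t) ->
  Esum p [seq v i | i <- l] (fun x => expR (- b x x)) s <=
  \prod_(i <- l) Ex p (fun t => expR (- ((G i t)%:R * m i / Lam))).
Proof.
elim: l b B s => [|i l IH] b B s hb hlam hB hL.
  rewrite big_nil /= -expR0 ler_expR oppr_le0.
  apply: le_trans (dual_lower hdot Lam0 hB _ s).
    by rewrite divr_ge0 // ltW.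
  by move=> t; have := hL t; rewrite big_nil mulr0 addr0.
have hcl t : 0 <= \sum_(j <- l) c j t by apply: sumr_ge0.
have hL' t : B t + 16 * \sum_(j <- l) c j t <= Lam * dot t t.
  by apply: le_trans (hL t); rewrite big_cons; have := c_ge0 i t; lra.
have hBL t : B t <= Lam * dot t t by have := hL' t; have := hcl t; lra.
rewrite big_cons /= Ex_swap.
set P := \prod_(j <- l) _.
have -> : Ex p (fun t => expR (- ((G i t)%:R * m i / Lam))) * P =
   Ex p (fun t => P * expR (- ((G i t)%:R * m i / Lam))).
  by rewrite Ex_scale mulrC.
apply: Ex_le => // t; rewrite v_swap.
case Gt: (G i t); last first.
  rewrite mul0r mul0r oppr0 expR0 mulr1.
  by have := IH b B (s + v i t) hb hlam hB hL'; have := IH b B (s - v i t) hb hlam hB hL'; rewrite -/P; lra.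
rewrite !Esum_translate -Esum_add.
set w := v i t; set a := b w w.
pose b' x y := b x y - 8 * b x w * b y w.
have aw : a <= 16^-1 by apply: le_trans (hlam w) _; exact: v_lam.
have am : m i / Lam <= a.
  apply: le_trans (dual_lower hdot Lam0 hB hBL w).
  by rewrite ler_pM2r ?invr_gt0 // v_m.
(* The sum over the sign is 2 exp(- b x x - a) cosh (2 b x w), and [cosh_le] bounds the cosh by
   exp(8 (b x w)^2), which is exactly the downdate of [b]. *)
have step x : expR (- b (x + w) (x + w)) + expR (- b (x - w) (x - w)) <=
   2 * (expR (- (m i / Lam)) * expR (- b' x x)).
  rewrite form_sqrDE // form_sqrBE // -/a.
  have -> : - (b x x + 2 * b x w + a) = - b x x - a + - (2 * b x w) by ring.
  have -> : - (b x x - 2 * b x w + a) = - b x x - a + 2 * b x w by ring.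
  rewrite ![expR (_ - a + _)]expRD -mulrDr [_ + expR (2 * _)]addrC.
  have -> : expR (- (m i / Lam)) * expR (- b' x x) =
     expR (- b x x - (m i / Lam)) * expR (2 * (2 * b x w) ^+ 2).
    by rewrite -!expRD; congr expR; rewrite /b'; ring.
  apply: (@le_trans _ _ (expR (- b x x - a) * (2 * expR (2 * (2 * b x w) ^+ 2)))).
    by rewrite ler_wpM2l ?expR_ge0 //; have := cosh_le (2 * b x w); lra.
  by rewrite mulrCA ler_wpM2l // ler_wpM2r ?expR_ge0 // ler_expR; lra.
rewrite mul1r.
apply: (@le_trans _ _ (Esum p [seq v j | j <- l] (fun x => 2 * (expR (- (m i / Lam)) * expR (- b' x x))) s / 2)).
  by rewrite ler_pM2r ?invr_gt0 //; apply: Esum_le.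
rewrite Esum_scale mulrAC divff ?pnatr_eq0 // mul1r Esum_scale mulrC ler_wpM2r ?expR_ge0 //.
apply: (IH b' (fun x => B x + 16 * dot w x ^+ 2)).
- exact: form_downdate.
- by move=> x; apply: le_trans (hlam x); rewrite /b'; have := sqr_ge0 (b x w); lra.
- exact: downdate_dual.
- move=> x; apply: le_trans (hL x); rewrite big_cons.
  by have := @v_c i t x Gt; rewrite -/w; lra.
Qed.
End SignedSum.
End SmallBall.

(** * Small balls in high dimension *)

Section RowSmallBall.
Variable (R : realType).

Definition dotc k (x y : 'rV[R[i]]_k) : R :=
  complex.Re (\sum_a x 0 a * (y 0 a)^*%C).

Lemma dotc_form k : is_form (@dotc k).
Proof.
split=> [x y|x y z|a x z]; rewrite /dotc !Re_sum.
- apply: eq_bigr => b _; case: (x 0 b) (y 0 b) => [x1 x2] [y1 y2] /=; ring.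
- rewrite -big_split; apply: eq_bigr => b _ /=; rewrite mxE.
  by case: (x 0 b) (y 0 b) (z 0 b) => [x1 x2] [y1 y2] [z1 z2] /=; ring.
- rewrite mulr_sumr; apply: eq_bigr => b _ /=; rewrite mxE.
  by case: (x 0 b) (z 0 b) => [x1 x2] [z1 z2] /=; ring.
Qed.

Lemma dotc_nrm2 k (x : 'rV[R[i]]_k) : dotc x x = nrm2 x.
Proof.
rewrite /dotc Re_sum nrm2_rV; apply: eq_bigr => a _.
by rewrite mul_conjC.
Qed.

Lemma dotcZ_sqr k (c : R[i]) (x y : 'rV[R[i]]_k) :
  dotc (c *: x) y ^+ 2 <= sqn c * sqn (\sum_a x 0 a * (y 0 a)^*%C).
Proof.
rewrite -sqnM mulr_sumr /dotc.
under eq_bigr do rewrite mxE -mulrA.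
by rewrite /sqn lerDl sqr_ge0.
Qed.

Lemma exp_small_le (tau g x : R) : tau <= g -> g <= 1 -> 0 <= tau -> 0 <= x -> x <= 1 ->
  g * expR (- x) + (1 - g) <= expR (- (tau * x / 2)).
Proof.
move=> tg g1 t0 x0 x1; apply: le_trans (expR_ge1Dx _).
have h : expR (- x) <= 1 - x / 2.
  apply: le_trans (expRN_le_inv x0) _.
  by rewrite -[leLHS]mul1r ler_pdivrMr; nra.
have h1 : 0 <= g * (1 - x / 2 - expR (- x)) by rewrite mulr_ge0 ?subr_ge0 // (le_trans t0).
have h2 : 0 <= (g - tau) * x by rewrite mulr_ge0 // subr_ge0.
lra.
Qed.

Variables (F : finType) (p : F -> R) (val : F -> R[i]) (tau : R).
Hypothesis hp : fdist p.
Hypothesis tau01 : 0 < tau <= 1.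

(** The lower bound supplies randomness, the upper bound keeps each increment bounded. One parameter
    serves as probability, lower scale and inverse upper scale, so all later constants are powers of
    [tau]. *)
Definition spread_pair (z : F * F) : bool :=
  (tau ^+ 2 <= sqn (val z.1 - val z.2)) && (sqn (val z.1 - val z.2) <= tau ^- 2).

Hypothesis law : tau <= Ex (pairw p) (fun z => (spread_pair z)%:R).

(* Conditioning on the pairs [val (r j), val (r' j)] of two independent copies leaves
   only independent signs, handled by the downdates of [expR (- b)]. *)
Lemma row_small_ball n k (U : 'M[R[i]]_(n, k)) (sg : 'I_n -> R) (N : {set 'I_n})
    (v : 'rV[R[i]]_k) :
  (forall g : 'cV_k, nrm2 (U *m g) <= nrm2 g) ->
  (forall j, 0 <= sg j <= 1) -> (forall j, j \in N -> tau <= sg j) ->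
  Pr (prodw p) (fun r : {ffun 'I_n -> F} =>
    nrm2 (v + \sum_j ((sg j)%:C%C * val (r j)) *: row j U) <=
    tau ^+ 5 / 32 * \sum_(j in N) rown U j) <=
  expR (- (tau ^+ 7 / 256 * \sum_(j in N) rown U j)).
Proof.
move=> hU sg01 sgN; have /andP[t0 t1] := tau01.
set W := \sum_(j in N) _; set E := (X in Pr _ X).
have W0 : 0 <= W by apply: sumr_ge0 => j _; exact: rown_ge0.
(* Contraction of [U] at the conjugate of t: the rows of [U] satisfy a Bessel inequality. With t a
   row of [U], it shows that no row has norm above 1. *)
have gram (t : 'rV[R[i]]_k) : \sum_j sqn (\sum_a U j a * (t 0 a)^*%C) <= nrm2 t.
  have := hU (map_mx conjc t)^T; rewrite nrm2_tr nrm2_conj; apply: le_trans.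
  rewrite nrm2_cV le_eqVlt; apply/orP; left; apply/eqP; apply: eq_bigr => j _.
  by rewrite mxE; congr sqn; apply: eq_bigr => a _; rewrite !mxE.
have w1 j : rown U j <= 1.
  have h1 := gram (row j U).
  have h2 : sqn (\sum_a U j a * (row j U 0 a)^*%C) <= nrm2 (row j U).
    apply: le_trans h1; rewrite [leRHS](bigD1 j) //= lerDl.
    by apply: sumr_ge0 => l _; exact: sqn_ge0.
  move: h2; rewrite -rownE (eq_bigr (fun a => (sqn (U j a))%:C%C)); last first.
    by move=> a _; rewrite mxE mul_conjC.
  rewrite -(big_morph (real_complex R) (rmorphD _) (rmorph0 _)) sqn_real -/(rown U j).
  by have := rown_ge0 U j; nra.
pose vv (j : 'I_n) (z : F * F) := ((sg j)%:C%C * (val z.1 - val z.2)) *: row j U.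
pose G (j : 'I_n) (z : F * F) := (j \in N) && spread_pair z.
pose c (j : 'I_n) (t : 'rV[R[i]]_k) := tau ^- 2 * sqn (\sum_a U j a * (t 0 a)^*%C).
(* A spread increment has squared norm at most tau^(-2), so this [lam] gives 1/16. The initial dual
   1/lam and the increments, at most 16 tau^(-2) in total by [gram], add up to [Lam]. *)
pose lam := tau ^+ 2 / 16; pose Lam := 32 / tau ^+ 2.
have lam0 : 0 < lam by rewrite divr_gt0 // exprn_gt0.
have sqv j z : dotc (vv j z) (vv j z) = sg j ^+ 2 * sqn (val z.1 - val z.2) * rown U j.
  by rewrite dotc_nrm2 nrm2Z sqnM sqn_real rownE.
have sg2 j : sg j ^+ 2 <= 1 by have /andP[] := sg01 j; nra.
have key : Ex (@prodw R 'I_n _ (pairw p)) (fun z => expR (- (lam * nrm2 (\sum_j vv j (z j))))) <=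
   expR (- (tau ^+ 7 / 64 * W)).
  have -> : Ex (@prodw R 'I_n _ (pairw p)) (fun z => expR (- (lam * nrm2 (\sum_j vv j (z j))))) =
    Esum (pairw p) [seq vv j | j <- index_enum 'I_n] (fun x => expR (- (lam * dotc x x))) 0.
    rewrite -Ex_Esum ?index_enum_uniq //; last exact: fdist_pairw.
    by apply: eq_bigr => z _; rewrite add0r dotc_nrm2.
  apply: (@le_trans _ _ (\prod_(j <- index_enum 'I_n) Ex (pairw p) (fun z => expR (- ((G j z)%:R * (tau ^+ 4 * rown U j) / Lam))))).
    apply: (@Esum_exp_form _ _ (@dotc k) _ (pairw p) (@dotc_form k) _ _ (fun z => (z.2, z.1)) _ _
      _ vv G c (fun j => tau ^+ 4 * rown U j) lam Lam _ _ _ _ _ _ _ (fun x y => lam * dotc x y) (fun t => lam^-1 * dotc t t)).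
    - by move=> x; rewrite dotc_nrm2 nrm2_ge0.
    - exact: fdist_pairw.
    - by case.
    - by move=> z; rewrite /pairw /= mulrC.
    - by rewrite divr_gt0 // exprn_gt0.
    - by move=> j z; rewrite /vv /= -scaleNr -mulrN opprB.
    - by move=> j x; rewrite mulr_ge0 ?sqn_ge0 // invr_ge0 exprn_ge0 // ltW.
    - move=> j z x /andP[_ /andP[_ hz]]; apply: le_trans (dotcZ_sqr _ _ _) _.
      rewrite /c; under [X in _ * sqn X]eq_bigr do rewrite mxE.
      rewrite ler_wpM2r ?sqn_ge0 // sqnM sqn_real.
      by apply: le_trans hz; rewrite ler_piMl ?sqn_ge0.
    - move=> j z /andP[_ /andP[_ hz]]; rewrite sqv /lam.
      have h : sg j ^+ 2 * sqn (val z.1 - val z.2) * rown U j <= tau ^- 2.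
        apply: le_trans hz; rewrite -mulrA.
        apply: le_trans (ler_piMl _ (sg2 j)) _; first by rewrite mulr_ge0 ?sqn_ge0 ?rown_ge0.
        by rewrite ler_piMr ?sqn_ge0.
      apply: le_trans (ler_wpM2l (ltW lam0) h) _.
      by rewrite /lam mulrAC divff ?mul1r // expf_neq0 ?gt_eqF.
    - move=> j z /andP[jN /andP[hz _]]; rewrite sqv.
      rewrite ler_wpM2r ?rown_ge0 //.
      have -> : tau ^+ 4 = tau ^+ 2 * tau ^+ 2 by rewrite -exprD.
      apply: ler_pM => //; try exact: sqr_ge0.
      by have := sgN j jN; have := t0; nra.
    - have [h1 h2 h3] := dotc_form k; split => [x y|x y z|a x z].
      + by rewrite h1.
      + by rewrite h2 mulrDr.
      + by rewrite h3 mulrCA.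
    - by [].
    - move=> x t; rewrite -subr_ge0.
      have := nrm2_ge0 (lam%:C%C *: x - t); rewrite -dotc_nrm2 (form_sqrBE _ _ (@dotc_form k)).
      rewrite !(formZ (@dotc_form k)) (formC (@dotc_form k) x (_ *: _)) (formZ (@dotc_form k)).
      set a := dotc x x; set b := dotc x t; set d := dotc t t => h.
      have -> : lam * a - (2 * b - lam^-1 * d) = lam^-1 * (lam * (lam * a) - 2 * (lam * b) + d).
        by field; rewrite gt_eqF.
      by rewrite mulr_ge0 // invr_ge0 ltW.
    - move=> t; rewrite -mulr_sumr dotc_nrm2.
      have -> : Lam = lam^-1 + 16 * tau ^- 2.
        by rewrite /Lam /lam; field; rewrite gt_eqF.
      rewrite [leRHS]mulrDl lerD2l -[leRHS]mulrA ler_pM2l // ler_pM2l ?invr_gt0 ?exprn_gt0 //.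
  have -> : expR (- (tau ^+ 7 / 64 * W)) = \prod_(j <- index_enum 'I_n) (if j \in N then expR (- (tau * (tau ^+ 6 / 32 * rown U j) / 2)) else 1).
    rewrite -big_mkcond -expR_sum; congr expR; rewrite sumrN; congr (- _).
    by rewrite /W mulr_sumr; apply: eq_bigr => j _; field.
  apply: ler_prod => j _; apply/andP; split.
    by apply: Ex_ge0 => [|z]; [exact: fdist_pairw|exact: expR_ge0].
  have hq := fdist_pairw hp.
  case: ifP => jN; last first.
    rewrite -(Ex_cst hq 1); apply: Ex_le => // z.
    by rewrite /G jN /= !mul0r oppr0 expR0.
  set x := tau ^+ 6 / 32 * rown U j.
  have x0 : 0 <= x by rewrite mulr_ge0 ?rown_ge0 // divr_ge0 // exprn_ge0 // ltW.
  have x1 : x <= 1.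
    have h6 : tau ^+ 6 <= 1 by rewrite exprn_ile1 // ltW.
    have h6' : 0 <= tau ^+ 6 by rewrite exprn_ge0 // ltW.
    have := w1 j; have := rown_ge0 U j; rewrite /x.
    by move=> a b; apply: le_trans (_ : tau ^+ 6 / 32 * 1 <= _); [rewrite ler_wpM2l // divr_ge0|lra].
  set g := Ex (pairw p) (fun z => (spread_pair z)%:R).
  have g1 : g <= 1 by rewrite -(Ex_cst hq 1); apply: Ex_le => // z; case: spread_pair.
  apply: le_trans (exp_small_le law g1 (ltW t0) x0 x1).
  have -> : g * expR (- x) + (1 - g) = 1 + (expR (- x) - 1) * g by ring.
  have -> : 1 + (expR (- x) - 1) * g = Ex (pairw p) (fun z => 1 + (expR (- x) - 1) * (spread_pair z)%:R).
    by rewrite Ex_add Ex_scale (Ex_cst hq).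
  rewrite le_eqVlt; apply/orP; left; apply/eqP.
  apply: eq_bigr => z _; congr (_ * _); rewrite /G jN /=.
  case: spread_pair; last by rewrite !mul0r oppr0 expR0 mulr0 addr0.
  rewrite mul1r mulr1 addrC subrK; congr (expR (- _)); rewrite /x /Lam.
  by field; rewrite gt_eqF.
(* If two independent copies both lie in the ball, their difference, free of [v], has squared norm
   at most four times the squared radius; exponential Markov then bounds the square of the
   probability. The exponents +1/128 and -1/64 leave -1/128, and the root gives 1/256. *)
have E2 : Pr (prodw p) E ^+ 2 <= expR (4 * lam * (tau ^+ 5 / 32 * W)) * expR (- (tau ^+ 7 / 64 * W)).
  apply: le_trans (ler_wpM2l (expR_ge0 _) key).
  rewrite -Ex_scale.
  pose h (x y : {ffun 'I_n -> F}) := expR (4 * lam * (tau ^+ 5 / 32 * W)) *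
     expR (- (lam * nrm2 (\sum_j ((sg j)%:C%C * (val (x j) - val (y j))) *: row j U))).
  have -> : Ex (@prodw R 'I_n _ (pairw p)) (fun z => expR (4 * lam * (tau ^+ 5 / 32 * W)) *
      expR (- (lam * nrm2 (\sum_j vv j (z j))))) = Ex (prodw p) (fun x => Ex (prodw p) (h x)).
    rewrite Ex_pairs; apply: eq_bigr => z _; congr (_ * (_ * expR (- (_ * nrm2 _)))).
    by apply: eq_bigr => j _; rewrite !ffunE.
  have hpw := @fdist_prodw R 'I_n _ _ hp.
  rewrite expr2 {1}/Pr mulr_suml; apply: ler_sum => x _; rewrite -mulrA.
  rewrite ler_wpM2l ?(proj1 hpw) // -Ex_scale; apply: Ex_le => // y.
  case: (asboolP (E x)) => Ex_; last by rewrite mul0r mulr_ge0 ?expR_ge0.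
  case: (asboolP (E y)) => Ey_; last by rewrite mulr0 mulr_ge0 ?expR_ge0.
  rewrite mulr1 /h -expRD -[leLHS]expR0 ler_expR.
  have -> : \sum_j ((sg j)%:C%C * (val (x j) - val (y j))) *: row j U =
    (v + \sum_j ((sg j)%:C%C * val (x j)) *: row j U) - (v + \sum_j ((sg j)%:C%C * val (y j)) *: row j U).
    rewrite opprD addrACA subrr add0r -sumrB; apply: eq_bigr => j _.
    by rewrite -scalerBl mulrBr.
  have := nrm2D_le (v + \sum_j ((sg j)%:C%C * val (x j)) *: row j U) (- (v + \sum_j ((sg j)%:C%C * val (y j)) *: row j U)).
  rewrite nrm2N; move: Ex_ Ey_; rewrite /E /=; set D := nrm2 (_ - _); set X := nrm2 _; set Y := nrm2 _; set TT := _ / 32 * W => hX hY hD.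
  have : lam * D <= lam * (4 * TT) by rewrite ler_pM2l //; lra.
  lra.
have : Pr (prodw p) E ^+ 2 <= expR (- (tau ^+ 7 / 256 * W)) ^+ 2.
  apply: le_trans E2 _; rewrite expr2 -!expRD ler_expR /lam.
  have : 0 <= tau ^+ 7 * W by rewrite mulr_ge0 // exprn_ge0 // ltW.
  have -> : 4 * (tau ^+ 2 / 16) * (tau ^+ 5 / 32 * W) = tau ^+ 7 * W / 128 by field.
  lra.
rewrite ler_pXn2r // nnegrE ?expR_ge0 //.
by apply: Pr_ge0; exact: fdist_prodw.
Qed.
End RowSmallBall.

(** * Small balls in the plane *)

Section Trigonometry.
Import classical_sets topology normedtype derive realfun.
Import numFieldNormedType.Exports.
Variable R : realType.

Lemma sin_eq_mul_cos (y : R) : 0 <= y ->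
  exists c, 0 <= c <= y /\ sin y = cos c * y.
Proof.
move=> y0.
have [|c] := @MVT_segment R sin cos 0 y y0 (fun x _ => is_derive_sin x).
  by apply: continuous_subspaceT => x; exact: continuous_sin.
rewrite in_itv /= => cy; rewrite sin0 !subr0 => h; by exists c.
Qed.

Lemma sin_sqr_le (y : R) : sin y ^+ 2 <= y ^+ 2.
Proof.
wlog y0 : y / 0 <= y.
  move=> h; have [/h //|y0] := leP 0 y.
  by have := h (- y); rewrite sinN !sqrrN; apply; lra.
have [c [_ ->]] := sin_eq_mul_cos y0.
have := cos_geN1 c; have := cos_le1 c; rewrite exprMn => h1 h2.
by rewrite ler_piMl ?sqr_ge0 //; nra.
Qed.

Lemma cos_half (y : R) : cos y = 1 - 2 * sin (y / 2) ^+ 2.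
Proof.
have -> : cos y = cos (y / 2 + y / 2) by congr cos; field.
by rewrite cosD -!expr2 cos2sin2; ring.
Qed.

Lemma cos_ge (y : R) : 1 - y ^+ 2 / 2 <= cos y.
Proof. by rewrite cos_half; have := sin_sqr_le (y / 2); lra. Qed.

Lemma cos_le (y : R) : y ^+ 2 <= 1 -> cos y <= 1 - y ^+ 2 / 8.
Proof.
wlog y0 : y / 0 <= y.
  move=> h; have [/h //|y0] := leP 0 y.
  by have := h (- y); rewrite cosN !sqrrN; apply; lra.
move=> y1; have y2 : 0 <= y / 2 by lra.
have [c [/andP[c0 cy] hs]] := sin_eq_mul_cos y2.
rewrite cos_half hs; have := cos_ge c; have := cos_le1 c => h1 h2.
have : 3 / 4 <= cos c by nra.
rewrite exprMn => h3; have h4 : 1 / 2 <= cos c ^+ 2 by nra.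
have : 1 / 2 * (y / 2) ^+ 2 <= cos c ^+ 2 * (y / 2) ^+ 2 by rewrite ler_wpM2r ?sqr_ge0.
have -> : y ^+ 2 = 4 * (y / 2) ^+ 2 by field.
set a := _ ^+ 2 * _; set b := (y / 2) ^+ 2; have b0 : 0 <= b by exact: sqr_ge0.
lra.
Qed.

Definition cis (y : R) : R[i] := (cos y +i* sin y)%C.

Lemma cisD x y : cis (x + y) = cis x * cis y.
Proof.
rewrite /cis cosD sinD; apply/eqP; rewrite eq_complex /=.
by apply/andP; split; apply/eqP; ring.
Qed.

Lemma cis0 : cis 0 = 1.
Proof. by rewrite /cis cos0 sin0. Qed.

Lemma sqn_cis y : sqn (cis y) = 1.
Proof. by rewrite /sqn /= cos2Dsin2. Qed.

Lemma cis_conj y : (cis y)^*%C = cis (- y).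
Proof. by rewrite /cis cosN sinN. Qed.

Lemma cis_sum (I : Type) (r : seq I) (f : I -> R) :
  cis (\sum_(i <- r) f i) = \prod_(i <- r) cis (f i).
Proof. by apply: (big_morph _ cisD cis0). Qed.

Lemma sqn_prod (I : Type) (r : seq I) (f : I -> R[i]) :
  sqn (\prod_(i <- r) f i) = \prod_(i <- r) sqn (f i).
Proof. by apply: (big_morph _ (@sqnM R) (@sqn1 R)). Qed.

(** This is m times the Fejer kernel: nonnegative, large near 0, and a finite trigonometric sum, so
    its mean is a finite sum of values of the characteristic function and no Fourier integral
    occurs. *)
Definition fejer (m : nat) (y : R) : R := sqn (\sum_(l < m) cis (l%:R * y)).

Lemma fejer_ge (m : nat) (y : R) : (m%:R * y) ^+ 2 <= 1 -> m%:R ^+ 2 / 4 <= fejer m y.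
Proof.
move=> h; have : m%:R / 2 <= complex.Re (\sum_(l < m) cis (l%:R * y)).
  have -> : m%:R / 2 = \sum_(l < m) (1 / 2 : R).
    by rewrite sumr_const card_ord -mulr_natr; field.
  rewrite Re_sum.
  apply: ler_sum => l _; apply: le_trans (cos_ge _).
  suff : (l%:R * y) ^+ 2 <= 1 by lra.
  apply: le_trans h; rewrite !exprMn ler_wpM2r ?sqr_ge0 //.
  by rewrite ler_pXn2r ?nnegrE // ler_nat ltnW.
move=> h2; rewrite /fejer /sqn.
have : 0 <= m%:R / 2 :> R by rewrite divr_ge0.
have := sqr_ge0 (complex.Im (\sum_(l < m) cis (l%:R * y))).
nra.
Qed.

Lemma fejerE m y :
  (fejer m y)%:C%C = \sum_(l < m) \sum_(l' < m) cis ((l%:R - l'%:R) * y).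
Proof.
rewrite -mul_conjC mulr_suml; apply: eq_bigr => l _.
rewrite conj_sum mulr_sumr; apply: eq_bigr => l' _.
by rewrite cis_conj -cisD mulrBl.
Qed.

Lemma fejer_ge0 m y : 0 <= fejer m y. Proof. exact: sqn_ge0. Qed.

(** With truncated subtraction [(l - l') + (l' - l)] is the distance of l and l'. The terms up to
    the diagonal sum to at most 2, those beyond it to at most 1. *)
Lemma geometric_sum_le (m l : nat) :
  \sum_(l' < m) (2 : R) ^- ((l - l') + (l' - l)) <= 3.
Proof.
have below k : (k <= l.+1)%N -> \sum_(l' < k) (2 : R) ^- ((l - l') + (l' - l)) <= 2 ^+ k / 2 ^+ l.
  elim: k => [|k IH] kl; first by rewrite big_ord0 divr_ge0 // exprn_ge0.
  rewrite big_ord_recr /=; have {IH} := IH (ltnW kl).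
  have -> : (k - l = 0)%N by lia.
  rewrite addn0; have -> : (2 : R) ^- (l - k) = 2 ^+ k / 2 ^+ l.
    have -> : (2 : R) ^+ l = 2 ^+ k * 2 ^+ (l - k) by rewrite -exprD subnKC.
    by rewrite invfM mulrA divff ?mul1r // expf_neq0 // pnatr_eq0.
  rewrite exprS; set a := _ / _; move=> h.
  have -> : 2 * 2 ^+ k / 2 ^+ l = a + a by rewrite /a; ring.
  by rewrite lerD2r.
have [ml|lm] := leqP m l.+1.
  apply: le_trans (below m ml) _; rewrite ler_pdivrMr ?exprn_gt0 //.
  apply: (@le_trans _ _ (2 ^+ l.+1)); first by rewrite ler_weXn2l // ler1n.
  by rewrite exprS ler_wpM2r ?exprn_ge0 // ler_nat.
suff above k : \sum_(l' < l.+1 + k) (2 : R) ^- ((l - l') + (l' - l)) <= 3 - 2 ^- k.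
  have := above (m - l.+1)%N; rewrite subnKC 1?ltnW // => /le_trans; apply.
  by rewrite gerBl invr_ge0 exprn_ge0.
elim: k => [|k IH].
  rewrite addn0; apply: le_trans (below l.+1 (leqnn _)) _.
  rewrite exprS expr0 invr1 mulfK ?expf_neq0 ?pnatr_eq0 //; lra.
rewrite addnS big_ord_recr /=.
have -> : (l - (l.+1 + k) + (l.+1 + k - l) = k.+1)%N by lia.
rewrite exprS invfM; move: IH; set a := (_ ^+ k)^-1; set S := \sum_(_ < _) _.
lra.
Qed.

Lemma gauss_sum_le (m : nat) :
  \sum_(l < m) \sum_(l' < m) expR (- (l%:R - l'%:R : R) ^+ 2) <= 3 * m%:R.
Proof.
have -> : 3 * m%:R = \sum_(l < m) (3 : R).
  by rewrite sumr_const card_ord mulr_natr.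
apply: ler_sum => l _; apply: le_trans (geometric_sum_le m l).
apply: ler_sum => l' _.
set d := ((l - l') + (l' - l))%N.
have dE : (l%:R - l'%:R : R) ^+ 2 = d%:R ^+ 2.
  rewrite /d; have [ll|ll] := leqP l l'.
    have -> : (l - l' = 0)%N by lia.
    by rewrite add0n natrB // -sqrrN opprB.
  have -> : (l' - l = 0)%N by lia.
  by rewrite addn0 natrB // ltnW.
rewrite dE expRN lef_pV2 ?posrE ?expR_gt0 ?exprn_gt0 //.
apply: (@le_trans _ _ (expR d%:R)).
  rewrite -[d%:R]mulr1 expRM_natl lerXn2r ?nnegrE ?expR_ge0 //.
  by apply: le_trans (expR_ge1Dx 1).
rewrite ler_expR; have : (d <= d * d)%N by case: (d) => // e; rewrite leq_pmulr.
by rewrite -(ler_nat R) natrM -expr2.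
Qed.
End Trigonometry.

Section PlanarSmallBall.
Variable R : realType.

Definition inner (t z : R[i]) : R :=
  complex.Re t * complex.Re z + complex.Im t * complex.Im z.

Lemma innerD t z w : inner t (z + w) = inner t z + inner t w.
Proof. by rewrite /inner Re_add Im_add; ring. Qed.

Lemma innerB t z w : inner t (z - w) = inner t z - inner t w.
Proof. by case: t z w => [t1 t2] [z1 z2] [w1 w2]; rewrite /inner /=; ring. Qed.

Lemma inner_sum t (I : Type) (r : seq I) (f : I -> R[i]) :
  inner t (\sum_(i <- r) f i) = \sum_(i <- r) inner t (f i).
Proof.
apply: (big_morph (inner t) (innerD t)); rewrite /inner /=; ring.
Qed.

(** Separates the rotation invariant part from a part linear in z^2. Summed over coefficients c_j,
    the anisotropy is carried by the single number sum c_j^2. *)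
Lemma inner_sqr t z :
  inner t z ^+ 2 = (sqn t * sqn z + complex.Re ((t^*%C) ^+ 2 * z ^+ 2)) / 2.
Proof. by case: t z => [t1 t2] [z1 z2]; rewrite /inner /sqn /= !expr2 /=; field. Qed.

Lemma inner_sqr_le t z : inner t z ^+ 2 <= sqn t * sqn z.
Proof.
rewrite -subr_ge0; case: t z => [t1 t2] [z1 z2]; rewrite /inner /sqn /=.
have -> : (t1 ^+ 2 + t2 ^+ 2) * (z1 ^+ 2 + z2 ^+ 2) - (t1 * z1 + t2 * z2) ^+ 2 =
  (t1 * z2 - t2 * z1) ^+ 2 by ring.
exact: sqr_ge0.
Qed.

Lemma Re_ge (z : R[i]) (b : R) : 0 <= b -> sqn z <= b ^+ 2 -> - b <= complex.Re z.
Proof.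
rewrite /sqn => b0; have := sqr_ge0 (complex.Im z).
by set x := complex.Re z; move=> h1 h2; nra.
Qed.

Variables (F : finType) (p : F -> R) (val : F -> R[i]) (tau : R).
Hypothesis hp : fdist p.
Hypothesis tau01 : 0 < tau <= 1.
Hypothesis law : tau <= Ex (pairw p) (fun z => (spread_pair val tau z)%:R).
Local Notation spr := (spread_pair val tau).

Lemma RC_sum (I : Type) (r : seq I) (P : pred I) (f : I -> R) :
  (\sum_(i <- r | P i) f i)%:C%C = \sum_(i <- r | P i) (f i)%:C%C.
Proof. exact: (big_morph (real_complex R) (rmorphD _) (rmorph0 _)). Qed.

Lemma sqn_charfn (y : F -> R) :
  sqn (\sum_f (p f)%:C%C * cis (y f)) = Ex (pairw p) (fun z => cos (y z.1 - y z.2)).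
Proof.
set S := \sum_f _; have : (sqn S)%:C%C = S * S^*%C by rewrite mul_conjC.
move=> /(congr1 (@complex.Re R)) /= ->; rewrite mulr_suml Re_sum.
rewrite /Ex -(pair_bigA _ (fun a b => pairw p (a, b) * cos (y a - y b))) /=.
apply: eq_bigr => a _; rewrite conj_sum mulr_sumr Re_sum; apply: eq_bigr => b _.
by rewrite /pairw /cis cosB /=; ring.
Qed.

(** The squared modulus is the mean of a cosine of the difference of two copies. On spread pairs the
    difference is at most 1 and the cosine drops by an eighth of its square; elsewhere the cosine is
    at most 1. *)
Lemma sqn_charfn_le (y : F -> R) :
  (forall z, spr z -> (y z.1 - y z.2) ^+ 2 <= 1) ->
  sqn (\sum_f (p f)%:C%C * cis (y f)) <=
  expR (- (Ex (pairw p) (fun z => (spr z)%:R * (y z.1 - y z.2) ^+ 2) / 8)).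
Proof.
move=> h; apply: le_trans (expR_ge1Dx _).
have hq := fdist_pairw hp.
rewrite sqn_charfn; set f := fun z => (spr z)%:R * _.
have -> : 1 + - (Ex (pairw p) f / 8) = Ex (pairw p) (fun z => 1 + - 8^-1 * f z).
  by rewrite Ex_add Ex_scale (Ex_cst hq); ring.
rewrite /f; apply: Ex_le => // z; case hz: (spr z).
  by rewrite mul1r; have := cos_le (h z hz); lra.
by rewrite mul0r mulr0 addr0 cos_le1.
Qed.

Section CharacteristicFunction.
Variables (n : nat) (c : 'I_n -> R[i]) (v : R[i]).
Local Notation X := (fun r : {ffun 'I_n -> F} => v + \sum_j c j * val (r j)).

Definition charfn (t : R[i]) : R[i] :=
  \sum_(r : {ffun 'I_n -> F}) (prodw p r)%:C%C * cis (inner t (X r)).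

Lemma charfn_prod t : charfn t =
  cis (inner t v) * \prod_j \sum_f (p f)%:C%C * cis (inner t (c j * val f)).
Proof.
rewrite bigA_distr_bigA mulr_sumr; apply: eq_bigr => r _.
rewrite innerD cisD inner_sum cis_sum mulrCA; congr (_ * _).
rewrite big_split /=; congr (_ * _).
by rewrite /prodw (big_morph (real_complex R) (rmorphM _) (rmorph1 _)).
Qed.

Variables (N : {set 'I_n}).
Let Om := \sum_(j in N) sqn (c j).
(** The real 2 x 2 matrix of the vectors c_j has eigenvalues (Om + |Q|)/2 and (Om - |Q|)/2, with Q
    the sum of the c_j^2. Hence both are at least Om/4, while |Q| = Om if all c_j lie on one real
    line. *)
Hypothesis isotropic : sqn (\sum_(j in N) c j ^+ 2) <= (Om / 2) ^+ 2.

Lemma Om_ge0 : 0 <= Om. Proof. by apply: sumr_ge0 => j _; exact: sqn_ge0. Qed.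

Lemma sum_inner_sqr_ge t z :
  sqn t * sqn z * Om / 4 <= \sum_(j in N) inner t (c j * z) ^+ 2.
Proof.
rewrite (eq_bigr (fun j => (sqn t * sqn z / 2) * sqn (c j) +
   complex.Re ((t^*%C) ^+ 2 * z ^+ 2 * c j ^+ 2) / 2)); last first.
  move=> j _; rewrite inner_sqr sqnM.
  have -> : (t^*%C) ^+ 2 * z ^+ 2 * c j ^+ 2 = (t^*%C) ^+ 2 * (c j * z) ^+ 2 by ring.
  by field.
rewrite big_split /= -mulr_sumr -mulr_suml -Re_sum -mulr_sumr -/Om.
set Q := \sum_(j in N) _; have isoQ : sqn Q <= (Om / 2) ^+ 2 by exact: isotropic.
have : - (sqn t * sqn z * (Om / 2)) <= complex.Re ((t^*%C) ^+ 2 * z ^+ 2 * Q).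
  have Om0 := Om_ge0; apply: Re_ge; first by rewrite !mulr_ge0 ?sqn_ge0 ?invr_ge0.
  rewrite !expr2 !sqnM sqn_conj -!expr2 !exprMn !expr2.
  move: isoQ; set q := sqn Q => hq.
  have : 0 <= (sqn t * sqn t * (sqn z * sqn z)) * ((Om / 2) ^+ 2 - q).
    by rewrite !mulr_ge0 ?sqn_ge0 ?subr_ge0.
  by rewrite expr2; lra.
lra.
Qed.

Lemma charfn_le t : (forall j, j \in N -> sqn t * sqn (c j) <= tau ^+ 2) ->
  sqn (charfn t) <= expR (- (sqn t * tau ^+ 3 * Om / 32)).
Proof.
have /andP[t0 t1] := tau01; have hq := fdist_pairw hp.
move=> ht; rewrite charfn_prod sqnM sqn_cis mul1r sqn_prod.
pose e j := Ex (pairw p) (fun z => (spr z)%:R * inner t (c j * (val z.1 - val z.2)) ^+ 2).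
apply: (@le_trans _ _ (\prod_j (if j \in N then expR (- (e j / 8)) else 1))).
  apply: ler_prod => j _; rewrite sqn_ge0 /=; case: ifP => jN.
    apply: le_trans (sqn_charfn_le _) _ => [z /andP[_ hz]|].
      rewrite -innerB -mulrBr; apply: le_trans (inner_sqr_le _ _) _; rewrite sqnM.
      apply: le_trans (_ : tau ^+ 2 * tau ^- 2 <= _); last first.
        by rewrite divff // expf_neq0 ?gt_eqF.
      by rewrite mulrA ler_pM ?mulr_ge0 ?sqn_ge0 ?ht.
    rewrite ler_expR le_eqVlt; apply/orP; left; apply/eqP; congr (- (_ / _)).
    by apply: eq_bigr => z _; rewrite -innerB -mulrBr.
  by rewrite sqn_charfn -(Ex_cst hq 1); apply: Ex_le => // z; exact: cos_le1.
rewrite -big_mkcond -expR_sum ler_expR sumrN lerN2 -mulr_suml /e -Ex_sum.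
have : sqn t * tau ^+ 2 * Om / 4 * tau <= Ex (pairw p)
   (fun z => \sum_(j in N) (spr z)%:R * inner t (c j * (val z.1 - val z.2)) ^+ 2).
  have h0 : 0 <= sqn t * tau ^+ 2 * Om / 4.
    by have Om0 := Om_ge0; rewrite !mulr_ge0 ?sqn_ge0 ?invr_ge0 ?exprn_ge0 // ltW.
  apply: le_trans (ler_wpM2l h0 law) _; rewrite -Ex_scale; apply: Ex_le => // z.
  rewrite -mulr_sumr; case hz: (spr z); last by rewrite mulr0 mul0r.
  rewrite mulr1 mul1r; apply: le_trans (sum_inner_sqr_ge _ _).
  have /andP[hz1 _] := hz.
  by rewrite ler_wpM2r ?invr_ge0 // ler_wpM2r ?Om_ge0 // ler_wpM2l ?sqn_ge0.
set a := Ex _ _; have -> : tau ^+ 3 = tau ^+ 2 * tau by rewrite -exprSr.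
lra.
Qed.

(** The product of two Fejer kernels at step h is at least m^4/16 on the disc of radius 1/(h m). Its
    mean sums the characteristic function over frequencies h (l - l', q - q'), where the hypothesis
    on [Om] gives Gaussian decay, so it is at most (3 m)^2; and 16 * 9 = 144. The last hypothesis
    keeps the largest frequency in the range of [charfn_le]. *)
Lemma planar_small_ball (m : nat) (h : R) : (0 < m)%N -> 0 < h ->
  64 <= h ^+ 2 * tau ^+ 3 * Om ->
  (forall j, j \in N -> 2 * (m%:R * h) ^+ 2 * sqn (c j) <= tau ^+ 2) ->
  Pr (prodw p) (fun r => sqn (X r) <= (h * m%:R) ^- 2) <= 144 / m%:R ^+ 2.
Proof.
move=> m0 h0 hOm hc; have /andP[t0 t1] := tau01.
have hpw := @fdist_prodw R 'I_n _ _ hp.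
have m0R : 0 < m%:R :> R by rewrite ltr0n.
pose K (z : R[i]) := fejer m (h * complex.Re z) * fejer m (h * complex.Im z).
pose tt (l l' q q' : 'I_m) : R[i] := ((h * (l%:R - l'%:R)) +i* (h * (q%:R - q'%:R)))%C.
have EK : Ex (prodw p) (fun r => K (X r)) <= (3 * m%:R) ^+ 2.
  have -> : Ex (prodw p) (fun r => K (X r)) =
    \sum_(l < m) \sum_(l' < m) \sum_(q < m) \sum_(q' < m) complex.Re (charfn (tt l l' q q')).
    rewrite /Ex; under eq_bigr => r _.
      have -> : K (X r) = \sum_(l < m) \sum_(l' < m) \sum_(q < m) \sum_(q' < m)
         complex.Re (cis (inner (tt l l' q q') (X r))).
        have : (K (X r))%:C%C = \sum_(l < m) \sum_(l' < m) \sum_(q < m) \sum_(q' < m)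
          cis (inner (tt l l' q q') (X r)).
          rewrite /K rmorphM /= !fejerE mulr_suml; apply: eq_bigr => l _.
          rewrite mulr_suml; apply: eq_bigr => l' _.
          rewrite mulr_sumr; apply: eq_bigr => q _.
          rewrite mulr_sumr; apply: eq_bigr => q' _.
          by rewrite -cisD; congr cis; rewrite /inner /tt /=; ring.
        move=> /(congr1 (@complex.Re R)) /= ->.
        rewrite Re_sum; apply: eq_bigr => l _; rewrite Re_sum; apply: eq_bigr => l' _.
        by rewrite Re_sum; apply: eq_bigr => q _; rewrite Re_sum.
      over.
    rewrite /=; under eq_bigr do rewrite mulr_sumr.
    rewrite exchange_big /=; apply: eq_bigr => l _.
    under eq_bigr do rewrite mulr_sumr.
    rewrite exchange_big /=; apply: eq_bigr => l' _.
    under eq_bigr do rewrite mulr_sumr.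
    rewrite exchange_big /=; apply: eq_bigr => q _.
    under eq_bigr do rewrite mulr_sumr.
    rewrite exchange_big /=; apply: eq_bigr => q' _.
    rewrite /charfn Re_sum; apply: eq_bigr => r _ /=; ring.
  apply: (@le_trans _ _ (\sum_(l < m) \sum_(l' < m) \sum_(q < m) \sum_(q' < m)
     (expR (- (l%:R - l'%:R : R) ^+ 2) * expR (- (q%:R - q'%:R : R) ^+ 2)))); last first.
    apply: (@le_trans _ _ ((\sum_(l < m) \sum_(l' < m) expR (- (l%:R - l'%:R : R) ^+ 2)) ^+ 2)).
      rewrite expr2 mulr_suml; apply: ler_sum => l _; rewrite mulr_suml; apply: ler_sum => l' _.
      rewrite mulr_sumr; apply: ler_sum => q _; rewrite mulr_sumr; exact: ler_sum.
    rewrite ler_pXn2r ?nnegrE ?gauss_sum_le // ?mulr_ge0 //.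
    by apply: sumr_ge0 => l _; apply: sumr_ge0 => l' _; exact: expR_ge0.
  apply: ler_sum => l _; apply: ler_sum => l' _; apply: ler_sum => q _; apply: ler_sum => q' _.
  have diff_le (a b : 'I_m) : (a%:R - b%:R : R) ^+ 2 <= m%:R ^+ 2.
    have : a%:R <= m%:R :> R by rewrite ler_nat ltnW.
    have : b%:R <= m%:R :> R by rewrite ler_nat ltnW.
    have : 0 <= a%:R :> R by []. have : 0 <= b%:R :> R by [].
    nra.
  have sqt : sqn (tt l l' q q') = h ^+ 2 * ((l%:R - l'%:R) ^+ 2 + (q%:R - q'%:R) ^+ 2).
    by rewrite /sqn /=; ring.
  have h2 : 0 < h ^+ 2 by rewrite exprn_gt0.
  have := @charfn_le (tt l l' q q') _.
  rewrite sqt => /(_ _)/wrap[j jN|].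
    apply: le_trans (hc j jN); rewrite ler_wpM2r ?sqn_ge0 // exprMn.
    by have := diff_le l l'; have := diff_le q q'; nra.
  set d := _ ^+ 2 + _ ^+ 2 => hle.
  have d0 : 0 <= d by rewrite addr_ge0 ?sqr_ge0.
  have hle2 : sqn (charfn (tt l l' q q')) <= expR (- d) ^+ 2.
    apply: le_trans hle _; rewrite [leRHS]expr2 -expRD ler_expR.
    have : 0 <= d * (h ^+ 2 * tau ^+ 3 * Om - 64) by rewrite mulr_ge0 ?subr_ge0.
    lra.
  rewrite -expRD; have -> : - (l%:R - l'%:R : R) ^+ 2 + - (q%:R - q'%:R) ^+ 2 = - d by rewrite /d; ring.
  have := expR_ge0 (- d); move: hle2; rewrite /sqn.
  set a := complex.Re _; set b := complex.Im _; set e := expR _.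
  by have := sqr_ge0 b; nra.
apply: (@le_trans _ _ (Ex (prodw p) (fun r => 16 / m%:R ^+ 4 * K (X r)))).
  apply: Pr_markov => //.
    by move=> r; rewrite !mulr_ge0 ?fejer_ge0 // invr_ge0 exprn_ge0.
  move=> r hr.
  have hre (x : R) : x ^+ 2 <= sqn (X r) -> m%:R ^+ 2 / 4 <= fejer m (h * x).
    move=> hx; apply: fejer_ge; rewrite mulrA exprMn [m%:R * h]mulrC.
    rewrite -[leRHS](@divff _ ((h * m%:R) ^+ 2)); last by rewrite expf_neq0 // mulf_neq0 ?gt_eqF.
    by rewrite ler_pM2l ?exprn_gt0 ?mulr_gt0 //; apply: le_trans hx hr.
  have h1 : m%:R ^+ 2 / 4 <= fejer m (h * complex.Re (X r)).
    by apply: hre; rewrite /sqn lerDl sqr_ge0.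
  have h2 : m%:R ^+ 2 / 4 <= fejer m (h * complex.Im (X r)).
    by apply: hre; rewrite /sqn lerDr sqr_ge0.
  rewrite [leLHS](_ : 1 = 16 / m%:R ^+ 4 * (m%:R ^+ 2 / 4 * (m%:R ^+ 2 / 4))); last first.
    by field; rewrite gt_eqF.
  apply: ler_wpM2l; first by rewrite divr_ge0 // exprn_ge0.
  by apply: ler_pM => //; rewrite divr_ge0 // exprn_ge0.
rewrite Ex_scale.
have -> : 144 / m%:R ^+ 2 = 16 / m%:R ^+ 4 * (3 * m%:R) ^+ 2 :> R by field; rewrite gt_eqF.
by apply: ler_wpM2l EK; rewrite divr_ge0 // exprn_ge0.
Qed.
End CharacteristicFunction.
End PlanarSmallBall.

(** * Random vectors in a frame *)

Section RandomPhases.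
Variable R : realType.

Definition unif4 (a : 'I_4) : R := 4^-1.

Lemma fdist_unif4 : fdist unif4.
Proof.
split=> [a|]; first by rewrite invr_ge0.
by rewrite /unif4 sumr_const card_ord -[LHS]mulr_natr mulVf // pnatr_eq0.
Qed.

(** Fourth roots of unity rather than signs: the square of a random phase also has mean zero, so a
    random combination has no preferred real direction. *)
Definition phase (a : 'I_4) : R[i] := 'i%C ^+ a.

Lemma iC2 : ('i%C : R[i]) ^+ 2 = -1.
Proof. exact: sqr_i. Qed.

Lemma iC4 : ('i%C : R[i]) ^+ 4 = 1.
Proof. by rewrite (exprM _ 2 2) iC2 sqrrN expr1n. Qed.

Lemma iXmod (m : nat) : ('i%C : R[i]) ^+ m = 'i%C ^+ (m %% 4).
Proof. by rewrite {1}(divn_eq m 4) exprD mulnC exprM iC4 expr1n mul1r. Qed.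

Lemma conj_phase a : (phase a)^*%C = phase a ^+ 3.
Proof.
have h : ('i%C : R[i])^*%C = 'i%C ^+ 3.
  by rewrite exprS iC2; apply/eqP; rewrite eq_complex /=; apply/andP; split; apply/eqP; ring.
have -> : (phase a)^*%C = ('i%C^*%C) ^+ a by rewrite /phase rmorphXn.
by rewrite h -!exprM mulnC.
Qed.

Lemma conj_phaseX a e : (phase a ^+ e)^*%C = phase a ^+ (3 * e).
Proof.
have -> : (phase a ^+ e)^*%C = (phase a)^*%C ^+ e by rewrite rmorphXn.
by rewrite conj_phase -exprM.
Qed.

Lemma sum_phase (e : nat) :
  \sum_a (unif4 a)%:C%C * phase a ^+ e = ((4 %| e)%N%:R : R[i]).
Proof.
rewrite /unif4 -mulr_sumr /phase.
have -> : \sum_(a < 4) ('i%C ^+ a) ^+ e = \sum_(a < 4) (('i%C : R[i]) ^+ (e %% 4)) ^+ a.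
  by apply: eq_bigr => a _; rewrite -!exprM [LHS]iXmod [RHS]iXmod modnMml mulnC.
rewrite /dvdn; have : (e %% 4 < 4)%N by rewrite ltn_mod.
have c4 : (4^-1 : R)%:C%C = 4^-1 by rewrite fmorphV rmorph_nat.
rewrite c4; move: iC2; generalize ('i%C : R[i]) => z z2.
case: (e %% 4)%N => [|[|[|[|m]]]] // _; rewrite !big_ord_recl big_ord0 /bump /=.
- by rewrite !expr1n !addr0 -[X in _ * X]/(4%:R) mulVf // pnatr_eq0.
- rewrite (_ : _ + _ = (1 + z) * (1 + z ^+ 2)); last by ring.
  by rewrite z2 subrr !mulr0.
- rewrite (_ : _ + _ = (1 + z ^+ 2) * (1 + z ^+ 4)); last by ring.
  by rewrite z2 subrr mul0r mulr0.
- rewrite (_ : _ + _ = (1 + z ^+ 3) * (1 + (z ^+ 2) ^+ 3)); last by ring.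
  by rewrite z2 -signr_odd expr1 subrr !mulr0.
Qed.

Variable k : nat.
Local Notation Om := {ffun 'I_k -> 'I_4}.

Definition phase_law : Om -> R := prodw unif4.

Lemma fdist_phase_law : fdist phase_law.
Proof. exact: (@fdist_prodw R 'I_k _ _ fdist_unif4). Qed.

Definition monomial (e : 'I_k -> nat) (g : Om) : R[i] := \prod_l phase (g l) ^+ e l.

Lemma sum_mono (e : 'I_k -> nat) :
  \sum_g (phase_law g)%:C%C * monomial e g = [forall l, (4 %| e l)%N]%:R.
Proof.
transitivity (\prod_(l < k) \sum_a (unif4 a)%:C%C * phase a ^+ e l).
  rewrite bigA_distr_bigA; apply: eq_bigr => g _ /=.
  rewrite big_split /=; congr (_ * _).
  by rewrite /phase_law /prodw (big_morph (real_complex R) (rmorphM _) (rmorph1 _)).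
under eq_bigr do rewrite sum_phase.
case: forallP => h; first by rewrite big1 // => l _; rewrite h.
have /existsP[l hl] : [exists l, ~~ (4 %| e l)%N].
  by rewrite -negb_forall; apply/forallP.
by rewrite (bigD1 l) //= (negbTE hl) mul0r.
Qed.

(* Schur test for the Gram matrix of the monomials. *)
Lemma Ex_sqn_mono (P : finType) (Q : pred P) (e : P -> 'I_k -> nat) (al : P -> R[i]) (C : R) :
  (forall x, Q x -> \sum_(y | Q y) [forall l, (4 %| e x l + 3 * e y l)%N]%:R <= C) ->
  Ex phase_law (fun g => sqn (\sum_(x | Q x) al x * monomial (e x) g)) <=
  C * \sum_(x | Q x) sqn (al x).
Proof.
move=> hC; pose M x y : R := [forall l, (4 %| e x l + 3 * e y l)%N]%:R.
have Msym x y : M x y = M y x.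
  by rewrite /M; congr (_%:R); congr (nat_of_bool _); apply: eq_forallb => l; apply/idP/idP; lia.
have -> : Ex phase_law (fun g => sqn (\sum_(x | Q x) al x * monomial (e x) g)) =
  \sum_(x | Q x) \sum_(y | Q y) complex.Re (al x * (al y)^*%C) * M x y.
  transitivity (complex.Re (\sum_g (phase_law g)%:C%C * (\sum_(x | Q x) \sum_(y | Q y)
      al x * (al y)^*%C * monomial (fun l => e x l + 3 * e y l)%N g))).
    rewrite Re_sum; apply: eq_bigr => g _.
    suff <- : (sqn (\sum_(x | Q x) al x * monomial (e x) g))%:C%C = \sum_(x | Q x) \sum_(y | Q y)
        al x * (al y)^*%C * monomial (fun l => e x l + 3 * e y l)%N g by rewrite -rmorphM.
    rewrite -mul_conjC mulr_suml; apply: eq_bigr => x _.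
    rewrite conj_sum mulr_sumr; apply: eq_bigr => y _.
    rewrite rmorphM /= mulrACA; congr (_ * _).
    rewrite /monomial (big_morph (fun z : R[i] => z^*%C) (fun x y => rmorphM _ x y) (conjc1 _)).
    rewrite -big_split; apply: eq_bigr => l _ /=.
    by rewrite conj_phaseX -exprD.
  under eq_bigr do rewrite mulr_sumr.
  rewrite exchange_big Re_sum /=; apply: eq_bigr => x _.
  under eq_bigr do rewrite mulr_sumr.
  rewrite exchange_big Re_sum /=; apply: eq_bigr => y _.
  under eq_bigr do rewrite mulrCA.
  rewrite -mulr_sumr sum_mono /M; case: [forall l, _]; last by rewrite !mulr0.
  by rewrite !mulr1.
apply: (@le_trans _ _ (\sum_(x | Q x) \sum_(y | Q y) ((sqn (al x) + sqn (al y)) / 2) * M x y)).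
  apply: ler_sum => x _; apply: ler_sum => y _; apply: ler_wpM2r; first exact: ler0n.
  case: (al x) (al y) => [a b] [c d]; rewrite /sqn /=.
  by have := sqr_ge0 (a - c); have := sqr_ge0 (b - d); nra.
have h1 : \sum_(x | Q x) \sum_(y | Q y) sqn (al x) * M x y <= C * \sum_(x | Q x) sqn (al x).
  rewrite mulr_sumr; apply: ler_sum => x Qx; rewrite -mulr_sumr mulrC.
  by rewrite ler_wpM2r ?sqn_ge0 // hC.
have h2 : \sum_(x | Q x) \sum_(y | Q y) sqn (al y) * M x y = \sum_(x | Q x) \sum_(y | Q y) sqn (al x) * M x y.
  by rewrite exchange_big /=; apply: eq_bigr => x _; apply: eq_bigr => y _; rewrite Msym.
rewrite (_ : \sum_(x | Q x) _ = (\sum_(x | Q x) \sum_(y | Q y) sqn (al x) * M x y +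
    \sum_(x | Q x) \sum_(y | Q y) sqn (al y) * M x y) / 2); first by rewrite h2; lra.
rewrite -big_split mulr_suml; apply: eq_bigr => x _.
by rewrite -big_split mulr_suml; apply: eq_bigr => y _ /=; ring.
Qed.

Definition phase_vector (g : Om) : 'cV[R[i]]_k := \col_a phase (g a).

Lemma mono1 (g : Om) a : monomial (fun l => (l == a) : nat) g = phase (g a).
Proof.
rewrite /monomial (bigD1 a) //= eqxx expr1 big1 ?mulr1 // => l /negbTE ->.
by rewrite expr0.
Qed.

Lemma mono_add (g : Om) e f : monomial (fun l => e l + f l)%N g = monomial e g * monomial f g.
Proof. by rewrite /monomial -big_split; apply: eq_bigr => l _; rewrite exprD. Qed.

Lemma mono_mul3 (g : Om) e : monomial (fun l => 3 * e l)%N g = (monomial e g)^*%C.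
Proof.
rewrite /monomial (big_morph (fun z : R[i] => z^*%C) (fun x y => rmorphM _ x y) (conjc1 _)).
by apply: eq_bigr => l _; rewrite conj_phaseX.
Qed.

Lemma count1 (P : finType) (Q : pred P) (S : pred P) (y0 : P) :
  (forall y, Q y -> S y -> y = y0) -> \sum_(y | Q y) (S y)%:R <= (1 : R).
Proof.
move=> h; have [Qy0|nQ] := boolP (Q y0); last first.
  rewrite big1 // => y Qy; case Sy: (S y) => //.
  by move: nQ; rewrite -(h y Qy Sy) Qy.
rewrite (bigD1 y0) //= big1 ?addr0 ?lern1 ?leq_b1 // => y /andP[Qy /eqP yn].
by case Sy: (S y) => //; case: yn; exact: h.
Qed.

Lemma Ex_linear (al : 'I_k -> R[i]) :
  Ex phase_law (fun g => sqn (\sum_a al a * phase (g a))) <= \sum_a sqn (al a).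
Proof.
have := @Ex_sqn_mono 'I_k xpredT (fun a l => (l == a) : nat) al 1 _.
rewrite mul1r => /(_ _)/wrap[a _|].
  apply: (@count1 _ _ _ a) => y _ /forallP /(_ a); rewrite eqxx.
  by case: eqP => // ->.
by apply: le_trans; apply: Ex_le => [|g]; [exact: fdist_phase_law|under eq_bigr do rewrite -mono1].
Qed.

Lemma Ex_linear_mx m (A : 'M[R[i]]_(m, k)) :
  Ex phase_law (fun g => nrm2 (A *m phase_vector g)) <= nrm2 A.
Proof.
under [X in X <= _]eq_bigr do rewrite nrm2_cV.
have -> : \sum_i phase_law i * (\sum_(i0 < m) sqn ((A *m phase_vector i) i0 0)) =
  \sum_(j < m) Ex phase_law (fun g => sqn ((A *m phase_vector g) j 0)).
  by rewrite -Ex_sum.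
apply: ler_sum => j _; apply: le_trans (Ex_linear (fun a => A j a)).
apply: Ex_le => [|g]; first exact: fdist_phase_law.
by rewrite mxE; under eq_bigr do rewrite mxE.
Qed.

(** The factor 2 arises because the index pairs (a, b) and (b, a) give the same monomial; all other
    pairs are orthogonal. *)
Lemma Ex_quadratic (A : 'M[R[i]]_k) :
  Ex phase_law (fun g => sqn (\sum_a \sum_b A a b * (phase (g a) * phase (g b)))) <= 2 * nrm2 A.
Proof.
have := @Ex_sqn_mono ('I_k * 'I_k)%type xpredT (fun x l => (l == x.1) + (l == x.2))%N
  (fun x => A x.1 x.2) 2 _.
rewrite /nrm2 (pair_bigA _ (fun a b => sqn (A a b))) /= => /(_ _)/wrap[[a b] _ /=|].
  apply: (@le_trans _ _ (\sum_(y : 'I_k * 'I_k) ((y == (a, b))%:R + (y == (b, a))%:R))).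
    apply: ler_sum => -[c d] _ /=; case: forallP => [h|_]; last by rewrite addr_ge0.
    have := h a; have := h b; rewrite !eqxx /= !xpair_eqE.
    rewrite [b == a]eq_sym ![a == _]eq_sym ![b == _]eq_sym.
    have [ca|ca] := eqVneq c a; have [da|da] := eqVneq d a;
    have [cb|cb] := eqVneq c b; have [db|db] := eqVneq d b; subst; rewrite ?eqxx /=;
    rewrite ?(negbTE ca) ?(negbTE cb) ?(negbTE da) ?(negbTE db) //= ?addr0 ?add0r //; 
    by rewrite ?lerDl ?ler1n //; case: (_ == _).
  rewrite big_split /= (_ : 2 = 1 + 1) //; apply: lerD.
    by apply: (@count1 _ _ _ (a, b)) => y _ /eqP.
  by apply: (@count1 _ _ _ (b, a)) => y _ /eqP.
apply: le_trans; apply: Ex_le => [|g]; first exact: fdist_phase_law.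
rewrite pair_bigA /= le_eqVlt; apply/orP; left; apply/eqP; congr sqn.
by apply: eq_bigr => -[a b] _ /=; rewrite mono_add !mono1.
Qed.

(** The diagonal terms are constant and make up the trace. Distinct off-diagonal pairs are
    orthogonal, including (a, b) against (b, a), whose quotient is a product of squares of
    phases. *)
Lemma Ex_hermitian (B : 'M[R[i]]_k) :
  Ex phase_law (fun g => sqn (\sum_a \sum_b B a b * (phase (g a) * (phase (g b))^*%C) - \tr B)) <= nrm2 B.
Proof.
have := @Ex_sqn_mono ('I_k * 'I_k)%type (fun x => x.1 != x.2)
  (fun x l => (l == x.1) + 3 * (l == x.2))%N (fun x => B x.1 x.2) 1 _.
rewrite mul1r => /(_ _)/wrap[[a b] /= ab|h].
  apply: (@count1 _ _ _ (a, b)) => -[c d] /= cd /forallP h.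
  have := h a; have := h b; rewrite !eqxx /= (negbTE ab) [b == a]eq_sym (negbTE ab).
  rewrite ![a == _]eq_sym ![b == _]eq_sym.
  have [ca|ca] := eqVneq c a; have [da|da] := eqVneq d a;
  have [cb|cb] := eqVneq c b; have [db|db] := eqVneq d b; subst; rewrite ?eqxx //=;
  by rewrite ?(negbTE ca) ?(negbTE cb) ?(negbTE da) ?(negbTE db) //=; move: ab cd; rewrite ?eqxx.
apply: (@le_trans _ _ (\sum_(x : 'I_k * 'I_k | x.1 != x.2) sqn (B x.1 x.2))); last first.
  rewrite /nrm2 (pair_bigA _ (fun a b => sqn (B a b))) /= [leRHS](bigID (fun x : 'I_k * 'I_k => x.1 != x.2)) /= lerDl.
  by apply: sumr_ge0 => x _; exact: sqn_ge0.
apply: le_trans h; apply: Ex_le => [|g]; first exact: fdist_phase_law.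
rewrite pair_bigA /= le_eqVlt; apply/orP; left; apply/eqP; congr sqn.
rewrite [X in X - _ = _](bigID (fun x : 'I_k * 'I_k => x.1 != x.2)) /=.
rewrite [X in _ + X - _ = _](_ : _ = \tr B); last first.
  have unit_phase a : phase a * (phase a)^*%C = 1.
    by rewrite conj_phase -exprS /phase -exprM mulnC exprM iC4 expr1n.
  rewrite /mxtrace -(pair_big_dep xpredT (fun a b => ~~ (a != b))
   (fun a b => B a b * (phase (g a) * (phase (g b))^*%C))) /=.
  apply: eq_bigr => a _; rewrite (big_pred1 a) => [|b /=]; first by rewrite unit_phase mulr1.
  by rewrite negbK eq_sym.
rewrite addrK; apply: eq_bigr => -[a b] _ /=.
by rewrite mono_add mono_mul3 !mono1.
Qed.
End RandomPhases.

Section GoodVector.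
Variables (R : realType) (n k : nat) (U : 'M[R[i]]_(n, k)).
Hypothesis hU : isometric U.

Lemma isometric_trmx_le p (W : 'M[R[i]]_(n, p)) : nrm2 (U^T *m W) <= nrm2 W.
Proof.
rewrite -[leLHS]nrm2_tr trmx_mul trmxK -[leRHS]nrm2_tr.
apply: ler_sum => i _.
have := isometric_adj (row i W^T) hU; rewrite !nrm2_rV.
rewrite -row_mul; under eq_bigr do rewrite mxE.
by move=> /le_trans; apply; apply: ler_sum => j _; rewrite !mxE.
Qed.

Lemma nrm2_diag_le (s : 'I_n -> R) p (W : 'M[R[i]]_(n, p)) : (forall j, 0 <= s j <= 1) ->
  nrm2 (\matrix_(j, a) ((s j)%:C%C * W j a)) <= nrm2 W.
Proof.
move=> hs; apply: ler_sum => j _; apply: ler_sum => a _.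
rewrite mxE sqnM sqn_real ler_piMl ?sqn_ge0 //.
by have /andP[] := hs j; nra.
Qed.

(** A quadratic form in the phases, with matrix the transpose of [U] times diag(s) times [U], of
    squared Frobenius norm at most k. The pseudo-variance is thus of order sqrt k, negligible
    against a mass proportional to k. *)
Lemma Ex_weighted_squares (s : 'I_n -> R) : (forall j, 0 <= s j <= 1) ->
  Ex (@phase_law R k) (fun g => sqn (\sum_j (s j)%:C%C * ((U *m phase_vector R g) j 0) ^+ 2)) <= 2 * k%:R.
Proof.
move=> hs; pose A := U^T *m (\matrix_(j, a) ((s j)%:C%C * U j a)).
have hA : nrm2 A <= k%:R.
  rewrite -(isometric_nrm2 hU); apply: le_trans (isometric_trmx_le _) _.
  exact: nrm2_diag_le.
apply: (@le_trans _ _ (2 * nrm2 A)); last by rewrite ler_pM2l.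
apply: le_trans (Ex_quadratic A); rewrite le_eqVlt; apply/orP; left; apply/eqP.
apply: eq_bigr => g _; congr (_ * sqn _).
under [RHS]eq_bigr do under eq_bigr do rewrite mxE mulr_suml.
under [RHS]eq_bigr do rewrite exchange_big /=.
rewrite exchange_big /=; apply: eq_bigr => j _.
rewrite mxE expr2 mulr_suml mulr_sumr; apply: eq_bigr => a _.
rewrite mulr_sumr mulr_sumr; apply: eq_bigr => b _.
by rewrite !mxE; ring.
Qed.

Lemma Ex_weighted_norms (s : 'I_n -> R) : (forall j, 0 <= s j <= 1) ->
  Ex (@phase_law R k) (fun g => (\sum_j s j * sqn ((U *m phase_vector R g) j 0) - \sum_j s j * rown U j) ^+ 2) <= k%:R.
Proof.
move=> hs; pose B := U^T *m (\matrix_(j, a) ((s j)%:C%C * (U j a)^*%C)).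
have hB : nrm2 B <= k%:R.
  apply: le_trans (isometric_trmx_le _) _.
  rewrite -(isometric_nrm2 hU) -[leRHS]nrm2_conj.
  rewrite (_ : \matrix_(j, a) _ = \matrix_(j, a) ((s j)%:C%C * (map_mx conjc U) j a)).
    exact: nrm2_diag_le.
  by apply/matrixP => j a; rewrite !mxE.
apply: le_trans hB; apply: le_trans (Ex_hermitian B).
rewrite le_eqVlt; apply/orP; left; apply/eqP.
apply: eq_bigr => g _; congr (_ * _).
have trB : \tr B = (\sum_j s j * rown U j)%:C%C.
  rewrite /mxtrace RC_sum; under eq_bigr do rewrite mxE.
  rewrite exchange_big /=; apply: eq_bigr => j _.
  rewrite rmorphM /= /rown RC_sum mulr_sumr; apply: eq_bigr => a _.
  by rewrite !mxE -mul_conjC; ring.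
have SB : \sum_a \sum_b B a b * (phase R (g a) * (phase R (g b))^*%C) =
   (\sum_j s j * sqn ((U *m phase_vector R g) j 0))%:C%C.
  rewrite RC_sum; under eq_bigr do under eq_bigr do rewrite mxE mulr_suml.
  under eq_bigr do rewrite exchange_big /=.
  rewrite exchange_big /=; apply: eq_bigr => j _.
  rewrite rmorphM /= -mul_conjC mxE conj_sum mulr_suml mulr_sumr; apply: eq_bigr => a _.
  rewrite mulr_sumr mulr_sumr; apply: eq_bigr => b _.
  by rewrite !mxE rmorphM /=; ring.
by rewrite trB SB -rmorphB sqn_real.
Qed.

(** Fourth moments control all coordinates of [L] at once: when every [rown U j] there is of order
    k/n, the sum over [L] of these bounds is of order k^2/n, and after division by k^2 the largest
    coordinate is small. *)
Lemma Ex_coord4 (j : 'I_n) :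
  Ex (@phase_law R k) (fun g => sqn ((U *m phase_vector R g) j 0) ^+ 2) <= 2 * rown U j ^+ 2.
Proof.
pose A := \matrix_(a, b) (U j a * U j b).
have hA : nrm2 A = rown U j ^+ 2.
  rewrite expr2 {1}/rown mulr_suml; apply: eq_bigr => a _.
  by rewrite mulr_sumr; apply: eq_bigr => b _; rewrite mxE sqnM.
rewrite -hA; apply: le_trans (Ex_quadratic A).
rewrite le_eqVlt; apply/orP; left; apply/eqP.
apply: eq_bigr => g _; congr (_ * _); rewrite expr2 -sqnM; congr sqn.
rewrite mxE mulr_suml; apply: eq_bigr => a _; rewrite mulr_sumr.
by apply: eq_bigr => b _; rewrite !mxE; ring.
Qed.

Variables (J L : {set 'I_n}) (m q : nat) (H : {set 'I_m}) (B : 'M[R[i]]_(q, n)).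
Variables (s : 'I_m -> 'I_n -> R) (rho2 D D4 eta beta b4 : R).
Hypothesis k0 : (0 < k)%N.
Hypothesis hs : forall i j, 0 <= s i j <= 1.
Hypothesis rho0 : 0 < rho2.
Hypothesis D0 : 0 < D.
Hypothesis eta0 : 0 < eta.
Hypothesis beta0 : 0 < beta.
Hypothesis b40 : 0 < b4.
Hypothesis hJ : \sum_(j | j \notin J) rown U j <= rho2 * k%:R.
Hypothesis hB : nrm2 (B *m U) <= D * k%:R.
Hypothesis hL : \sum_(j in L) rown U j ^+ 2 <= D4 * k%:R ^+ 2.
Hypothesis hk : 30 <= beta * eta ^+ 2 * k%:R.
Hypothesis hb : 20 * D4 <= b4.

(** First moment argument: five nonnegative functionals of the phases, scaled so that their means
    are at most 1/4 and four times 1/10. The total is below 1, hence some choice of phases makes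
    each of them at most 1. *)
Lemma good_vector : exists u : 'cV[R[i]]_n,
  [/\ nrm2 u <= 4, \sum_(j | j \notin J) sqn (u j 0) <= 10 * rho2,
      nrm2 (B *m u) <= 10 * D, forall j, j \in L -> sqn (u j 0) ^+ 2 <= b4
    & #|[set i in H | ~~ ((sqn (\sum_j (s i j)%:C%C * u j 0 ^+ 2) <= eta ^+ 2) &&
         ((\sum_j s i j * sqn (u j 0) - (\sum_j s i j * rown U j) / k%:R) ^+ 2 <= eta ^+ 2))]|%:R <=
      beta * #|H|%:R].
Proof.
have kR : 0 < k%:R :> R by rewrite ltr0n.
have hw := @fdist_phase_law R k.
pose u' g := U *m @phase_vector R k g.
pose bad i g := (sqn (\sum_j (s i j)%:C%C * u' g j 0 ^+ 2) +
   (\sum_j s i j * sqn (u' g j 0) - \sum_j s i j * rown U j) ^+ 2).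
pose T1 g := nrm2 (u' g); pose T2 g := \sum_(j | j \notin J) sqn (u' g j 0).
pose T3 g := nrm2 (B *m u' g); pose T4 g := \sum_(i in H) bad i g.
pose T5 g := \sum_(j in L) sqn (u' g j 0) ^+ 2.
pose c1 : R := (4 * k%:R)^-1; pose c2 := (10 * rho2 * k%:R)^-1; pose c3 := (10 * D * k%:R)^-1.
(* For empty [H] the inverse of 0 is 0, so the functional vanishes; the bound on the bad rows is
   then settled apart. *)
pose c4 := (k%:R ^+ 2 * eta ^+ 2 * beta * #|H|%:R)^-1; pose c5 := (k%:R ^+ 2 * b4)^-1.
have c1p : 0 < c1 by rewrite invr_gt0 mulr_gt0.
have c2p : 0 < c2 by rewrite invr_gt0 !mulr_gt0.
have c3p : 0 < c3 by rewrite invr_gt0 !mulr_gt0.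
have c4p : 0 <= c4 by rewrite invr_ge0 !mulr_ge0 ?exprn_ge0 // ltW.
have c5p : 0 < c5 by rewrite invr_gt0 !mulr_gt0 ?exprn_gt0.
have E1 : Ex (@phase_law R k) T1 <= k%:R.
  by have := Ex_linear_mx U; rewrite (isometric_nrm2 hU).
have E2 : Ex (@phase_law R k) T2 <= rho2 * k%:R.
  apply: le_trans hJ; rewrite Ex_sum; apply: ler_sum => j _.
  apply: le_trans (Ex_linear (fun a => U j a)); apply: Ex_le => // g.
  by rewrite mxE; under eq_bigr do rewrite mxE.
have E3 : Ex (@phase_law R k) T3 <= D * k%:R.
  apply: le_trans hB; apply: le_trans (Ex_linear_mx (B *m U)); apply: Ex_le => // g.
  by rewrite /T3 /u' mulmxA.
have E4 : Ex (@phase_law R k) T4 <= #|H|%:R * (3 * k%:R).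
  rewrite Ex_sum mulr_natl -sumr_const; apply: ler_sum => i _.
  rewrite Ex_add; have := Ex_weighted_squares (hs i); have := Ex_weighted_norms (hs i).
  rewrite /u'; lra.
have E5 : Ex (@phase_law R k) T5 <= 2 * (D4 * k%:R ^+ 2).
  apply: le_trans (_ : 2 * \sum_(j in L) rown U j ^+ 2 <= _); last by rewrite ler_pM2l.
  by rewrite Ex_sum mulr_sumr; apply: ler_sum => j _; exact: Ex_coord4.
have : Ex (@phase_law R k) (fun g => c1 * T1 g + (c2 * T2 g + (c3 * T3 g + (c4 * T4 g + c5 * T5 g)))) < 1.
  rewrite !Ex_add !Ex_scale.
  have F1 : c1 * Ex (@phase_law R k) T1 <= 4^-1.
    apply: le_trans (ler_wpM2l (ltW c1p) E1) _; rewrite le_eqVlt; apply/orP; left; apply/eqP.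
    by rewrite /c1; field; rewrite gt_eqF.
  have F2 : c2 * Ex (@phase_law R k) T2 <= 10^-1.
    apply: le_trans (ler_wpM2l (ltW c2p) E2) _; rewrite le_eqVlt; apply/orP; left; apply/eqP.
    by rewrite /c2; field; rewrite !gt_eqF.
  have F3 : c3 * Ex (@phase_law R k) T3 <= 10^-1.
    apply: le_trans (ler_wpM2l (ltW c3p) E3) _; rewrite le_eqVlt; apply/orP; left; apply/eqP.
    by rewrite /c3; field; rewrite !gt_eqF.
  have F4 : c4 * Ex (@phase_law R k) T4 <= 10^-1.
    apply: le_trans (ler_wpM2l c4p E4) _.
    have [h0|hn] := eqVneq (#|H|%:R : R) 0; first by rewrite h0 mul0r mulr0 invr_ge0.
    rewrite [leLHS](_ : _ = 3 / (beta * eta ^+ 2 * k%:R)); last first.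
      by rewrite /c4; field; rewrite hn !gt_eqF.
    by rewrite ler_pdivrMr ?mulr_gt0 ?exprn_gt0 //; move: hk; set x := beta * _ * _; lra.
  have F5 : c5 * Ex (@phase_law R k) T5 <= 10^-1.
    apply: le_trans (ler_wpM2l (ltW c5p) E5) _.
    rewrite [leLHS](_ : _ = 2 * D4 / b4); last by rewrite /c5; field; rewrite !gt_eqF.
    by rewrite ler_pdivrMr // [leRHS]mulrC ler_pdivlMr //; apply: le_trans hb; rewrite mulrAC -natrM.
  lra.
move=> /(Ex_lt_exists hw) [g].
have T1p : 0 <= T1 g by exact: nrm2_ge0.
have T2p : 0 <= T2 g by apply: sumr_ge0 => j _; exact: sqn_ge0.
have T3p : 0 <= T3 g by exact: nrm2_ge0.
have badp i : 0 <= bad i g by rewrite addr_ge0 ?sqn_ge0 ?sqr_ge0.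
have T4p : 0 <= T4 g by apply: sumr_ge0.
have T5p : 0 <= T5 g by apply: sumr_ge0 => j _; exact: sqr_ge0.
have P1 : 0 <= c1 * T1 g by rewrite mulr_ge0 // ltW.
have P2 : 0 <= c2 * T2 g by rewrite mulr_ge0 // ltW.
have P3 : 0 <= c3 * T3 g by rewrite mulr_ge0 // ltW.
have P4 : 0 <= c4 * T4 g by rewrite mulr_ge0.
have P5 : 0 <= c5 * T5 g by rewrite mulr_ge0 // ltW.
move=> hlt.
have Q1 : T1 g <= 4 * k%:R.
  have : c1 * T1 g <= 1 by lra.
  by rewrite mulrC ler_pdivrMr ?mulr_gt0 // mul1r.
have Q2 : T2 g <= 10 * rho2 * k%:R.
  have : c2 * T2 g <= 1 by lra.
  by rewrite mulrC ler_pdivrMr ?mulr_gt0 // mul1r.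
have Q3 : T3 g <= 10 * D * k%:R.
  have : c3 * T3 g <= 1 by lra.
  by rewrite mulrC ler_pdivrMr ?mulr_gt0 // mul1r.
have Q5 : T5 g <= k%:R ^+ 2 * b4.
  have : c5 * T5 g <= 1 by lra.
  by rewrite mulrC ler_pdivrMr ?mulr_gt0 ?exprn_gt0 // mul1r.
(* The combination of k orthonormal columns with unimodular coefficients has squared norm k; this
   scales it to order 1. *)
pose c : R := (Num.sqrt k%:R)^-1.
have c2k : c ^+ 2 = k%:R^-1 by rewrite exprVn sqr_sqrtr ?ltW.
have sc z : sqn (c%:C%C * z) = sqn z / k%:R by rewrite sqnM sqn_real c2k mulrC.
exists (c%:C%C *: u' g); split.
- by rewrite nrm2Z sqn_real c2k mulrC ler_pdivrMr.
- under eq_bigr do rewrite mxE sc.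
  by rewrite -mulr_suml ler_pdivrMr.
- by rewrite -scalemxAr nrm2Z sqn_real c2k mulrC ler_pdivrMr.
- move=> j jL; rewrite mxE sc exprMn exprVn ler_pdivrMr ?exprn_gt0 // mulrC.
  apply: le_trans Q5; rewrite /T5 (bigD1 j) //= lerDl.
  by apply: sumr_ge0 => l _; exact: sqr_ge0.
set Bd := [set i in H | _].
have hbad i : i \in Bd -> k%:R ^+ 2 * eta ^+ 2 <= bad i g.
  rewrite inE => /andP[_]; apply: contraR; rewrite -ltNge => hlt'.
  have hh : sqn (\sum_j (s i j)%:C%C * u' g j 0 ^+ 2) <= k%:R ^+ 2 * eta ^+ 2 /\
     (\sum_j s i j * sqn (u' g j 0) - \sum_j s i j * rown U j) ^+ 2 <= k%:R ^+ 2 * eta ^+ 2.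
    move: hlt'; rewrite /bad; set x := sqn _; set y := _ ^+ 2.
    have : 0 <= x by exact: sqn_ge0. have : 0 <= y by exact: sqr_ge0.
    by move=> *; split; lra.
  have kp : 0 < k%:R^-2 :> R by rewrite invr_gt0 exprn_gt0.
  apply/andP; split.
    under eq_bigr do rewrite mxE exprMn mulrCA.
    rewrite -mulr_sumr sqnM expr2 sqnM !sqn_real c2k mulrC.
    rewrite -invfM -expr2 ler_pdivrMr ?exprn_gt0 // mulrC.
    by case: hh.
  under eq_bigr do rewrite mxE sc mulrA.
  rewrite -mulr_suml -mulrBl exprMn exprVn ler_pdivrMr ?exprn_gt0 // mulrC.
  by case: hh.
have [H0|Hn] := eqVneq #|H| 0%N.
  have : (#|Bd| <= #|H|)%N by apply/subset_leq_card/subsetP => i; rewrite inE => /andP[].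
  by rewrite H0 leqn0 => /eqP ->; rewrite mulr0.
have HR : 0 < #|H|%:R :> R by rewrite ltr0n lt0n.
have Q4 : T4 g <= k%:R ^+ 2 * eta ^+ 2 * beta * #|H|%:R.
  have : c4 * T4 g <= 1 by lra.
  by rewrite mulrC ler_pdivrMr ?mulr_gt0 ?exprn_gt0 // mul1r.
have : #|Bd|%:R * (k%:R ^+ 2 * eta ^+ 2) <= T4 g.
  rewrite mulr_natl -sumr_const; apply: (@le_trans _ _ (\sum_(i in Bd) bad i g)).
    exact: ler_sum.
  rewrite /T4 [leRHS](bigID (mem Bd)) /= [X in _ <= X + _](eq_bigl (mem Bd)); last first.
    by move=> i; rewrite !inE; case: (i \in H).
  by rewrite lerDl; apply: sumr_ge0 => i _; exact: badp.
move=> h; rewrite -(ler_pM2l (_ : 0 < k%:R ^+ 2 * eta ^+ 2)) ?mulr_gt0 ?exprn_gt0 //.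
by rewrite mulrC; apply: le_trans h _; rewrite mulrA.
Qed.
End GoodVector.

(** * Lattice nets of sparse vectors and their cardinality *)

Section Net.
Variable R : realType.

Lemma geometric_two_sided (x : R) (m l : nat) : 0 <= x -> x <= 1 ->
  (1 - x) * \sum_(l' < m) x ^+ ((l - l') + (l' - l)) <= 2.
Proof.
move=> x0 x1.
have below k : (k <= l.+1)%N ->
    (1 - x) * \sum_(l' < k) x ^+ ((l - l') + (l' - l)) <= x ^+ (l.+1 - k).
  elim: k => [|k IH] kl; first by rewrite big_ord0 mulr0 exprn_ge0.
  rewrite big_ord_recr /= mulrDr; have {IH} := IH (ltnW kl).
  have -> : (l - k + (k - l) = l - k)%N by lia.
  have -> : (l.+1 - k.+1 = l - k)%N by lia.
  have -> : (l.+1 - k = (l - k).+1)%N by lia.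
  rewrite exprS; lra.
have [ml|lm] := leqP m l.+1.
  apply: le_trans (below m ml) _; apply: le_trans (_ : 1 <= _); last by rewrite ler1n.
  exact: exprn_ile1.
suff above k : (1 - x) * \sum_(l' < l.+1 + k) x ^+ ((l - l') + (l' - l)) <= 2 - x ^+ k.
  have := above (m - l.+1)%N; rewrite subnKC 1?ltnW // => /le_trans; apply.
  by rewrite gerBl exprn_ge0.
elim: k => [|k IH].
  rewrite addn0; apply: le_trans (below l.+1 (leqnn _)) _.
  by rewrite subnn expr0; lra.
rewrite addnS big_ord_recr /= mulrDr.
have -> : (l - (l.+1 + k) + (l.+1 + k - l) = k.+1)%N by lia.
have := exprn_ge0 k x0; rewrite exprS; move: IH; set a := x ^+ k => IH a0.
have : 0 <= a * (1 - x) ^+ 2 by rewrite mulr_ge0 ?sqr_ge0.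
by rewrite !expr2; lra.
Qed.

Variables (n B : nat).
Local Notation coord := ('I_(B.*2.+1) * 'I_(B.*2.+1))%type.

(** Ordinals below 2B+1 encode the integers from -B to B; [lattice_origin] encodes 0, and [dB] is
    the absolute value. *)
Definition shiftB (a : 'I_(B.*2.+1)) : R := a%:R - B%:R.

Definition lattice_entry (h : R) (z : coord) : R[i] :=
  ((h * shiftB z.1) +i* (h * shiftB z.2))%C.

Definition lattice_point (h : R) (z : {ffun 'I_n -> coord}) : 'cV[R[i]]_n :=
  \col_j lattice_entry h (z j).

Definition lattice_origin : coord := (inord B, inord B).

Lemma lattice_entry_origin h : lattice_entry h lattice_origin = 0.
Proof.
rewrite /lattice_entry /lattice_origin /shiftB /= inordK ?subrr ?mulr0 // ltnS -addnn; exact: leq_addr.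
Qed.

Definition net (h : R) (m : nat) (z : {ffun 'I_n -> coord}) : bool :=
  (#|[set j | z j != lattice_origin]| <= m)%N && (nrm2 (lattice_point h z) <= 16).

Definition dB (a : 'I_(B.*2.+1)) : nat := ((B - a) + (a - B))%N.

Lemma dB_sqr a : (dB a)%:R ^+ 2 = shiftB a ^+ 2.
Proof.
rewrite /dB /shiftB; have [h|h] := leqP a B.
  have -> : (a - B = 0)%N by lia.
  by rewrite addn0 natrB // -sqrrN opprB.
have -> : (B - a = 0)%N by lia.
by rewrite add0n natrB // ltnW.
Qed.

(** Rankin's trick: a coordinate weighs 1 at the origin and y x^(|a|+|b|) elsewhere, with x about
    exp(-1/H). The choice of y makes the weights of one coordinate sum to at most 1 + m/n, hence
    those of all points to at most exp(m). By |a|/H <= (a^2/H^2 + 1)/2 and the norm bound, a net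
    point weighs at least y^m exp(-2m). Here [H] is the typical coordinate size in lattice units,
    and the choice of support is counted too. *)
Lemma net_card (h : R) (m H : nat) : (0 < m)%N -> (m <= n)%N -> (0 < H)%N ->
  16 <= h ^+ 2 * (m%:R * H%:R ^+ 2) ->
  #|net h m|%:R <= (16 * H%:R ^+ 2 * n%:R / m%:R) ^+ m * expR (1 : R) ^+ (3 * m).
Proof.
move=> m0 mn H0 hR.
have HR : 0 < H%:R :> R by rewrite ltr0n.
have H1 : 1 <= H%:R :> R by rewrite ler1n.
have mR : 0 < m%:R :> R by rewrite ltr0n.
have nR : 0 < n%:R :> R by rewrite ltr0n (leq_trans m0).
pose x : R := H%:R / (H%:R + 1).
have x0 : 0 < x by rewrite divr_gt0 //; lra.
have x1 : x <= 1 by rewrite ler_pdivrMr; lra.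
have xE : expR (- H%:R^-1) <= x.
  apply: (@le_trans _ _ ((1 + H%:R^-1)^-1)).
    rewrite expRN lef_pV2 ?posrE ?expR_gt0 ?addr_gt0 ?invr_gt0 //; exact: expR_ge1Dx.
  by rewrite le_eqVlt; apply/orP; left; apply/eqP; rewrite /x; field; rewrite !gt_eqF //; lra.
pose y : R := m%:R / (16 * H%:R ^+ 2 * n%:R).
have y0 : 0 < y by rewrite divr_gt0 // !mulr_gt0 ?exprn_gt0.
have x0' := ltW x0; have y0' := ltW y0.
have y1 : y <= 1.
  rewrite ler_pdivrMr ?mulr_gt0 ?exprn_gt0 // mul1r.
  have : m%:R <= n%:R :> R by rewrite ler_nat.
  have : 1 <= H%:R ^+ 2 :> R by rewrite expr_ge1.
  nra.
pose w (z : coord) : R := if z == lattice_origin then 1 else y * x ^+ (dB z.1 + dB z.2).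
have w0 z : 0 <= w z by rewrite /w; case: eqP => // _; rewrite mulr_ge0 ?exprn_ge0 // ltW.
have sumx : \sum_(a < B.*2.+1) x ^+ dB a <= 4 * H%:R.
  have := geometric_two_sided B.*2.+1 B (ltW x0) x1; rewrite -/dB.
  have -> : 1 - x = (H%:R + 1)^-1 by rewrite /x; field; rewrite gt_eqF //; lra.
  rewrite mulrC ler_pdivrMr ?addr_gt0 // => /le_trans; apply; lra.
have sumw : \sum_z w z <= expR (m%:R / n%:R).
  apply: le_trans (expR_ge1Dx _); rewrite (bigD1 lattice_origin) //= {1}/w eqxx lerD2l.
  apply: (@le_trans _ _ (\sum_(z : coord) y * (x ^+ dB z.1 * x ^+ dB z.2))).
    rewrite [leRHS](bigD1 lattice_origin) //=; apply: ler_wpDl.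
      by apply: mulr_ge0 => //; apply: mulr_ge0; exact: exprn_ge0.
    by apply: ler_sum => z zc; rewrite /w (negbTE zc) exprD.
  rewrite -mulr_sumr -(pair_bigA _ (fun a b => x ^+ dB a * x ^+ dB b)) /=.
  under eq_bigr do rewrite -mulr_sumr.
  rewrite -mulr_suml; set S := \sum_(a < _) _ in sumx *.
  have S0 : 0 <= S by apply: sumr_ge0 => a _; rewrite exprn_ge0 // ltW.
  have SS : S * S <= 16 * H%:R ^+ 2 by nra.
  apply: le_trans (ler_wpM2l (ltW y0) SS) _.
  rewrite le_eqVlt; apply/orP; left; apply/eqP; rewrite /y; field.
  by rewrite !gt_eqF.
have key : #|net h m|%:R * (y ^+ m * expR (- (2 * m%:R))) <= expR m%:R.
  apply: (@le_trans _ _ (\sum_(z : {ffun 'I_n -> coord}) \prod_j w (z j))).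
    rewrite mulr_natl -sumr_const.
    apply: (@le_trans _ _ (\sum_(z in net h m) \prod_j w (z j))); last first.
      rewrite [leRHS](bigID (mem (net h m))) /= lerDl.
      by apply: sumr_ge0 => z _; apply: prodr_ge0.
    apply: ler_sum => z /andP[hs hn].
    rewrite [leRHS](bigID (fun j => z j != lattice_origin)) /= [X in _ <= _ * X]big1 ?mulr1; last first.
      by move=> j; rewrite negbK /w => ->.
    rewrite (eq_bigr (fun j => y * x ^+ (dB (z j).1 + dB (z j).2))); last first.
      by move=> j zj; rewrite /w (negbTE zj).
    rewrite big_split /= prodr_const prodrXr.
    have hcard : #|(fun j => z j != lattice_origin)| = #|[set j | z j != lattice_origin]|.
      by apply: eq_card => j; rewrite inE.
    apply: ler_pM; rewrite ?exprn_ge0 ?expR_ge0 // ?(ltW y0) //.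
      by rewrite hcard; apply: ler_wiXn2l => //; exact: ltW.
    set D := (\sum_(j | _) _)%N.
    apply: (@le_trans _ _ (expR (- H%:R^-1) ^+ D)); last first.
      by rewrite lerXn2r ?nnegrE ?expR_ge0 // ltW.
    rewrite -expRM_natl ler_expR mulrN lerN2.
    have DE : D%:R = \sum_(j | z j != lattice_origin) ((dB (z j).1)%:R + (dB (z j).2)%:R) :> R.
      by rewrite natr_sum; apply: eq_bigr => j _; rewrite natrD.
    have aux (a : 'I_(B.*2.+1)) : (dB a)%:R / H%:R <= (shiftB a ^+ 2 / H%:R ^+ 2 + 1) / 2.
      rewrite -dB_sqr -expr_div_n; set t := _ / _.
      by have := sqr_ge0 (t - 1); nra.
    rewrite DE mulr_suml.
    apply: (@le_trans _ _ (\sum_(j | z j != lattice_origin) ((shiftB (z j).1 ^+ 2 + shiftB (z j).2 ^+ 2) / H%:R ^+ 2 / 2 + 1))).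
      apply: ler_sum => j _; rewrite mulrDl.
      have := aux (z j).1; have := aux (z j).2.
      set a := shiftB _ ^+ 2 / _; set b := shiftB _ ^+ 2 / _.
      by rewrite [X in X / 2 + 1]mulrDl -/a -/b; lra.
    rewrite big_split /= sumr_const -[X in _ + X]mulr_natl mulr1.
    have h1 : #|(fun j => z j != lattice_origin)|%:R <= m%:R :> R by rewrite ler_nat hcard.
    rewrite -!mulr_suml.
    set T := \sum_(j | _) _.
    have hT : h ^+ 2 * T <= 16.
      apply: le_trans hn; rewrite nrm2_cV /T mulr_sumr.
      rewrite [leRHS](bigID (fun j => z j != lattice_origin)) /=; apply: ler_wpDr.
        by apply: sumr_ge0 => j _; exact: sqn_ge0.
      apply: ler_sum => j _; rewrite mxE /lattice_entry /sqn /=.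
      by rewrite mulrDr !exprMn.
    have h2 : 0 < h ^+ 2.
      rewrite lt_neqAle sqr_ge0 andbT eq_sym; apply/eqP => h0.
      by move: hR; rewrite h0 mul0r; lra.
    have hT2 : T / H%:R ^+ 2 <= m%:R.
      rewrite ler_pdivrMr ?exprn_gt0 // -(ler_pM2l h2); exact: le_trans hT hR.
    by move: h1 hT2; set a := T / _; set c := #|_|%:R; move: mR; lra.
  rewrite -(bigA_distr_bigA (fun _ : 'I_n => w)) /= prodr_const card_ord.
  have sw0 : 0 <= \sum_z w z by apply: sumr_ge0.
  apply: (@le_trans _ _ (expR (m%:R / n%:R) ^+ n)).
    by rewrite lerXn2r ?nnegrE ?expR_ge0.
  by rewrite -expRM_natl mulrC divfK ?gt_eqF.
have yp : 0 < y ^+ m * expR (- (2 * m%:R)) by rewrite mulr_gt0 ?exprn_gt0 ?expR_gt0.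
rewrite -(ler_pM2r yp); apply: le_trans key _.
rewrite -expRM_natl mulr1 natrM mulrACA -exprMn.
have -> : 16 * H%:R ^+ 2 * n%:R / m%:R * y = 1 by rewrite /y; field; rewrite !gt_eqF.
rewrite expr1n mul1r -expRD ler_expR; lra.
Qed.

Lemma net_round (h : R) (m : nat) (J : {set 'I_n}) (u : 'cV[R[i]]_n) :
  0 < h -> (#|J| <= m)%N -> 4 / h + 1 <= B%:R -> (forall j, sqn (u j 0) <= 16) ->
  exists z : {ffun 'I_n -> coord},
    [/\ (#|[set j | z j != lattice_origin]| <= m)%N,
        forall j, j \notin J -> lattice_point h z j 0 = 0
      & forall j, j \in J -> sqn (u j 0 - lattice_point h z j 0) <= 2 * h ^+ 2].
Proof.
move=> h0 Jm hB hu.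
have round (t : R) : t ^+ 2 <= 16 ->
    exists a : 'I_(B.*2.+1), (t - h * shiftB a) ^+ 2 <= h ^+ 2.
  move=> ht; have [t1 t2] : - 4 <= t /\ t <= 4 by split; nra.
  pose f := Num.floor (t / h).
  have f1 : f%:~R <= t / h by exact: Num.Theory.ge_floor.
  have f2 : t / h < f%:~R + 1 by have := Num.Theory.lt_succ_floor (t / h); rewrite intrD.
  have t3 : t / h <= 4 / h by rewrite ler_pM2r ?invr_gt0.
  have t4 : - (4 / h) <= t / h by rewrite -mulNr ler_pM2r ?invr_gt0.
  have g1 : - B%:R <= f%:~R :> R by lra.
  have g2 : f%:~R <= B%:R :> R by lra.
  have e1 : (- B%:Z <= f)%R by rewrite -(ler_int R) rmorphN.
  have e2 : (f <= B%:Z)%R by rewrite -(ler_int R).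
  have lt : (`|(f + B%:Z)%R|%N < B.*2.+1)%N by move: e1 e2; clear; lia.
  exists (Ordinal lt); rewrite /shiftB /=.
  have -> : `|(f + B%:Z)%R|%N%:R - B%:R = f%:~R :> R.
    have -> : `|(f + B%:Z)%R|%N%:R = (f + B%:Z)%:~R :> R.
      by rewrite -[LHS]/((`|(f + B%:Z)%R|%N : int)%:~R) gez0_abs //; move: e1 e2; clear; lia.
    by rewrite intrD /=; ring.
  have q : t - h * f%:~R = h * (t / h - f%:~R) by field; rewrite gt_eqF.
  rewrite q exprMn ler_piMr ?sqr_ge0 //; set r := t / h - _.
  have r0 : 0 <= r by rewrite /r; lra.
  have r1 : r <= 1 by rewrite /r; lra.
  nra.
have rz (j : 'I_n) : exists z : coord, sqn (u j 0 - lattice_entry h z) <= 2 * h ^+ 2.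
  have := hu j; rewrite /sqn => hj.
  have [|a ha] := round (complex.Re (u j 0)).
    by have := sqr_ge0 (complex.Im (u j 0)); lra.
  have [|b hb] := round (complex.Im (u j 0)).
    by have := sqr_ge0 (complex.Re (u j 0)); lra.
  exists (a, b); rewrite /lattice_entry; case: (u j 0) ha hb => p q /=; lra.
pose z := [ffun j => if j \in J then sval (cid (rz j)) else lattice_origin].
exists z; split.
- apply: leq_trans Jm; apply/subset_leq_card/subsetP => j; rewrite inE ffunE.
  by case: ifP => //; rewrite eqxx.
- by move=> j jJ; rewrite mxE ffunE (negbTE jJ) lattice_entry_origin.
- move=> j jJ; rewrite mxE ffunE jJ; exact: svalP (cid (rz j)).
Qed.
End Net.

(** * The discretized model *)

Section Model.
Variables (R : realType) (F : finType) (p : F -> R) (val : F -> R[i]) (tau : R).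
Hypothesis hp : fdist p.
Hypothesis tau01 : 0 < tau <= 1.
Hypothesis law : tau <= Ex (pairw p) (fun z => (spread_pair val tau z)%:R).
Variables (n : nat) (S : 'M[R]_n) (Z : 'M[R[i]]_n) (N : 'I_n -> {set 'I_n}).
Hypothesis n0 : (0 < n)%N.
Hypothesis hS : forall i j, 0 <= S i j <= 1.
Hypothesis hN : forall i j, j \in N i -> tau <= S i j.

Local Notation Row := {ffun 'I_n -> F}.
Local Notation Omega := {ffun 'I_n -> Row}.

Definition row_law : Row -> R := prodw p.
Definition matrix_law : Omega -> R := prodw row_law.

Lemma fdist_row_law : fdist row_law. Proof. exact: (@fdist_prodw R 'I_n _ _ hp). Qed.
Lemma fdist_matrix_law : fdist matrix_law. Proof. exact: (@fdist_prodw R 'I_n _ _ fdist_row_law). Qed.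

Definition model_mx (x : Omega) : 'M[R[i]]_n :=
  \matrix_(i, j) ((S i j)%:C%C * val (x i j) + Z i j).

Definition rowval (i : 'I_n) (r : Row) (u : 'cV[R[i]]_n) : R[i] :=
  \sum_j (Z i j * u j 0) + \sum_j ((S i j)%:C%C * u j 0) * val (r j).

Lemma model_mxE x i u : (model_mx x *m u) i 0 = rowval i (x i) u.
Proof.
rewrite mxE /rowval -big_split; apply: eq_bigr => j _ /=; rewrite mxE; ring.
Qed.

Definition restr (A : {set 'I_n}) (M : 'M[R[i]]_n) : 'M[R[i]]_n :=
  \matrix_(i, j) (if i \in A then M i j else 0).

Lemma restrE A M q (V : 'M[R[i]]_(n, q)) i a :
  (restr A M *m V) i a = if i \in A then (M *m V) i a else 0.
Proof.
rewrite !mxE; case: ifP => iA; last by rewrite big1 // => j _; rewrite mxE iA mul0r.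
by apply: eq_bigr => j _; rewrite mxE iA.
Qed.

Lemma nrm2_restr A M q (V : 'M[R[i]]_(n, q)) :
  nrm2 (restr A M *m V) = \sum_(i in A) \sum_a sqn ((M *m V) i a).
Proof.
rewrite /nrm2 [LHS](bigID (mem A)) /= [X in _ + X]big1 ?addr0; last first.
  by move=> i iA; rewrite big1 // => a _; rewrite restrE (negbTE iA) sqn0.
by apply: eq_bigr => i iA; apply: eq_bigr => a _; rewrite restrE iA.
Qed.

Lemma nrm2_restr_le A M q (V : 'M[R[i]]_(n, q)) : nrm2 (restr A M *m V) <= nrm2 (M *m V).
Proof.
rewrite nrm2_restr /nrm2 [leRHS](bigID (mem A)) /= lerDl.
by apply: sumr_ge0 => i _; apply: sumr_ge0 => j _; exact: sqn_ge0.
Qed.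

(* The operator norm is at most [sqrt n / tau]. *)
Definition bounded (x : Omega) : Prop :=
  forall v : 'cV_n, nrm2 (model_mx x *m v) <= n%:R / tau ^+ 2 * nrm2 v.

Lemma few_large (A I0 : {set 'I_n}) M (u : 'cV[R[i]]_n) (s2 : R) :
  I0 \subset A -> 0 <= s2 ->
  #|[set i in I0 | ~~ (sqn ((M *m u) i 0) <= s2)]|%:R * s2 <= nrm2 (restr A M *m u).
Proof.
move=> /subsetP IA s0; rewrite nrm2_restr mulr_natl -sumr_const.
set T := [set i in I0 | _].
rewrite [leRHS](bigID (mem T)) /=; apply: ler_wpDr.
  by apply: sumr_ge0 => i _; apply: sumr_ge0 => a _; exact: sqn_ge0.
rewrite [leRHS](eq_bigl (mem T)).
  apply: ler_sum => i; rewrite inE big_ord1 => /andP[_]; rewrite -ltNge; exact: ltW.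
move=> i /=; apply/andP/idP => [[]//|iT]; split => //; apply: IA.
by move: iT; rewrite inE => /andP[].
Qed.

(** The set of nice rows depends on the net point only, not on [x], so [Pr_few_failures] applies to
    each point; a point with fewer than [r1] nice rows contributes an impossible event. *)
Lemma net_union (h s2 pp xx : R) (B m r1 t : nat) (A : {set 'I_n})
    (nice : 'cV[R[i]]_n -> 'I_n -> Prop) :
  0 < xx <= 1 -> 0 <= pp -> pp + xx <= 1 ->
  (forall u i, nice u i -> Pr row_law (fun r => sqn (rowval i r u) <= s2) <= pp) ->
  Pr matrix_law (fun x => exists2 z : {ffun 'I_n -> 'I_(B.*2.+1) * 'I_(B.*2.+1)}, net h m z &
    let I0 := [set i in A | `[< nice (lattice_point h z) i >]] in (r1 <= #|I0|)%N /\
      (#|[set i in I0 | ~~ (sqn ((model_mx x *m lattice_point h z) i 0%R) <= s2)%R]| <= t)%N) <=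
  #|@net R n B h m|%:R * (xx ^- t * (pp + xx) ^+ r1).
Proof.
move=> /andP[xx0 xx1] pp0 ppx hn; apply: Pr_bigcup => [|z _]; first exact: fdist_matrix_law.
set I0 := [set i in A | _] => /=.
have px0 : 0 <= pp + xx by rewrite addr_ge0 // ltW.
have [r1I|Ir1] := boolP (r1 <= #|I0|)%N; last first.
  rewrite (_ : Pr _ _ = 0).
    by rewrite mulr_ge0 ?invr_ge0 ?exprn_ge0 // ltW.
  by apply: big1 => x _; rewrite asboolF ?mulr0 // => -[].
apply: (@le_trans _ _ (xx ^- t * (pp + xx) ^+ #|I0|)); last first.
  by rewrite ler_pM2l ?invr_gt0 ?exprn_gt0 // ler_wiXn2l.
apply: le_trans (@Pr_few_failures R 'I_n _ _ fdist_row_law I0 (fun i r => sqn (rowval i r (lattice_point h z)) <= s2) pp xx t xx0 xx1 _); last first.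
  by move=> i; rewrite inE => /andP[_ /asboolP /hn].
apply: Pr_sub => [|x [_ h1]]; first exact: fdist_matrix_law.
apply: leq_trans h1; apply/subset_leq_card/subsetP => i.
by rewrite !inE => /andP[-> /=]; rewrite asboolb model_mxE.
Qed.

(* The contributions of the coordinates in [N'] are spread out, and genuinely
   two-dimensional: the covariance of the row sum is comparable to the identity. *)
Definition planar_nice (eta bb : R) (u : 'cV[R[i]]_n) (i : 'I_n) : Prop :=
  exists N' : {set 'I_n}, let Om := \sum_(j in N') S i j ^+ 2 * sqn (u j 0) in
  [/\ 6 * eta <= Om, sqn (\sum_(j in N') (S i j ^+ 2)%:C%C * u j 0 ^+ 2) <= (Om / 2) ^+ 2
    & forall j, j \in N' -> sqn (u j 0) <= bb].

(** The value of [hh] is forced by the decay condition of [planar_small_ball]: hh^2 tau^3 (6 eta) =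
    384 / (tau eta), which is at least 64. *)
Lemma planar_nice_small (eta bb hh : R) (mF : nat) u i :
  (0 < mF)%N -> 0 < eta <= 1 -> hh = 8 / (tau ^+ 2 * eta) ->
  2 * (mF%:R * hh) ^+ 2 * bb <= tau ^+ 2 -> planar_nice eta bb u i ->
  Pr row_law (fun r => sqn (rowval i r u) <= (hh * mF%:R) ^- 2) <= 144 / mF%:R ^+ 2.
Proof.
move=> mF0 /andP[eta0 eta1] hhE hbb [N' [hOm hQ hb]].
have /andP[t0 t1] := tau01.
have hh0 : 0 < hh by rewrite hhE divr_gt0 // mulr_gt0 // exprn_gt0.
have sc j : sqn ((S i j)%:C%C * u j 0) = S i j ^+ 2 * sqn (u j 0) by rewrite sqnM sqn_real.
have OmE : \sum_(j in N') sqn ((S i j)%:C%C * u j 0) = \sum_(j in N') S i j ^+ 2 * sqn (u j 0).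
  by apply: eq_bigr => j _; rewrite sc.
apply: (@planar_small_ball R F p val tau hp tau01 law n (fun j => (S i j)%:C%C * u j 0)
   (\sum_j Z i j * u j 0) N' _ mF hh mF0 hh0).
- rewrite OmE (eq_bigr (fun j => (S i j ^+ 2)%:C%C * u j 0 ^+ 2)) // => j _.
  by rewrite exprMn rmorphXn.
- rewrite OmE; apply: (@le_trans _ _ (hh ^+ 2 * tau ^+ 3 * (6 * eta))); last first.
    by rewrite ler_pM2l // !mulr_gt0 ?exprn_gt0.
  have -> : hh ^+ 2 * tau ^+ 3 * (6 * eta) = 384 / (tau * eta).
    by rewrite hhE; field; rewrite !gt_eqF.
  rewrite ler_pdivlMr ?mulr_gt0 //.
  have : tau * eta <= 1 by rewrite mulr_ile1 // ltW.
  lra.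
- move=> j jN; rewrite sc; apply: le_trans hbb; apply: ler_wpM2l.
    by rewrite mulr_ge0 ?sqr_ge0.
  apply: le_trans (hb j jN); rewrite ler_piMl ?sqn_ge0 //.
  by have /andP[] := hS i j; nra.
Qed.
End Model.

(** * Nets for heavy frames *)

Section HeavyFrame.
Variables (R : realType) (F : finType) (val : F -> R[i]).
Variables (n : nat) (S : 'M[R]_n) (Z : 'M[R[i]]_n) (N : 'I_n -> {set 'I_n}).
Local Notation Row := {ffun 'I_n -> F}.
Local Notation Omega := {ffun 'I_n -> Row}.
Local Notation M := (model_mx val S Z).

(** [J] carries almost all of the frame; [L] drops the coordinates where the frame is peaked, since
    the planar small ball needs small coefficients; the rows in [H] still see a share [omega] of the
    mass through [L]. *)
Definition heavy_frame (A : {set 'I_n}) (m : nat) (C0 omega rho2 r0 : R) k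
    (x : Omega) (U : 'M[R[i]]_(n, k)) : Prop :=
  exists J L H : {set 'I_n},
    [/\ (#|J| <= m)%N, L \subset J & forall j, j \in L -> rown U j <= C0 * k%:R / n%:R] /\
    [/\ \sum_(j | j \notin J) rown U j <= rho2 * k%:R,
        nrm2 (restr A (M x) *m U) <= rho2 * n%:R * k%:R,
        H \subset A, r0 <= #|H|%:R
      & forall i, i \in H -> omega * k%:R <= \sum_(j in N i :&: L) rown U j].

End HeavyFrame.

(** A good random vector of the frame is rounded on [J] and set to zero elsewhere. The mesh h^2 =
    g2/n gives an error 2 g2 on [J] and 10 rho2 off it; the operator norm turns this into a small
    residual, so that few rows can be large at the net point. *)
Lemma frame_to_net (R : realType) (F : finType) (val : F -> R[i]) (tau : R)
    (n : nat) (S : 'M[R]_n) (Z : 'M[R[i]]_n) (N : 'I_n -> {set 'I_n})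
    (A : {set 'I_n}) (k m t r1 B : nat) (eta omega C0 g2 rho2 b2 beta r0 h s2 : R)
    (x : {ffun 'I_n -> {ffun 'I_n -> F}}) (U : 'M[R[i]]_(n, k)) :
  0 < tau <= 1 -> (0 < n)%N -> (forall i j, 0 <= S i j <= 1) ->
  (forall i j, j \in N i -> tau <= S i j) -> (0 < k)%N -> (m <= n)%N ->
  0 < eta <= 1 -> 8 * eta <= tau ^+ 2 * omega -> 0 < beta <= 1 ->
  30 <= beta * eta ^+ 2 * k%:R -> 0 < g2 -> 80 * g2 <= eta ^+ 2 -> 0 < rho2 ->
  10 * rho2 <= g2 -> 0 < b2 -> 20 * (C0 ^+ 2 / n%:R) <= b2 ^+ 2 -> 2 * g2 <= b2 * n%:R ->
  0 < s2 -> 8 * g2 * n%:R / tau ^+ 2 <= t%:R * s2 -> 0 < h -> h ^+ 2 = g2 / n%:R ->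
  4 / h + 1 <= B%:R -> r1%:R <= (1 - beta) * r0 ->
  bounded val tau S Z x -> isometric U -> heavy_frame val S Z N A m C0 omega rho2 r0 x U ->
  exists2 z : {ffun 'I_n -> 'I_(B.*2.+1) * 'I_(B.*2.+1)}, net h m z &
    let I0 := [set i in A | `[< planar_nice S eta (4 * b2) (lattice_point h z) i >]] in
    (r1 <= #|I0|)%N /\
    (#|[set i in I0 | ~~ (sqn ((model_mx val S Z x *m lattice_point h z) i 0%R) <= s2)%R]| <= t)%N.
Proof.
move=> tau01 n0 hS hN k0 mn eta01 eta_omega beta01 hk g0 g_eta rho0 rho_g b20 C0b gb s20 g_t h0 hh hB hr1.
move=> bx hU [J [L [H [[Jm LJ hL] [hJ hA HA hH heavy]]]]].
have /andP[t0 t1] := tau01; have /andP[e0 e1] := eta01; have /andP[be0 be1] := beta01.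
have kR : 0 < k%:R :> R by rewrite ltr0n.
have nR : 0 < n%:R :> R by rewrite ltr0n.
have tau2 : 0 < tau ^+ 2 by rewrite exprn_gt0.
have S2 i j : 0 <= S i j ^+ 2 <= 1.
  by rewrite sqr_ge0; have /andP[] := hS i j; exact: exprn_ile1.
(* With these weights the two sums in [good_vector] are the pseudo-variance and the variance of the
   i-th row sum, up to the variance of the entries. *)
pose s i j : R := if j \in N i :&: L then S i j ^+ 2 else 0.
have s01 i j : 0 <= s i j <= 1 by rewrite /s; case: ifP => _; rewrite ?S2 ?lexx ?ler01.
have hL2 : \sum_(j in L) rown U j ^+ 2 <= C0 ^+ 2 / n%:R * k%:R ^+ 2.
  apply: (@le_trans _ _ (\sum_(j in L) (C0 * k%:R / n%:R) ^+ 2)).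
    by apply: ler_sum => j jL; rewrite ler_pXn2r ?nnegrE ?rown_ge0 ?hL // (le_trans (rown_ge0 U j)) ?hL.
  rewrite sumr_const -[leLHS]mulr_natl.
  apply: (@le_trans _ _ (n%:R * (C0 * k%:R / n%:R) ^+ 2)).
    by rewrite ler_wpM2r ?sqr_ge0 // ler_nat -[X in (_ <= X)%N]card_ord max_card.
  by rewrite le_eqVlt; apply/orP; left; apply/eqP; field; rewrite gt_eqF.
have rn0 : 0 < rho2 * n%:R by rewrite mulr_gt0.
have b4 : 0 < b2 ^+ 2 by rewrite exprn_gt0.
have [u [u4 uJ uB uL ubad]] := @good_vector R n k U hU J L n n H (restr A (model_mx val S Z x)) s rho2
  (rho2 * n%:R) (C0 ^+ 2 / n%:R) eta beta (b2 ^+ 2) k0 s01 rho0 rn0 e0 be0 b4 hJ hA hL2 hk C0b.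
have u16 j : sqn (u j 0) <= 16.
  apply: (@le_trans _ _ (nrm2 u)); last by apply: le_trans u4 _; rewrite ler_nat.
  rewrite nrm2_cV (bigD1 j) //= lerDl; apply: sumr_ge0 => l _; exact: sqn_ge0.
have [z [zm zJ zu]] := net_round h0 Jm hB u16.
set v := lattice_point h z in zJ zu *.
pose dd := u - v.
have ddE j : dd j 0 = u j 0 - v j 0 by rewrite !mxE.
have sumJ : \sum_(j in J) sqn (dd j 0) <= 2 * g2.
  apply: (@le_trans _ _ (\sum_(j in J) 2 * h ^+ 2)).
    by apply: ler_sum => j jJ; rewrite ddE zu.
  rewrite sumr_const -[leLHS]mulr_natl hh.
  apply: (@le_trans _ _ (n%:R * (2 * (g2 / n%:R)))); last first.
    by rewrite le_eqVlt; apply/orP; left; apply/eqP; field; rewrite gt_eqF.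
  apply: ler_wpM2r; first by rewrite mulr_ge0 // divr_ge0 // ltW.
  by rewrite ler_nat (leq_trans Jm).
have g1 : g2 <= 1.
  have : eta ^+ 2 <= 1 by rewrite expr_le1 // ltW.
  by move: g_eta g0; clear; lra.
have uJ4 : \sum_(j in J) sqn (u j 0) <= 4.
  apply: le_trans u4; rewrite nrm2_cV [leRHS](bigID (mem J)) /= lerDl.
  by apply: sumr_ge0 => l _; exact: sqn_ge0.
have vJ : nrm2 v = \sum_(j in J) sqn (v j 0).
  rewrite nrm2_cV [LHS](bigID (mem J)) /= [X in _ + X]big1 ?addr0 // => j jJ.
  by rewrite zJ // sqn0.
have v16 : nrm2 v <= 16.
  rewrite vJ; apply: (@le_trans _ _ (2 * \sum_(j in J) sqn (u j 0) + 2 * \sum_(j in J) sqn (dd j 0))).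
    rewrite !mulr_sumr -big_split /=; apply: ler_sum => j _.
    have -> : v j 0 = u j 0 + - dd j 0 by rewrite ddE; ring.
    by apply: le_trans (sqnD_le _ _) _; rewrite sqnN.
  by move: sumJ uJ4 g1; set a := \sum_(j in J) _; set b := \sum_(j in J) _; clear; lra.
have sJ : \sum_(j in J) sqn (v j 0 + u j 0) <= 40.
  apply: (@le_trans _ _ (2 * \sum_(j in J) sqn (v j 0) + 2 * \sum_(j in J) sqn (u j 0))).
    by rewrite !mulr_sumr -big_split /=; apply: ler_sum => j _; exact: sqnD_le.
  by move: uJ4 v16; rewrite vJ; set a := \sum_(j in J) _; set b := \sum_(j in J) _; clear; lra.
exists z; first by rewrite /net zm v16.
(* Both variance sums change by products of v - u with v + u or its conjugate. Their square sums on
   [J] are at most 2 g2 and 40, and 80 g2 <= eta^2. *)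
have prod_small (P : {set 'I_n}) (a b : 'I_n -> R[i]) : P \subset J ->
    (forall j, j \in P -> sqn (a j) <= sqn (dd j 0)) ->
    (forall j, j \in P -> sqn (b j) <= sqn (v j 0 + u j 0)) ->
    sqn (\sum_(j in P) a j * b j) <= eta ^+ 2.
  move=> /subsetP PJ ha hb; apply: le_trans (cauchy_schwarz _ _ _) _.
  have mono (f g : 'I_n -> R[i]) : (forall j, j \in P -> sqn (f j) <= sqn (g j)) ->
      \sum_(j in P) sqn (f j) <= \sum_(j in J) sqn (g j).
    move=> hfg; apply: (@le_trans _ _ (\sum_(j in P) sqn (g j))); first exact: ler_sum.
    rewrite [leRHS](bigID (mem P)) /=; apply: ler_wpDr.
      by apply: sumr_ge0 => j _; exact: sqn_ge0.
    rewrite [leRHS](eq_bigl (mem P)) // => j /=; apply/andP/idP => [[]//|jP]; split => //; exact: PJ.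
  have := mono a (fun j => dd j 0) ha; have := mono b (fun j => v j 0 + u j 0) hb.
  have : 0 <= \sum_(j in P) sqn (a j) by apply: sumr_ge0 => j _; exact: sqn_ge0.
  have : 0 <= \sum_(j in P) sqn (b j) by apply: sumr_ge0 => j _; exact: sqn_ge0.
  move: sumJ sJ; set a1 := \sum_(j in J) sqn (dd j 0); set b1 := \sum_(j in J) sqn (v j 0 + u j 0).
  set a2 := \sum_(j in P) _; set b3 := \sum_(j in P) _ => h1 h2 h3 h4 h5 h6.
  apply: (@le_trans _ _ ((2 * g2) * 40)); last by move: g_eta; clear; lra.
  by apply: ler_pM => //; [exact: le_trans h6 h1|exact: le_trans h5 h2].
set Bd : {set 'I_n} := [set i in H | _] in ubad.
have nice i : i \in H :\: Bd -> planar_nice S eta (4 * b2) v i.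
  rewrite !inE => /andP[+ iH]; rewrite iH /= negbK => /andP[hQ hW].
  exists (N i :&: L) => Om.
  have NJ : N i :&: L \subset J by apply: subset_trans LJ; exact: subsetIr.
  have sE (f : 'I_n -> R) : \sum_j s i j * f j = \sum_(j in N i :&: L) S i j ^+ 2 * f j.
    by rewrite [RHS]big_mkcond; apply: eq_bigr => j _; rewrite /s; case: ifP => _ //; rewrite mul0r.
  have sEc (f : 'I_n -> R[i]) : \sum_j (s i j)%:C%C * f j = \sum_(j in N i :&: L) (S i j ^+ 2)%:C%C * f j.
    by rewrite [RHS]big_mkcond; apply: eq_bigr => j _; rewrite /s; case: ifP => _ //; rewrite mul0r.
  have W : 8 * eta <= (\sum_j s i j * rown U j) / k%:R.
    rewrite ler_pdivlMr // sE.
    apply: (@le_trans _ _ (tau ^+ 2 * (omega * k%:R))).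
      by rewrite mulrA ler_pM2r.
    apply: le_trans (ler_wpM2l (ltW tau2) (heavy i iH)) _.
    rewrite mulr_sumr; apply: ler_sum => j; rewrite inE => /andP[jN _].
    by rewrite ler_wpM2r ?rown_ge0 // ler_pXn2r ?nnegrE ?(ltW t0) ?hN //; have /andP[] := hS i j.
  have dS j (w : R[i]) : sqn ((S i j ^+ 2)%:C%C * w) <= sqn w.
    by rewrite sqnM sqn_real ler_piMl ?sqn_ge0 //; have /andP[] := S2 i j; exact: exprn_ile1.
  have dQ : sqn (\sum_(j in N i :&: L) (S i j ^+ 2)%:C%C * v j 0 ^+ 2 -
       \sum_(j in N i :&: L) (S i j ^+ 2)%:C%C * u j 0 ^+ 2) <= eta ^+ 2.
    rewrite -sumrB (eq_bigr (fun j => ((S i j ^+ 2)%:C%C * (v j 0 - u j 0)) * (v j 0 + u j 0))); last first.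
      by move=> j _; ring.
    apply: prod_small => // j jP; apply: le_trans (dS _ _) _.
    by rewrite ddE -sqnN opprB.
  have dO : (\sum_(j in N i :&: L) S i j ^+ 2 * sqn (v j 0) -
       \sum_(j in N i :&: L) S i j ^+ 2 * sqn (u j 0)) ^+ 2 <= eta ^+ 2.
    apply: (@le_trans _ _ (sqn (\sum_(j in N i :&: L) ((S i j ^+ 2)%:C%C * (v j 0 - u j 0)) * (v j 0 + u j 0)^*%C))).
      rewrite /sqn; apply: ler_wpDr; first exact: sqr_ge0.
      rewrite le_eqVlt; apply/orP; left; apply/eqP; congr (_ ^+ 2).
      rewrite -sumrB Re_sum; apply: eq_bigr => j _.
      by case: (v j 0) (u j 0) => [a b] [c d]; rewrite /sqn /=; ring.
    apply: prod_small => // j jP; last by rewrite sqn_conj.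
    by apply: le_trans (dS _ _) _; rewrite ddE -sqnN opprB.
  (* Of the 8 eta in the frame, one eta is lost in passing to the random vector and one by rounding.
     Likewise the pseudo-variance grows from eta to at most 2 eta, below half of [Om]. *)
  have Om6 : 6 * eta <= Om.
    move: hW dO W; rewrite !sE -/Om; set w := _ / k%:R; set o := \sum_(j in _) _ * sqn (u j 0).
    move=> a1 a2 a3.
    have b1 : - eta <= o - w by move: a1 e0; clear; nra.
    have b3 : - eta <= Om - o by move: a2 e0; clear; nra.
    by move: a3 b1 b3; clear; lra.
  split=> //.
    move: hQ dQ; rewrite sEc; set q := \sum_(j in _) _ * u j 0 ^+ 2; set q' := \sum_(j in _) _ => a1 a2.
    have -> : q' = q + (q' - q) by ring.
    apply: le_trans (sqnD_le _ _) _.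
    by move: a1 a2 Om6 e0; clear; nra.
  move=> j; rewrite inE => /andP[_ jL].
  have jJ : j \in J by apply: (subsetP LJ).
  have -> : v j 0 = u j 0 + - dd j 0 by rewrite ddE; ring.
  apply: le_trans (sqnD_le _ _) _; rewrite sqnN.
  have a1 : sqn (dd j 0) <= 2 * (g2 / n%:R) by rewrite ddE -hh zu.
  have a2 : sqn (u j 0) <= b2.
    by have := uL j jL; rewrite ler_pXn2r ?nnegrE ?sqn_ge0 // ltW.
  have a3 : 2 * (g2 / n%:R) <= b2 by rewrite mulrA ler_pdivrMr.
  by move: a1 a2 a3; clear; lra.
move=> I0; split.
  rewrite -(ler_nat R); apply: le_trans hr1 _.
  apply: (@le_trans _ _ #|H :\: Bd|%:R); last first.
    rewrite ler_nat; apply/subset_leq_card/subsetP => i iH.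
    rewrite inE; apply/andP; split; last by apply/asboolP/nice.
    by apply: (subsetP HA); move: iH; rewrite inE => /andP[].
  have BH : Bd \subset H by apply/subsetP => i; rewrite inE => /andP[].
  rewrite cardsD (setIidPr BH) natrB ?subset_leq_card //.
  have : (1 - beta) * r0 <= (1 - beta) * #|H|%:R by rewrite ler_wpM2l // subr_ge0.
  by move: ubad; clear; lra.
rewrite -(ler_nat R) -(ler_pM2r s20).
apply: le_trans (_ : nrm2 (restr A (model_mx val S Z x) *m v) <= _).
  apply: few_large (ltW s20); by apply/subsetP => i; rewrite inE => /andP[].
apply: le_trans g_t.
have -> : v = u - dd by rewrite /dd opprB addrC subrK.
rewrite mulmxBr; apply: le_trans (nrm2D_le _ _) _; rewrite nrm2N.
have d1 : nrm2 (restr A (model_mx val S Z x) *m dd) <= n%:R / tau ^+ 2 * (2 * g2 + 10 * rho2).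
  apply: le_trans (nrm2_restr_le _ _ _) _; apply: le_trans (bx dd) _.
  apply: ler_wpM2l; first by rewrite divr_ge0 // ltW.
  rewrite nrm2_cV [leLHS](bigID (mem J)) /=; apply: lerD => //.
  by apply: le_trans uJ; apply: ler_sum => j jJ; rewrite ddE zJ // subr0.
have d2 : rho2 * n%:R <= n%:R / tau ^+ 2 * rho2.
  rewrite mulrC; apply: ler_wpM2r; first exact: ltW.
  by rewrite ler_peMr ?(ltW nR) // invf_ge1 // expr_le1 // ltW.
move: d1 d2 uB; set c := n%:R / tau ^+ 2.
have -> : 8 * g2 * n%:R / tau ^+ 2 = c * (8 * g2) by rewrite /c; ring.
have c0 : 0 <= c by rewrite divr_ge0 // ltW.
have : 0 <= c * (g2 - 10 * rho2) by rewrite mulr_ge0 // subr_ge0.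
by clear; lra.
Qed.

(** * The union bound for heavy frames and its constants *)

Section StepProbability.
Variable R : realType.

Lemma expR1_le4 : expR (1 : R) <= 4.
Proof.
have -> : (1 : R) = 2^-1 + 2^-1 by field.
rewrite expRD; have h : expR (2^-1 : R) <= 2.
  rewrite -[leLHS]invrK -expRN -[leRHS]invrK lef_pV2 ?posrE ?expR_gt0 ?invr_gt0 //.
  by apply: le_trans (expR_ge1Dx _); lra.
have := expR_ge0 (2^-1 : R); nra.
Qed.

Lemma natr_between (y : R) : 0 < y -> exists g : nat, y <= g%:R /\ g%:R <= y + 1.
Proof.
move=> y0; exists (Num.truncn y).+1; have := Num.Theory.truncn_itv (ltW y0).
by move=> /andP[a b]; split; [exact: ltW|rewrite -natr1 lerD2r].
Qed.

Lemma ratio_le_half (x : R) : 288 <= x -> 144 <= 2^-1 * x ^+ 2.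
Proof. by rewrite expr2; nra. Qed.

Lemma ratio_le1 (x : R) : 288 <= x -> 144 <= 1 * x ^+ 2.
Proof. by rewrite expr2; nra. Qed.

Lemma double_le1 (x : R) : x <= 2^-1 -> x + x <= 1.
Proof. lra. Qed.

Variables (F : finType) (p : F -> R) (val : F -> R[i]) (tau : R).
Hypothesis hp : fdist p.
Hypothesis tau01 : 0 < tau <= 1.
Hypothesis law : tau <= Ex (pairw p) (fun z => (spread_pair val tau z)%:R).
Variables (n : nat) (S : 'M[R]_n) (Z : 'M[R[i]]_n) (N : 'I_n -> {set 'I_n}).
Hypothesis n0 : (0 < n)%N.
Hypothesis hS : forall i j, 0 <= S i j <= 1.
Hypothesis hN : forall i j, j \in N i -> tau <= S i j.

(** With pp = 144 / g^(2e) as failure weight, the rows contribute 2^(m+m'+t) pp^m pp^(m'). The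
    factor pp^m meets the entropy of the net. Since e m' >= m, pp^(m') is at most (144 / g^2)^m, and
    this surplus beats the constants: 16 from the net, 64 above e^3, and 4 from the power of 2. *)
Lemma planar_step (A : {set 'I_n}) (k m m' t g e H : nat)
    (eta omega C0 g2 rho2 b2 beta r0 hh : R) :
  (0 < k)%N -> (0 < m <= n)%N -> (0 < H)%N -> (0 < e)%N -> (288 <= g)%N ->
  0 < eta <= 1 -> 8 * eta <= tau ^+ 2 * omega -> 0 < beta <= 1 ->
  30 <= beta * eta ^+ 2 * k%:R -> 0 < g2 -> 80 * g2 <= eta ^+ 2 ->
  0 < rho2 -> 10 * rho2 <= g2 -> 0 < b2 ->
  20 * (C0 ^+ 2 / n%:R) <= b2 ^+ 2 -> 2 * g2 <= b2 * n%:R ->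
  hh = 8 / (tau ^+ 2 * eta) ->
  2 * ((g ^ e)%:R * hh) ^+ 2 * (4 * b2) <= tau ^+ 2 ->
  8 * g2 * n%:R / tau ^+ 2 <= t%:R * (hh * (g ^ e)%:R) ^- 2 ->
  (m + m' + t)%:R <= (1 - beta) * r0 -> (m + m' + t <= 2 * m)%N -> (m <= e * m')%N ->
  16 <= g2 / n%:R * (m%:R * H%:R ^+ 2) ->
  (64 : R) * 64 * H%:R ^+ 2 * (n%:R / m%:R) * (144 / (g ^ e)%:R ^+ 2) * (144 / g%:R ^+ 2) <= 2^-1 ->
  Pr (@matrix_law R F p n) (fun x => bounded val tau S Z x /\
     exists U : 'M[R[i]]_(n, k), isometric U /\
       heavy_frame val S Z N A m C0 omega rho2 r0 x U) <= 2^-1 ^+ m.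
Proof.
move=> k0 /andP[m0 mn] H0 e0 g288 eta01 eo be hk g20 ge rho0 rg b20 C0b gb hhE hb gt hr1 r1m me hH big.
have /andP[t0 t1] := tau01; have /andP[et0 et1] := eta01.
have nR : 0 < n%:R :> R by rewrite ltr0n.
have mR : 0 < m%:R :> R by rewrite ltr0n.
set mF := (g ^ e)%N; have g0 : (0 < g)%N by apply: leq_trans g288.
have mF0 : (0 < mF)%N by rewrite expn_gt0 g0.
have gmF : (g <= mF)%N by rewrite -{1}(expn1 g) leq_pexp2l.
have mFR : 0 < mF%:R :> R by rewrite ltr0n.
have gR : 0 < g%:R :> R by rewrite ltr0n.
have hh0 : 0 < hh by rewrite hhE divr_gt0 // mulr_gt0 // exprn_gt0.
pose s2 := (hh * mF%:R) ^- 2.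
have s20 : 0 < s2 by rewrite invr_gt0 exprn_gt0 // mulr_gt0.
pose h := Num.sqrt (g2 / n%:R).
have h0 : 0 < h by rewrite sqrtr_gt0 divr_gt0.
have h2 : h ^+ 2 = g2 / n%:R by rewrite sqr_sqrtr // divr_ge0 // ltW.
have [B [hB _]] := @natr_between (4 / h + 1) (addr_gt0 (divr_gt0 (ltr0n _ 4) h0) ltr01).
pose pp : R := 144 / mF%:R ^+ 2.
have pp0 : 0 < pp by rewrite divr_gt0 // exprn_gt0.
have pp2 : pp <= 2^-1.
  rewrite ler_pdivrMr ?exprn_gt0 //.
  by apply: ratio_le_half; rewrite ler_nat (leq_trans g288).
pose q0 : R := 144 / g%:R ^+ 2.
have q00 : 0 < q0 by rewrite divr_gt0 // exprn_gt0.
have q01 : q0 <= 1.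
  rewrite ler_pdivrMr ?exprn_gt0 //.
  by apply: ratio_le1; rewrite ler_nat.
have net_le := @net_card R n B h m H m0 mn H0.
have {}net_le := net_le _; rewrite h2 in net_le; have {}net_le := net_le hH.
set r1 := (m + m' + t)%N in hr1 r1m *.
apply: le_trans (_ : #|@net R n B h m|%:R * (pp ^- t * (pp + pp) ^+ r1) <= _).
  apply: le_trans (_ : Pr (@matrix_law R F p n) (fun x => exists2 z : {ffun 'I_n -> 'I_(B.*2.+1) * 'I_(B.*2.+1)}, net h m z &
    let I0 := [set i in A | `[< planar_nice S eta (4 * b2) (lattice_point h z) i >]] in (r1 <= #|I0|)%N /\
      (#|[set i in I0 | ~~ (sqn ((model_mx val S Z x *m lattice_point h z) i 0%R) <= s2)%R]| <= t)%N) <= _).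
    apply: Pr_sub; first exact: fdist_matrix_law.
    move=> x [bx [U [hU fU]]].
    exact: (@frame_to_net R F val tau n S Z N A k m t r1 B eta omega C0 g2 rho2 b2 beta r0 h s2 x U
      tau01 n0 hS hN k0 mn eta01 eo be hk g20 ge rho0 rg b20 C0b gb s20 gt h0 h2 hB hr1 bx hU fU).
  apply: net_union => //.
  - by rewrite pp0 (le_trans pp2) // invf_le1 // ler1n.
  - exact: ltW.
  - exact: double_le1.
  - move=> u i hu; exact: (planar_nice_small hp tau01 law Z hS mF0 eta01 hhE hb hu).
apply: (@le_trans _ _ (((16 * H%:R ^+ 2 * n%:R / m%:R) ^+ m * expR (1 : R) ^+ (3 * m)) * (pp ^- t * (pp + pp) ^+ r1))).
  apply: ler_wpM2r net_le; rewrite mulr_ge0 ?invr_ge0 ?exprn_ge0 ?addr_ge0 ?(ltW pp0) //.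
have -> : pp ^- t * (pp + pp) ^+ r1 = 2 ^+ r1 * (pp ^+ m * pp ^+ m').
  move: pp0; generalize pp => q qp0.
  have -> : q + q = 2 * q by ring.
  rewrite exprMn mulrCA; congr (_ * _); rewrite mulrC -exprD /r1 [in LHS]exprD mulfK //.
  by rewrite expf_neq0 // gt_eqF.
have ppm' : pp ^+ m' <= q0 ^+ m.
  apply: (@le_trans _ _ (q0 ^+ (e * m'))); last by apply: ler_wiXn2l => //; exact: ltW.
  rewrite exprM lerXn2r ?nnegrE ?exprn_ge0 ?(ltW q00) ?(ltW pp0) //.
  rewrite /pp /q0 /mF natrX expr_div_n -exprM mulnC exprM -!exprM ler_wpM2r //.
    by rewrite invr_ge0 exprn_ge0.
  by rewrite -[leLHS]expr1 ler_weXn2l // ler1n.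
have h3 : expR (1 : R) ^+ (3 * m) <= 64 ^+ m.
  rewrite exprM lerXn2r ?nnegrE ?exprn_ge0 ?expR_ge0 //.
  have -> : 64 = 4 ^+ 3 :> R by rewrite -natrX.
  by rewrite lerXn2r ?nnegrE ?expR_ge0 // expR1_le4.
have h4 : (2 : R) ^+ r1 <= 4 ^+ m.
  have -> : 4 = 2 ^+ 2 :> R by rewrite -natrX.
  by rewrite -exprM ler_weXn2l // ler1n.
set y := 16 * H%:R ^+ 2 * n%:R / m%:R in net_le *.
have y0 : 0 <= y by rewrite !mulr_ge0 ?invr_ge0 ?exprn_ge0.
apply: (@le_trans _ _ ((y ^+ m * 64 ^+ m) * (4 ^+ m * (pp ^+ m * q0 ^+ m)))).
  apply: ler_pM.
  - by rewrite mulr_ge0 ?exprn_ge0 ?expR_ge0.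
  - by rewrite !mulr_ge0 ?exprn_ge0 // ltW.
  - by rewrite ler_wpM2l ?exprn_ge0.
  - by apply: ler_pM => //; rewrite ?mulr_ge0 ?exprn_ge0 ?(ltW pp0) // ler_wpM2l // exprn_ge0 // ltW.
rewrite -!exprMn.
have nn : 0 <= y * 64 * (4 * (pp * q0)).
  apply: mulr_ge0; first exact: mulr_ge0.
  by apply: mulr_ge0 => //; apply: mulr_ge0; exact: ltW.
apply: lerXn2r; rewrite ?nnegrE ?invr_ge0 //.
apply: le_trans big; rewrite le_eqVlt; apply/orP; left; apply/eqP.
by rewrite /y /pp /q0; ring.
Qed.
End StepProbability.

(** Algebra behind the values of [c] and [q] below, with the exponent E = 2 e symbolic: it exhibits
    the admissible tolerance as a monomial in [tau], [om], [th]. *)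
Lemma step_exponents (K : fieldType) (tau om th nu D C1 : K) (E : nat) :
  tau != 0 -> om != 0 -> th != 0 -> nu != 0 -> D != 0 -> C1 != 0 -> (10 : K) != 0 ->
  tau ^+ 10 * om ^+ 2 * nu * th / D /
    (C1 / (tau ^+ 10 * om ^+ 2 * nu * th * th ^+ 2)) ^+ E =
  10 * (nu ^+ (1 + E) / (10 * D * C1 ^+ E)) *
    (tau ^+ (10 + 10 * E) * om ^+ (2 + 2 * E) * th ^+ (1 + (E + 2 * E))).
Proof.
move=> t0 o0 h0 n0 D0 C0 h10.
rewrite (exprD nu 1 E) (exprD tau 10 (10 * E)) (exprD om 2 (2 * E)) (exprD th 1) (exprD th E (2 * E)).
rewrite (exprM tau) (exprM om) (exprM th) expr_div_n !exprMn !expr1.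
by field; repeat (apply/andP; split) => //; exact: expf_neq0.
Qed.

(** Since mF = g^e with e of order 1/nu and g rational in the parameters, the tolerance is a fixed
    power of them, with exponent governed by nu. The peak level [C0] enters only through the
    threshold [n1]. *)
Lemma planar_step_poly (R : realType) (nu : R) : 0 < nu < 1 ->
  exists (c : R) (q : nat), 0 < c <= 1 /\
  forall tau omega th : R, 0 < tau <= 1 -> 0 < omega <= 1 -> 0 < th <= 1 ->
  forall C0 : R, exists n1 k1 : nat,
  forall (n k m : nat), (n1 <= n)%N -> (k1 <= k)%N -> (m <= n)%N -> th * n%:R <= 2 * m%:R ->
  forall (F : finType) (p : F -> R) (val : F -> R[i]), fdist p ->
    tau <= Ex (pairw p) (fun z => (spread_pair val tau z)%:R) ->
  forall (S : 'M[R]_n) (Z : 'M[R[i]]_n) (N : 'I_n -> {set 'I_n}) (A : {set 'I_n}),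
    (forall i j, 0 <= S i j <= 1) -> (forall i j, j \in N i -> tau <= S i j) ->
  Pr (@matrix_law R F p n) (fun x => bounded val tau S Z x /\
     exists U : 'M[R[i]]_(n, k), isometric U /\
       heavy_frame val S Z N A m C0 omega (c * (tau * omega * th) ^+ q) ((1 + nu) * m%:R) x U) <= 2^-1 ^+ m.
Proof.
move=> /andP[nu0 nu1].
(* The surplus m' will be at least nu m / 4, so this makes e m' >= m. *)
have [e [e1 _]] := @natr_between R (4 / nu) (divr_gt0 (ltr0n _ 4) nu0).
have e0 : (0 < e)%N.
  by rewrite -(ltr_nat R); apply: lt_le_trans e1; rewrite divr_gt0.
pose D : R := 1024 * 1024.
have D1 : 1024 <= D by rewrite /D; lra.
have D5 : 5120 <= D by rewrite /D; lra.
have DE : D = 1024 * 1024 by [].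
clearbody D.
have D0 : 0 < D by move: D1; clear; lra.
pose K : R := 64 * 64 * 256 * 144 * 144.
have K1 : 288 <= K by rewrite /K; lra.
have KE : K = 64 * 64 * 256 * 144 * 144 by [].
clearbody K.
pose C1 : R := 4 * K * D.
have C10 : 1 <= C1 by rewrite /C1; nra.
have C1p : 0 < C1 by move: C10; clear; lra.
pose c : R := nu ^+ (1 + 2 * e) / (10 * D * C1 ^+ (2 * e)).
pose q := (10 + 20 * e)%N.
have c01 : 0 < c <= 1.
  rewrite divr_gt0 ?exprn_gt0 ?mulr_gt0 ?exprn_gt0 //=.
  rewrite ler_pdivrMr ?mulr_gt0 ?exprn_gt0 // mul1r.
  apply: (@le_trans _ _ 1); first by rewrite exprn_ile1 // ltW.
  have : 1 <= C1 ^+ (2 * e) by exact: exprn_ege1.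
  nra.
have /andP[c0 c1] := c01.
exists c, q; split=> // tau omega th tau01 om01 th01 C0.
have /andP[t0 t1] := tau01; have /andP[o0 o1] := om01; have /andP[h0 h1] := th01.
(* The residual budget: tau^2 from the operator norm, tau^8 omega^2 from hh^(-2) in the squared
   small ball radius, and nu th for the proportion of rows allowed to fail. *)
pose X := tau ^+ 10 * omega ^+ 2 * nu * th.
have X0 : 0 < X by rewrite /X !mulr_gt0 ?exprn_gt0.
have X1 : X <= 1.
  rewrite /X; have a1 : tau ^+ 10 <= 1 by rewrite exprn_ile1 // ltW.
  have a2 : omega ^+ 2 <= 1 by rewrite exprn_ile1 // ltW.
  have a3 : tau ^+ 10 * omega ^+ 2 <= 1 by rewrite mulr_ile1 ?exprn_ge0 // ltW.
  have a4 : tau ^+ 10 * omega ^+ 2 * nu <= 1.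
    by rewrite mulr_ile1 ?mulr_ge0 ?exprn_ge0 // ltW.
  by rewrite mulr_ile1 ?mulr_ge0 ?exprn_ge0 // ltW.
(* H^2 is of order 1 / (gg th) and gg = X / (D mF^2), so mF^2 cancels against 144 / mF^2, and the
   union bound closes as soon as g^2 >= Y. *)
pose Y := 2 * K * D / (X * th ^+ 2).
have Xt0 : 0 < X * th ^+ 2 by rewrite mulr_gt0 ?exprn_gt0.
have Xt1 : X * th ^+ 2 <= 1.
  by rewrite mulr_ile1 ?exprn_ge0 ?exprn_ile1 // ltW.
have KD : 288 <= 2 * K * D by move: K1 D1; clear; nra.
have Y1 : 288 <= Y.
  by rewrite ler_pdivlMr //; move: Xt0 Xt1 KD; clear; set z := _ * th ^+ 2; set w := _ * D; nra.
have [g [g1 g2Y]] := @natr_between R Y (lt_le_trans (ltr0n _ 288) Y1).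
have g288 : (288 <= g)%N by rewrite -(ler_nat R); exact: le_trans g1.
have gR : 0 < g%:R :> R by apply: lt_le_trans g1; apply: lt_le_trans Y1; rewrite ltr0n.
set mF := (g ^ e)%N.
have mFE : mF%:R = g%:R ^+ e :> R by rewrite natrX.
have mF0 : 0 < mF%:R :> R by rewrite mFE exprn_gt0.
have mF1 : 1 <= mF%:R :> R by rewrite mFE exprn_ege1 // ler1n (leq_trans _ g288).
pose gg := X / D / mF%:R ^+ 2.
have gg0 : 0 < gg by rewrite /gg !divr_gt0 ?exprn_gt0.
have ggX : gg <= X / D.
  by rewrite /gg ler_pdivrMr ?exprn_gt0 // ler_peMr ?exprn_ege1 // divr_ge0 // ltW.
pose eta := tau ^+ 2 * omega / 8.
have eta0 : 0 < eta by rewrite divr_gt0 ?mulr_gt0 ?exprn_gt0.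
have eta1 : eta <= 1.
  have a1 : tau ^+ 2 <= 1 by rewrite exprn_ile1 // ltW.
  have : tau ^+ 2 * omega <= 1 by rewrite mulr_ile1 ?exprn_ge0 // ltW.
  by rewrite /eta; clear; lra.
pose beta := nu / 8.
pose hh := 8 / (tau ^+ 2 * eta).
have hh0 : 0 < hh by apply: divr_gt0 => //; apply: mulr_gt0 => //; exact: exprn_gt0.
pose b2 := tau ^+ 2 / (8 * (mF%:R * hh) ^+ 2).
have b20 : 0 < b2.
  by apply: divr_gt0; [exact: exprn_gt0|apply: mulr_gt0 => //; apply: exprn_gt0; exact: mulr_gt0].
have [n1 [hn1 _]] := @natr_between R (20 * C0 ^+ 2 / b2 ^+ 2 + 2 * gg / b2 + 64 / (nu * th))
  (ltr_wpDl (addr_ge0 (divr_ge0 (mulr_ge0 (ler0n _ 20) (sqr_ge0 _)) (sqr_ge0 _))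
    (divr_ge0 (mulr_ge0 (ler0n _ 2) (ltW gg0)) (ltW b20))) (divr_gt0 (ltr0n _ 64) (mulr_gt0 nu0 h0))).
have [k1 [hk1 _]] := @natr_between R (30 / (beta * eta ^+ 2))
  (divr_gt0 (ltr0n _ 30) (mulr_gt0 (divr_gt0 nu0 (ltr0n _ 8)) (exprn_gt0 2 eta0))).
exists n1, k1 => n k m nn kk mn hm F p val hp law S Z N A hS hN.
have nnR : n1%:R <= n%:R :> R by rewrite ler_nat.
have kkR : k1%:R <= k%:R :> R by rewrite ler_nat.
have P1 : 0 <= 20 * C0 ^+ 2 / b2 ^+ 2 by rewrite divr_ge0 ?sqr_ge0 // mulr_ge0 ?sqr_ge0.
have P2 : 0 <= 2 * gg / b2 by rewrite divr_ge0 ?(ltW b20) // mulr_ge0 // ltW.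
have P3 : 0 < 64 / (nu * th) by rewrite divr_gt0 // mulr_gt0.
have nR : 0 < n%:R :> R by move: hn1 nnR P1 P2 P3; clear; lra.
have n0 : (0 < n)%N by rewrite -(ltr_nat R).
have Q1 : 20 * C0 ^+ 2 / b2 ^+ 2 <= n%:R by move: hn1 nnR P1 P2 P3; clear; lra.
have Q2 : 2 * gg / b2 <= n%:R by move: hn1 nnR P1 P2 P3; clear; lra.
have Q3 : 64 / (nu * th) <= n%:R by move: hn1 nnR P1 P2 P3; clear; lra.
have m32 : 32 <= nu * m%:R.
  move: Q3; rewrite ler_pdivrMr ?mulr_gt0 // => Q3.
  have : nu * (th * n%:R) <= nu * (2 * m%:R) by rewrite ler_pM2l.
  by move: Q3; clear; lra.
have mR : 32 <= m%:R :> R by move: m32 nu0 nu1 (ler0n R m); clear; nra.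
have m0 : (0 < m)%N by rewrite -(ltr_nat R); move: mR; clear; lra.
have m0R : 0 < m%:R :> R by move: mR; clear; lra.
(* Sharing out the nu m surplus rows: about nu m / 4 for the gain, nu m / 16 for failures, while
   [beta] = nu/8 covers the rows on which the random vector is bad. *)
have [m' [m1 m2]] := @natr_between R (nu * m%:R / 4) (divr_gt0 (mulr_gt0 nu0 m0R) (ltr0n _ 4)).
have [t [tt1 tt2]] := @natr_between R (nu * m%:R / 16) (divr_gt0 (mulr_gt0 nu0 m0R) (ltr0n _ 16)).
(* Value of H^2 demanded by [net_card], in view of m / n >= th / 2. *)
pose y := 32 / (gg * th).
have y1 : 1 <= y.
  rewrite ler_pdivlMr; last exact: mulr_gt0.
  have a1 : X / D <= 1 by rewrite ler_pdivrMr //; move: X1 D1; clear; lra.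
  have a2 : gg * th <= gg by rewrite ler_piMr // ltW.
  by rewrite mul1r; move: (le_trans a2 (le_trans ggX a1)); clear; lra.
have sy1 : 1 <= Num.sqrt y by rewrite -sqrtr1 ler_sqrt //; move: y1; clear; lra.
have [H [H1 H2]] := @natr_between R (Num.sqrt y) (lt_le_trans ltr01 sy1).
have HR : 0 < H%:R :> R by move: H1 sy1; clear; lra.
have sqy : Num.sqrt y ^+ 2 = y by rewrite sqr_sqrtr //; move: y1; clear; lra.
have Hlo : y <= H%:R ^+ 2 by rewrite -sqy lerXn2r ?nnegrE //; exact: sqrtr_ge0.
have Hhi : H%:R ^+ 2 <= 4 * y.
  rewrite -sqy; have -> : 4 * Num.sqrt y ^+ 2 = (2 * Num.sqrt y) ^+ 2 by ring.
  by rewrite lerXn2r ?nnegrE //; move: H2 sy1; clear; lra.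
have nm : n%:R / m%:R <= 2 / th.
  by rewrite ler_pdivrMr // mulrAC ler_pdivlMr //; move: hm; clear; lra.
have rho0 : 0 < c * (tau * omega * th) ^+ q.
  by apply: mulr_gt0 => //; apply: exprn_gt0; rewrite !mulr_gt0.
have rhog : 10 * (c * (tau * omega * th) ^+ q) <= gg.
  have gle : g%:R <= C1 / (X * th ^+ 2).
    apply: le_trans g2Y _; have -> : C1 / (X * th ^+ 2) = Y + Y.
      by rewrite /C1 /Y; field; rewrite !gt_eqF.
    by move: Y1; clear; lra.
  apply: (@le_trans _ _ (X / D / (C1 / (X * th ^+ 2)) ^+ (2 * e))); last first.
    rewrite /gg mFE -exprM [(e * 2)%N]mulnC ler_wpM2l ?divr_ge0 ?(ltW X0) ?(ltW D0) //.
    rewrite lef_pV2 ?posrE ?exprn_gt0 // ?divr_gt0 //.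
    by rewrite lerXn2r ?nnegrE ?(ltW gR) // divr_ge0 // ltW.
  rewrite (@step_exponents _ tau omega th nu D C1 (2 * e)) ?gt_eqF // -/c.
  have -> : (10 + 10 * (2 * e) = q)%N by rewrite /q; clear; lia.
  rewrite mulrA; apply: ler_wpM2l.
    by apply: mulr_ge0 => //; exact: ltW.
  have tq : 0 <= tau ^+ q by rewrite exprn_ge0 // ltW.
  have oq : 0 <= omega ^+ q by rewrite exprn_ge0 // ltW.
  have thq : 0 <= th ^+ q by rewrite exprn_ge0 // ltW.
  rewrite !exprMn; apply: ler_pM => //; first exact: mulr_ge0.
    apply: ler_wpM2l => //; apply: ler_wiXn2l; [exact: ltW|by []|rewrite /q; clear; lia].
  apply: ler_wiXn2l; [exact: ltW|by []|rewrite /q; clear; lia].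
apply: (@planar_step R F p val tau hp tau01 law n S Z N n0 hS hN A k m m' t g e H
  eta omega C0 gg (c * (tau * omega * th) ^+ q) b2 beta ((1 + nu) * m%:R) hh) => //.
- rewrite -(ltr_nat R); apply: lt_le_trans (le_trans hk1 kkR).
  by rewrite divr_gt0 // mulr_gt0 ?exprn_gt0 // divr_gt0.
- by rewrite m0.
- by rewrite -(ltr_nat R).
- by rewrite eta0.
- by rewrite /eta; clear; lra.
- by rewrite /beta; move: nu0 nu1; clear; lra.
- have be : 0 < beta * eta ^+ 2 by rewrite mulr_gt0 ?exprn_gt0 // divr_gt0.
  by move: (le_trans hk1 kkR); rewrite ler_pdivrMr // mulrC.
- apply: (@le_trans _ _ (80 * (X / D))); first by rewrite ler_pM2l.
  have -> : eta ^+ 2 = (tau ^+ 4 * omega ^+ 2) / 64 by rewrite /eta; field.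
  have XX : X <= tau ^+ 4 * omega ^+ 2.
    rewrite /X; have a1 : tau ^+ 10 <= tau ^+ 4 by apply: ler_wiXn2l => //; exact: ltW.
    have o2 : 0 <= omega ^+ 2 by rewrite exprn_ge0 // ltW.
    have t10 : 0 <= tau ^+ 10 by rewrite exprn_ge0 // ltW.
    have a2 : tau ^+ 10 * omega ^+ 2 * nu * th <= tau ^+ 10 * omega ^+ 2.
      by rewrite -mulrA; apply: ler_piMr; [exact: mulr_ge0|apply: mulr_ile1 => //; exact: ltW].
    by apply: le_trans a2 _; rewrite ler_wpM2r.
  have a3 : X / D <= X / 5120 by rewrite ler_pM2l // lef_pV2 ?posrE //.
  by move: a3 XX; clear; lra.
- by move: Q1; rewrite ler_pdivrMr ?exprn_gt0 // mulrA ler_pdivrMr // [n%:R * _]mulrC.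
- by move: Q2; rewrite ler_pdivrMr // [n%:R * _]mulrC.
- by rewrite le_eqVlt /b2; apply/orP; left; apply/eqP; field; rewrite !gt_eqF.
- have -> : 8 * gg * n%:R / tau ^+ 2 = (hh * mF%:R) ^- 2 * (nu * (th * n%:R) / 32).
    by rewrite /gg /hh /eta /X DE; field; rewrite !gt_eqF.
  rewrite mulrC; apply: ler_wpM2r; first by rewrite invr_ge0 exprn_ge0 // mulr_ge0 // ltW.
  apply: le_trans tt1; have a1 : nu * (th * n%:R) <= nu * (2 * m%:R) by rewrite ler_pM2l.
  by move: a1; clear; lra.
- rewrite !natrD /beta; have : 0 <= nu * m%:R * (1 - nu) by rewrite !mulr_ge0 ?subr_ge0 // ltW.
  by move: m2 tt2 m32; clear; lra.
- rewrite -(ler_nat R) (natrM R 2 m) !natrD.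
  have a1 : nu * m%:R <= m%:R by rewrite ler_piMl // ltW.
  by move: m2 tt2 m32 a1 mR; clear; lra.
- rewrite -(ler_nat R) natrM.
  have : 4 / nu * (nu * m%:R / 4) <= e%:R * m'%:R.
    by apply: ler_pM => //; rewrite ?divr_ge0 ?mulr_ge0 // ltW.
  have -> : 4 / nu * (nu * m%:R / 4) = m%:R by field; rewrite gt_eqF.
  by [].
- have h3 : th / 2 <= m%:R / n%:R by rewrite ler_pdivlMr //; move: hm; clear; lra.
  have -> : gg / n%:R * (m%:R * H%:R ^+ 2) = gg * (m%:R / n%:R) * H%:R ^+ 2.
    by field; rewrite gt_eqF.
  apply: (@le_trans _ _ (gg * (th / 2) * y)).
    by rewrite le_eqVlt /y; apply/orP; left; apply/eqP; field; rewrite !gt_eqF.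
  apply: ler_pM.
  - by apply: mulr_ge0; [exact: ltW|apply: divr_ge0 => //; exact: ltW].
  - by apply: le_trans y1.
  - by rewrite ler_pM2l.
  - by [].
- have ng : g%:R <= g%:R ^+ 2 :> R by rewrite expr2 ler_peMr ?(ltW gR) // ler1n (leq_trans _ g288).
  apply: (@le_trans _ _ (64 * 64 * (4 * y) * (2 / th) * (144 / mF%:R ^+ 2) * (144 / g%:R ^+ 2))).
    rewrite ler_pM2r ?divr_gt0 ?exprn_gt0 // ler_pM2r ?divr_gt0 ?exprn_gt0 //.
    apply: ler_pM => //.
    - by apply: mulr_ge0 => //; exact: sqr_ge0.
    - exact: divr_ge0.
    - by apply: ler_wpM2l Hhi; rewrite mulr_ge0.
  have -> : 64 * 64 * (4 * y) * (2 / th) * (144 / mF%:R ^+ 2) * (144 / g%:R ^+ 2) =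
     K * D / (X * th ^+ 2) / g%:R ^+ 2.
    by rewrite /y /gg KE; field; rewrite !gt_eqF.
  rewrite ler_pdivrMr ?exprn_gt0 //.
  have -> : K * D / (X * th ^+ 2) = Y / 2 by rewrite /Y; field; rewrite !gt_eqF.
  by move: (le_trans g1 ng); clear; lra.
Qed.

(** * Sparse vectors *)

Section Sparse.
Variable R : realType.

(** Double counting: by the column degrees the rows see at least delta n W in total, where W is the
    sum of [f]. The light rows account for at most half of it, and a row sees at most W. *)
Lemma heavy_rows (n : nat) (N : 'I_n -> {set 'I_n}) (delta : R) (f : 'I_n -> R) :
  0 <= delta -> (forall j, delta * n%:R <= #|[set i | j \in N i]|%:R) -> (forall j, 0 <= f j) ->
  0 < \sum_j f j ->
  delta / 2 * n%:R <= #|[set i | delta / 2 * \sum_j f j <= \sum_(j in N i) f j]|%:R.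
Proof.
move=> d0 hd f0 W0; set W := \sum_j f j in W0 *; set I1 := [set i | _].
have h1 : delta * n%:R * W <= \sum_i \sum_(j in N i) f j.
  under eq_bigr do rewrite big_mkcond /=.
  rewrite exchange_big /= mulr_sumr; apply: ler_sum => j _.
  rewrite -big_mkcond /= (eq_bigl (fun i => i \in [set i | j \in N i])); last by move=> i /=; rewrite inE.
  by rewrite sumr_const -[leRHS]mulr_natl ler_wpM2r.
have h2 : \sum_i \sum_(j in N i) f j <= #|I1|%:R * W + n%:R * (delta / 2 * W).
  rewrite (bigID (mem I1)) /=; apply: lerD.
    rewrite mulr_natl -sumr_const; apply: ler_sum => i _.
    by rewrite /W [leRHS](bigID (mem (N i))) /= lerDl; apply: sumr_ge0.
  apply: (@le_trans _ _ (\sum_(i < n | i \notin I1) delta / 2 * W)).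
    by apply: ler_sum => i; rewrite inE -ltNge => /ltW.
  rewrite sumr_const -[leLHS]mulr_natl; apply: ler_wpM2r.
    by apply: mulr_ge0; [exact: divr_ge0|exact: ltW].
  by rewrite ler_nat -[X in (_ <= X)%N]card_ord max_card.
have h3 := le_trans h1 h2.
rewrite -(ler_pM2r W0); lra.
Qed.

Variables (F : finType) (p : F -> R) (val : F -> R[i]) (tau : R).
Hypothesis hp : fdist p.
Hypothesis tau01 : 0 < tau <= 1.
Hypothesis law : tau <= Ex (pairw p) (fun z => (spread_pair val tau z)%:R).
Variables (n : nat) (S : 'M[R]_n) (Z : 'M[R[i]]_n) (N : 'I_n -> {set 'I_n}).
Hypothesis n0 : (0 < n)%N.
Hypothesis hS : forall i j, 0 <= S i j <= 1.
Hypothesis hN : forall i j, j \in N i -> tau <= S i j.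
Variable delta : R.
Hypothesis d01 : 0 < delta < 1.
Hypothesis hdeg : forall j, delta * n%:R <= #|[set i | j \in N i]|%:R.

Definition sparse_nice (u : 'cV[R[i]]_n) (i : 'I_n) : Prop :=
  nrm2 u <= 16 /\ delta / 8 <= \sum_(j in N i) sqn (u j 0).

(** [row_small_ball] for the single column u/4, a contraction because nrm2 u <= 16. The one-row
    probability is only bounded away from 1, which suffices against the entropy of very sparse
    vectors. *)
Lemma sparse_nice_small u i : sparse_nice u i ->
  Pr (@row_law R F p n) (fun r => sqn (rowval val S Z i r u) <= tau ^+ 5 * delta / 256) <=
  expR (- (tau ^+ 7 * delta / (128 * 256))).
Proof.
move=> [u16 hu]; have /andP[t0 t1] := tau01.
pose U : 'M[R[i]]_(n, 1) := (4^-1 : R)%:C%C *: u.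
have rU j : rown U j = sqn (u j 0) / 16.
  by rewrite /rown big_ord1 mxE sqnM sqn_real; field.
have cU (g : 'cV_1) : nrm2 (U *m g) <= nrm2 g.
  apply: le_trans (nrm2_mul _ _) _; rewrite ler_piMl ?nrm2_ge0 // nrm2Z sqn_real.
  by rewrite (_ : (4^-1 : R) ^+ 2 = 16^-1); [move: u16; set a := nrm2 u; lra|field].
set w := \sum_(j in N i) rown U j.
have wE : delta / 128 <= w.
  rewrite /w (eq_bigr _ (fun j _ => rU j)) -mulr_suml.
  by move: hu; set s := \sum_(j in _) _; lra.
have sg01 j : 0 <= S i j <= 1 := hS i j.
have key := row_small_ball hp tau01 law ((4^-1 : R)%:C%C *: (\sum_j Z i j * u j 0)%:M) cU sg01 (@hN i).
apply: le_trans (_ : expR (- (tau ^+ 7 / 256 * w)) <= _); last first.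
  rewrite ler_expR lerN2; have t7 : 0 <= tau ^+ 7 by rewrite exprn_ge0 // ltW.
  have : tau ^+ 7 / 256 * (delta / 128) <= tau ^+ 7 / 256 * w by rewrite ler_wpM2l // divr_ge0.
  by have -> : tau ^+ 7 / 256 * (delta / 128) = tau ^+ 7 * delta / (128 * 256) by field.
apply: le_trans key; apply: Pr_sub; first exact: fdist_row_law.
move=> r hr.
have -> : (4^-1 : R)%:C%C *: (\sum_j Z i j * u j 0)%:M + \sum_j ((S i j)%:C%C * val (r j)) *: row j U =
   (4^-1 : R)%:C%C *: (rowval val S Z i r u)%:M.
  apply/matrixP => a b; rewrite !ord1 !mxE summxE eqxx !mulr1n /rowval mulrDr; congr (_ + _).
  by rewrite mulr_sumr; apply: eq_bigr => j _; rewrite !mxE; ring.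
rewrite nrm2Z sqn_real nrm2_cV big_ord1 mxE eqxx mulr1n.
apply: (@le_trans _ _ (tau ^+ 5 / 32 * (delta / 128))).
  have -> : tau ^+ 5 / 32 * (delta / 128) = 4^-1 ^+ 2 * (tau ^+ 5 * delta / 256) by field.
  by rewrite ler_wpM2l // exprn_ge0 // invr_ge0.
by rewrite ler_wpM2l // divr_ge0 // exprn_ge0 // ltW.
Qed.

Definition sparse_vector (A : {set 'I_n}) (m : R) (rho : R) (x : {ffun 'I_n -> {ffun 'I_n -> F}})
    (u : 'cV[R[i]]_n) : Prop :=
  nrm2 u = 1 /\ exists J : {set 'I_n}, [/\ #|J|%:R <= m, \sum_(j | j \notin J) sqn (u j 0) <= rho
     & nrm2 (restr A (model_mx val S Z x) *m u) <= rho * n%:R].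

Variables (A : {set 'I_n}) (m t r1 B : nat) (g2 rho h s2 : R).
Hypothesis hA : #|~: A|%:R <= delta / 4 * n%:R.
Hypothesis mn : (m <= n)%N.
Hypothesis g0 : 0 < g2.
Hypothesis g1 : 12 * g2 <= 1.
Hypothesis rho_g : rho <= g2.
Hypothesis s20 : 0 < s2.
Hypothesis g_t : 8 * g2 * n%:R / tau ^+ 2 <= t%:R * s2.
Hypothesis h0 : 0 < h.
Hypothesis hh : h ^+ 2 = g2 / n%:R.
Hypothesis hB : 4 / h + 1 <= B%:R.
Hypothesis hr1 : r1%:R <= delta / 4 * n%:R.

Lemma sparse_to_net x (M := model_mx val S Z x) (u : 'cV[R[i]]_n) :
  bounded val tau S Z x -> sparse_vector A m%:R rho x u ->
  exists2 z : {ffun 'I_n -> 'I_(B.*2.+1) * 'I_(B.*2.+1)}, net h m z &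
    let I0 := [set i in A | `[< sparse_nice (lattice_point h z) i >]] in
    (r1 <= #|I0|)%N /\
    (#|[set i in I0 | ~~ (sqn ((M *m lattice_point h z) i 0%R) <= s2)%R]| <= t)%N.
Proof.
move=> bx [u1 [J [Jm hJ hM]]]; rewrite ler_nat in Jm.
have /andP[t0 t1] := tau01; have /andP[d0 d1] := d01.
have nR : 0 < n%:R :> R by rewrite ltr0n.
have tau2 : 0 < tau ^+ 2 by rewrite exprn_gt0.
have u16 j : sqn (u j 0) <= 16.
  apply: (@le_trans _ _ (nrm2 u)); last by rewrite u1 ler1n.
  rewrite nrm2_cV (bigD1 j) //= lerDl; apply: sumr_ge0 => l _; exact: sqn_ge0.
have [z [zm zJ zu]] := net_round h0 Jm hB u16.
set v := lattice_point h z in zJ zu *.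
pose dd := u - v.
have ddE j : dd j 0 = u j 0 - v j 0 by rewrite !mxE.
have sumJ : \sum_(j in J) sqn (dd j 0) <= 2 * g2.
  apply: (@le_trans _ _ (\sum_(j in J) 2 * h ^+ 2)).
    by apply: ler_sum => j jJ; rewrite ddE zu.
  rewrite sumr_const -[leLHS]mulr_natl hh.
  apply: (@le_trans _ _ (n%:R * (2 * (g2 / n%:R)))); last first.
    by rewrite le_eqVlt; apply/orP; left; apply/eqP; field; rewrite gt_eqF.
  apply: ler_wpM2r; first by rewrite mulr_ge0 // divr_ge0 // ltW.
  by rewrite ler_nat (leq_trans Jm).
have nd : nrm2 dd <= 3 * g2.
  rewrite nrm2_cV [leLHS](bigID (mem J)) /=.
  have : \sum_(j | j \notin J) sqn (dd j 0) <= rho.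
    by apply: le_trans hJ; apply: ler_sum => j jJ; rewrite ddE zJ // subr0.
  by move: sumJ rho_g; set a := \sum_(j in J) _; set b := \sum_(j | _) _; lra.
have nd0 := nrm2_ge0 dd.
have vhi : nrm2 v <= 16.
  have -> : v = u - dd by rewrite /dd opprB addrC subrK.
  by apply: le_trans (nrm2D_le _ _) _; rewrite nrm2N u1; move: nd g1; lra.
have vlo : 4^-1 <= nrm2 v.
  have := nrm2D_le v dd; have -> : v + dd = u by rewrite /dd addrC subrK.
  by rewrite u1; move: nd g1; lra.
exists z; first by rewrite /net zm vhi.
have W0 : 0 < \sum_j sqn (v j 0) by rewrite -nrm2_cV; apply: lt_le_trans vlo; rewrite invr_gt0.
move=> I0; split.
  rewrite -(ler_nat R); apply: le_trans hr1 _.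
  have := heavy_rows (ltW d0) hdeg (fun j => sqn_ge0 (v j 0)) W0.
  set I1 := [set i | _] => hI1.
  have sub : I1 \subset I0 :|: ~: A.
    apply/subsetP => i; rewrite !inE => hi; case iA: (i \in A) => //=; rewrite orbF.
    apply/asboolP; split => //; apply: le_trans hi.
    rewrite -nrm2_cV; have : delta / 2 * 4^-1 <= delta / 2 * nrm2 v by rewrite ler_wpM2l // divr_ge0 // ltW.
    by have -> : delta / 2 * 4^-1 = delta / 8 by field.
  have : #|I1|%:R <= #|I0|%:R + #|~: A|%:R :> R.
    rewrite -natrD ler_nat; apply: leq_trans (subset_leq_card sub) _.
    by rewrite cardsU leq_subr.
  by move: hI1 hA; lra.
rewrite -(ler_nat R) -(ler_pM2r s20).
apply: le_trans (_ : nrm2 (restr A M *m v) <= _).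
  by apply: few_large (ltW s20); apply/subsetP => i; rewrite inE => /andP[].
apply: le_trans g_t.
have -> : v = u - dd by rewrite /dd opprB addrC subrK.
rewrite mulmxBr; apply: le_trans (nrm2D_le _ _) _; rewrite nrm2N.
have e1 : nrm2 (restr A M *m dd) <= n%:R / tau ^+ 2 * (3 * g2).
  apply: le_trans (nrm2_restr_le _ _ _) _; apply: le_trans (bx dd) _.
  by apply: ler_wpM2l => //; rewrite divr_ge0 // ltW.
have e2 : nrm2 (restr A M *m u) <= n%:R / tau ^+ 2 * g2.
  apply: le_trans hM _; apply: (@le_trans _ _ (g2 * n%:R)); first by rewrite ler_pM2r.
  rewrite mulrC; apply: ler_wpM2r; first exact: ltW.
  by rewrite ler_peMr ?(ltW nR) // invf_ge1 // expr_le1 // ltW.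
move: e1 e2; set c := n%:R / tau ^+ 2.
have -> : 8 * g2 * n%:R / tau ^+ 2 = c * (8 * g2) by rewrite /c; ring.
by set a := nrm2 _; set b := nrm2 _; lra.
Qed.
End Sparse.

Section SparseProbability.
Variable R : realType.

(** [cb] is the exponent of the one-row estimate. The net is handled crudely by ka^(-8) <=
    exp(8/ka), which the sparsity ka^4 makes affordable: it costs at most cb delta n / 128, the
    failures cost cb delta n / 64, and the rows gain cb delta n / 32. *)
Lemma sparse_count (m t r1 n : nat) (cb delta ka g2 Y : R) :
  0 < cb <= 1 -> 0 < delta <= 1 -> 0 < g2 <= 1 -> ka = g2 * cb * delta / (1024 * 1024) ->
  m%:R <= ka ^+ 4 * n%:R -> 0 <= Y -> Y <= 4096 / (g2 * (ka ^+ 4) ^+ 2) ->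
  t%:R <= cb ^+ 2 * delta * n%:R / 256 -> delta * n%:R / 8 <= r1%:R ->
  (Y ^+ m * expR (1 : R) ^+ (3 * m)) * ((cb / 4) ^- t * (expR (- cb) + cb / 4) ^+ r1) <=
  expR (- (cb * delta * n%:R / 128)).
Proof.
move=> /andP[cb0 cb1] /andP[d0 d1] /andP[g0 g1] kaE hm Y0 hY ht hr.
have n0 : 0 <= n%:R :> R by [].
have ka0 : 0 < ka by rewrite kaE !mulr_gt0 // invr_gt0 !mulr_gt0.
have kag : ka <= g2 / (1024 * 1024).
  rewrite kaE ler_wpM2r // ?invr_ge0 ?mulr_ge0 // -mulrA ler_piMr ?(ltW g0) //.
  by apply: mulr_ile1 => //; exact: ltW.
have ka1 : ka <= 1 by move: kag g1; clear; lra.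
have kac : ka <= cb * delta / (1024 * 1024).
  rewrite kaE ler_wpM2r // ?invr_ge0 ?mulr_ge0 // -mulrA ler_piMl //.
  by apply: mulr_ge0; exact: ltW.
have pp1 : expR (- cb) <= 1 - cb / 2.
  apply: le_trans (expRN_le_inv (ltW cb0)) _.
  by rewrite -[leLHS]mul1r ler_pdivrMr; move: cb0 cb1; clear; nra.
have p2 : expR (- cb) + cb / 4 <= expR (- (cb / 4)).
  apply: le_trans (expR_ge1Dx _); by move: pp1; clear; lra.
have p0 : 0 <= expR (- cb) + cb / 4 by rewrite addr_ge0 ?expR_ge0 // divr_ge0 // ltW.
have f1 : (expR (- cb) + cb / 4) ^+ r1 <= expR (- (cb * delta * n%:R / 32)).
  apply: (@le_trans _ _ (expR (- (cb / 4)) ^+ r1)).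
    by rewrite lerXn2r ?nnegrE ?expR_ge0.
  rewrite -expRM_natl ler_expR mulrN lerN2.
  have : cb / 4 * (delta * n%:R / 8) <= cb / 4 * r1%:R by rewrite ler_wpM2l // divr_ge0 // ltW.
  by clear; lra.
have f2 : (cb / 4) ^- t <= expR (cb * delta * n%:R / 64).
  have -> : (cb / 4) ^- t = (4 / cb) ^+ t by rewrite -exprVn invf_div.
  have c40 : 0 <= 4 / cb by rewrite divr_ge0 // ltW.
  apply: (@le_trans _ _ (expR (4 / cb) ^+ t)).
    rewrite lerXn2r ?nnegrE ?expR_ge0 //; apply: le_trans (expR_ge1Dx _); by clear; lra.
  rewrite -expRM_natl ler_expR.
  apply: (@le_trans _ _ (cb ^+ 2 * delta * n%:R / 256 * (4 / cb))); first by rewrite ler_wpM2r.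
  by rewrite le_eqVlt; apply/orP; left; apply/eqP; field; rewrite gt_eqF.
have f3 : Y ^+ m * expR (1 : R) ^+ (3 * m) <= expR (cb * delta * n%:R / 128).
  pose a := 4096 * 64 / g2.
  have a0 : 0 <= a by apply: divr_ge0; [exact: mulr_ge0|exact: ltW].
  have h3 : expR (1 : R) ^+ (3 * m) <= 64 ^+ m.
    rewrite exprM lerXn2r ?nnegrE ?exprn_ge0 ?expR_ge0 //.
    have -> : 64 = 4 ^+ 3 :> R by rewrite -natrX.
    by rewrite lerXn2r ?nnegrE ?expR_ge0 // expR1_le4.
  have kv : ka^-1 ^+ 8 <= expR (8 / ka).
    rewrite expRM_natl lerXn2r ?nnegrE ?expR_ge0 ?invr_ge0 ?(ltW ka0) //.
    apply: le_trans (expR_ge1Dx _); by clear; lra.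
  have Y64 : Y * 64 <= expR (a + 8 / ka).
    apply: (@le_trans _ _ (a * ka^-1 ^+ 8)).
      apply: (@le_trans _ _ (4096 / (g2 * (ka ^+ 4) ^+ 2) * 64)); first by rewrite ler_wpM2r.
      by rewrite le_eqVlt /a; apply/orP; left; apply/eqP; field; rewrite !gt_eqF.
    rewrite expRD; apply: ler_pM => //; first by rewrite exprn_ge0 // invr_ge0 ltW.
    apply: le_trans (expR_ge1Dx _); by clear; lra.
  apply: (@le_trans _ _ ((Y * 64) ^+ m)).
    by rewrite exprMn ler_wpM2l // exprn_ge0.
  apply: (@le_trans _ _ (expR (a + 8 / ka) ^+ m)).
    by rewrite lerXn2r ?nnegrE ?expR_ge0 // mulr_ge0.
  rewrite -expRM_natl ler_expR.
  have aka : 0 <= a + 8 / ka by rewrite addr_ge0 // divr_ge0 // ltW.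
  apply: (@le_trans _ _ (ka ^+ 4 * n%:R * (a + 8 / ka))); first by rewrite ler_wpM2r.
  have -> : ka ^+ 4 * n%:R * (a + 8 / ka) = n%:R * (ka * (ka ^+ 3 * a) + 8 * ka ^+ 3).
    by field; rewrite gt_eqF.
  have -> : cb * delta * n%:R / 128 = n%:R * (cb * delta / 128) by ring.
  apply: ler_wpM2l => //.
  have k3 : ka ^+ 3 <= ka by rewrite -[leRHS]expr1; apply: ler_wiXn2l => //; exact: ltW.
  have k3a : ka ^+ 3 * a <= 1.
    rewrite /a mulrA ler_pdivrMr // mul1r; move: k3 kag g0; clear; lra.
  have : ka * (ka ^+ 3 * a) <= ka by rewrite ler_piMr // ltW.
  have cd0 : 0 <= cb * delta by apply: mulr_ge0; exact: ltW.
  by move: k3 kac cd0; clear; lra.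
have e : - (cb * delta * n%:R / 128) = cb * delta * n%:R / 128 + (cb * delta * n%:R / 64 + - (cb * delta * n%:R / 32)).
  by field.
rewrite e !expRD; apply: ler_pM => //.
- by apply: mulr_ge0; apply: exprn_ge0 => //; exact: expR_ge0.
- apply: mulr_ge0; last exact: exprn_ge0.
  by rewrite invr_ge0 exprn_ge0 // divr_ge0 // ltW.
- apply: ler_pM => //; last exact: exprn_ge0.
  by rewrite invr_ge0 exprn_ge0 // divr_ge0 // ltW.
Qed.

Lemma sparse_step_poly (delta : R) : 0 < delta < 1 ->
  exists (c : R) (q : nat), 0 < c <= 1 /\
  forall tau : R, 0 < tau <= 1 -> exists n1 : nat,
  forall n : nat, (n1 <= n)%N ->
  forall (F : finType) (p : F -> R) (val : F -> R[i]), fdist p ->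
    tau <= Ex (pairw p) (fun z => (spread_pair val tau z)%:R) ->
  forall (S : 'M[R]_n) (Z : 'M[R[i]]_n) (N : 'I_n -> {set 'I_n}) (A : {set 'I_n}),
    (forall i j, 0 <= S i j <= 1) -> (forall i j, j \in N i -> tau <= S i j) ->
    (forall j, delta * n%:R <= #|[set i | j \in N i]|%:R) ->
    #|~: A|%:R <= delta / 4 * n%:R ->
  Pr (@matrix_law R F p n) (fun x => bounded val tau S Z x /\
     exists u, sparse_vector val S Z A (c * tau ^+ q * n%:R) (c * tau ^+ q) x u) <=
  expR (- (c * tau ^+ q * n%:R)).
Proof.
move=> d01; have /andP[d0 d1] := d01.
pose b1 : R := delta / (128 * 256).
have b1E : b1 = delta / (128 * 256) by [].
clearbody b1.
have b10 : 0 < b1 by rewrite b1E; move: d0; clear; lra.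
pose b2 : R := delta / 256.
have b2E : b2 = delta / 256 by [].
clearbody b2.
have b20 : 0 < b2 by rewrite b2E; move: d0; clear; lra.
pose b3 := b2 * b1 ^+ 2 * delta / 4096.
have b3E : b3 = b2 * b1 ^+ 2 * delta / 4096 by [].
clearbody b3.
have b30 : 0 < b3 by rewrite b3E divr_gt0 // !mulr_gt0 ?exprn_gt0.
pose b4 := b3 * b1 * delta / (1024 * 1024).
have b4E : b4 = b3 * b1 * delta / (1024 * 1024) by [].
clearbody b4.
have b40 : 0 < b4 by rewrite b4E divr_gt0 // !mulr_gt0.
have b1d : b1 <= 1 by rewrite b1E; move: d1; clear; lra.
have b2d : b2 <= 1 by rewrite b2E; move: d1; clear; lra.
have b31 : b3 <= 4096^-1.
  rewrite b3E -[leRHS]mul1r ler_pM2r ?invr_gt0 //.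
  by rewrite !mulr_ile1 ?mulr_ge0 ?exprn_ge0 ?exprn_ile1 // ltW.
have b31' : b3 <= 1 by move: b31; clear; lra.
have b4b3 : b4 <= b3.
  rewrite b4E -!mulrA ler_piMr ?(ltW b30) //.
  have : b1 * delta <= 1 by apply: mulr_ile1 => //; exact: ltW.
  by rewrite mulrA; set z := b1 * delta; clear; lra.
have b4b1 : b4 <= b1 * delta / (1024 * 1024).
  rewrite b4E ler_pM2r ?invr_gt0 ?mulr_gt0 // -mulrA ler_piMl //.
  by apply: mulr_ge0; exact: ltW.
have b41 : b4 <= 1 := le_trans b4b3 b31'.
exists (b4 ^+ 4), 112%N; split; first by rewrite exprn_gt0 //= exprn_ile1 // ltW.
move=> tau tau01; have /andP[t0 t1] := tau01.
(* Exponents: 7 and 5 come from the small ball, 21 = 2 + 5 + 14 from g2 proportional to tau^2 s2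
   cb^2, 28 = 21 + 7 from ka proportional to g2 cb, and 112 = 4 * 28 from the sparsity ka^4. *)
pose cb := tau ^+ 7 * b1; pose s2 := tau ^+ 5 * b2.
pose g2 := tau ^+ 21 * b3; pose ka := tau ^+ 28 * b4.
have cbE : cb = tau ^+ 7 * b1 by [].
have s2E : s2 = tau ^+ 5 * b2 by [].
have g2E' : g2 = tau ^+ 21 * b3 by [].
have kaE' : ka = tau ^+ 28 * b4 by [].
clearbody cb s2 g2 ka.
have tp k : 0 < tau ^+ k by rewrite exprn_gt0.
have tp1 k : tau ^+ k <= 1 by rewrite exprn_ile1 // ltW.
have cb0 : 0 < cb by rewrite cbE mulr_gt0.
have cb1 : cb <= 1 by rewrite cbE; apply: mulr_ile1 => //; exact: ltW.
have s20 : 0 < s2 by rewrite s2E mulr_gt0.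
have g20 : 0 < g2 by rewrite g2E' mulr_gt0.
have g2b : g2 <= 4096^-1 by apply: le_trans b31; rewrite g2E' ler_piMl // ltW.
have g21 : g2 <= 1 by move: g2b; clear; lra.
have ka0 : 0 < ka by rewrite kaE' mulr_gt0.
have kaE : ka = g2 * cb * delta / (1024 * 1024).
  by rewrite kaE' g2E' cbE b4E; field.
have g2E : g2 = tau ^+ 2 * s2 * cb ^+ 2 * delta / 4096.
  by rewrite g2E' s2E cbE b3E; field.
have thE : b4 ^+ 4 * tau ^+ 112 = ka ^+ 4 by rewrite kaE' exprMn -exprM mulrC.
rewrite thE; set th := ka ^+ 4.
have th0 : 0 < th by exact: exprn_gt0.
have ka1 : ka <= 1 by rewrite kaE'; apply: mulr_ile1 => //; exact: ltW.
have thka : th <= ka by rewrite /th -[leRHS]expr1; apply: ler_wiXn2l => //; exact: ltW.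
have kag : ka <= g2 by rewrite kaE' g2E'; apply: ler_pM => //; try exact: ltW; apply: ler_wiXn2l => //; exact: ltW.
have thg : th <= g2 := le_trans thka kag.
have [n1 [hn1 _]] := @natr_between R (2 / th + 512 / (cb ^+ 2 * delta) + 8 / delta)
  (ltr_wpDl (addr_ge0 (divr_ge0 (ler0n _ 2) (ltW th0))
    (divr_ge0 (ler0n _ 512) (mulr_ge0 (exprn_ge0 2 (ltW cb0)) (ltW d0)))) (divr_gt0 (ltr0n _ 8) d0)).
exists n1 => n nn F p val hp law S Z N A hS hN hdeg hA.
have nnR : n1%:R <= n%:R :> R by rewrite ler_nat.
have P1 : 0 < 2 / th by rewrite divr_gt0.
have P2 : 0 < 512 / (cb ^+ 2 * delta) by rewrite divr_gt0 // mulr_gt0 ?exprn_gt0.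
have P3 : 0 < 8 / delta by rewrite divr_gt0.
have nR : 0 < n%:R :> R by move: hn1 nnR P1 P2 P3; clear; lra.
have n0 : (0 < n)%N by rewrite -(ltr_nat R).
have Q1 : 2 <= th * n%:R.
  have : 2 / th <= n%:R by move: hn1 nnR P1 P2 P3; clear; lra.
  by rewrite ler_pdivrMr // mulrC.
have Q2 : 512 <= cb ^+ 2 * delta * n%:R.
  have : 512 / (cb ^+ 2 * delta) <= n%:R by move: hn1 nnR P1 P2 P3; clear; lra.
  by rewrite ler_pdivrMr ?mulr_gt0 ?exprn_gt0 // mulrC.
have Q3 : 8 <= delta * n%:R.
  have : 8 / delta <= n%:R by move: hn1 nnR P1 P2 P3; clear; lra.
  by rewrite ler_pdivrMr // mulrC.
pose m := Num.truncn (th * n%:R).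
have thn0 : 0 <= th * n%:R by apply: mulr_ge0; exact: ltW.
have /andP[m1 m2] := Num.Theory.truncn_itv thn0.
rewrite -/m -natr1 in m2; rewrite -/m in m1.
have m0R : 1 < m%:R + 0%:R + 0 :> R by move: m2 Q1; rewrite mulr0n; clear; lra.
have mpos : (0 < m)%N by rewrite -(ltr_nat R); move: m0R; rewrite mulr0n; clear; lra.
have mR : 0 < m%:R :> R by rewrite ltr0n.
have m1' : 1 <= m%:R :> R by rewrite ler1n.
have thm : th * n%:R <= 2 * m%:R by move: m1' m2; clear; lra.
have mn : (m <= n)%N.
  rewrite -(ler_nat R); apply: le_trans m1 _; rewrite ler_piMl ?(ltW nR) //.
  exact: le_trans thka ka1.
have [t [tt1 tt2]] := @natr_between R (cb ^+ 2 * delta * n%:R / 512)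
  (divr_gt0 (mulr_gt0 (mulr_gt0 (exprn_gt0 2 cb0) d0) nR) (ltr0n _ 512)).
have [r1 [r11 r12]] := @natr_between R (delta * n%:R / 8) (divr_gt0 (mulr_gt0 d0 nR) (ltr0n _ 8)).
pose h := Num.sqrt (g2 / n%:R).
have h0 : 0 < h by rewrite sqrtr_gt0 divr_gt0.
have h2 : h ^+ 2 = g2 / n%:R by rewrite sqr_sqrtr // divr_ge0 // ltW.
have [B [hB _]] := @natr_between R (4 / h + 1) (addr_gt0 (divr_gt0 (ltr0n _ 4) h0) ltr01).
pose y := 32 / (g2 * th).
have y1 : 1 <= y.
  rewrite ler_pdivlMr ?mulr_gt0 // mul1r.
  have : g2 * th <= 1 by apply: mulr_ile1 => //; try exact: ltW; exact: le_trans thka ka1.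
  by clear; lra.
have sy1 : 1 <= Num.sqrt y by rewrite -sqrtr1 ler_sqrt //; move: y1; clear; lra.
have [H [H1 H2]] := @natr_between R (Num.sqrt y) (lt_le_trans ltr01 sy1).
have HR : 0 < H%:R :> R by move: H1 sy1; clear; lra.
have H0 : (0 < H)%N by rewrite -(ltr_nat R).
have sqy : Num.sqrt y ^+ 2 = y by rewrite sqr_sqrtr //; move: y1; clear; lra.
have Hlo : y <= H%:R ^+ 2 by rewrite -sqy lerXn2r ?nnegrE //; exact: sqrtr_ge0.
have Hhi : H%:R ^+ 2 <= 4 * y.
  rewrite -sqy; have -> : 4 * Num.sqrt y ^+ 2 = (2 * Num.sqrt y) ^+ 2 by ring.
  by rewrite lerXn2r ?nnegrE //; move: H2 sy1; clear; lra.
have hH : 16 <= h ^+ 2 * (m%:R * H%:R ^+ 2).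
  have h3 : th / 2 <= m%:R / n%:R by rewrite ler_pdivlMr //; move: thm; clear; lra.
  rewrite h2; have -> : g2 / n%:R * (m%:R * H%:R ^+ 2) = g2 * (m%:R / n%:R) * H%:R ^+ 2.
    by field; rewrite gt_eqF.
  apply: (@le_trans _ _ (g2 * (th / 2) * y)).
    by rewrite le_eqVlt /y; apply/orP; left; apply/eqP; field; rewrite !gt_eqF.
  apply: ler_pM.
  - by apply: mulr_ge0; [exact: ltW|apply: divr_ge0 => //; exact: ltW].
  - by apply: le_trans y1.
  - by rewrite ler_pM2l.
  - by [].
have gt : 8 * g2 * n%:R / tau ^+ 2 <= t%:R * s2.
  have -> : 8 * g2 * n%:R / tau ^+ 2 = cb ^+ 2 * delta * n%:R / 512 * s2.
    by rewrite g2E; field; rewrite gt_eqF.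
  by rewrite ler_pM2r.
have g12 : 12 * g2 <= 1 by move: g2b; clear; lra.
have hr1 : r1%:R <= delta / 4 * n%:R by move: r12 Q3; clear; lra.
apply: le_trans (_ : Pr (@matrix_law R F p n) (fun x => exists2 z : {ffun 'I_n -> 'I_(B.*2.+1) * 'I_(B.*2.+1)}, net h m z &
    let I0 := [set i in A | `[< sparse_nice N delta (lattice_point h z) i >]] in (r1 <= #|I0|)%N /\
      (#|[set i in I0 | ~~ (sqn ((model_mx val S Z x *m lattice_point h z) i 0%R) <= s2)%R]| <= t)%N) <= _).
  apply: Pr_sub; first exact: fdist_matrix_law.
  move=> x [bx [u hu]].
  have hu' : sparse_vector val S Z A m%:R th x u.
    have [u1 [J [hJ1 hJ2 hJ3]]] := hu; split => //; exists J; split => //.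
    by rewrite ler_nat /m Num.Theory.truncn_ge_nat.
  exact: (@sparse_to_net R F val tau tau01 n S Z N n0 delta d01 hdeg A m t r1 B g2 th h s2
     hA mn g20 g12 thg s20 gt h0 h2 hB hr1 x u bx hu').
have pp1 : expR (- cb) + cb / 4 <= 1.
  have : expR (- cb) <= 1 - cb / 2.
    apply: le_trans (expRN_le_inv (ltW cb0)) _.
    by rewrite -[leLHS]mul1r ler_pdivrMr; move: cb0 cb1; clear; nra.
  by move: cb0; clear; lra.
apply: le_trans (@net_union R F p val hp n S Z h s2 (expR (- cb)) (cb / 4) B m r1 t A (sparse_nice N delta) _ _ pp1 _) _.
- by apply/andP; split; move: cb0 cb1; clear; lra.
- exact: expR_ge0.
- move=> u i hu; have := sparse_nice_small hp tau01 law Z hS hN hu.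
  have -> : tau ^+ 5 * delta / 256 = s2 by rewrite s2E b2E; field.
  by have -> : tau ^+ 7 * delta / (128 * 256) = cb by rewrite cbE b1E; field.
have cd0 : 0 <= cb * delta by apply: mulr_ge0; exact: ltW.
apply: (@le_trans _ _ (expR (- (cb * delta * n%:R / 128)))); last first.
  rewrite ler_expR lerN2; have -> : cb * delta * n%:R / 128 = cb * delta / 128 * n%:R by ring.
  rewrite ler_pM2r //; apply: le_trans thka _.
  have : ka <= cb * delta / (1024 * 1024).
    by rewrite kaE ler_pM2r ?invr_gt0 ?mulr_gt0 // -mulrA ler_piMl.
  by move: cd0; set z := cb * delta; clear; lra.
have Ypos : 0 <= 16 * H%:R ^+ 2 * n%:R / m%:R :> R.
  by rewrite !mulr_ge0 ?invr_ge0 ?sqr_ge0.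
apply: le_trans (@sparse_count m t r1 n cb delta ka g2 (16 * H%:R ^+ 2 * n%:R / m%:R) _ _ _ kaE m1 Ypos _ _ r11).
- apply: ler_wpM2r; last exact: net_card.
  apply: mulr_ge0; first by rewrite invr_ge0 exprn_ge0 // divr_ge0 // ltW.
  by rewrite exprn_ge0 // addr_ge0 ?expR_ge0 // divr_ge0 // ltW.
- by rewrite cb0.
- by rewrite d0 ltW.
- by rewrite g20.
- rewrite ler_pdivrMr //.
  apply: (@le_trans _ _ (16 * (4 * y) * n%:R)); first by rewrite ler_pM2r // ler_pM2l.
  rewrite -/th; have -> : 4096 / (g2 * th ^+ 2) * m%:R = 16 * (4 * y) * (2 * m%:R / th).
    by rewrite /y; field; rewrite !gt_eqF.
  apply: ler_wpM2l.
    by apply: mulr_ge0 => //; apply: mulr_ge0 => //; exact: le_trans ler01 y1.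
  by rewrite ler_pdivlMr // mulrC.
- by move: tt2 Q2; clear; lra.
Qed.
End SparseProbability.

(** * Compressible frames *)

Section Compressible.
Variable R : realType.
Variables (F : finType) (val : F -> R[i]) (tau : R).
Variables (n : nat) (S : 'M[R]_n) (Z : 'M[R[i]]_n) (N : 'I_n -> {set 'I_n}).
Hypothesis n0 : (0 < n)%N.
Local Notation Omega := {ffun 'I_n -> {ffun 'I_n -> F}}.
Local Notation M := (model_mx val S Z).

(* Concentration of a k-frame [U] on few coordinates. Working with frames rather than
   vectors makes a random vector of the span automatically planar and spread out. *)
Definition comp_frame (A : {set 'I_n}) (m rho : R) (x : Omega) k (U : 'M[R[i]]_(n, k)) : Prop :=
  isometric U /\ exists J : {set 'I_n}, [/\ #|J|%:R <= m,
    \sum_(j | j \notin J) rown U j <= rho * k%:R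
    & nrm2 (restr A (M x) *m U) <= rho * n%:R * k%:R].

(** The mass off [J] and the scaled residual add up over the k columns to at most 2 rho k, so some
    column has both below 2 rho. *)
Lemma comp_to_sparse A m rho x k (U : 'M[R[i]]_(n, k)) : (0 < k)%N -> 0 < rho ->
  comp_frame A m rho x U -> exists u, sparse_vector val S Z A m (2 * rho) x u.
Proof.
move=> k0 r0 [hU [J [hm hJ hM]]].
have nR : 0 < n%:R :> R by rewrite ltr0n.
have kR : 0 < k%:R :> R by rewrite ltr0n.
pose f (a : 'I_k) := \sum_(j | j \notin J) sqn (U j a) + nrm2 (restr A (M x) *m col a U) / n%:R.
have sf : \sum_a f a <= k%:R * (2 * rho).
  rewrite big_split /= exchange_big /= -mulr_suml.
  have -> : \sum_a nrm2 (restr A (M x) *m col a U) = nrm2 (restr A (M x) *m U).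
    rewrite /nrm2 [RHS]exchange_big; apply: eq_bigr => a _; apply: eq_bigr => i _.
    rewrite big_ord1; congr sqn; rewrite !mxE; apply: eq_bigr => j _; by rewrite !mxE.
  have : nrm2 (restr A (M x) *m U) / n%:R <= rho * k%:R.
    by rewrite ler_pdivrMr // mulrAC.
  by move: hJ; rewrite /rown; set a := \sum_(j | _) _; set b := _ / n%:R; lra.
have [a ha] : exists a, f a <= 2 * rho.
  apply: contrapT => /forallNP hn.
  have : \sum_(a < k) (2 * rho) < \sum_a f a.
    apply: ltr_sum => [|a _]; first by apply/hasP; exists (Ordinal k0); rewrite ?mem_index_enum.
    by rewrite ltNge; apply/negP.
  by rewrite sumr_const card_ord -[X in X < _]mulr_natl ltNge sf.
have p1 : 0 <= \sum_(j | j \notin J) sqn (U j a) by apply: sumr_ge0 => j _; exact: sqn_ge0.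
have p2 : 0 <= nrm2 (restr A (M x) *m col a U) / n%:R by rewrite divr_ge0 ?nrm2_ge0.
exists (col a U); split.
  have := hU (delta_mx a 0); rewrite -colE => ->.
  rewrite nrm2_cV (bigD1 a) //= mxE !eqxx sqn1 big1 ?addr0 // => j ja.
  by rewrite mxE (negbTE ja) sqn0.
exists J; split=> //.
  under eq_bigr do rewrite mxE.
  by move: ha p2; rewrite /f; set u := \sum_(j | _) _; set v := _ / _; lra.
rewrite -ler_pdivrMr //.
by move: ha p1; rewrite /f; set u := \sum_(j | _) _; set v := _ / _; lra.
Qed.

Variables (A : {set 'I_n}) (m : nat) (C0 delta th' rho rho' r0 : R).
Hypothesis C00 : 0 < C0.
Hypothesis mn : (m <= n)%N.
Hypothesis d01 : 0 < delta < 1.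
Hypothesis rr : 2 * rho <= rho'.
Hypothesis rho0 : 0 < rho.

Lemma big_rows k (U : 'M[R[i]]_(n, k)) (J : {set 'I_n}) : (0 < k)%N -> isometric U ->
  #|[set j in J | ~~ (rown U j <= C0 * k%:R / n%:R)]|%:R <= n%:R / C0.
Proof.
move=> k0 hU; set T := [set j in J | _].
have nR : 0 < n%:R :> R by rewrite ltr0n.
have kR : 0 < k%:R :> R by rewrite ltr0n.
have : #|T|%:R * (C0 * k%:R / n%:R) <= k%:R.
  rewrite -[leRHS](isometric_sum_rown hU) mulr_natl -sumr_const.
  rewrite [leRHS](bigID (mem T)) /=; apply: ler_wpDr; first by apply: sumr_ge0 => j _; exact: rown_ge0.
  rewrite [leRHS](eq_bigl (fun j => j \in T)) //.
  by apply: ler_sum => j; rewrite inE -ltNge => /andP[_ /ltW].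
rewrite ler_pdivlMr // !mulrA ler_pdivrMr // [leRHS]mulrC ler_pM2r //.
Qed.

Lemma enlarge (J : {set 'I_n}) : (#|J| <= m)%N ->
  exists J' : {set 'I_n}, J \subset J' /\ #|J'| = m.
Proof.
move=> Jm; have [B [BJ cB]] : exists B : {set 'I_n}, B \subset ~: J /\ #|B| = (m - #|J|)%N.
  have h : (m - #|J| <= #|~: J|)%N.
    have := cardsC J; rewrite card_ord; move: mn; lia.
  have [s [us ss sz]] : exists s : seq 'I_n, [/\ uniq s, {subset s <= ~: J} & size s = (m - #|J|)%N].
    exists (take (m - #|J|) (enum (~: J))); split.
    - by rewrite take_uniq ?enum_uniq.
    - by move=> j /mem_take; rewrite mem_enum.
    - by rewrite size_take -cardE; case: ltngtP h.
  exists [set j in s]; split; first by apply/subsetP => j; rewrite inE => /ss.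
  by rewrite cardsE -sz; exact/card_uniqP.
exists (J :|: B); split; first exact: subsetUl.
rewrite cardsU (_ : J :&: B = set0) ?cards0 ?subn0 ?cB ?subnKC //.
apply/eqP; rewrite -subset0; apply/subsetP => j; rewrite !inE => /andP[jJ jB].
by move/subsetP: BJ => /(_ j jB); rewrite inE jJ.
Qed.

(** A frame that lives on [J] but on no set of size th' n keeps mass at least rho' k / 2 on [J]
    minus any such set, because at most rho k <= rho' k / 2 lies off [J]. [J] is first enlarged to
    exactly m elements, so that expansion is used at size m. *)
Lemma comp_to_heavy x k (U : 'M[R[i]]_(n, k)) :
  (0 < k)%N -> comp_frame A m%:R rho x U -> ~ comp_frame A (th' * n%:R) rho' x U ->
  (forall J L : {set 'I_n}, #|J| = m -> L \subset J -> #|J :\: L|%:R <= n%:R / C0 ->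
     (forall J' : {set 'I_n}, J' \subset J -> #|J'|%:R <= th' * n%:R ->
        rho' * k%:R / 2 <= \sum_(j in J :\: J') rown U j) ->
     exists H : {set 'I_n}, [/\ H \subset A, r0 <= #|H|%:R &
       forall i, i \in H -> delta * rho' / 4 * k%:R <= \sum_(j in N i :&: L) rown U j]) ->
  heavy_frame val S Z N A m C0 (delta * rho' / 4) rho r0 x U.
Proof.
move=> k0 [hU [J0 [hm hJ0 hM]]] hn hH; rewrite ler_nat in hm.
have nR : 0 < n%:R :> R by rewrite ltr0n.
have kR : 0 < k%:R :> R by rewrite ltr0n.
have [J [JJ Jm]] := enlarge hm.
have hJ : \sum_(j | j \notin J) rown U j <= rho * k%:R.
  apply: le_trans hJ0; rewrite [leRHS](bigID (fun j => j \notin J)) /=.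
  rewrite [X in _ <= X + _](eq_bigl (fun j => j \notin J)).
    by rewrite lerDl; apply: sumr_ge0 => j _; exact: rown_ge0.
  by move=> j; apply: andb_idl; apply: contra; exact: (subsetP JJ).
pose L := [set j in J | rown U j <= C0 * k%:R / n%:R].
have LJ : L \subset J by apply/subsetP => j; rewrite inE => /andP[].
have JL : #|J :\: L|%:R <= n%:R / C0.
  rewrite (_ : J :\: L = [set j in J | ~~ (rown U j <= C0 * k%:R / n%:R)]); first exact: big_rows.
  by apply/setP => j; rewrite !inE; case: (j \in J); rewrite ?andbF ?andbT.
have [H [HA hr hheavy]] : exists H : {set 'I_n}, [/\ H \subset A, r0 <= #|H|%:R &
       forall i, i \in H -> delta * rho' / 4 * k%:R <= \sum_(j in N i :&: L) rown U j].
  apply: (hH J L) => // J' J'J J'm.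
  rewrite leNgt; apply/negP => hlt; apply: hn; split => //; exists J'; split => //.
    rewrite (bigID (fun j => j \in J)) /=.
    rewrite [X in X + _ <= _](eq_bigl (fun j => j \in J :\: J')); last by move=> j; rewrite !inE.
    rewrite [X in _ + X <= _](eq_bigl (fun j => j \notin J)); last first.
      by move=> j /=; apply: andb_idl; apply: contra; exact: (subsetP J'J).
    have : 2 * (rho * k%:R) <= rho' * k%:R by rewrite mulrA ler_pM2r.
    by move: hJ hlt; set a := \sum_(j in _) _; set b := \sum_(j | _) _; lra.
  apply: le_trans hM _; rewrite -!mulrA ler_pM2r ?mulr_gt0 //.
  by move: rr rho0; lra.
exists J, L, H; split; split => //.
- by rewrite Jm.
- by move=> j; rewrite inE => /andP[].
Qed.

(** Column degrees alone give delta n / 4 heavy rows in [A]. This is more than (1 + nu') m when m <=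
    delta n / 8, so no expansion is called for below that size. *)
Lemma jump_heavy k (U : 'M[R[i]]_(n, k)) (J L : {set 'I_n}) :
  (0 < k)%N ->
  (forall j, delta * n%:R <= #|[set i | j \in N i]|%:R) -> #|~: A|%:R <= delta / 4 * n%:R ->
  r0 <= delta / 4 * n%:R -> n%:R / C0 <= th' * n%:R -> L \subset J ->
  #|J :\: L|%:R <= n%:R / C0 ->
  (forall J' : {set 'I_n}, J' \subset J -> #|J'|%:R <= th' * n%:R ->
        rho' * k%:R / 2 <= \sum_(j in J :\: J') rown U j) ->
  exists H : {set 'I_n}, [/\ H \subset A, r0 <= #|H|%:R &
       forall i, i \in H -> delta * rho' / 4 * k%:R <= \sum_(j in N i :&: L) rown U j].
Proof.
move=> k0 hdeg hA hr0 hC LJ JL hJ.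
have kR : 0 < k%:R :> R by rewrite ltr0n.
have /andP[d0 d1] := d01.
have rho'0 : 0 < rho' by move: rr rho0; lra.
have hL : rho' * k%:R / 2 <= \sum_(j in L) rown U j.
  have := hJ (J :\: L) (subsetDl _ _) (le_trans JL hC).
  by rewrite setDDr setDv set0U (setIidPr LJ).
pose f j := if j \in L then rown U j else 0.
have f0 j : 0 <= f j by rewrite /f; case: ifP => // _; exact: rown_ge0.
have sf : \sum_j f j = \sum_(j in L) rown U j by rewrite [RHS]big_mkcond.
have W0 : 0 < \sum_j f j.
  by rewrite sf; apply: lt_le_trans hL; rewrite divr_gt0 // mulr_gt0.
have := heavy_rows (ltW d0) hdeg f0 W0; set I1 := [set i | _] => hI1.
exists (I1 :&: A); split; first exact: subsetIr.
  have : #|I1|%:R <= #|I1 :&: A|%:R + #|~: A|%:R :> R.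
    by rewrite -natrD ler_nat -(cardsID A I1) leq_add2l subset_leq_card // setDE subsetIr.
  by move: hI1 hA hr0; lra.
move=> i; rewrite !inE => /andP[hi _].
have -> : \sum_(j in N i :&: L) rown U j = \sum_(j in N i) f j.
  rewrite /f -big_mkcondr; apply: eq_bigl => j; by rewrite inE.
apply: le_trans hi; rewrite sf.
have : delta / 2 * (rho' * k%:R / 2) <= delta / 2 * \sum_(j in L) rown U j.
  by rewrite ler_wpM2l // divr_ge0 // ltW.
by set w := \sum_(j in L) _; lra.
Qed.

(** A row seeing a share delta of [J] misses, within [J] and after restriction to [L], at most (1 -
    delta) m + n/C0 coordinates. This is too few to carry the frame, so the seen part has mass at
    least rho' k / 2. *)
Lemma increment_heavy k (U : 'M[R[i]]_(n, k)) (J L : {set 'I_n}) :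
  (0 < k)%N -> #|J| = m ->
  r0 + #|~: A|%:R <= #|[set i | delta * #|J|%:R <= #|N i :&: J|%:R]|%:R ->
  (1 - delta) * m%:R + n%:R / C0 <= th' * n%:R -> L \subset J ->
  #|J :\: L|%:R <= n%:R / C0 ->
  (forall J' : {set 'I_n}, J' \subset J -> #|J'|%:R <= th' * n%:R ->
        rho' * k%:R / 2 <= \sum_(j in J :\: J') rown U j) ->
  exists H : {set 'I_n}, [/\ H \subset A, r0 <= #|H|%:R &
       forall i, i \in H -> delta * rho' / 4 * k%:R <= \sum_(j in N i :&: L) rown U j].
Proof.
move=> k0 Jm hr hth LJ JL hJ.
have kR : 0 < k%:R :> R by rewrite ltr0n.
have /andP[d0 d1] := d01.
have rho'0 : 0 < rho' by move: rr rho0; lra.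
set I1 := [set i | _] in hr.
exists (I1 :&: A); split; first exact: subsetIr.
  have : #|I1|%:R <= #|I1 :&: A|%:R + #|~: A|%:R :> R.
    by rewrite -natrD ler_nat -(cardsID A I1) leq_add2l subset_leq_card // setDE subsetIr.
  by move: hr; lra.
move=> i; rewrite !inE => /andP[hi _].
have NLJ : N i :&: L \subset J by apply: subset_trans LJ; exact: subsetIr.
have := hJ (J :\: (N i :&: L)) (subsetDl _ _); rewrite setDDr setDv set0U (setIidPr NLJ).
have card_le : #|J :\: (N i :&: L)|%:R <= th' * n%:R.
  apply: le_trans hth.
  have h1 : #|J :\: (N i :&: L)|%:R <= #|J :\: (N i :&: J)|%:R + #|J :\: L|%:R :> R.
    rewrite -natrD ler_nat; apply: leq_trans (_ : #|(J :\: (N i :&: J)) :|: (J :\: L)| <= _)%N; last first.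
      by rewrite cardsU leq_subr.
    apply/subset_leq_card/subsetP => j; rewrite !inE.
    by case: (j \in N i); case: (j \in L); case: (j \in J).
  have h2 : #|J :\: (N i :&: J)|%:R = m%:R - #|N i :&: J|%:R :> R.
    rewrite cardsD (setIidPr (subsetIr _ _)) natrB ?Jm // -Jm subset_leq_card //.
    exact: subsetIr.
  move: hi; rewrite Jm => hi; move: h1 JL; rewrite h2; lra.
move=> /(_ card_le); apply: le_trans.
have : delta * (rho' * k%:R) <= 1 * (rho' * k%:R) by rewrite ler_pM2r ?mulr_gt0 // ltW.
have : 0 < rho' * k%:R by rewrite mulr_gt0.
by set z := rho' * k%:R; rewrite (_ : delta * rho' / 4 * k%:R = delta * z / 4); [lra|rewrite /z; field].
Qed.
End Compressible.

(** The sets [N i] stand for the neighbourhoods in the thresholded profile; separating them from [S]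
    leaves [tau] as the only scale. *)
Definition admissible (R : realType) (delta nu tau : R) (F : finType) (p : F -> R)
    (val : F -> R[i]) n (S : 'M[R]_n) (N : 'I_n -> {set 'I_n}) : Prop :=
  [/\ fdist p, tau <= Ex (pairw p) (fun z => (spread_pair val tau z)%:R)
    & forall i j, 0 <= S i j <= 1] /\
  [/\ forall i j, j \in N i -> tau <= S i j,
      forall j, delta * n%:R <= #|[set i | j \in N i]|%:R
    & forall J : {set 'I_n}, Num.min n%:R ((1 + nu) * #|J|%:R) <=
        #|[set i | delta * #|J|%:R <= #|N i :&: J|%:R]|%:R].

(* [c] and [q] precede [tau]: this is what keeps the final constants polynomial. *)
Definition comp_bound (R : realType) (delta nu alpha : R) (theta : R -> R) : Prop :=
  exists (c : R) (q : nat), 0 < c <= 1 /\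
  forall tau, 0 < tau <= 1 -> exists (a C : R) (n1 k1 : nat), [/\ 0 < a, 0 <= C &
  forall n k, (n1 <= n)%N -> (k1 <= k)%N ->
  forall (F : finType) (p : F -> R) (val : F -> R[i]) (S : 'M[R]_n) (Z : 'M[R[i]]_n) N,
  admissible delta nu tau p val S N ->
  forall A : {set 'I_n}, #|~: A|%:R <= alpha * n%:R ->
  Pr (@matrix_law R F p n) (fun x => bounded val tau S Z x /\
    exists U : 'M[R[i]]_(n, k), comp_frame val S Z A (theta tau * n%:R) (c * tau ^+ q) x U)
  <= C * expR (- (a * n%:R))].

Lemma heavy_frame_mono (R : realType) (F : finType) (val : F -> R[i]) n (S : 'M[R]_n) Z N
    (A : {set 'I_n}) m (C0 om rho rho' r0 : R) x k (U : 'M[R[i]]_(n, k)) : rho <= rho' ->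
  heavy_frame val S Z N A m C0 om rho r0 x U -> heavy_frame val S Z N A m C0 om rho' r0 x U.
Proof.
move=> rr [J [L [H [[h1 h2 h3] [h4 h5 h6]]]]].
exists J, L, H; split; split => //.
- by apply: le_trans h4 _; rewrite ler_wpM2r.
- by apply: le_trans h5 _; do 2! rewrite ler_wpM2r //.
Qed.

Lemma half_pow_le (R : realType) (y : R) (m : nat) : y <= m%:R + 1 -> (2^-1 : R) ^+ m <= 2 * expR (- (y / 2)).
Proof.
move=> ym.
have e2 : expR (2^-1 : R) <= 2.
  by have := @expR_ge1Dx R (- 2^-1); rewrite expRN => h; rewrite -(invrK (expR _)) -[leRHS]invrK lef_pV2 ?posrE ?invr_gt0 ?expR_gt0 //; move: h; clear; lra.
have : expR (- (m%:R / 2)) <= expR (2^-1) * expR (- (y / 2)) :> R.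
  by rewrite -expRD ler_expR; move: ym; clear; lra.
have : (2^-1 : R) ^+ m <= expR (- (m%:R / 2)).
  rewrite expRN exprVn lef_pV2 ?posrE ?exprn_gt0 ?expR_gt0 // expRM_natl.
  by rewrite lerXn2r ?nnegrE ?expR_ge0.
have : expR (2^-1) * expR (- (y / 2)) <= 2 * expR (- (y / 2)) :> R by rewrite ler_wpM2r ?expR_ge0.
by move=> h1 h2 h3; apply: le_trans h2 (le_trans h3 h1).
Qed.

Lemma comp_bound_base (R : realType) (delta nu : R) : 0 < delta < 1 ->
  exists (c : R) (q : nat), 0 < c <= 1 /\
  comp_bound delta nu (delta / 4) (fun tau => c * tau ^+ q).
Proof.
move=> d01; have [c [q [/andP[c0 c1] h]]] := sparse_step_poly d01.
exists c, q; split; first by rewrite c0.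
exists (c / 2), q; split; first by apply/andP; split; move: c0 c1; clear; lra.
move=> tau t01; have [n1 hn] := h _ t01.
have /andP[t0 _] := t01.
have tq : 0 < c * tau ^+ q by rewrite mulr_gt0 ?exprn_gt0.
exists (c * tau ^+ q), 1, n1.+1, 1%N; split=> // n k n1n k0 F p val S Z N.
move=> [[hp law hS] [hN hdeg hexp]] A hA; rewrite mul1r.
apply: le_trans (hn n (ltnW n1n) F p val hp law S Z N A hS hN hdeg hA).
apply: Pr_sub => [|x [hb [U hU]]]; first exact: fdist_matrix_law.
split=> //.
have n0 : (0 < n)%N by apply: leq_ltn_trans n1n.
have [u hu] := comp_to_sparse n0 k0 (mulr_gt0 (divr_gt0 c0 (ltr0n _ 2)) (exprn_gt0 q t0)) hU.
exists u; move: hu.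
by rewrite (_ : 2 * (c / 2 * tau ^+ q) = c * tau ^+ q) //; field.
Qed.

(** Either the frame is already concentrated at level [theta'] with the larger tolerance, an event
    bounded by hypothesis, or the geometric premise makes it heavy and [planar_step_poly] applies.
    The initial jump and the later increments share this probabilistic part. *)
Lemma comp_bound_step (R : realType) (delta nu alpha nu' theta : R) (theta' C0 : R -> R) :
  0 < delta < 1 -> 0 < nu' < 1 -> 0 < theta <= 1 ->
  (forall tau, 0 < tau <= 1 -> 0 < C0 tau) ->
  (forall tau, 0 < tau <= 1 -> exists n2 : nat, forall n, (n2 <= n)%N ->
   forall (F : finType) (p : F -> R) (val : F -> R[i]) (S : 'M[R]_n) N,
   admissible delta nu tau p val S N ->
   forall A : {set 'I_n}, #|~: A|%:R <= alpha * n%:R ->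
   forall m, m%:R <= theta * n%:R -> theta * n%:R <= m%:R + 1 ->
   forall (rho' : R) k (U : 'M[R[i]]_(n, k)) (J L : {set 'I_n}),
   0 < rho' -> (0 < k)%N -> #|J| = m -> L \subset J -> #|J :\: L|%:R <= n%:R / C0 tau ->
   (forall J' : {set 'I_n}, J' \subset J -> #|J'|%:R <= theta' tau * n%:R ->
      rho' * k%:R / 2 <= \sum_(j in J :\: J') rown U j) ->
   exists H : {set 'I_n}, [/\ H \subset A, (1 + nu') * m%:R <= #|H|%:R &
     forall i, i \in H -> delta * rho' / 4 * k%:R <= \sum_(j in N i :&: L) rown U j]) ->
  comp_bound delta nu alpha theta' -> comp_bound delta nu alpha (fun=> theta).
Proof.
move=> d01 nu01 th01 C0p geo [c' [q' [/andP[c'0 c'1] h']]].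
have /andP[d0 d1] := d01; have /andP[th0 th1] := th01.
have [c [q [/andP[c0 c1] hc]]] := planar_step_poly nu01.
pose b := delta * c' * theta / 4.
have bE : b = delta * c' * theta / 4 by [].
clearbody b.
have b0 : 0 < b by rewrite bE divr_gt0 // !mulr_gt0.
have b1 : b <= 1.
  have : delta * c' <= 1 by apply: mulr_ile1; rewrite // ltW.
  have dc : 0 <= delta * c' by rewrite mulr_ge0 // ltW.
  move=> h; have := mulr_ile1 dc (ltW th0) h th1; rewrite bE; clear; lra.
have bq0 : 0 < b ^+ q by exact: exprn_gt0.
have bq1 : b ^+ q <= 1 by apply: exprn_ile1 => //; exact: ltW.
(* The tolerance is c (tau om theta)^q rho' / 2. As om = delta rho' / 4 brings tau^q', the power
   gives (1 + q') q, and the last factor adds q'; [b] collects what is independent of [tau]. *)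
exists (c * b ^+ q * c' / 2), ((1 + q') * q + q')%N; split.
  apply/andP; split; first by rewrite divr_gt0 // !mulr_gt0.
  have h1 : c * b ^+ q <= 1 by apply: mulr_ile1; rewrite // ltW.
  have h2 : c * b ^+ q * c' <= 1 by apply: mulr_ile1; rewrite // ltW // mulr_gt0.
  by move: h2; clear; lra.
move=> tau t01; have /andP[t0 t1] := t01.
have [a [C [n1 [k1 [a0 C0' hA]]]]] := h' _ t01.
have [n2 hn2] := geo _ t01.
pose om := delta * (c' * tau ^+ q') / 4.
have omE : om = delta * (c' * tau ^+ q') / 4 by [].
clearbody om.
have tq0 : 0 < tau ^+ q' by exact: exprn_gt0.
have tq1 : tau ^+ q' <= 1 by apply: exprn_ile1 => //; exact: ltW.
have ct0 : 0 < c' * tau ^+ q' by rewrite mulr_gt0.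
have ct1 : c' * tau ^+ q' <= 1 by apply: mulr_ile1 => //; exact: ltW.
have om01 : 0 < om <= 1.
  rewrite omE divr_gt0 ?mulr_gt0 //=.
  have := mulr_ile1 (ltW d0) (ltW ct0) (ltW d1) ct1; clear; lra.
have [n3 [k3 hp]] := hc tau om theta t01 om01 th01 (C0 tau).
have [n4 [hn4 _]] := natr_between (divr_gt0 (ltr0n _ 2) th0).
exists (Num.min a (theta / 2)), (C + 2), (1 + n1 + n2 + n3 + n4)%N, (1 + k1 + k3)%N; split.
- by rewrite lt_min a0 divr_gt0.
- by rewrite addr_ge0.
move=> n k hn hk F p val S Z N adm A cA.
have n0 : (0 < n)%N by move: hn; clear; lia.
have k0 : (0 < k)%N by move: hk; clear; lia.
have nR : 0 < n%:R :> R by rewrite ltr0n.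
pose m := Num.truncn (theta * n%:R).
have /andP[m1 m2] := Num.Theory.truncn_itv (mulr_ge0 (ltW th0) (ltW nR)).
rewrite -/m in m1 m2.
have m3 : theta * n%:R <= m%:R + 1 by rewrite natr1 ltW.
have mn : (m <= n)%N.
  rewrite -(ler_nat R); apply: le_trans m1 _; rewrite -[leRHS]mul1r ler_wpM2r //.
have thn : 2 <= theta * n%:R.
  rewrite mulrC -ler_pdivrMr //; apply: le_trans hn4 _; rewrite ler_nat.
  by move: hn; clear; lia.
have mh : theta * n%:R <= 2 * m%:R by move: m3 thn; clear; lra.
have [[fp law hS] [hN hdeg hexp]] := adm.
have B1 := hA n k (ltac:(move: hn; clear; lia)) (ltac:(move: hk; clear; lia)) F p val S Z N adm A cA.
have B2 := hp n k m (ltac:(move: hn; clear; lia)) (ltac:(move: hk; clear; lia)) mn mh F p val fp law S Z N A hS hN.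
set rho' := c' * tau ^+ q' in B1 ct0 ct1.
set rho := c * b ^+ q * c' / 2 * _.
have rhoE : rho = c * (tau * om * theta) ^+ q * (rho' / 2).
  rewrite /rho omE bE /rho' exprD exprM exprD expr1 !exprMn.
  by move: (tau ^+ q') => z; rewrite !exprVn; field; rewrite expf_neq0 // pnatr_eq0.
have tot0 : 0 < tau * om * theta.
  by move: om01 => /andP[o1 _]; rewrite !mulr_gt0.
have tot1 : tau * om * theta <= 1.
  move: om01 => /andP[o1 o2].
  by apply: mulr_ile1 => //; rewrite ?(ltW th0) ?mulr_ge0 ?(ltW t0) ?(ltW o1) //; apply: mulr_ile1 => //; apply: ltW.
have e0 : 0 < c * (tau * om * theta) ^+ q by rewrite mulr_gt0 ?exprn_gt0.
have e1 : c * (tau * om * theta) ^+ q <= 1.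
  apply: mulr_ile1 => //; [exact: ltW|exact/ltW/exprn_gt0|apply: exprn_ile1 => //; exact: ltW].
have rho0 : 0 < rho by rewrite rhoE mulr_gt0 ?divr_gt0.
have rr : 2 * rho <= rho'.
  rewrite rhoE; have : c * (tau * om * theta) ^+ q * rho' <= 1 * rho' by rewrite ler_pM2r.
  by clear; lra.
have re : rho <= c * (tau * om * theta) ^+ q.
  rewrite rhoE -[leRHS]mulr1 ler_pM2l //; move: ct1; clear; lra.
apply: le_trans (_ : Pr (@matrix_law R F p n) (fun x => (bounded val tau S Z x /\
    exists U : 'M[R[i]]_(n, k), comp_frame val S Z A (theta' tau * n%:R) rho' x U) \/
   (bounded val tau S Z x /\
     exists U : 'M[R[i]]_(n, k), isometric U /\
       heavy_frame val S Z N A m (C0 tau) om (c * (tau * om * theta) ^+ q) ((1 + nu') * m%:R) x U)) <= _).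
  apply: Pr_sub => [|x [hb [U hU]]]; first exact: fdist_matrix_law.
  have [|hn'] := pselect (exists U : 'M[R[i]]_(n, k), comp_frame val S Z A (theta' tau * n%:R) rho' x U).
    by move=> h; left.
  right; split=> //; exists U; split; first by case: hU.
  apply: (heavy_frame_mono re); rewrite omE.
  apply: (comp_to_heavy (th' := theta' tau) n0 (C0p _ t01) mn d01 rr rho0 k0).
  - move: hU; case=> hI [J [hJ h2 h3]]; split=> //; exists J; split=> //.
    by rewrite ler_nat -ltnS -(ltr_nat R); apply: le_lt_trans hJ m2.
  - by move=> h; apply: hn'; exists U.
  - move=> J L Jm LJ cJ hJ.
    exact: (hn2 n (ltac:(move: hn; clear; lia)) F p val S N adm A cA m m1 m3 rho' k U J L).
apply: le_trans.
  by apply: Pr_or; exact: fdist_matrix_law.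
apply: le_trans (lerD B1 B2) _.
have B3 := half_pow_le m3.
apply: le_trans (lerD (lexx _) B3) _; rewrite [leRHS]mulrDl; apply: lerD.
  by rewrite ler_wpM2l // ler_expR lerN2 ler_pM2r // ge_min lexx.
by rewrite ler_wpM2l // ler_expR lerN2 mulrAC ler_pM2r // ge_min lexx orbT.
Qed.

(* From a support proportional to [tau ^+ q] to one of size [delta / 8 * n], independent
   of [tau], so that a bounded number of expansion steps follows. *)
Lemma comp_bound_jump (R : realType) (delta nu nu' alpha : R) : 0 < delta < 1 -> 0 < nu' < 1 ->
  0 < alpha <= delta / 4 -> comp_bound delta nu alpha (fun=> delta / 8).
Proof.
move=> d01 nu01 /andP[al0 al1].
have /andP[d0 d1] := d01; have /andP[nu0 nu1] := nu01.
have [c [q [/andP[c0 c1] [c' [q' [c'01 h]]]]]] := @comp_bound_base R delta nu d01.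
(* The peak level is the inverse of the starting proportion, so the peaked coordinates themselves
   form a set of the excluded smaller size. *)
apply: (@comp_bound_step R delta nu alpha nu' (delta / 8) (fun tau => c * tau ^+ q)
   (fun tau => (c * tau ^+ q)^-1)) => //.
- by apply/andP; split; move: d0 d1; clear; lra.
- by move=> tau /andP[t0 t1]; rewrite invr_gt0 mulr_gt0 ?exprn_gt0.
- move=> tau /andP[t0 t1]; have h0 : 0 < c * tau ^+ q by rewrite mulr_gt0 ?exprn_gt0.
  exists 0%N => n _ F p val S N [_ [_ hdeg _]] A hA m m1 _ rho' k U J L r0 k0 Jm LJ JL hJ.
  have hA' : #|~: A|%:R <= delta / 4 * n%:R by apply: le_trans hA _; rewrite ler_wpM2r.
  have hr : (1 + nu') * m%:R <= delta / 4 * n%:R.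
    have : (1 + nu') * m%:R <= 2 * m%:R by rewrite ler_wpM2r //; move: nu1; clear; lra.
    by move: m1; clear; lra.
  have hC : n%:R / (c * tau ^+ q)^-1 <= c * tau ^+ q * n%:R by rewrite invrK mulrC.
  have rr : 2 * (rho' / 4) <= rho' by move: r0; clear; lra.
  have rr0 : 0 < rho' / 4 by rewrite divr_gt0.
  exact: (jump_heavy d01 rr rr0 k0 hdeg hA' hr hC LJ JL hJ).
- exists c', q'; split=> // tau t01; have [a [C [n1 [k1 [a0 C0 hA]]]]] := h _ t01.
  exists a, C, n1, k1; split=> // n k hn hk F p val S Z N adm A cA.
  by apply: (hA n k hn hk F p val S Z N adm A); apply: le_trans cA _; rewrite ler_wpM2r.
Qed.

(** Growth by 1 + delta/4 is affordable: (1 - delta)(1 + delta/4) theta' stays below theta' by a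
    margin that absorbs the n/C0 = delta^2 n / 16 peaked coordinates, thanks to theta' >=
    delta/8. *)
Lemma comp_bound_increment (R : realType) (delta nu nu' alpha theta theta' : R) :
  0 < delta < 1 -> 0 < nu' -> 2 * nu' <= nu -> 4 * nu' <= delta -> nu < 1 ->
  0 < alpha -> 4 * alpha <= delta -> 16 * alpha <= nu' * delta ->
  delta / 8 <= theta' -> theta' <= theta -> theta <= 1 - delta / 2 ->
  theta <= (1 + delta / 4) * theta' ->
  comp_bound delta nu alpha (fun=> theta') -> comp_bound delta nu alpha (fun=> theta).
Proof.
move=> d01 nu0 nnu nd nu1 al0 al1 al2 t1 t2 t3 t4; have /andP[d0 d1] := d01.
have dd0 : 0 < delta ^+ 2 by rewrite exprn_gt0.
apply: (@comp_bound_step R delta nu alpha nu' theta (fun=> theta') (fun=> 16 / delta ^+ 2)) => //.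
- by apply/andP; split => //; move: nnu nu1 nu0; clear; lra.
- by apply/andP; split; move: d0 t1 t2 t3; clear; lra.
- by move=> tau _; rewrite divr_gt0.
move=> tau /andP[tau0 tau1].
have [n4 [hn4 _]] := natr_between (divr_gt0 (ltr0n _ 16) d0).
exists n4 => n hn F p val S N [_ [_ _ hexp]] A hA m m1 m2 rho' k U J L r0 k0 Jm LJ JL hJ.
have dn : 16 <= delta * n%:R.
  by rewrite mulrC -ler_pdivrMr //; apply: le_trans hn4 _; rewrite ler_nat.
have n0 : 0 <= n%:R :> R by [].
(* If the minimum is n, the cap theta <= 1 - delta/2 leaves room. If it is (1 + nu) m, half of nu m
   is kept for [nu'], and the deleted rows are covered by alpha <= nu' delta / 16. *)
have cA : (1 + nu') * m%:R + #|~: A|%:R <= #|[set i | delta * #|J|%:R <= #|N i :&: J|%:R]|%:R.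
  apply: le_trans (hexp J); rewrite Jm.
  have an : 16 * (alpha * n%:R) <= nu' * (delta * n%:R).
    by rewrite !mulrA ler_wpM2r.
  have tn : delta * n%:R <= 8 * (theta * n%:R).
    by rewrite mulrA ler_wpM2r //; move: t1 t2; clear; lra.
  have nm : nu' * (delta * n%:R) <= nu' * (16 * m%:R).
    by rewrite ler_wpM2l ?(ltW nu0) //; move: tn m2 dn; clear; lra.
  rewrite minEle; case: ifP => _.
    have e1 : theta * n%:R <= (1 - delta / 2) * n%:R by rewrite ler_wpM2r.
    have e2 : nu' * m%:R <= delta / 4 * m%:R by rewrite ler_wpM2r //; move: nd; clear; lra.
    have e3 : (1 + delta / 4) * m%:R <= (1 + delta / 4) * ((1 - delta / 2) * n%:R).
      by rewrite ler_wpM2l ?(le_trans m1 e1) //; move: d0; clear; lra.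
    have e4 : (1 + delta / 4) * ((1 - delta / 2) * n%:R) <= (1 - delta / 4) * n%:R.
      by rewrite mulrA ler_wpM2r //; move: d0; clear; nra.
    have e5 : alpha * n%:R <= delta / 4 * n%:R by rewrite ler_wpM2r //; move: al1; clear; lra.
    by move: e2 e3 e4 e5 hA; clear; lra.
  have e2 : 2 * nu' * m%:R <= nu * m%:R by rewrite ler_wpM2r.
  by move: an nm e2 hA; clear; lra.
have hth : (1 - delta) * m%:R + n%:R / (16 / delta ^+ 2) <= theta' * n%:R.
  have -> : n%:R / (16 / delta ^+ 2) = delta / 16 * delta * n%:R :> R.
    by field; rewrite gt_eqF.
  have e1 : (1 - delta) * m%:R <= (1 - delta) * ((1 + delta / 4) * theta' * n%:R).
    rewrite ler_wpM2l //; first by move: d1; clear; lra.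
    by apply: le_trans m1 _; rewrite ler_wpM2r.
  apply: le_trans (lerD e1 (lexx _)) _; rewrite mulrA -mulrDl ler_wpM2r //.
  by move: t1 d0 d1; clear; nra.
have rr : 2 * (rho' / 4) <= rho' by move: r0; clear; lra.
have rr0 : 0 < rho' / 4 by rewrite divr_gt0.
exact: (increment_heavy d01 rr rr0 k0 Jm cA hth LJ JL hJ).
Qed.

Lemma comp_bound_top (R : realType) (delta nu : R) : 0 < delta < 1 -> 0 < nu < 1 ->
  exists alpha : R, 0 < alpha <= 1 /\ comp_bound delta nu alpha (fun=> 1 - delta / 2).
Proof.
move=> d01 /andP[nu0 nu1]; have /andP[d0 d1] := d01.
pose nu' := Num.min (nu / 2) (delta / 4).
have nu'0 : 0 < nu' by rewrite lt_min !divr_gt0.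
have nu'1 : 2 * nu' <= nu.
  have : nu' <= nu / 2 by rewrite ge_min lexx.
  by clear; lra.
have nu'2 : 4 * nu' <= delta.
  have : nu' <= delta / 4 by rewrite ge_min lexx orbT.
  by clear; lra.
pose alpha := nu' * delta / 16.
have al0 : 0 < alpha by rewrite divr_gt0 ?mulr_gt0.
have al1 : 4 * alpha <= delta.
  by rewrite /alpha; move: (nu'0) nu'1 nu1 d0; clear; clearbody nu'; nra.
have al2 : 16 * alpha <= nu' * delta by rewrite /alpha; clear; lra.
exists alpha; split; first by apply/andP; split => //; move: al1 d1; clear; lra.
pose r := 1 + delta / 4.
pose th t := Num.min (delta / 8 * r ^+ t) (1 - delta / 2).
have r1 : 1 <= r by rewrite /r; move: d0; clear; lra.
have r0 : 0 < r by apply: lt_le_trans r1.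
have rt t : 1 <= r ^+ t by exact: exprn_ege1.
have H t : comp_bound delta nu alpha (fun=> th t).
  elim: t => [|t IH].
    have -> : th 0%N = delta / 8 by rewrite /th expr0 mulr1 min_l //; move: d0 d1; clear; lra.
    apply: (@comp_bound_jump R delta nu nu') => //; first by apply/andP; split => //; move: nu'1 nu1; clear -nu'0; lra.
    by rewrite al0 /=; move: al1; clear; lra.
  apply: (@comp_bound_increment R delta nu nu' alpha _ _ _ _ _ _ _ _ _ _ _ _ _ _ IH) => //.
  - rewrite /th le_min; apply/andP; split; last by move: d0 d1; clear; lra.
    by rewrite ler_peMr //; move: d0; clear; lra.
  - rewrite /th le_min !ge_min lexx orbT andbT exprS mulrCA; apply/orP; left.
    by rewrite ler_peMl // mulr_ge0 ?divr_ge0 ?(ltW d0) ?exprn_ge0 ?(ltW r0).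
  - by rewrite /th ge_min lexx orbT.
  - rewrite /th -/r minr_pMr ?(ltW r0) // le_min !ge_min; apply/andP; split; apply/orP; [left|right].
      by rewrite exprS mulrCA.
    by rewrite ler_peMl //; move: d1; clear; lra.
(* By Bernoulli's inequality, 32 / delta^2 steps suffice: (delta/8)(delta/4)(32/delta^2) = 1. *)
have [t ht] : exists t, 1 - delta / 2 <= delta / 8 * r ^+ t.
  have [g [hg _]] := natr_between (divr_gt0 (ltr0n R 32) (mulr_gt0 d0 d0)).
  exists g; have bern : 1 + delta / 4 * g%:R <= r ^+ g.
    elim: (g) => [|u IH]; first by rewrite expr0 mulr0 addr0.
    rewrite exprS -(natr1 u); apply: le_trans (_ : r * (1 + delta / 4 * u%:R) <= _); last by rewrite ler_pM2l.
    have d4 : 0 <= delta / 4 by rewrite divr_ge0 // ltW.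
    have : 0 <= delta / 4 * (delta / 4 * u%:R) by apply: mulr_ge0 => //; apply: mulr_ge0.
    by rewrite /r; set z := u%:R; clear; lra.
  have e1 : delta / 8 * (1 + delta / 4 * g%:R) <= delta / 8 * r ^+ g.
    by rewrite ler_wpM2l // divr_ge0 // ltW.
  have e2 : 32 <= delta * delta * g%:R by rewrite mulrC -ler_pdivrMr // mulr_gt0.
  by move: e1 e2 d0; clear; lra.
have := H t; congr comp_bound; apply/funext => _; rewrite /th min_r //.
Qed.

(** * Kernel frames and intermediate singular values *)

Section KernelFrames.
Variable R : realType.

Lemma exists_ker_frame n k (A : {set 'I_n}) (M : 'M[R[i]]_n) : (#|A| + k <= n)%N ->
  exists U : 'M[R[i]]_(n, k), isometric U /\ restr A M *m U = 0.
Proof.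
move=> h; have [U [hU iU]] := isometric_kernel (rowsub (fun i : 'I_#|A| => enum_val i) M) h.
exists U; split=> //; apply/matrixP => i a; rewrite restrE [RHS]mxE; case: ifP => // iA.
have := congr1 (fun B : 'M_(_, _) => B (enum_rank_in iA i) a) hU.
rewrite !mxE => e; apply: etrans e; apply: eq_bigr => j _; by rewrite mxE enum_rankK_in.
Qed.

(* A frame in the kernel, chosen as a function of the matrix, hence independent of the
   rows that [restr] erases. *)
Definition ker_frame n k (B : 'M[R[i]]_n) : 'M[R[i]]_(n, k) :=
  if pselect (exists U : 'M[R[i]]_(n, k), isometric U /\ B *m U = 0) is left h
  then projT1 (cid h) else 0.

Lemma ker_frameP n k (A : {set 'I_n}) (M : 'M[R[i]]_n) : (#|A| + k <= n)%N ->
  isometric (ker_frame k (restr A M)) /\ restr A M *m ker_frame k (restr A M) = 0.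
Proof.
move=> h; rewrite /ker_frame; case: pselect => [e|]; first exact: (projT2 (cid e)).
by case; exact: exists_ker_frame.
Qed.

Lemma restr_mul0 n k (A : {set 'I_n}) (M : 'M[R[i]]_n) (U : 'M[R[i]]_(n, k)) i :
  restr A M *m U = 0 -> i \in A -> row i (M *m U) = 0.
Proof.
move=> h iA; apply/rowP => a; rewrite !mxE.
by have := congr1 (fun B : 'M_(_, _) => B i a) h; rewrite restrE iA !mxE.
Qed.

(** A witness form of a small singular value. Vectors act on the rows by transpose, without
    conjugation, so that [M] enters through linear combinations of its rows; [t2] bounds a squared
    norm. *)
Definition left_small n k (M : 'M[R[i]]_n) (t2 : R) : Prop :=
  exists Y : 'M[R[i]]_(n, k), isometric Y /\
    forall g : 'cV_k, nrm2 ((Y *m g)^T *m M) <= t2 * nrm2 g.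

(** A negative second moment argument: the left space is cut to an l-frame [Y'] supported on [A0].
    Testing against the kernel frame of the other rows gives rown Y' i * d2 <= t2 for each i, and
    summing gives l d2 <= n t2. *)
Lemma left_small_contra n k l (A0 : {set 'I_n}) (M : 'M[R[i]]_n) (t2 d2 : R) kap :
  (#|~: A0| + l <= k)%N -> (#|A0| + kap <= n.+1)%N -> n%:R * t2 < l%:R * d2 -> 0 < d2 -> 0 <= t2 ->
  (forall i, i \in A0 -> d2 < nrm2 (row i M *m ker_frame kap (restr (A0 :\ i) M))) ->
  ~ left_small k M t2.
Proof.
move=> hl hk ht d0 t0 hU [Y [iY hY]].
pose B := rowsub (fun i : 'I_#|~: A0| => enum_val i) Y.
have [V [hV iV]] := isometric_kernel B hl.
pose Y' := Y *m V.
have iY' : isometric Y' by exact: isometric_mul.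
have Y'0 i : i \notin A0 -> row i Y' = 0.
  move=> iA; have iA' : i \in ~: A0 by rewrite inE.
  apply/rowP => a; have := congr1 (fun B : 'M_(_, _) => B (enum_rank_in iA' i) a) hV.
  rewrite !mxE => e; apply: etrans e; apply: eq_bigr => j _; by rewrite mxE enum_rankK_in.
have hw i : i \in A0 -> rown Y' i * d2 <= t2.
  move=> iA; have := hU i iA.
  have hcard : (#|A0 :\ i| + kap <= n)%N by move: hk; rewrite (cardsD1 i A0) iA addSn ltnS.
  have [iU hU0] := ker_frameP M hcard; move: iU hU0; set U := ker_frame _ _ => iU hU0 hd.
  (* This combination makes the i-th coordinate of [Y' *m g] equal to [rown Y' i], which is also
     [nrm2 g]. Multiplied by the kernel frame, only row i survives: other rows of [A0] are
     annihilated, and [Y'] vanishes off [A0]. *)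
  pose g := (map_mx conjc (row i Y'))^T.
  have ng : nrm2 g = rown Y' i by rewrite nrm2_tr nrm2_conj rownE.
  have yi : (Y' *m g) i 0 = (rown Y' i)%:C%C.
    rewrite mxE /rown (big_morph (real_complex R) (rmorphD _) (rmorph0 _)).
    by apply: eq_bigr => a _; rewrite !mxE mul_conjC.
  have e1 : (Y' *m g)^T *m M *m U = (Y' *m g) i 0 *: (row i M *m U).
    rewrite -mulmxA; apply/rowP => a; rewrite mxE (bigD1 i) //= big1 ?addr0.
      by rewrite !mxE; congr (_ * _); apply: eq_bigr => j _; rewrite mxE.
    move=> j ji; have [jA|jA] := boolP (j \in A0).
      have jA' : j \in A0 :\ i by rewrite !inE ji.
      have -> : (M *m U) j a = (row j (M *m U)) 0 a by rewrite [RHS]mxE.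
      by rewrite (restr_mul0 hU0 jA') [X in _ * X]mxE mulr0.
    have -> : (Y' *m g)^T 0 j = 0.
      rewrite mxE; have -> : (Y' *m g) j 0 = (row j (Y' *m g)) 0 0 by rewrite [RHS]mxE.
      by rewrite row_mul Y'0 // mul0mx mxE.
    by rewrite mul0r.
  have := hY (V *m g); rewrite mulmxA -/Y' iV => h1.
  have := le_trans (isometric_adj _ iU) h1; rewrite e1 nrm2Z yi sqn_real ng => h2.
  have r0 := rown_ge0 Y' i.
  have [r00|rp] := eqVneq (rown Y' i) 0; first by rewrite r00 mul0r.
  have rp' : 0 < rown Y' i by rewrite lt_neqAle eq_sym rp.
  rewrite -(ler_pM2r rp'); apply: le_trans h2.
  rewrite mulrAC -expr2 ler_wpM2l ?sqr_ge0 //; exact: ltW.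
have : \sum_i rown Y' i * d2 <= n%:R * t2.
  rewrite mulr_natl -[X in _ *+ X](card_ord n) -sumr_const; apply: ler_sum => i _.
  have [iA|iA] := boolP (i \in A0); first exact: hw.
  by rewrite rownE Y'0 // nrm20 mul0r.
rewrite -mulr_suml isometric_sum_rown //.
by move=> h; have := lt_le_trans ht h; rewrite ltxx.
Qed.
End KernelFrames.

Lemma card_ord_lt n k : #|[set i : 'I_n | (i < n - k)%N]%SET| = (n - k)%N.
Proof.
have le : (n - k <= n)%N by exact: leq_subr.
rewrite -[RHS]card_ord -(card_imset predT (f := widen_ord le)); last first.
  by move=> i j /(congr1 val) /= e; exact: val_inj.
apply: eq_card => i; rewrite !inE; apply/idP/imsetP => [hi|[j _ ->]]; last exact: (valP j).
by exists (Ordinal hi) => //; exact: val_inj.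
Qed.

Lemma restr_model_mx_upd (R : realType) (F : finType) (val : F -> R[i]) n (S : 'M[R]_n) Z
    (x : {ffun 'I_n -> {ffun 'I_n -> F}}) i t (A : {set 'I_n}) : i \notin A ->
  restr A (model_mx val S Z (upd x i t)) = restr A (model_mx val S Z x).
Proof.
move=> iA; apply/matrixP => a b; rewrite !mxE; case: ifP => // aA.
by rewrite upd_other //; apply: contraTneq aA => ->.
Qed.

Lemma row_model_mx_upd (R : realType) (F : finType) (val : F -> R[i]) n (S : 'M[R]_n) Z
    (x : {ffun 'I_n -> {ffun 'I_n -> F}}) i t k (U : 'M[R[i]]_(n, k)) :
  row i (model_mx val S Z (upd x i t)) *m U =
  row i Z *m U + \sum_j ((S i j)%:C%C * val (t j)) *: row j U.
Proof.
rewrite !mulmx_sum_row -big_split; apply: eq_bigr => j _ /=.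
by rewrite -scalerDl !mxE upd_same addrC.
Qed.

(** Row i is resampled with the rest frozen, which freezes the kernel frame. If the frame had mass
    below rho k on [N i], it would be concentrated on the complement, of size at most (1 - delta) n,
    with zero residual, against the first condition of the event; otherwise [row_small_ball]
    applies. *)
Lemma kernel_row_small (R : realType) (delta nu tau : R) (F : finType) (p : F -> R)
    (val : F -> R[i]) n (S : 'M[R]_n) Z N (A : {set 'I_n}) i k (rho : R) :
  0 < delta < 1 -> 0 < tau <= 1 -> admissible delta nu tau p val S N ->
  (forall i, delta * n%:R <= #|N i|%:R) -> (#|A| + k <= n)%N -> i \notin A -> 0 < rho ->
  Pr (@matrix_law R F p n) (fun x =>
    ~ (exists U : 'M[R[i]]_(n, k), comp_frame val S Z A ((1 - delta / 2) * n%:R) rho x U) /\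
    nrm2 (row i (model_mx val S Z x) *m ker_frame k (restr A (model_mx val S Z x)))
      <= tau ^+ 5 / 32 * (rho * k%:R)) <=
  expR (- (tau ^+ 7 / 256 * (rho * k%:R))).
Proof.
move=> /andP[d0 d1] t01 [[fp law hS] [hN _ _]] hrow hA iA r0.
rewrite /matrix_law; apply: (fun h => Pr_resample h (i := i)) => [|x]; first exact: fdist_row_law.
have [iU hU] := ker_frameP (model_mx val S Z x) hA.
move: (iU) (hU); set U := ker_frame _ _ => iU' hU'.
have /andP[t0 t1] := t01.
have [small|big] := ltP (\sum_(j in N i) rown U j) (rho * k%:R).
  apply: (@le_trans _ _ 0); last exact: expR_ge0.
  rewrite /Pr /Ex big1 // => t _; rewrite asboolF ?mulr0 // => -[hn _]; apply: hn.
  exists U; split=> //; exists (~: N i); split.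
  - have -> : #|~: N i|%:R = n%:R - #|N i|%:R :> R.
      by rewrite -natrB; [congr _%:R; have := cardsC (N i); rewrite card_ord; lia|
        rewrite -[leqRHS]card_ord max_card].
    have := hrow i; have : 0 <= delta * n%:R by rewrite mulr_ge0 ?(ltW d0).
    by clear; lra.
  - by rewrite (eq_bigl (fun j => j \in N i)) ?(ltW small) // => j; rewrite inE negbK.
  - by rewrite restr_model_mx_upd // hU' nrm20 !mulr_ge0 ?(ltW r0).
have con (g : 'cV_k) : nrm2 (U *m g) <= nrm2 g by rewrite iU'.
have := @row_small_ball R F p val tau fp t01 law n k U (S i) (N i) (row i Z *m U) con (hS i) (hN i).
move=> h; apply: le_trans (_ : _ <= expR (- (tau ^+ 7 / 256 * \sum_(j in N i) rown U j))) _.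
  apply: le_trans h; apply: Pr_sub => [|t [_]]; first exact: fdist_row_law.
  rewrite restr_model_mx_upd // row_model_mx_upd => h; apply: le_trans h _.
  by rewrite ler_wpM2l // divr_ge0 // exprn_ge0 // ltW.
by rewrite ler_expR lerN2 ler_wpM2l // divr_ge0 // exprn_ge0 // ltW.
Qed.

(** The factor n is a union over the tested rows. Each term splits according to whether a
    concentrated frame is almost annihilated by the remaining rows, whose number falls short of n by
    at most alpha n. *)
Theorem left_small_bound (R : realType) (delta nu : R) : 0 < delta < 1 -> 0 < nu < 1 ->
  exists (c : R) (q : nat), 0 < c <= 1 /\
  forall tau, 0 < tau <= 1 -> exists (a C : R) (n1 k1 : nat), [/\ 0 < a, 0 <= C &
  forall n k, (n1 <= n)%N -> (k1 <= k)%N -> k%:R <= c * tau ^+ q * n%:R ->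
  forall (F : finType) (p : F -> R) (val : F -> R[i]) (S : 'M[R]_n) (Z : 'M[R[i]]_n) N,
  admissible delta nu tau p val S N -> (forall i, delta * n%:R <= #|N i|%:R) ->
  Pr (@matrix_law R F p n) (fun x => bounded val tau S Z x /\
    left_small k.+1 (model_mx val S Z x) (c * tau ^+ q * (k%:R ^+ 2 / n%:R)))
  <= n%:R * (C * expR (- (a * n%:R)) + expR (- (c * tau ^+ q * k%:R)))].
Proof.
move=> d01 nu01.
have [al [/andP[al0 al1] [c [q [/andP[c0 c1] h]]]]] := comp_bound_top d01 nu01.
exists (c * al / 512), (q + 7)%N; split.
  apply/andP; split; first by rewrite divr_gt0 // mulr_gt0.
  by have := mulr_ile1 (ltW c0) (ltW al0) c1 al1; clear; lra.
move=> tau t01; have /andP[t0 t1] := t01.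
have [a [C [n1 [k1 [a0 C0 hb]]]]] := h _ t01.
exists a, C, n1.+1, (2 * k1 + 4)%N; split=> // n k hn hk hkn F p val S Z N adm hrow.
have [[fp law hS] [hN hdeg hexp]] := adm.
pose rho := c * tau ^+ q.
have rhoE : rho = c * tau ^+ q by [].
have rho0 : 0 < rho by rewrite mulr_gt0 ?exprn_gt0.
have rho1 : rho <= 1.
  by apply: mulr_ile1; rewrite ?(ltW c0) ?exprn_ge0 ?exprn_ile1 ?(ltW t0).
set ct := c * al / 512 * tau ^+ (q + 7) in hkn *.
have t7 : 0 < tau ^+ 7 by exact: exprn_gt0.
have t71 : tau ^+ 7 <= 1 by apply: exprn_ile1; rewrite ?(ltW t0).
have t5 : 0 < tau ^+ 5 by exact: exprn_gt0.
have t75 : tau ^+ 7 <= tau ^+ 5 by rewrite (exprD tau 2 5) ler_piMl ?(ltW t5) // exprn_ile1 ?(ltW t0).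
have ctE : 512 * ct = tau ^+ 7 * rho * al.
  by rewrite /ct rhoE exprD; field.
have ct0 : 0 < ct by rewrite /ct mulr_gt0 ?divr_gt0 ?exprn_gt0 // mulr_gt0.
have ct7 : 512 * ct <= tau ^+ 7 * rho.
  by rewrite ctE ler_piMr // mulr_ge0 // ltW.
have ct5 : 512 * ct <= tau ^+ 5 * rho.
  by apply: le_trans ct7 _; rewrite ler_pM2r.
have ctal : 512 * ct <= al.
  by rewrite ctE ler_piMl ?(ltW al0) // mulr_ile1 // ltW.
clearbody ct rho.
have nR : 0 < n%:R :> R by rewrite ltr0n; apply: leq_trans hn.
have kR : 0 < k%:R :> R by rewrite ltr0n; move: hk; clear; lia.
(* Dropping k' rows leaves a part of the left space of dimension l >= k/2; the n - k' - 1 rows other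
   than i admit a kernel frame of exactly k' + 1 vectors. *)
pose k' := k./2.
have k'1 : (2 * k' <= k <= 2 * k' + 1)%N by rewrite /k'; have := odd_double_half k; move: k./2 (odd k) => u [] /=; rewrite -muln2; clear; lia.
clearbody k'.
have kal : 512 * k%:R <= al * n%:R.
  have : 512 * ct * n%:R <= al * n%:R by rewrite ler_pM2r.
  by move: hkn; clear; lra.
have kn : (k <= n)%N.
  rewrite -(ler_nat R); have : al * n%:R <= 1 * n%:R by rewrite ler_pM2r.
  by move: kal kR; clear; lra.
pose A0 : {set 'I_n} := [set i : 'I_n | (i < n - k')%N].
have cA0 : #|A0| = (n - k')%N by exact: card_ord_lt.
have cA0' : #|~: A0| = k'.
  by have := cardsC A0; rewrite cA0 card_ord; move: kn k'1; clear; lia.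
pose l := (k.+1 - k')%N.
have lk : k%:R <= 2 * l%:R :> R.
  by rewrite -natrM ler_nat /l; move: k'1; clear; lia.
have kk : k%:R <= 2 * k'.+1%:R :> R.
  by rewrite -natrM ler_nat; move: k'1; clear; lia.
pose d2 := tau ^+ 5 / 32 * (rho * k'.+1%:R).
have d20 : 0 < d2 by rewrite !mulr_gt0 ?invr_gt0.
have main x : left_small k.+1 (model_mx val S Z x) (ct * (k%:R ^+ 2 / n%:R)) ->
   exists2 i, i \in A0 & nrm2 (row i (model_mx val S Z x) *m
      ker_frame k'.+1 (restr (A0 :\ i) (model_mx val S Z x))) <= d2.
  move=> hl; apply: contrapT => hno; move: hl; apply: (left_small_contra (l := l) (A0 := A0) (d2 := d2) (kap := k'.+1)) => //.
  - by rewrite cA0' /l; move: k'1; clear; lia.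
  - by rewrite cA0; move: k'1 kn; clear; lia.
  - have -> : n%:R * (ct * (k%:R ^+ 2 / n%:R)) = ct * k%:R ^+ 2.
      by field; rewrite gt_eqF.
    have e1 : l%:R * d2 = tau ^+ 5 * rho / 32 * (l%:R * k'.+1%:R) by rewrite /d2; field.
    have e2 : k%:R * k%:R <= (2 * l%:R) * (2 * k'.+1%:R) :> R by apply: ler_pM.
    have e3 : 512 * ct * (k%:R * k%:R) <= tau ^+ 5 * rho * (k%:R * k%:R).
      by rewrite ler_pM2r ?mulr_gt0.
    have e4 : tau ^+ 5 * rho * (k%:R * k%:R) <= tau ^+ 5 * rho * ((2 * l%:R) * (2 * k'.+1%:R)).
      by rewrite ler_pM2l ?mulr_gt0.
    have e5 : 0 < ct * (k%:R * k%:R) by rewrite !mulr_gt0.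
    rewrite e1 expr2; move: e3 e4 e5.
    rewrite (_ : _ * (2 * l%:R * (2 * k'.+1%:R)) = 128 * (tau ^+ 5 * rho / 32 * (l%:R * k'.+1%:R))); last by field.
    set y1 := _ * (l%:R * _); rewrite -mulrA; set y2 := ct * _; set y3 := _ * (k%:R * _).
    by clear; lra.
  - by rewrite mulr_ge0 ?(ltW ct0) // divr_ge0 ?exprn_ge0 // ltW.
  - move=> i iA; rewrite ltNge; apply/negP => hi; apply: hno; exists i => //.
pose Ev i x := (bounded val tau S Z x /\ exists U : 'M[R[i]]_(n, k'.+1),
     comp_frame val S Z (A0 :\ i) ((1 - delta / 2) * n%:R) rho x U) \/
   (~ (exists U : 'M[R[i]]_(n, k'.+1), comp_frame val S Z (A0 :\ i) ((1 - delta / 2) * n%:R) rho x U) /\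
    nrm2 (row i (model_mx val S Z x) *m ker_frame k'.+1 (restr (A0 :\ i) (model_mx val S Z x))) <= d2).
apply: le_trans (_ : Pr (@matrix_law R F p n) (fun x => exists2 i, i \in A0 & Ev i x) <= _).
  apply: Pr_sub => [|x [hbd hl]]; first exact: fdist_matrix_law.
  have [i iA hi] := main x hl; exists i => //.
  by have [e|e] := pselect (exists U : 'M[R[i]]_(n, k'.+1),
     comp_frame val S Z (A0 :\ i) ((1 - delta / 2) * n%:R) rho x U); [left|right].
set cc := _ + _.
have cc0 : 0 <= cc by rewrite addr_ge0 ?mulr_ge0 ?expR_ge0.
apply: le_trans (_ : #|mem A0|%:R * cc <= _); last first.
  by rewrite ler_wpM2r // ler_nat -[leqRHS]card_ord max_card.
apply: Pr_bigcup => [|i iA]; first exact: fdist_matrix_law.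
apply: le_trans.
  by apply: Pr_or; exact: fdist_matrix_law.
have cAi : (#|A0 :\ i| + k'.+1 <= n)%N.
  by have := cardsD1 i A0; rewrite iA cA0; move: k'1 kn; clear; lia.
apply: lerD.
  rewrite rhoE; have k1k : (k1 <= k'.+1)%N.
    by move: hk k'1; clear; lia.
  apply: (hb n k'.+1 (ltnW hn) k1k F p val S Z N adm).
  have -> : #|~: (A0 :\ i)| = k'.+1.
    have := cardsC (A0 :\ i); have := cardsD1 i A0; rewrite iA cA0 card_ord.
    by move: k'1 kn; clear; lia.
  have : k'.+1%:R <= k%:R :> R by rewrite ler_nat; move: hk k'1; clear; lia.
  by move: kal kR; clear; lra.
apply: le_trans.
  by apply: (kernel_row_small _ d01 t01 adm) => //; rewrite !inE eqxx.
rewrite ler_expR lerN2.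
have e1 : 512 * ct * k%:R <= tau ^+ 7 * rho * k%:R by rewrite ler_pM2r.
have e2 : tau ^+ 7 * rho * k%:R <= tau ^+ 7 * rho * (2 * k'.+1%:R) by rewrite ler_pM2l ?mulr_gt0.
rewrite (_ : _ * (rho * _) = tau ^+ 7 * rho * (2 * k'.+1%:R) / 512); last by field.
by move: e1 e2; clear; lra.
Qed.

From mathcomp Require Import classical_sets.

(** * Singular values under perturbation *)

Lemma nth_sort_lt (R : realType) (s : seq R) (t : R) j : (j < size s)%N ->
  (nth 0 (sort (fun x y : R => y <= x) s) j < t) = (count (fun y => (t <= y)%R) s <= j)%N.
Proof.
set s' := sort _ s => js.
have tot : total (fun x y : R => y <= x) by move=> x y; exact: le_total.
have srt : sorted (fun x y : R => y <= x) s' by exact: sort_sorted.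
have tr : transitive (fun x y : R => y <= x) by move=> y x z h1 h2; exact: le_trans h2 h1.
have mono i l : (i <= l)%N -> (l < size s')%N -> nth 0 s' l <= nth 0 s' i.
  move=> il ls; apply: (sorted_leq_nth tr (fun x => lexx x) 0 srt) => //; rewrite inE //.
  exact: leq_ltn_trans il ls.
have sz : size s' = size s by rewrite size_sort.
have -> : count (fun y => t <= y) s = count (fun y => t <= y) s'.
  by apply/permP; rewrite perm_sym perm_sort.
apply/idP/idP => h.
  rewrite -(cat_take_drop j s') count_cat.
  have -> : count (fun y => t <= y) (drop j s') = 0%N.
    apply/eqP; rewrite -leqn0 leqNgt -has_count; apply/hasPn => y /(nthP 0)[l].
    rewrite size_drop nth_drop ltn_subRL => ls <-; rewrite -ltNge; apply: le_lt_trans h.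
    by apply: mono => //; exact: leq_addr.
  by rewrite addn0; apply: leq_trans (count_size _ _) _; rewrite size_take; case: ltnP.
rewrite ltNge; apply/negP => hj; move: h; rewrite leqNgt => /negP; apply.
rewrite -(cat_take_drop j.+1 s') count_cat; apply: leq_trans (leq_addr _ _).
have st : size (take j.+1 s') = j.+1 by rewrite size_takel // sz.
suff : all (fun y => t <= y) (take j.+1 s') by rewrite all_count => /eqP ->; rewrite st.
apply/(all_nthP 0) => l; rewrite st => lj; rewrite nth_take //.
by apply: le_trans hj _; apply: mono; rewrite ?sz.
Qed.

Section Singular.
Variable R : realType.

Definition gram_eig n (M : 'M[R[i]]_n) (i : 'I_n) : R :=
  complex.Re (spectral_diag (M ^t* *m M)%sesqui 0 i).

Definition gram_basis n (M : 'M[R[i]]_n) : 'M[R[i]]_n := spectralmx (M ^t* *m M)%sesqui.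

Lemma gram_basis_isometric n (M : 'M[R[i]]_n) : isometric (gram_basis M).
Proof.
apply: isometricP.
have : (gram_basis M)^T \is unitarymx by rewrite trmx_unitary; exact: spectral_unitarymx.
by move=> /unitarymxP; rewrite trmxK.
Qed.

(** Spectral decomposition of the Gram matrix, a normal matrix; the left side is real, so real parts
    may be taken. *)
Lemma nrm2_gram n (M : 'M[R[i]]_n) (z : 'cV_n) :
  nrm2 (M *m z) = \sum_i gram_eig M i * sqn ((gram_basis M *m z) i 0).
Proof.
have nE m (v : 'cV[R[i]]_m) : (nrm2 v)%:C%C = ((map_mx Num.conj v)^T *m v) 0 0.
  rewrite nrm2_cV (big_morph (real_complex R) (rmorphD _) (rmorph0 _)) mxE.
  by apply: eq_bigr => i _; rewrite !mxE -mul_conjC mulrC.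
set A := (M ^t* *m M)%sesqui.
have AH : (A ^t*)%sesqui = A.
  by rewrite /A trmx_mul map_mxM trmxCK.
have AN : A \is normalmx by apply/normalmxP; rewrite AH.
have AE := orthomx_spectralP AN.
rewrite invmx_unitary ?spectral_unitarymx // in AE.
have : (nrm2 (M *m z))%:C%C =
   \sum_i spectral_diag A 0 i * (sqn ((gram_basis M *m z) i 0))%:C%C.
  rewrite nE.
  have -> : (map_mx Num.conj (M *m z))^T *m (M *m z) = (map_mx Num.conj z)^T *m A *m z.
    by rewrite map_mxM trmx_mul /A -(map_trmx Num.conj M) !mulmxA.
  rewrite [in LHS]AE -/(gram_basis M) !mulmxA.
  have -> : (map_mx Num.conj z)^T *m (map_mx Num.conj (gram_basis M)^T) = (map_mx Num.conj (gram_basis M *m z))^T.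
    by rewrite map_mxM trmx_mul (map_trmx Num.conj (gram_basis M)).
  rewrite -mulmxA mxE; apply: eq_bigr => i _.
  rewrite mul_mx_diag; set w := gram_basis M *m z.
  by rewrite mxE [in X in X * _]mxE [in X in X * _ * _]mxE -mul_conjC [w i 0 * _]mulrC mulrCA -mulrA.
move=> /(congr1 (@complex.Re R)); rewrite Re_sum /= => ->.
apply: eq_bigr => i _; rewrite /gram_eig -/A; case: (spectral_diag A 0 i) => a b /=.
by rewrite mulr0 subr0.
Qed.

Definition big_eig n (M : 'M[R[i]]_n) (t : R) : {set 'I_n} :=
  [set i | t <= Num.sqrt (gram_eig M i)]%SET.

(** Indexing from 1, [n - k] reads position n - k - 1 of the decreasing list, so the value is below
    t exactly when at most n - k - 1 entries are at least t. *)
Lemma singular_value_lt n (M : 'M[R[i]]_n) (t : R) k : (k < n)%N ->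
  (singular_value M (n - k) < t) = (#|big_eig M t| + k < n)%N.
Proof.
move=> kn; rewrite /singular_value /singular_values nth_sort_lt; last first.
  by rewrite size_map size_enum_ord; move: kn; clear; lia.
rewrite count_map -size_filter.
have -> : size [seq x <- enum 'I_n | preim (fun i => Num.sqrt (complex.Re
     (spectral_diag (M^t* *m M)%sesqui 0 i))) (fun y => t <= y) x] = #|big_eig M t|.
  rewrite -(card_uniqP (filter_uniq _ (enum_uniq 'I_n))); apply: eq_card => i.
  by rewrite mem_filter mem_enum !inE andbT.
by move: kn; clear; lia.
Qed.

Lemma small_eig n (M : 'M[R[i]]_n) (t : R) i : 0 <= t -> i \notin big_eig M t -> gram_eig M i < t ^+ 2.
Proof.
(* [Num.sqrt] is 0 on negative numbers, hence the two cases. *)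
move=> t0; rewrite inE -ltNge => h; have [d0|d0] := leP 0 (gram_eig M i).
  by rewrite -(sqr_sqrtr d0) ltr_pXn2r ?nnegrE ?sqrtr_ge0.
by apply: lt_le_trans d0 _; exact: sqr_ge0.
Qed.

Lemma big_eigP n (M : 'M[R[i]]_n) (t : R) i : 0 < t -> i \in big_eig M t -> t ^+ 2 <= gram_eig M i.
Proof.
move=> t0; rewrite inE => h; have d0 : 0 < gram_eig M i.
  by rewrite ltNge; apply/negP => d0; move: h; rewrite ler0_sqrtr // leNgt t0.
by rewrite -(sqr_sqrtr (ltW d0)) lerXn2r // nnegrE ?(ltW t0) ?sqrtr_ge0.
Qed.

Lemma rowsub_mul0 n (P : 'M[R[i]]_n) (B : {set 'I_n}) (z : 'cV_n) i :
  rowsub (fun i : 'I_#|B| => enum_val i) P *m z = 0 -> i \in B -> (P *m z) i 0 = 0.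
Proof.
move=> hz iB; have := congr1 (fun C : 'M_(_, _) => C (enum_rank_in iB i) 0) hz.
by rewrite !mxE => e; apply: etrans e; apply: eq_bigr => j _; rewrite mxE enum_rankK_in.
Qed.

Lemma nrm2_gram_le n (M : 'M[R[i]]_n) (B : {set 'I_n}) (s : R) (z : 'cV_n) :
  (forall i, i \notin B -> gram_eig M i <= s) ->
  rowsub (fun i : 'I_#|B| => enum_val i) (gram_basis M) *m z = 0 ->
  nrm2 (M *m z) <= s * nrm2 z.
Proof.
move=> hs hz; rewrite nrm2_gram -(gram_basis_isometric M z) nrm2_cV mulr_sumr.
apply: ler_sum => i _; have [iB|iB] := boolP (i \in B).
  have -> := rowsub_mul0 hz iB.
  by rewrite sqn0 !mulr0.
by rewrite ler_wpM2r ?sqn_ge0 // hs.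
Qed.

(** [Y] is chosen so that z, the conjugate transpose of u = y^T M, is orthogonal to the large
    eigenvectors. Then nrm2 u = y^T M z is at most |y| t |z| with |z| = |u|, which gives the bound
    on u. *)
Lemma left_small_singular n (M : 'M[R[i]]_n) (t : R) k : (k < n)%N -> 0 <= t ->
  singular_value M (n - k) < t -> left_small k.+1 M (t ^+ 2).
Proof.
move=> kn t0; rewrite singular_value_lt // => hB; set B := big_eig M t in hB.
pose W := rowsub (fun i : 'I_#|B| => enum_val i) (gram_basis M).
have [|Y [hY iY]] := @isometric_kernel R _ n k.+1 (map_mx conjc W *m M^T); first by rewrite addnS.
exists Y; split=> // g; set y := Y *m g.
have ny : nrm2 y = nrm2 g by exact: iY.
set u := y^T *m M; pose z := (map_mx conjc u)^T.
have nz : nrm2 z = nrm2 u by rewrite nrm2_tr nrm2_conj.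
have Wz : W *m z = 0.
  have : map_mx conjc W *m M^T *m Y *m g = 0 by rewrite hY mul0mx.
  move=> /(congr1 (map_mx conjc)); rewrite map_mx0 => e; apply: etrans e.
  rewrite -(mulmxA _ Y) -/y -mulmxA map_mxM -map_mx_comp.
  rewrite (map_mx_id (@conjCK _)); congr (_ *m _).
  by rewrite /z /u map_trmx trmx_mul trmxK.
have hz : nrm2 (M *m z) <= t ^+ 2 * nrm2 z.
  by apply: nrm2_gram_le Wz => i iB; apply/ltW/small_eig.
have e1 : (y^T *m (M *m z)) 0 0 = (nrm2 u)%:C%C.
  rewrite mulmxA -/u mxE nrm2_rV (big_morph (real_complex R) (rmorphD _) (rmorph0 _)).
  by apply: eq_bigr => i _; rewrite !mxE mul_conjC.
have e2 : nrm2 u ^+ 2 <= nrm2 y * (t ^+ 2 * nrm2 u).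
  rewrite -sqn_real -e1; apply: le_trans (_ : nrm2 (y^T *m (M *m z)) <= _).
    by rewrite nrm2_cV big_ord1.
  by apply: le_trans (nrm2_mul _ _) _; rewrite nrm2_tr -nz ler_wpM2l ?nrm2_ge0.
have [u0|u0] := eqVneq (nrm2 u) 0; first by rewrite u0 mulr_ge0 ?sqr_ge0 ?nrm2_ge0.
have up : 0 < nrm2 u by rewrite lt_neqAle eq_sym u0 nrm2_ge0.
by rewrite -ny -(ler_pM2r up) -expr2; apply: le_trans e2 _; rewrite mulrA [nrm2 y * _]mulrC.
Qed.

Definition right_small n k (M : 'M[R[i]]_n) (s : R) : Prop :=
  exists V : 'M[R[i]]_(n, k), isometric V /\ forall g : 'cV_k, nrm2 (M *m (V *m g)) <= s * nrm2 g.

(** Courant-Fischer: the k + 1 or more small eigenvectors span the required space, and conversely a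
    space of dimension k + 1 meets the span of n - k large ones. The strict gap between s and t^2 is
    what survives a perturbation. *)
Lemma singular_right_small n (M : 'M[R[i]]_n) (t : R) k : (k < n)%N -> 0 < t ->
  singular_value M (n - k) < t <-> exists s, [/\ 0 <= s, s < t ^+ 2 & right_small k.+1 M s].
Proof.
move=> kn t0; rewrite singular_value_lt //; set B := big_eig M t; split=> [hB|[s [s0 st [V [iV hV]]]]].
  pose W := rowsub (fun i : 'I_#|B| => enum_val i) (gram_basis M).
  have [|V [hV iV]] := @isometric_kernel R _ n k.+1 W; first by rewrite addnS.
  exists (\big[Num.max/0]_(i | i \notin B) gram_eig M i); split.
  - elim/big_rec: _ => // i x _ x0; by rewrite le_max x0 orbT.
  - elim/big_rec: _ => [|i x iB xt]; first by rewrite exprn_gt0.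
    by rewrite gt_max xt andbT; apply: small_eig => //; exact: ltW.
  exists V; split=> // g; rewrite -[X in _ <= _ * X]iV.
  apply: (nrm2_gram_le (B := B)); last by rewrite mulmxA hV mul0mx.
  by move=> i iB; rewrite (bigD1 i) //= le_max lexx.
rewrite ltnNge; apply/negP => hB.
pose W := rowsub (fun i : 'I_#|~: B| => enum_val i) (gram_basis M) *m V.
have cB : (#|~: B| + 1 <= k.+1)%N by have := cardsC B; rewrite card_ord; move: hB; clear; lia.
have [g [hg ig]] := isometric_kernel W cB.
have ng : nrm2 g = 1 by have := ig 1%:M; rewrite mulmx1 => ->; rewrite nrm2_cV big_ord1 mxE eqxx sqn1.
have := hV g; rewrite ng mulr1; apply/negP; rewrite -ltNge; apply: lt_le_trans st _.
set z := V *m g; have nz : nrm2 z = 1 by rewrite iV.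
rewrite nrm2_gram -[leLHS]mulr1 -nz -(gram_basis_isometric M z) nrm2_cV mulr_sumr.
apply: ler_sum => i _; have [iB|iB] := boolP (i \in B).
  by rewrite ler_wpM2r ?sqn_ge0 // big_eigP.
have iB' : i \in ~: B by rewrite inE.
have hz : rowsub (fun i : 'I_#|~: B| => enum_val i) (gram_basis M) *m z = 0.
  by rewrite mulmxA.
have -> := rowsub_mul0 hz iB'.
by rewrite sqn0 !mulr0.
Qed.

Lemma l2normE n (v : 'cV[R[i]]_n) : l2norm v = Num.sqrt (nrm2 v).
Proof. by rewrite /l2norm nrm2_cV; congr Num.sqrt; apply: eq_bigr => i _; rewrite normc_sqr. Qed.

Lemma opnorm_le n (M : 'M[R[i]]_n) (K : R) : 0 <= K ->
  opnorm M <= K <-> forall v : 'cV_n, nrm2 (M *m v) <= K ^+ 2 * nrm2 v.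
Proof.
move=> K0; rewrite /opnorm; set E := (X in sup X).
have E0 : (E !=set0)%classic by exists (l2norm (M *m 0)), 0 => //=; rewrite l2normE nrm20 sqrtr0.
split=> [h v|h]; last first.
  apply: ge_sup => // y [v /= v1 <-]; move: v1; rewrite !l2normE -[X in _ <= X -> _]sqrtr1 ler_sqrt // => nv.
  rewrite -(ger0_norm K0) -sqrtr_sqr ler_sqrt ?sqr_ge0 //.
  by apply: le_trans (h v) _; rewrite -[leRHS]mulr1 ler_wpM2l ?sqr_ge0.
have [v0|v0] := eqVneq (nrm2 v) 0.
  by rewrite (nrm2_eq0 v0) mulmx0 nrm20 mulr0.
have vp : 0 < nrm2 v by rewrite lt_neqAle eq_sym v0 nrm2_ge0.
(* [sup] dominates the set only if it is bounded above; the Frobenius norm provides a bound. *)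
have up : has_ubound E.
  exists (Num.sqrt (nrm2 M)) => _ [w /= w1 <-]; rewrite l2normE ler_sqrt ?nrm2_ge0 //.
  apply: le_trans (nrm2_mul _ _) _; rewrite -[leRHS]mulr1 ler_wpM2l ?nrm2_ge0 //.
  by move: w1; rewrite l2normE -[X in _ <= X -> _]sqrtr1 ler_sqrt.
pose c := ((Num.sqrt (nrm2 v))^-1)%:C%C : R[i].
have sc : sqn c = (nrm2 v)^-1 by rewrite sqn_real exprVn sqr_sqrtr // ltW.
have : l2norm (M *m (c *: v)) <= K.
  apply: le_trans h; apply: ub_le_sup => //; exists (c *: v) => //=.
  by rewrite l2normE nrm2Z sc mulVf // sqrtr1.
rewrite l2normE -scalemxAr nrm2Z sc => h1.
have h2 : (nrm2 v)^-1 * nrm2 (M *m v) <= K ^+ 2.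
  rewrite -(@sqr_sqrtr _ ((nrm2 v)^-1 * _)) ?lerXn2r ?nnegrE ?sqrtr_ge0 //.
  by rewrite mulr_ge0 ?invr_ge0 ?nrm2_ge0.
by move: h2; rewrite mulrC ler_pdivrMr.
Qed.

(** The free parameter brings the factor of the main term as close to 1 as wanted, so strict
    inequalities survive small perturbations. *)
Lemma nrm2D_weighted m n (A B : 'M[R[i]]_(m, n)) (a : R) : 0 < a ->
  nrm2 (A + B) <= (1 + a) * nrm2 A + (1 + a^-1) * nrm2 B.
Proof.
move=> a0; rewrite /nrm2 !mulr_sumr -big_split; apply: ler_sum => i _.
rewrite !mulr_sumr -big_split; apply: ler_sum => j _ /=; rewrite mxE.
rewrite -subr_ge0 (_ : _ - _ = a^-1 * sqn (a%:C%C * A i j - B i j)).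
  by rewrite mulr_ge0 ?invr_ge0 ?sqn_ge0 // ltW.
case: (A i j) (B i j) => [x y] [z w]; rewrite /sqn /=; field; exact: lt0r_neq0.
Qed.

Definition entry_close n (M M' : 'M[R[i]]_n) (eta : R) : Prop :=
  forall i j, sqn (M' i j - M i j) <= eta.

Lemma entry_close_nrm2 n (M M' : 'M[R[i]]_n) eta : entry_close M M' eta ->
  nrm2 (M' - M) <= n%:R ^+ 2 * eta.
Proof.
move=> h; apply: le_trans (_ : \sum_(i < n) \sum_(j < n) eta <= _).
  by apply: ler_sum => i _; apply: ler_sum => j _; have := h i j; rewrite !mxE.
by rewrite !sumr_const card_ord -[leLHS]mulr_natl -[X in _ * X <= _]mulr_natl mulrA expr2.
Qed.

Lemma perturb_le n (M M' : 'M[R[i]]_n) (eta a : R) (v : 'cV_n) : 0 < a -> entry_close M M' eta ->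
  nrm2 (M' *m v) <= (1 + a) * nrm2 (M *m v) + (1 + a^-1) * (n%:R ^+ 2 * eta * nrm2 v).
Proof.
move=> a0 /entry_close_nrm2 h; have -> : M' *m v = M *m v + (M' - M) *m v.
  by rewrite -mulmxDl addrCA subrr addr0.
apply: le_trans (nrm2D_weighted _ _ a0) _; rewrite lerD2l ler_wpM2l //.
  by rewrite addr_ge0 // invr_ge0 ltW.
by apply: le_trans (nrm2_mul _ _) _; rewrite ler_wpM2r ?nrm2_ge0.
Qed.

(** Openness for the entrywise distance, in exactly the form used to cover the event by cells. *)
Definition entry_open n (G : 'M[R[i]]_n -> Prop) : Prop :=
  forall M, G M -> exists eta, 0 < eta /\ forall M', entry_close M M' eta -> G M'.

Lemma perturb_room n (s t : R) : 0 <= s -> s < t ->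
  exists a eta : R, [/\ 0 < a, 0 < eta & (1 + a) * s + (1 + a^-1) * (n%:R ^+ 2 * eta) < t].
Proof.
move=> s0 st; pose d := (t - s) / 3; have d0 : 0 < d by rewrite divr_gt0 // subr_gt0.
pose a := d / (s + 1); have a0 : 0 < a by rewrite divr_gt0 // ltr_wpDl.
pose eta := d / ((1 + a^-1) * (n%:R ^+ 2 + 1)).
have p1 : 0 < 1 + a^-1 by rewrite addr_gt0 // invr_gt0.
have p2 : 0 < n%:R ^+ 2 + 1 :> R by rewrite ltr_wpDl ?sqr_ge0.
exists a, eta; split => //; first by rewrite divr_gt0 // mulr_gt0.
have h1 : a * s <= d.
  by rewrite /a mulrAC ler_pdivrMr ?ltr_wpDl // ler_pM2l // lerDl.
have h2 : (1 + a^-1) * (n%:R ^+ 2 * eta) <= d.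
  have e (x y v w : R) : x != 0 -> y != 0 -> x * (v * (w / (x * y))) = w * (v / y).
    by move=> x0 y0; field; rewrite x0 y0.
  rewrite /eta e ?lt0r_neq0 //.
  by rewrite -[leRHS]mulr1 ler_pM2l // ler_pdivrMr // mul1r lerDl.
by move: h1 h2 d0; rewrite /d; clear; lra.
Qed.

Lemma singular_value_open n (t : R) k : (k < n)%N -> 0 < t ->
  entry_open (fun M : 'M[R[i]]_n => singular_value M (n - k) < t).
Proof.
move=> kn t0 M /(singular_right_small _ kn t0)[s [s0 st [V [iV hV]]]].
have [a [eta [a0 eta0 room]]] := perturb_room n s0 st.
exists eta; split=> // M' hM'; apply/(singular_right_small _ kn t0).
exists ((1 + a) * s + (1 + a^-1) * (n%:R ^+ 2 * eta)); split => //.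
  have a0' := ltW a0; have eta0' := ltW eta0.
  by rewrite addr_ge0 // mulr_ge0 ?addr_ge0 ?invr_ge0 // mulr_ge0 ?sqr_ge0.
exists V; split=> // g; apply: le_trans (perturb_le _ a0 hM') _.
rewrite [leRHS]mulrDl iV -!mulrA lerD2r ler_wpM2l ?addr_ge0 ?(ltW a0) //.
Qed.

Lemma opnorm_open n (K : R) : 0 <= K -> entry_open (fun M : 'M[R[i]]_n => ~ opnorm M <= K).
Proof.
move=> K0 M hM; have [v hv] : exists v : 'cV_n, K ^+ 2 * nrm2 v < nrm2 (M *m v).
  apply: contrapT => hn; apply: hM; apply/(opnorm_le _ K0) => v.
  by rewrite leNgt; apply/negP => h; apply: hn; exists v.
have v0 : 0 <= nrm2 v by exact: nrm2_ge0.
have [a [eta [a0 eta0 room]]] := perturb_room n (mulr_ge0 (sqr_ge0 K) v0) hv.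
have p : 0 < nrm2 v + 1 by rewrite ltr_wpDl.
exists (eta / (nrm2 v + 1)); split; first by rewrite divr_gt0.
move=> M' hM' /(opnorm_le _ K0)/(_ v) h.
have hM2 : entry_close M' M (eta / (nrm2 v + 1)).
  by move=> i j; rewrite -sqnN opprB.
have := perturb_le v a0 hM2; apply/negP; rewrite -ltNge; apply: le_lt_trans room.
apply: lerD; first by rewrite ler_wpM2l // addr_ge0 // ltW.
apply: ler_wpM2l; first by rewrite addr_ge0 ?invr_ge0 ?(ltW a0).
rewrite -mulrA; apply: ler_wpM2l; first exact: sqr_ge0.
rewrite -mulrA -[leRHS]mulr1; apply: ler_wpM2l; first exact: ltW.
by rewrite mulrC ler_pdivrMr // mul1r lerDl.
Qed.
End Singular.

From mathcomp Require Import all_classical all_reals all_analysis.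
From mathcomp Require Import measurable_realfun.

Local Open Scope classical_set_scope.
Local Open Scope ring_scope.

(** * Discretization *)

Section Cells.
Variable R : realType.

Definition cell (m : nat) (c : int * int) : set (R * R) :=
  [set z | Num.floor (z.1 * m.+1%:R) = c.1] `&` [set z | Num.floor (z.2 * m.+1%:R) = c.2].

Lemma measurable_floor_fiber (m : nat) (k : int) :
  measurable [set y : R | Num.floor (y * m.+1%:R) = k].
Proof.
have -> : [set y : R | Num.floor (y * m.+1%:R) = k] =
   [set` `[k%:~R / m.+1%:R, (k + 1)%:~R / m.+1%:R[%R].
  apply/seteqP; split => y /=; rewrite in_itv /= ler_pdivrMr ?ltr0n // ltr_pdivlMr ?ltr0n //.
    by move=> <-; exact: floor_itv.
  by move=> h; apply: floor_def.
exact: measurable_itv.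
Qed.

Lemma measurable_cell m c : measurable (cell m c).
Proof.
apply: measurableI.
  have := @measurable_fst _ _ R R; move=> /(_ measurableT _ (measurable_floor_fiber m c.1)).
  by rewrite setTI.
have := @measurable_snd _ _ R R; move=> /(_ measurableT _ (measurable_floor_fiber m c.2)).
by rewrite setTI.
Qed.

Lemma floor_close (m : nat) (x y : R) : Num.floor (x * m.+1%:R) = Num.floor (y * m.+1%:R) ->
  (x - y) ^+ 2 <= m.+1%:R ^- 2.
Proof.
move=> e; have mp : 0 < m.+1%:R :> R by rewrite ltr0n.
have /andP[h1 h2] := floor_itv (x * m.+1%:R); have /andP[h3 h4] := floor_itv (y * m.+1%:R).
rewrite e in h1 h2; rewrite -exprVn -(ler_pM2r (exprn_gt0 2 mp)) -!exprMn mulVf ?lt0r_neq0 // expr1n.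
rewrite mulrBl; rewrite intrD in h2 h4; set a := x * _ in h1 h2 *; set b := y * _ in h1 h2 h3 h4 *.
move: h1 h2 h3 h4; move: (Num.floor b)%:~R => f h1 h2 h3 h4.
rewrite -(expr1n _ 2) -subr_ge0 subr_sqr mulr_ge0 //; move: h1 h2 h3 h4; clear; lra.
Qed.

Lemma cell_close (m : nat) c (z w : R[i]) : cell m c (cpair z) -> cell m c (cpair w) ->
  sqn (z - w) <= 2 / m.+1%:R ^+ 2.
Proof.
case: z w => [a b] [x y] [/= h1 h2] [/= h3 h4].
rewrite /sqn /=; apply: le_trans (lerD (@floor_close m a x _) (@floor_close m b y _)) _.
- by rewrite h1 h3.
- by rewrite h2 h4.
by rewrite [leRHS]mulr_natl mulr2n.
Qed.

Lemma cell_self (m : nat) (z : R * R) :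
  cell m (Num.floor (z.1 * m.+1%:R), Num.floor (z.2 * m.+1%:R)) z.
Proof. by []. Qed.

Variables (d : measure_display) (T : measurableType d) (n : nat).
Variables (S : 'M[R]_n) (Z : 'M[R[i]]_n) (X : T -> 'M[R[i]]_n).
Hypothesis hS : forall i j, 0 <= S i j <= 1.
Hypothesis mX : forall i j, cmeasurable (fun w => X w i j).

Lemma structured_close (X1 X2 : 'M[R[i]]_n) eta :
  (forall i j, sqn (X2 i j - X1 i j) <= eta) ->
  entry_close (structured S X1 Z) (structured S X2 Z) eta.
Proof.
move=> h i j; rewrite !mxE (_ : _ - _ = (S i j)%:C%C * (X2 i j - X1 i j)); last by ring.
rewrite sqnM sqn_real; apply: le_trans (h i j); rewrite ler_piMl ?sqn_ge0 //.
by have /andP[s0 s1] := hS i j; exact: exprn_ile1.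
Qed.

(** The event is the union, over the countably many pairs of a mesh and an assignment of cells to
    entries, of those products of cells that lie wholly in [G]. *)
Lemma measurable_entry_open (G : 'M[R[i]]_n -> Prop) : entry_open G ->
  measurable [set w | G (structured S (X w) Z)].
Proof.
move=> oG; pose J := (nat * {ffun 'I_n * 'I_n -> int * int})%type.
pose good (u : J) := forall Y : 'M[R[i]]_n,
  (forall i j, cell u.1 (u.2 (i, j)) (cpair (Y i j))) -> G (structured S Y Z).
pose E (u : J) := if pselect (good u) then
  \bigcap_(ij in [set: 'I_n * 'I_n]) ((@cpair R \o (fun w => X w ij.1 ij.2)) @^-1` cell u.1 (u.2 ij))
  else set0.
have -> : [set w | G (structured S (X w) Z)] = \bigcup_u E u.
  apply/seteqP; split => [w /= Gw|w [u _]]; last first.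
    by rewrite /E; case: pselect => // hu hw; apply: (hu) => i j; exact: (hw (i, j)).
  have [eta [eta0 heta]] := oG _ Gw.
  pose m := Num.truncn (2 / eta); have m1 : 2 / eta < m.+1%:R.
    by have /andP[] := truncn_itv (divr_ge0 (ler0n R 2) (ltW eta0)).
  have h2 : 2 / m.+1%:R ^+ 2 <= eta.
    rewrite ler_pdivrMr ?exprn_gt0 ?ltr0n // mulrC -ler_pdivrMr //.
    apply: le_trans (ltW m1) _; rewrite expr2 ler_peMr // ler1n //.
  pose c : {ffun 'I_n * 'I_n -> int * int} := [ffun ij =>
    (Num.floor ((cpair (X w ij.1 ij.2)).1 * m.+1%:R), Num.floor ((cpair (X w ij.1 ij.2)).2 * m.+1%:R))].
  exists (m, c) => //; rewrite /E; case: pselect => [hg|].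
    by move=> [i j] _ /=; rewrite ffunE; exact: cell_self.
  case=> Y hY; apply: heta; apply: structured_close => i j.
  apply: le_trans h2; apply: cell_close (hY i j) _.
  by rewrite /= ffunE; exact: cell_self.
apply: countable_bigcupT_measurable => [|u]; first exact: countableP.
rewrite /E; case: pselect => [gu|_] /=; last exact: measurable0.
apply: fin_bigcap_measurable; first exact: finite_finset.
move=> ij _; have := mX ij.1 ij.2 measurableT (measurable_cell u.1 (u.2 ij)).
by rewrite setTI.
Qed.
End Cells.

Section Discretize.
Variables (R : realType) (F : finType) (q : R * R -> F).
Hypothesis mq : forall f, measurable [set z | q z = f].
Variables (d' : measure_display) (T' : measurableType d') (P' : probability T' R) (xi : T' -> R[i]).
Hypothesis mxi : cmeasurable xi.

Definition code_law (f : F) : R := fine (P' [set w | q (cpair (xi w)) = f]).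

Lemma measurable_code f : measurable [set w | q (cpair (xi w)) = f].
Proof. by have := mxi measurableT (mq f); rewrite setTI. Qed.

Lemma code_lawE f : P' [set w | q (cpair (xi w)) = f] = (code_law f)%:E.
Proof. by rewrite /code_law fineK // fin_num_measure //; exact: measurable_code. Qed.

Lemma code_law_sum (Q : pred F) :
  (\sum_(f | Q f) code_law f)%:E = P' [set w | Q (q (cpair (xi w)))].
Proof.
have -> : [set w | Q (q (cpair (xi w)))] =
  \bigcup_(f in [set` [seq f <- index_enum F | Q f]]) [set w | q (cpair (xi w)) = f].
  apply/seteqP; split => w /= => [h|[f]]; last by rewrite /mkset mem_filter => /andP[h _] ->.
  by exists (q (cpair (xi w))) => //; rewrite /mkset mem_filter h mem_index_enum.
rewrite measure_fin_bigcup //.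
- rewrite -fsbig_seq ?filter_uniq ?index_enum_uniq // big_filter.
  by rewrite -sumEFin; apply: eq_bigr => f _; rewrite -code_lawE.
- by move=> f g _ _ [w [/= <- <-]].
- by move=> f _; exact: measurable_code.
Qed.

Lemma fdist_code_law : fdist code_law.
Proof.
split=> [f|]; first exact: fine_ge0.
by apply: EFin_inj; rewrite (code_law_sum xpredT) -[RHS](@probability_setT _ _ _ P'); congr (P' _); apply/seteqP.
Qed.

Lemma Pr_code_law (E : F -> Prop) : (Pr code_law E)%:E = P' [set w | E (q (cpair (xi w)))].
Proof.
rewrite /Pr /Ex; have -> : [set w | E (q (cpair (xi w)))] = [set w | asbool (E (q (cpair (xi w))))].
  by apply/seteqP; split => w /= /asboolP.
rewrite -(code_law_sum (fun f => asbool (E f))) [in RHS]big_mkcond; congr _%:E.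
by apply: eq_bigr => f _; case: asboolP => _; rewrite ?mulr1 ?mulr0.
Qed.

Variables (d : measure_display) (T : measurableType d) (P : probability T R) (n : nat).
Variable (X : T -> 'M[R[i]]_n).
Hypothesis mX : forall i j, cmeasurable (fun w => X w i j).
Hypothesis lawX : forall i j, same_law P P' (fun w => X w i j) xi.
Hypothesis indX : cindependent P (fun (ij : 'I_n * 'I_n) w => X w ij.1 ij.2).

Definition mcode (w : T) : {ffun 'I_n -> {ffun 'I_n -> F}} :=
  [ffun i => [ffun j => q (cpair (X w i j))]].

Lemma mcode_fiber x : [set w | mcode w = x] =
  \bigcap_(ij in [set` [set: 'I_n * 'I_n]%SET])
     ((@cpair R \o (fun w => X w ij.1 ij.2)) @^-1` [set z | q z = x ij.1 ij.2]).
Proof.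
apply/seteqP; split => w /=; first by move=> <- [i j] _ /=; rewrite !ffunE.
move=> h; apply/ffunP => i; apply/ffunP => j; rewrite !ffunE.
by apply: (h (i, j)); rewrite /= inE.
Qed.

Lemma measurable_mcode x : measurable [set w | mcode w = x].
Proof.
rewrite mcode_fiber; apply: fin_bigcap_measurable; first exact: finite_finset.
by move=> ij _; have := mX ij.1 ij.2 measurableT (mq (x ij.1 ij.2)); rewrite setTI.
Qed.

Lemma mcode_law x : P [set w | mcode w = x] = (@matrix_law R F code_law n x)%:E.
Proof.
rewrite mcode_fiber (indX [set: 'I_n * 'I_n]%SET (A := fun ij => [set z | q z = x ij.1 ij.2])) //.
rewrite (eq_bigr (fun ij => (code_law (x ij.1 ij.2))%:E)); last first.
  move=> ij _; rewrite -code_lawE.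
  by have := lawX ij.1 ij.2 (mq (x ij.1 ij.2)).
rewrite prodEFin; congr _%:E; rewrite /matrix_law /row_law /prodw pair_big /=.
by apply: eq_bigl => ij; rewrite inE.
Qed.

(** Transfer to the finite model: the event need only imply [E] on the codes or an exceptional code
    in one of the n^2 entries. [Q] will be the code of overflow. *)
Lemma mcode_bound (B : set T) (E : {ffun 'I_n -> {ffun 'I_n -> F}} -> Prop) (Q : F -> Prop) (c : R) :
  measurable B ->
  (forall w, B w -> (exists i j, Q (q (cpair (X w i j)))) \/ E (mcode w)) ->
  Pr code_law Q <= c ->
  (P B <= (Pr (@matrix_law R F code_law n) E + n%:R * (n%:R * c))%:E)%E.
Proof.
move=> mB hB hQ; have fp := fdist_code_law.
pose E' x := E x \/ exists2 i, i \in 'I_n & exists2 j, j \in 'I_n & Q (x i j).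
apply: (@le_trans _ _ (Pr (@matrix_law R F code_law n) E')%:E); last first.
  rewrite lee_fin; apply: le_trans; first by apply: Pr_or; exact: fdist_matrix_law.
  rewrite lerD2l; have fW : fdist (@matrix_law R F code_law n) by exact: fdist_matrix_law.
  have h1 i j : Pr (@matrix_law R F code_law n) (fun x => Q (x i j)) <= c.
    rewrite /matrix_law; apply: (fun h => Pr_resample h (i := i)) => [|x]; first exact: fdist_row_law.
    apply: (@le_trans _ _ (Pr (@row_law R F code_law n) (fun t => Q (t j)))).
      by apply: Pr_sub => [|t]; [exact: fdist_row_law|rewrite upd_same].
    rewrite /row_law; apply: (fun h => Pr_resample h (i := j)) => [|t]; first exact: fp.
    by apply: le_trans hQ; apply: Pr_sub => [|f] //; rewrite upd_same.
  have h2 i : Pr (@matrix_law R F code_law n) (fun x => exists2 j, j \in 'I_n & Q (x i j)) <= n%:R * c.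
    by have := Pr_bigcup fW (fun j (_ : j \in 'I_n) => h1 i j); rewrite card_ord.
  by have := Pr_bigcup fW (fun i (_ : i \in 'I_n) => h2 i); rewrite card_ord.
have sub : B `<=` \bigcup_(x in [set` [seq x <- index_enum {ffun 'I_n -> {ffun 'I_n -> F}} | asbool (E' x)]])
     [set w | mcode w = x].
  move=> w Bw; exists (mcode w) => //; rewrite /mkset mem_filter mem_index_enum andbT; apply/asboolP.
  have [[i [j h]]|h] := hB w Bw; [right|by left].
  by exists i => //; exists j => //; rewrite !ffunE.
apply: le_trans.
  apply: (content_sub_fsum P _ _ mB sub); first exact: finite_finset.
  by move=> x _; exact: measurable_mcode.
rewrite -fsbig_seq ?filter_uniq ?index_enum_uniq // big_filter.
rewrite (eq_bigr (fun x => (@matrix_law R F code_law n x)%:E)) => [|x _]; last exact: mcode_law.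
rewrite sumEFin lee_fin /Pr /Ex [leLHS]big_mkcond; apply: ler_sum => x _.
by case: asboolP => _; rewrite ?mulr1 ?mulr0.
Qed.
End Discretize.

(** * Anti-concentration of the entries *)

Lemma sqnD_weighted (R : realType) (z w : R[i]) (a : R) : 0 < a ->
  sqn (z + w) <= (1 + a) * sqn z + (1 + a^-1) * sqn w.
Proof.
move=> a0; rewrite -subr_ge0 (_ : _ - _ = a^-1 * sqn (a%:C%C * z - w)).
  by rewrite mulr_ge0 ?invr_ge0 ?sqn_ge0 // ltW.
case: z w => [x y] [z w]; rewrite /sqn /=; field; exact: lt0r_neq0.
Qed.

Lemma norm_le_1sqr (R : realType) (x : R) : `|x| <= 1 + x ^+ 2.
Proof.
by rewrite -real_normK ?num_real //; have := sqr_ge0 (`|x| - 1); move: `|x| => y; clear; nra.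
Qed.

Section Moments.
Variables (R : realType) (d : measure_display) (T : measurableType d) (P : probability T R).
Variable xi : T -> R[i].
Hypothesis mxi : cmeasurable xi.
Hypothesis mean0 : cmean P xi = 0.
Hypothesis var1 : cvar P xi = 1%E.

Local Notation ev f := (\int[P]_w f w).

Lemma measurable_Re : measurable_fun setT (fun w => complex.Re (xi w)).
Proof. exact: (measurableT_comp measurable_fst mxi). Qed.

Lemma measurable_Im : measurable_fun setT (fun w => complex.Im (xi w)).
Proof. exact: (measurableT_comp measurable_snd mxi). Qed.

Lemma measurable_sqn_shift (z : R[i]) : measurable_fun setT (fun w => sqn (xi w - z)).
Proof.
have -> : (fun w => sqn (xi w - z)) =
   (fun w => (complex.Re (xi w) - complex.Re z) ^+ 2 + (complex.Im (xi w) - complex.Im z) ^+ 2).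
  by apply/funext => w; case: (xi w) z => [a b] [x y].
apply: measurable_funD; apply: measurable_funX; apply: measurable_funB => //.
  exact: measurable_Re.
exact: measurable_Im.
Qed.

Lemma measurable_sqn : measurable_fun setT (fun w => sqn (xi w)).
Proof. by have := measurable_sqn_shift 0; under eq_fun do rewrite subr0. Qed.

Lemma int_sqn : (\int[P]_w (sqn (xi w))%:E = 1)%E.
Proof.
rewrite -var1 /cvar expectation.unlock; apply: eq_integral => w _.
by rewrite mean0 subr0 normc_sqr.
Qed.

(** A class of integrable functions, stable under the operations used below, which settles all
    integrability conditions by the second moment. *)
Definition dominated (f : T -> R) : Prop :=
  measurable_fun setT f /\ exists C : R, forall w, `|f w| <= C * (1 + sqn (xi w)).

Lemma dominated_integrable f : dominated f -> P.-integrable setT (EFin \o f).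
Proof.
move=> [mf [C hC]]; have hs : P.-integrable setT (EFin \o (fun w => sqn (xi w))).
  apply/integrableP; split; first by apply/measurable_EFinP; exact: measurable_sqn.
  under eq_integral do rewrite /= ger0_norm ?sqn_ge0 //.
  by rewrite int_sqn ltry.
have h1 : P.-integrable setT (EFin \o cst (1 : R)) by exact: finite_measure_integrable_cst.
have hi := integrableZl measurableT C (integrableD measurableT h1 hs).
apply: (le_integrable measurableT _ _ hi); first exact/measurable_EFinP.
by move=> w _ /=; rewrite lee_fin (le_trans (hC w)) // ler_norm.
Qed.

Lemma dominated_cst c : dominated (fun=> c).
Proof.
split; first exact: measurable_cst.
by exists `|c| => w; rewrite ler_peMr // lerDl sqn_ge0.
Qed.

Lemma dominatedD f g : dominated f -> dominated g -> dominated (fun w => f w + g w).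
Proof.
move=> [mf [C hC]] [mg [D hD]]; split; first exact: measurable_funD.
exists (C + D) => w; apply: le_trans (ler_normD _ _) _; rewrite mulrDl; exact: lerD.
Qed.

Lemma dominatedZ c f : dominated f -> dominated (fun w => c * f w).
Proof.
move=> [mf [C hC]]; split; first by apply: measurable_funM.
by exists (`|c| * C) => w; rewrite normrM -mulrA ler_wpM2l.
Qed.

Lemma dominated_bounded (f : T -> R) (C : R) : measurable_fun setT f -> (forall w, `|f w| <= C) -> dominated f.
Proof.
move=> mf h; split=> //; exists C => w; apply: le_trans (h w) _.
by rewrite ler_peMr ?lerDl ?sqn_ge0 // (le_trans (normr_ge0 (f w))).
Qed.

Lemma dominated_indic A : measurable A -> dominated (\1_A).
Proof.
move=> mA; apply: (@dominated_bounded _ 1); first exact: measurable_indic.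
by move=> w; rewrite indicE; case: (w \in A); rewrite ?normr1 ?normr0.
Qed.

Lemma dominated_sqn : dominated (fun w => sqn (xi w)).
Proof.
split; first exact: measurable_sqn.
by exists 1 => w; rewrite ger0_norm ?sqn_ge0 // mul1r lerDr.
Qed.

Lemma dominated_Re : dominated (fun w => complex.Re (xi w)).
Proof.
split; first exact: measurable_Re.
exists 1 => w; rewrite mul1r; apply: le_trans (norm_le_1sqr _) _.
by rewrite lerD2l /sqn lerDl sqr_ge0.
Qed.

Lemma dominated_Im : dominated (fun w => complex.Im (xi w)).
Proof.
split; first exact: measurable_Im.
exists 1 => w; rewrite mul1r; apply: le_trans (norm_le_1sqr _) _.
by rewrite lerD2l /sqn lerDr sqr_ge0.
Qed.

Lemma evD f g : dominated f -> dominated g -> ev (fun w => f w + g w) = ev f + ev g.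
Proof. by move=> hf hg; rewrite RintegralD //; exact: dominated_integrable. Qed.

Lemma evZ c f : dominated f -> ev (fun w => c * f w) = c * ev f.
Proof. by move=> hf; rewrite RintegralZl //; exact: dominated_integrable. Qed.

Lemma ev_cst c : ev (fun=> c) = c.
Proof. by rewrite Rintegral_cst // [X in fine X](_ : _ = 1%E) ?mulr1 //; exact: probability_setT. Qed.

Lemma ev_le f g : dominated f -> dominated g -> (forall w, f w <= g w) -> ev f <= ev g.
Proof. by move=> hf hg h; apply: le_Rintegral => //; exact: dominated_integrable. Qed.

Lemma ev_indic A : measurable A -> ev (\1_A) = fine (P A).
Proof. by move=> mA; rewrite /Rintegral integral_indic // setIT. Qed.

Lemma ev_sqn : ev (fun w => sqn (xi w)) = 1.
Proof. by rewrite /Rintegral int_sqn. Qed.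

Lemma ev_Re : ev (fun w => complex.Re (xi w)) = 0.
Proof. by have := congr1 (@complex.Re R) mean0; rewrite /cmean /= expectation.unlock. Qed.

Lemma ev_Im : ev (fun w => complex.Im (xi w)) = 0.
Proof. by have := congr1 (@complex.Im R) mean0; rewrite /cmean /= expectation.unlock. Qed.

Lemma sqn_tail (A : set T) (a : R) : measurable A -> 0 < a ->
  (forall w, A w -> a <= sqn (xi w)) -> fine (P A) <= a^-1.
Proof.
move=> mA a0 h; have : a * fine (P A) <= 1.
  rewrite -ev_indic // -(evZ a (dominated_indic mA)) -ev_sqn; apply: ev_le.
  - exact/dominatedZ/dominated_indic.
  - exact: dominated_sqn.
  move=> w; rewrite indicE; case: (boolP (w \in A)) => [/set_mem /h|_]; rewrite ?mulr1 // mulr0.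
  by rewrite sqn_ge0.
by rewrite mulrC -ler_pdivlMr // mul1r.
Qed.

Variable kappa : R.
Hypothesis kappa1 : 1 <= kappa.
Hypothesis spr : spread P kappa xi.

Definition disc_event (z : R[i]) (r2 : R) : set T := [set w | sqn (xi w - z) <= r2].

Lemma measurable_near z r2 : measurable (disc_event z r2).
Proof.
have := measurable_sqn_shift z measurableT (measurable_itv `]-oo, r2]%R); rewrite setTI.
by congr measurable; apply/seteqP; split=> w /=; rewrite /disc_event /= in_itv.
Qed.

(* A law concentrated far from 0 cannot have mean zero and variance one. *)
Lemma concentration_far z p : 9 / 16 <= sqn z -> p = fine (P (disc_event z (1 / 16))) -> p <= 1 - 1 / 64.
Proof.
move=> hz pE; rewrite leNgt; apply/negP => hp.
set A := disc_event z (1 / 16) in pE; have mA : measurable A by exact: measurable_near.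
have p1 : p <= 1 by rewrite pE -(fineK (@fin_num_measure _ _ _ P _ mA)) -lee_fin fineK ?fin_num_measure // probability_le1.
set s := sqn z in hz *.
(* On [A] the inner product of z and xi is at least s/2 - 1/32, so c1 can be subtracted there; off
   [A] the integrand is [sqn] of xi + 8 z, divided by 16. In the mean the inner product vanishes,
   leaving c1 p <= 4 s + 1/16. *)
pose c1 := s / 2 - 1 / 32 + 4 * s.
have h : 0 <= ev (fun w => (4 * s + - c1 * \1_A w) +
   (complex.Re z * complex.Re (xi w) + (complex.Im z * complex.Im (xi w) + 1 / 16 * sqn (xi w)))).
  apply: Rintegral_ge0 => w _; set x := xi w.
  have e1 : sqn (x - z) = sqn x - 2 * (complex.Re z * complex.Re x + complex.Im z * complex.Im x) + s.
    by rewrite /s; case: (x) (z) => [a b] [e f]; rewrite /sqn /=; ring.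
  have e2 : 0 <= sqn x + 16 * (complex.Re z * complex.Re x + complex.Im z * complex.Im x) + 64 * s.
    rewrite (_ : _ + _ = sqn (x + 8%:R%:C%C * z)) ?sqn_ge0 //.
    by rewrite /s; case: (x) (z) => [a b] [e f]; rewrite /sqn /=; ring.
  rewrite indicE; have [wA|wA] := boolP (w \in A).
    have := set_mem wA; rewrite /A /disc_event /= -/x e1 mulr1 /c1; have := sqn_ge0 x; move: hz; lra.
  by rewrite mulr0; move: e2; lra.
have dA := dominated_indic mA.
have dR := dominated_Re; have dI := dominated_Im; have dS := dominated_sqn.
move: h; rewrite evD; [|exact: dominatedD (dominated_cst _) (dominatedZ _ dA)|
  exact: dominatedD (dominatedZ _ dR) (dominatedD (dominatedZ _ dI) (dominatedZ _ dS))].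
rewrite evD; [|exact: dominated_cst|exact: dominatedZ].
rewrite evD; [|exact: dominatedZ|exact: dominatedD (dominatedZ _ dI) (dominatedZ _ dS)].
rewrite evD; [|exact: dominatedZ|exact: dominatedZ].
rewrite ev_cst !evZ // ev_Re ev_Im ev_sqn ev_indic // -pE /c1.
by move: hz hp p1; nra.
Qed.

Let B : set T := disc_event 0 (kappa ^+ 2).
Let Y (w : T) : R[i] := (\1_B w)%:C%C * xi w.

Lemma in_cutoff w : (w \in B) = (sqn (xi w) <= kappa ^+ 2).
Proof.
have e : disc_event 0 (kappa ^+ 2) w = (sqn (xi w) <= kappa ^+ 2) :> Prop by rewrite /disc_event /mkset subr0.
by apply/idP/idP => [/set_mem|h]; [rewrite /B e|apply/mem_set; rewrite /B e].
Qed.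

Lemma truncE : (fun w => if ComplexField.Normc.normc (xi w - cmean P xi)%R <= kappa then xi w else 0%R) = Y.
Proof.
apply/funext => w; rewrite /Y mean0 subr0 indicE.
have k0 : 0 <= kappa by apply: le_trans kappa1.
have -> : (w \in B) = (ComplexField.Normc.normc (xi w) <= kappa).
  rewrite in_cutoff -normc_sqr; have n0 : 0 <= ComplexField.Normc.normc (xi w) by rewrite normcE sqrtr_ge0.
  by apply/idP/idP => h; [rewrite -(ger0_norm n0) -(ger0_norm k0) -!sqrtr_sqr ler_sqrt ?sqr_ge0|
     rewrite lerXn2r ?nnegrE].
by case: ifP; rewrite ?mul1r ?mul0r.
Qed.

Lemma sqn_trunc w : sqn (Y w) <= kappa ^+ 2.
Proof.
rewrite /Y sqnM sqn_real indicE in_cutoff; case: (leP (sqn (xi w)) _) => h.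
  by rewrite expr1n mul1r.
by rewrite expr0n mul0r sqr_ge0.
Qed.

Lemma dominated_trunc : [/\ dominated (fun w => complex.Re (Y w)), dominated (fun w => complex.Im (Y w))
  & forall z, dominated (fun w => sqn (Y w - z))].
Proof.
have mB : measurable B by exact: measurable_near.
have mR : measurable_fun setT (fun w => complex.Re (Y w)).
  have -> : (fun w => complex.Re (Y w)) = (fun w => \1_B w * complex.Re (xi w)).
    by apply/funext => w; rewrite /Y; case: (xi w) => a b /=; rewrite mul0r subr0.
  by apply: measurable_funM; [exact: measurable_indic|exact: measurable_Re].
have mI : measurable_fun setT (fun w => complex.Im (Y w)).
  have -> : (fun w => complex.Im (Y w)) = (fun w => \1_B w * complex.Im (xi w)).
    by apply/funext => w; rewrite /Y; case: (xi w) => a b /=; rewrite mul0r addr0.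
  by apply: measurable_funM; [exact: measurable_indic|exact: measurable_Im].
split.
- apply: (@dominated_bounded _ (1 + kappa ^+ 2)) => // w.
  apply: le_trans (norm_le_1sqr _) _; rewrite lerD2l; apply: le_trans (sqn_trunc w).
  by rewrite /sqn lerDl sqr_ge0.
- apply: (@dominated_bounded _ (1 + kappa ^+ 2)) => // w.
  apply: le_trans (norm_le_1sqr _) _; rewrite lerD2l; apply: le_trans (sqn_trunc w).
  by rewrite /sqn lerDr sqr_ge0.
move=> z; apply: (@dominated_bounded _ (2 * kappa ^+ 2 + 2 * sqn z)) => [|w].
  have -> : (fun w => sqn (Y w - z)) =
     (fun w => (complex.Re (Y w) - complex.Re z) ^+ 2 + (complex.Im (Y w) - complex.Im z) ^+ 2).
    by apply/funext => w; case: (Y w) z => [a b] [x y].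
  by apply: measurable_funD; apply: measurable_funX; apply: measurable_funB.
rewrite ger0_norm ?sqn_ge0 //; apply: le_trans (sqnD_le _ _) _.
by rewrite sqnN lerD2r ler_pM2l // sqn_trunc.
Qed.

(** The mean is the best centre, so the lower bound on the variance of the truncation holds about
    every point. *)
Lemma trunc_variance z : kappa^-1 <= ev (fun w => sqn (Y w - z)).
Proof.
have [dR dI dz] := dominated_trunc.
have := spr; rewrite /spread truncE /cvar expectation.unlock; set m := cmean P Y.
have -> : (\int[P]_w (ComplexField.Normc.normc (Y w - m) ^+ 2)%:E = (ev (fun w => sqn (Y w - m)))%:E)%E.
  rewrite /Rintegral fineK; first by apply: eq_integral => w _; rewrite normc_sqr.
  exact: (integrable_fin_num measurableT (dominated_integrable (dz m))).
rewrite lee_fin => h; apply: le_trans h _.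
have eR : ev (fun w => complex.Re (Y w)) = complex.Re m by rewrite /m /cmean /= expectation.unlock.
have eI : ev (fun w => complex.Im (Y w)) = complex.Im m by rewrite /m /cmean /= expectation.unlock.
have -> : (fun w => sqn (Y w - m)) = (fun w => sqn (Y w - z) +
   ((2 * complex.Re (z - m)) * complex.Re (Y w) + ((2 * complex.Im (z - m)) * complex.Im (Y w) + (sqn m - sqn z)))).
  by apply/funext => w; case: (Y w) (z) (m) => [a b] [x y] [u v]; rewrite /sqn /=; ring.
set u := 2 * complex.Re (z - m); set v := 2 * complex.Im (z - m).
have dRu : dominated (fun w => u * complex.Re (Y w)) by exact: dominatedZ.
have dIv : dominated (fun w => v * complex.Im (Y w)) by exact: dominatedZ.
have dc := dominated_cst (sqn m - sqn z).
rewrite (evD (dz z) (dominatedD dRu (dominatedD dIv dc))).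
rewrite (evD dRu (dominatedD dIv dc)) (evD dIv dc) (evZ u dR) (evZ v dI) ev_cst eR eI gerDl /u /v.
rewrite (_ : _ + _ = - sqn (z - m)) ?oppr_le0 ?sqn_ge0 //.
by case: (z) (m) => [a b] [x y]; rewrite /sqn /=; ring.
Qed.

(** If |z| >= 3/4, [concentration_far] applies. Otherwise the disc lies in the unit disc, where
    truncation changes nothing; with larger mass, the second moment of the truncation about z would
    be at most 1/(16 kappa^2) + 4 kappa^2 (1 - p), below 1/kappa. *)
Lemma levy_concentration z : fine (P (disc_event z (1 / (16 * kappa ^+ 2)))) <= 1 - 1 / (64 * kappa ^+ 3).
Proof.
have k0 : 0 < kappa by apply: lt_le_trans kappa1.
have k2 : 1 <= kappa ^+ 2 by exact: exprn_ege1.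
have k3 : 1 <= kappa ^+ 3 by exact: exprn_ege1.
have r16 : 1 / (16 * kappa ^+ 2) <= 1 / 16 :> R.
  by rewrite !div1r lef_pV2 ?posrE ?mulr_gt0 ?exprn_gt0 // ler_peMr.
set A := disc_event z _; have mA : measurable A by exact: measurable_near.
have [zl|zs] := leP (9 / 16) (sqn z).
  have sub : A `<=` disc_event z (1 / 16) by move=> w /=; rewrite /A /disc_event /= => h; apply: le_trans r16.
  have h1 : fine (P A) <= fine (P (disc_event z (1 / 16))).
    by apply: fine_le; rewrite ?fin_num_measure ?le_measure ?inE //; exact: measurable_near.
  apply: le_trans h1 (le_trans (concentration_far zl erefl) _).
  rewrite lerD2l lerN2 !div1r lef_pV2 ?posrE ?mulr_gt0 ?exprn_gt0 // ler_peMr //.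
rewrite leNgt; apply/negP => hp; set p := fine (P A) in hp.
have [dR dI dz] := dominated_trunc.
have h := trunc_variance z.
have hle : ev (fun w => sqn (Y w - z)) <=
   ev (fun w => (1 / (16 * kappa ^+ 2) + 4 * kappa ^+ 2) + - (4 * kappa ^+ 2) * \1_A w).
  apply: ev_le => //; first by apply: dominatedD; [exact: dominated_cst|exact/dominatedZ/dominated_indic].
  move=> w; rewrite indicE; have [wA|wA] := boolP (w \in A).
    have hA := set_mem wA; rewrite /A /disc_event /= in hA.
    have wB : w \in B.
      rewrite in_cutoff; apply: le_trans k2.
      rewrite -[xi w](subrK z); apply: le_trans (sqnD_weighted _ _ (ltr0n R 3)) _.
      by have := le_trans hA r16; move: zs; lra.
    have -> : Y w = xi w by rewrite /Y indicE wB mul1r.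
    by apply: le_trans hA _; rewrite mulr1 addrK.
  rewrite mulr0 addr0; apply: le_trans (sqnD_le _ _) _; rewrite sqnN.
  have := sqn_trunc w; have : 0 < 1 / (16 * kappa ^+ 2) :> R by rewrite divr_gt0 // mulr_gt0 // exprn_gt0.
  move: (1 / (16 * kappa ^+ 2)) => r; move: zs k2; lra.
have := le_trans h hle; rewrite evD; [|exact: dominated_cst|exact/dominatedZ/dominated_indic].
rewrite ev_cst evZ; last exact: dominated_indic.
rewrite ev_indic // -/p => hk.
have kp : 4 * kappa ^+ 2 * (1 - p) < kappa^-1 / 16.
  have -> : kappa^-1 / 16 = 4 * kappa ^+ 2 * (1 / (64 * kappa ^+ 3)) by field; exact: lt0r_neq0.
  by rewrite ltr_pM2l ?mulr_gt0 ?exprn_gt0 //; move: hp; move: (1 / _) => u; lra.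
have kq : 1 / (16 * kappa ^+ 2) <= kappa^-1 / 16.
  have -> : 1 / (16 * kappa ^+ 2) = kappa^-1 / 16 * kappa^-1 by field; exact: lt0r_neq0.
  by rewrite ler_piMr ?divr_ge0 ?invr_ge0 ?(ltW k0) // invf_le1.
have ki : 0 < kappa^-1 by rewrite invr_gt0.
by move: hk kp kq ki; move: (1 / _) (kappa^-1) (4 * kappa ^+ 2) => u v w; nra.
Qed.
End Moments.

Section Grid.
Variables (R : realType) (N m : nat).
Local Notation F0 := ('I_(2 * N) * 'I_(2 * N))%type.

Definition grid_index (f : F0) : int * int := ((f.1 : nat)%:Z - N%:Z, (f.2 : nat)%:Z - N%:Z).

(** [None] codes overflow: with N = L (m + 1) the cells fill the square of half-side L about 0. *)
Definition grid (z : R * R) : option F0 := [pick f : F0 | asbool (cell m (grid_index f) z)].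

Definition grid_point (f : F0) : R[i] :=
  ((grid_index f).1%:~R / m.+1%:R +i* ((grid_index f).2%:~R / m.+1%:R))%C.

Definition grid_val (f : option F0) : R[i] := if f is Some f then grid_point f else 0.

Lemma grid_some f z : grid z = Some f <-> cell m (grid_index f) z.
Proof.
rewrite /grid; case: pickP => [g /asboolP hg|hn]; last first.
  by split=> // h; have := hn f; rewrite asboolT.
split=> [[<-] //|h]; have [/= h1 h2] := h; have [/= h3 h4] := hg.
have e1 : (f.1 : nat)%:Z - N%:Z = (g.1 : nat)%:Z - N%:Z by rewrite -h1 -h3.
have e2 : (f.2 : nat)%:Z - N%:Z = (g.2 : nat)%:Z - N%:Z by rewrite -h2 -h4.
have i1 : f.1 = g.1 by apply: ord_inj; have [] := addIr _ e1.
have i2 : f.2 = g.2 by apply: ord_inj; have [] := addIr _ e2.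
by rewrite [f]surjective_pairing [g]surjective_pairing i1 i2.
Qed.

Lemma measurable_grid_fiber f : measurable [set z | grid z = f].
Proof.
have mS g : measurable [set z | grid z = Some g].
  rewrite (_ : [set z | _] = cell m (grid_index g)); first exact: measurable_cell.
  by apply/seteqP; split => z /= /grid_some.
case: f => [g|]; first exact: mS.
rewrite (_ : [set z | _] = ~` (\bigcup_(g in [set: F0]) [set z | grid z = Some g])).
  apply: measurableC; apply: fin_bigcup_measurable; first exact: finite_finset.
  by move=> g _; exact: mS.
apply/seteqP; split => z /=; first by move=> e [g _ /=]; rewrite e.
by case e: (grid z) => [g|] // h; exfalso; apply: h; exists g.
Qed.

Lemma grid_val_close f (z : R[i]) : grid (cpair z) = Some f ->
  sqn (z - grid_val (Some f)) <= 2 / m.+1%:R ^+ 2.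
Proof.
move=> /grid_some h; apply: (cell_close h).
by split; rewrite /= divfK ?pnatr_eq0 // intrKfloor.
Qed.

Lemma grid_none (L : nat) (z : R[i]) : N = (L * m.+1)%N -> grid (cpair z) = None ->
  L%:R ^+ 2 <= sqn z.
Proof.
move=> NE hz; rewrite leNgt; apply/negP => hL.
have mp : 0 < m.+1%:R :> R by rewrite ltr0n.
have idx (y : R) : y ^+ 2 < L%:R ^+ 2 ->
   exists a : 'I_(2 * N), Num.floor (y * m.+1%:R) = (a : nat)%:Z - N%:Z.
  move=> hy; have yL : `|y| < L%:R.
    by rewrite -(ltr_pXn2r (n := 2)) ?nnegrE // real_normK ?num_real.
  have := yL; rewrite ltr_norml => /andP[y1 y2].
  have NR : N%:R = L%:R * m.+1%:R :> R by rewrite NE natrM.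
  have h1 : - N%:Z <= Num.floor (y * m.+1%:R).
    by rewrite floor_ge_int intrN /= -[(N%:Z)%:~R]/(N%:R) NR -mulNr ler_pM2r // ltW.
  have h2 : Num.floor (y * m.+1%:R) < N%:Z.
    by rewrite floor_lt_int -[(N%:Z)%:~R]/(N%:R) NR ltr_pM2r.
  move: h1 h2; move: (Num.floor _) => k h1 h2.
  have h3 : (absz (k + N%:Z)%R < 2 * N)%N by move: h1 h2; clear; lia.
  by exists (Ordinal h3) => /=; move: h1 h2; clear; lia.
have z1 : (complex.Re z) ^+ 2 < L%:R ^+ 2 by apply: le_lt_trans hL; rewrite lerDl sqr_ge0.
have z2 : (complex.Im z) ^+ 2 < L%:R ^+ 2 by apply: le_lt_trans hL; rewrite lerDr sqr_ge0.
have [a ha] := idx _ z1; have [b hb] := idx _ z2.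
have : grid (cpair z) = Some (a, b) by apply/grid_some; split.
by rewrite hz.
Qed.
End Grid.

Section RealArithmetic.
Variable R : realType.

Lemma arith_big (u v x t : R) : 4 * u < v -> v <= 2 * x + 2 * t -> t <= u -> u <= x.
Proof. lra. Qed.

Lemma arith_half (t : R) : 64 * (64 * t) <= 1 -> 0 < t -> 2 * t <= 1.
Proof. lra. Qed.

Lemma arith_near (u x y t : R) : 4 * t <= u -> x < t -> y <= t -> 2 * y + 2 * x <= u.
Proof. lra. Qed.

Lemma arith_eighth (u v : R) : 64 * (64 * v) <= 1 -> u <= v -> 0 < u -> 8 * u <= 1.
Proof. lra. Qed.

Lemma arith_far (u x y : R) : x <= u -> y <= u -> 2 * x + 2 * y <= 4 * u.
Proof. lra. Qed.

Lemma arith_row (q a b e l t be : R) : l <= q / 4 -> b <= 16 * t -> a <= 1 - q + l ->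
  1 + - 1 * be <= e + (a + b) -> q - q / 4 - 16 * t - be <= e.
Proof. lra. Qed.

Lemma arith_total (q tau t b : R) : 64 * tau <= q -> 64 * t <= tau -> 0 < tau -> b <= 16 * t ->
  tau <= q - q / 4 - 16 * t + - 1 * b.
Proof. lra. Qed.

Lemma arith_q (k : R) : 1 <= k -> 1 <= 64 * k.
Proof. lra. Qed.

Lemma arith_indic (x u v : R) : 0 <= x -> 0 <= u -> 0 <= v -> 1 + - 1 * u <= x + (1 + v).
Proof. lra. Qed.
End RealArithmetic.

Section GridLaw.
Variables (R : realType) (d : measure_display) (T : measurableType d) (P : probability T R).
Variable xi : T -> R[i].
Hypothesis mxi : cmeasurable xi.
Hypothesis mean0 : cmean P xi = 0.
Hypothesis var1 : cvar P xi = 1%E.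
Variables (L m : nat).
Hypothesis L0 : (0 < L)%N.
Local Notation N := (L * m.+1)%N.
Local Notation F := (option ('I_(2 * N) * 'I_(2 * N))).
Local Notation p := (code_law (@grid R N m) P xi).

Lemma fdist_grid_law : fdist p.
Proof. exact: (fdist_code_law (@measurable_grid_fiber R N m) P mxi). Qed.

Lemma Pr_grid_le (E : F -> Prop) (A : set T) : measurable A ->
  (forall w, E (grid N m (cpair (xi w))) -> A w) -> Pr p E <= fine (P A).
Proof.
move=> mA h; rewrite -lee_fin fineK ?fin_num_measure // (Pr_code_law (@measurable_grid_fiber R N m) P mxi).
apply: le_measure; rewrite ?inE //.
rewrite (_ : [set w | _] = \bigcup_(f in [set f | E f]) [set w | grid N m (cpair (xi w)) = f]).
  apply: fin_bigcup_measurable; first exact: finite_finset.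
  by move=> f _; exact: (measurable_code (@measurable_grid_fiber R N m) mxi).
by apply/seteqP; split => w /= => [hw|[f hf ->] //]; exists (grid N m (cpair (xi w))).
Qed.

Lemma measurable_sqn_ge (a : R) : measurable [set w | a <= sqn (xi w)].
Proof.
have := measurable_sqn mxi measurableT (measurable_itv `[a, +oo[%R); rewrite setTI.
by congr measurable; apply/seteqP; split=> w /=; rewrite in_itv /= andbT.
Qed.

Lemma grid_tail : Pr p (fun f => f = None) <= L%:R ^- 2.
Proof.
have Lp : 0 < L%:R ^+ 2 :> R by rewrite exprn_gt0 // ltr0n.
apply: le_trans (sqn_tail mxi mean0 var1 (measurable_sqn_ge (L%:R ^+ 2)) Lp _) => //.
by apply: Pr_grid_le => [|w]; [exact: measurable_sqn_ge|exact: grid_none].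
Qed.

Variables (kappa tau : R).
Hypothesis kappa1 : 1 <= kappa.
Hypothesis spr : spread P kappa xi.
Hypothesis tau0 : 0 < tau.
Hypothesis tauk : 64 * (64 * tau) * kappa ^+ 3 <= 1.
Hypothesis mtau : 2 / m.+1%:R ^+ 2 <= tau ^+ 2.
Hypothesis Lk : 256 * kappa ^+ 3 <= L%:R ^+ 2.
Local Notation gv := (@grid_val R N m).

Lemma grid_big : Pr p (fun f => 1 / (4 * tau ^+ 2) < sqn (gv f)) <= 16 * tau ^+ 2.
Proof.
have t2 : 0 < tau ^+ 2 by rewrite exprn_gt0.
have a0 : 0 < 1 / (16 * tau ^+ 2) by rewrite divr_gt0 // mulr_gt0.
have k3 : 1 <= kappa ^+ 3 by exact: exprn_ege1.
have t1 : 64 * (64 * tau) <= 1.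
  by apply: le_trans tauk; rewrite ler_peMr //; do 2! apply: mulr_ge0 => //; exact: ltW.
have -> : 16 * tau ^+ 2 = (1 / (16 * tau ^+ 2))^-1 by rewrite div1r invrK.
apply: le_trans (sqn_tail mxi mean0 var1 (measurable_sqn_ge (1 / (16 * tau ^+ 2))) a0 (fun w h => h)).
apply: Pr_grid_le => [|w]; first exact: measurable_sqn_ge.
case e: (grid _ _ _) => [f|] /=; last first.
  have : 0 <= 1 / (4 * tau ^+ 2) by rewrite divr_ge0 // mulr_ge0 // ltW.
  by rewrite sqn0 leNgt => /negbTE ->.
move=> h; have c := grid_val_close e; rewrite /= in c.
have h1 : sqn (grid_point R m f) <= 2 * sqn (xi w) + 2 * tau ^+ 2.
  rewrite [X in sqn X <= _](_ : _ = xi w + (grid_point R m f - xi w)); last by rewrite addrC subrK.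
  apply: le_trans (sqnD_le _ _) _.
  by rewrite lerD2l ler_pM2l // -[sqn _]sqnN opprB; apply: le_trans c mtau.
have h2 : tau ^+ 2 <= 1 / (16 * tau ^+ 2).
  rewrite ler_pdivlMr ?mulr_gt0 //; have t11 : 2 * tau <= 1 by exact: arith_half.
  rewrite [leLHS](_ : _ = (2 * tau) ^+ 4); last by ring.
  by apply: exprn_ile1 => //; rewrite mulr_ge0 // ltW.
have h3 : 1 / (4 * tau ^+ 2) = 4 * (1 / (16 * tau ^+ 2)) by field; exact: lt0r_neq0.
by rewrite h3 in h; exact: arith_big h h1 h2.
Qed.

Lemma grid_near f : Pr p (fun g => sqn (gv f - gv g) < tau ^+ 2) <=
  1 - 1 / (64 * kappa ^+ 3) + L%:R ^- 2.
Proof.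
have k0 : 0 < kappa by apply: lt_le_trans kappa1.
have k2 : 1 <= kappa ^+ 2 by exact: exprn_ege1.
have fp := fdist_grid_law.
apply: (@le_trans _ _ (Pr p (fun g => (sqn (gv f - gv g) < tau ^+ 2 /\ g <> None) \/ g = None))).
  apply: Pr_sub => // g h; have [->|gn] := pselect (g = None); [by right|by left].
apply: le_trans; first exact: Pr_or.
apply: lerD; last exact: grid_tail.
apply: le_trans (levy_concentration mxi mean0 var1 kappa1 spr (gv f)).
apply: Pr_grid_le => [|w]; first exact: measurable_near.
case e: (grid _ _ _) => [g|] /=; last by case.
move=> [h _]; have c := grid_val_close e; rewrite /disc_event /=.
rewrite -(subrK (gv (Some g)) (xi w)) -addrA; apply: le_trans (sqnD_le _ _) _.
rewrite -(sqnN (gv (Some g) - gv f)) opprB.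
have h1 : 4 * tau ^+ 2 <= 1 / (16 * kappa ^+ 2).
  rewrite ler_pdivlMr ?mulr_gt0 ?exprn_gt0 // [leLHS](_ : _ = (8 * tau * kappa) ^+ 2); last by ring.
  apply: exprn_ile1; first by rewrite !mulr_ge0 // ltW.
  have : tau * kappa <= tau * kappa ^+ 3 by rewrite ler_pM2l // ler_eXnr.
  have : 0 < tau * kappa by rewrite mulr_gt0.
  have := tauk; rewrite -!mulrA => h0 h1 h2; exact: arith_eighth h0 h2 h1.
have c' := le_trans c mtau.
exact: arith_near h1 h c'.
Qed.

(** For f not large, a partner g fails only by being near f, with probability at most 1 - q + q/4,
    where q = 1/(64 kappa^3), or by being large, with probability at most 16 tau^2. Averaging over f
    costs 16 tau^2 more, and q >= 64 tau leaves at least tau. *)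
Lemma grid_spread : tau <= Ex (pairw p) (fun z => (spread_pair gv tau z)%:R).
Proof.
have k0 : 0 < kappa by apply: lt_le_trans kappa1.
have k3 : 1 <= kappa ^+ 3 by exact: exprn_ege1.
have k30 : 0 < kappa ^+ 3 by apply: lt_le_trans k3.
have fp := fdist_grid_law; have t2 : 0 < tau ^+ 2 by rewrite exprn_gt0.
pose q : R := 1 / (64 * kappa ^+ 3).
pose big f := 1 / (4 * tau ^+ 2) < sqn (gv f).
have k64 : 0 < 64 * kappa ^+ 3 by rewrite mulr_gt0.
have tq : 64 * tau <= q.
  rewrite /q ler_pdivlMr //; have := tauk; congr (_ <= _); ring.
have q1 : q <= 1.
  by rewrite /q ler_pdivrMr // mul1r; exact: arith_q.
have Lq : L%:R ^- 2 <= q / 4.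
  have -> : q / 4 = (256 * kappa ^+ 3)^-1 by rewrite /q; field; exact: lt0r_neq0.
  by rewrite lef_pV2 ?posrE ?mulr_gt0 ?exprn_gt0 ?ltr0n.
have one f : q - q / 4 - 16 * tau ^+ 2 - (big f)%:R <= Ex p (fun g => (spread_pair gv tau (f, g))%:R).
  have h1 : Ex p (fun g => 1 + - 1 * (big f)%:R) <= Ex p (fun g => (spread_pair gv tau (f, g))%:R +
      ((asbool (sqn (gv f - gv g) < tau ^+ 2))%:R + (asbool (big g))%:R)).
    apply: Ex_le => // g; rewrite /spread_pair /=.
    case: asboolP => [_|/negP].
      exact: arith_indic.
    rewrite -leNgt => h; rewrite h /= add0r.
    have [bf|bf] := boolP (big f).
      by rewrite mulr1 subrr addr_ge0.
    case: asboolP => [_|/negP bg]; first by rewrite mulr0 addr0 lerDr.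
    rewrite /big -!leNgt in bf bg.
    have -> : sqn (gv f - gv g) <= tau ^- 2; last by rewrite mulr0 !addr0.
    apply: le_trans (sqnD_le _ _) _; rewrite sqnN.
    have -> : tau ^- 2 = 4 * (1 / (4 * tau ^+ 2)) by field; exact: lt0r_neq0.
    exact: arith_far.
  move: h1; rewrite Ex_cst // !Ex_add -/(Pr p (fun g => sqn (gv f - gv g) < tau ^+ 2)) -/(Pr p big).
  exact: (arith_row Lq grid_big (grid_near f)).
have -> : Ex (pairw p) (fun z => (spread_pair gv tau z)%:R) =
   Ex p (fun f => Ex p (fun g => (spread_pair gv tau (f, g))%:R)).
  rewrite /Ex /pairw; under [RHS]eq_bigr do rewrite mulr_sumr.
  by rewrite pair_big /=; apply: eq_bigr => -[f g] _ /=; rewrite mulrA.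
have h2 : Ex p (fun f => (q - q / 4 - 16 * tau ^+ 2) + - 1 * (asbool (big f))%:R) <=
   Ex p (fun f => Ex p (fun g => (spread_pair gv tau (f, g))%:R)).
  apply: Ex_le => // f; apply: le_trans (one f); rewrite mulN1r.
  by case: asboolP => [->|/negP/negbTE ->].
apply: le_trans h2; rewrite Ex_add Ex_cst // Ex_scale -/(Pr p big).
have t64 : 64 * tau ^+ 2 <= tau.
  rewrite expr2 mulrA ler_piMl ?(ltW tau0) //; exact: le_trans tq q1.
exact: (arith_total tq t64 tau0 grid_big).
Qed.
End GridLaw.

(** * Conclusion *)

Lemma pow_le_exp (R : realType) (y D : R) (m : nat) : (0 < m)%N -> 0 < D -> 0 <= y ->
  y ^+ m <= (m%:R / D) ^+ m * expR (D * y).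
Proof.
move=> m0 D0 y0; have mR : 0 < m%:R :> R by rewrite ltr0n.
have -> : D * y = m%:R * (D * y / m%:R) by field; rewrite gt_eqF.
rewrite expRM_natl -exprMn; apply: lerXn2r; rewrite ?nnegrE //.
  by rewrite mulr_ge0 ?divr_ge0 ?expR_ge0 // ltW.
apply: le_trans (_ : m%:R / D * (1 + D * y / m%:R) <= _).
  rewrite mulrDr mulr1 (_ : _ * (D * y / _) = y); last by field; rewrite !gt_eqF.
  by rewrite lerDr divr_ge0 // ltW.
by rewrite ler_wpM2l ?expR_ge1Dx // divr_ge0 // ltW.
Qed.

Lemma linear_le_pow (R : realType) (B D s : R) : 0 < D -> 0 < s -> 0 <= B ->
  exists C : R, forall y : R, 1 <= y -> B * y <= D * (y * y `^ s) + C.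
Proof.
move=> D0 s0 B0; exists (B * (B / D) `^ s^-1) => y y1.
have y0 : 0 <= y by apply: le_trans y1.
have [h|h] := leP (B / D) (y `^ s).
  apply: (@le_trans _ _ (D * (y * y `^ s))); last by rewrite lerDl mulr_ge0 ?powR_ge0.
  have : B <= D * y `^ s by rewrite mulrC -ler_pdivrMr.
  by move=> h1; rewrite mulrCA mulrC ler_wpM2l.
apply: (@le_trans _ _ (B * (B / D) `^ s^-1)); last first.
  by rewrite lerDr mulr_ge0 ?(ltW D0) // mulr_ge0 ?powR_ge0.
rewrite ler_wpM2l //.
have -> : y = (y `^ s) `^ s^-1 by rewrite -powRrM divff ?gt_eqF // powRr1.
by apply: ge0_ler_powR; rewrite ?invr_ge0 ?nnegrE ?powR_ge0 ?(ltW s0) ?divr_ge0 ?(ltW D0) // ltW.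
Qed.

(** The n^2 of the union bounds is absorbed by giving up part of the exponent. This is why k starts
    at n^(2 eps) whereas the final rate is n^eps. *)
Lemma poly_exp_decay (R : realType) (eps a B : R) : 0 < eps < 1 -> 0 < a -> 0 < B ->
  exists K : R, 0 < K /\ forall n : nat, (0 < n)%N ->
    n%:R ^+ 2 * expR (- (a * n%:R)) <= K * expR (- B * n%:R `^ eps) /\
    n%:R ^+ 2 * expR (- (2 * B * n%:R `^ (2 * eps))) <= K * expR (- B * n%:R `^ eps).
Proof.
move=> /andP[e0 e1] a0 B0.
have [m [hm _]] := natr_between (divr_gt0 (ltr0n R 2) e0).
have m0 : (0 < m)%N by rewrite -(ltr_nat R); apply: lt_le_trans hm; rewrite divr_gt0.
have s0 : 0 < eps^-1 - 1 by rewrite subr_gt0 invf_gt1.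
have B2 : 0 <= B + B by rewrite addr_ge0 // ltW.
have [C1 hC1] := linear_le_pow a0 s0 B2.
pose Km := (m%:R / B) ^+ m.
have Km0 : 0 < Km by rewrite exprn_gt0 // divr_gt0 // ltr0n.
exists (Km * expR C1 + Km); split; first by rewrite addr_gt0 // mulr_gt0 // expR_gt0.
move=> n n0; have n1 : 1 <= n%:R :> R by rewrite ler1n.
have nn : 0 <= n%:R :> R by [].
set y := n%:R `^ eps.
have y1 : 1 <= y by rewrite -(powRr0 n%:R); apply: ler_powR => //; exact: ltW.
have y0 : 0 <= y by apply: le_trans y1.
have ny : n%:R = y * y `^ (eps^-1 - 1).
  rewrite -{1}(powRr1 y0) -powRD; last first.
    by apply/implyP => _; rewrite gt_eqF // (lt_le_trans _ y1).
  by rewrite addrC subrK -powRrM divff ?gt_eqF // powRr1.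
have n2 : n%:R ^+ 2 <= Km * expR (B * y).
  apply: le_trans (pow_le_exp m0 B0 y0); rewrite -!powR_mulrn // -powRrM.
  apply: ler_powR => //; rewrite mulrC -ler_pdivrMr //.
have y2 : n%:R `^ (2 * eps) = y ^+ 2 by rewrite mulrC powRrM powR_mulrn.
have k1 : Km * expR C1 * expR (- B * y) <= (Km * expR C1 + Km) * expR (- B * y).
  by rewrite ler_wpM2r ?expR_ge0 // lerDl ltW.
have k2 : Km * expR (- B * y) <= (Km * expR C1 + Km) * expR (- B * y).
  by rewrite ler_wpM2r ?expR_ge0 // lerDr mulr_ge0 ?expR_ge0 // ltW.
split.
  apply: le_trans k1; apply: le_trans (_ : Km * expR (B * y) * expR (- (a * n%:R)) <= _).
    by rewrite ler_wpM2r ?expR_ge0.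
  rewrite -!mulrA ler_pM2l // -!expRD ler_expR.
  by have := hC1 y y1; rewrite -ny; clear; lra.
apply: le_trans k2; apply: le_trans (_ : Km * expR (B * y) * expR (- (2 * B * n%:R `^ (2 * eps))) <= _).
  by rewrite ler_wpM2r ?expR_ge0.
rewrite -!mulrA ler_pM2l // -!expRD ler_expR y2.
have : B * y <= B * y ^+ 2 by rewrite ler_pM2l // expr2 ler_peMr.
by clear; lra.
Qed.

Lemma powR_eventually (R : realType) (s : R) (k : nat) : 0 < s ->
  exists n2 : nat, forall n : nat, (n2 <= n)%N -> (0 < n)%N -> k%:R <= n%:R `^ s.
Proof.
move=> s0; have p : 0 < k%:R `^ s^-1 + 1 :> R by rewrite ltr_wpDl ?powR_ge0.
have [n2 [h _]] := natr_between p; exists n2 => n hn n0.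
have -> : k%:R = (k%:R `^ s^-1) `^ s :> R by rewrite -powRrM mulVf ?gt_eqF // powRr1.
apply: ge0_ler_powR; rewrite ?nnegrE ?powR_ge0 ?(ltW s0) //.
apply: le_trans (_ : n2%:R <= _); last by rewrite ler_nat.
by apply: le_trans h; rewrite lerDl.
Qed.

Lemma left_small_perturb (R : realType) n k (M M' : 'M[R[i]]_n) t eta :
  entry_close M M' eta -> left_small k M t -> left_small k M' (2 * t + 2 * (n%:R ^+ 2 * eta)).
Proof.
move=> /entry_close_nrm2 h [Y [iY hY]]; exists Y; split=> // g.
have -> : (Y *m g)^T *m M' = (Y *m g)^T *m M + (Y *m g)^T *m (M' - M).
  by rewrite -mulmxDr addrCA subrr addr0.
apply: le_trans (nrm2D_le _ _) _; rewrite [leRHS]mulrDl; apply: lerD.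
  by rewrite -mulrA ler_pM2l.
rewrite -mulrA ler_pM2l //; apply: le_trans (nrm2_mul _ _) _; rewrite nrm2_tr iY mulrC.
by rewrite ler_wpM2r ?nrm2_ge0.
Qed.

Lemma left_small_mono (R : realType) n k (M : 'M[R[i]]_n) t t' :
  t <= t' -> left_small k M t -> left_small k M t'.
Proof.
move=> tt [Y [iY hY]]; exists Y; split=> // g.
by apply: le_trans (hY g) _; rewrite ler_wpM2r ?nrm2_ge0.
Qed.

Lemma measurable_singular_event (R : realType) d (T : measurableType d) n (S : 'M[R]_n) Z
    (X : T -> 'M[R[i]]_n) (a1 a2 K0 e : R) : (0 < n)%N -> a1 < 1 -> 0 < a2 -> 0 <= K0 -> 0 < e ->
  (forall i j, 0 <= S i j <= 1) -> (forall i j, cmeasurable (fun w => X w i j)) ->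
  measurable [set w | exists k : nat, [/\ n%:R `^ e <= k%:R, k%:R <= a1 * n%:R,
          singular_value (structured S (X w) Z) (n - k) < a2 * (k%:R / Num.sqrt n%:R)
        & opnorm (structured S (X w) Z) <= K0 * Num.sqrt n%:R]].
Proof.
move=> n0 a11 a20 K00 e0 hS mX.
have nR : 0 < n%:R :> R by rewrite ltr0n.
have sn : 0 < Num.sqrt n%:R :> R by rewrite sqrtr_gt0.
pose E k : set T := if pselect (n%:R `^ e <= k%:R /\ k%:R <= a1 * n%:R) then
  [set w | singular_value (structured S (X w) Z) (n - k) < a2 * (k%:R / Num.sqrt n%:R)] `&`
  ~` [set w | ~ opnorm (structured S (X w) Z) <= K0 * Num.sqrt n%:R] else set0.
rewrite (_ : [set w | _] = \bigcup_k E k); last first.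
  apply/seteqP; split => w /= => [[k [h1 h2 h3 h4]]|[k _]].
    exists k => //; rewrite /E; case: pselect => [hk|hk]; last by case: hk.
    by split => //= h; apply: h.
  rewrite /E; case: pselect => // -[h1 h2] [h3 h4]; exists k; split=> //.
  exact: contrapT.
apply: bigcupT_measurable => k; rewrite /E; case: pselect => [[h1 h2]|_] /=; last exact: measurable0.
have kn : (k < n)%N.
  by rewrite -(ltr_nat R); apply: le_lt_trans h2 _; rewrite gtr_pMl.
have k0 : 0 < k%:R :> R by apply: lt_le_trans h1; rewrite powR_gt0.
apply: measurableI.
  apply: (@measurable_entry_open R d T n S Z X hS mX (fun M => singular_value M (n - k) < _)).
  by apply: singular_value_open => //; rewrite mulr_gt0 ?divr_gt0.
apply: measurableC; apply: (@measurable_entry_open R d T n S Z X hS mX (fun M => ~ opnorm M <= _)).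
by apply: opnorm_open; rewrite mulr_ge0 // ltW.
Qed.

Lemma structured_admissible (R : realType) (sigma0 delta nu tau : R) (F : finType) (p : F -> R)
    (val : F -> R[i]) n (S : 'M[R]_n) :
  broadly_connected sigma0 delta nu S -> 0 < sigma0 -> tau <= sigma0 -> fdist p ->
  tau <= Ex (pairw p) (fun z => (spread_pair val tau z)%:R) ->
  admissible delta nu tau p val S (nbhd (threshold sigma0 S)) /\
  forall i, delta * n%:R <= #|nbhd (threshold sigma0 S) i|%:R.
Proof.
move=> [hS hrow hcol hexp] s0 ts fp law; split=> //; split; split=> //.
- move=> i j; rewrite inE mxE; case: ifP => [h _|_]; [exact: le_trans ts h|by rewrite ltxx].
- move=> j; apply: le_trans (hcol j) _; rewrite ler_nat; apply: subset_leq_card.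
  by apply/fintype.subsetP => i; rewrite !inE mxE.
Qed.

Lemma finite_bad_event (R : realType) (delta nu tau g a C : R) (F : finType) (p : F -> R)
    (val : F -> R[i]) n (S : 'M[R]_n) Z N (y : R) :
  0 < g -> g < 1 -> 0 <= C -> admissible delta nu tau p val S N ->
  (forall k : nat, y <= k%:R -> k%:R <= g / 2 * n%:R ->
     Pr (@matrix_law R F p n) (fun x => bounded val tau S Z x /\
       left_small k.+1 (model_mx val S Z x) (g * (k%:R ^+ 2 / n%:R)))
     <= n%:R * (C * expR (- a) + expR (- (g * k%:R)))) ->
  Pr (@matrix_law R F p n) (fun x => bounded val tau S Z x /\ exists k : nat,
    [/\ y <= k%:R, k%:R <= g / 2 * n%:R
      & left_small k.+1 (model_mx val S Z x) (g * (k%:R ^+ 2 / n%:R))]) <=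
  n%:R ^+ 2 * (C * expR (- a) + expR (- (g * y))).
Proof.
move=> g0 g1 C0 [[fp _ _] _] h; set D := C * _ + _.
have D0 : 0 <= D by rewrite addr_ge0 ?mulr_ge0 ?expR_ge0.
have fW : fdist (@matrix_law R F p n) by exact: fdist_matrix_law.
pose Q (k : 'I_n) := (y <= k%:R) && (k%:R <= g / 2 * n%:R).
apply: (@le_trans _ _ (Pr (@matrix_law R F p n) (fun x => exists2 k : 'I_n, Q k & bounded val tau S Z x /\
    left_small k.+1 (model_mx val S Z x) (g * (k%:R ^+ 2 / n%:R))))).
  apply: Pr_sub => // x [hb [k [h1 h2 h3]]].
  have kn : (k < n)%N.
    (* For n = 0, a frame with k + 1 columns would have mass k + 1 and no rows. *)
    rewrite -(ltr_nat R); case: (posnP n) => [n0|n0].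
      exfalso; case: h3 => Y [iY _]; have := isometric_nrm2 iY.
      by rewrite /nrm2; move: Y iY; rewrite n0 => Y _; rewrite big_ord0 => /esym/eqP; rewrite pnatr_eq0.
    apply: le_lt_trans h2 _; rewrite gtr_pMl ?ltr0n //; move: g1; clear; lra.
  by exists (Ordinal kn); rewrite /Q /= ?h1.
apply: (@le_trans _ _ (#|Q|%:R * (n%:R * D))); last first.
  rewrite expr2 -mulrA ler_wpM2r ?mulr_ge0 // ler_nat -[leqRHS]card_ord; exact: max_card.
apply: Pr_bigcup => // k /andP[h1 h2]; apply: le_trans (h k h1 h2) _.
by rewrite ler_wpM2l // lerD2l ler_expR lerN2 ler_pM2l.
Qed.

Lemma discretized_bad (R : realType) (sigma0 kappa K0 delta nu tau g B e : R) n (d d' : measure_display)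
    (T : measurableType d) (T' : measurableType d') (P : probability T R) (P' : probability T' R)
    (xi : T' -> R[i]) (S : 'M[R]_n) (Z : 'M[R[i]]_n) (X : T -> 'M[R[i]]_n) :
  (0 < n)%N -> 0 < sigma0 -> 1 <= kappa -> 1 <= K0 -> 0 < tau -> tau <= sigma0 ->
  64 * (64 * tau) * kappa ^+ 3 <= 1 -> 2 * (K0 * tau) <= 1 -> 0 < g -> g < 1 -> 0 < e ->
  cmeasurable xi -> spread P' kappa xi -> cmean P' xi = 0 -> cvar P' xi = 1%E ->
  broadly_connected sigma0 delta nu S ->
  (forall i j, cmeasurable (fun w => X w i j)) ->
  (forall i j, same_law P P' (fun w => X w i j) xi) ->
  cindependent P (fun (ij : 'I_n * 'I_n) w => X w ij.1 ij.2) ->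
  (forall (F : finType) (p : F -> R) (val : F -> R[i]) N, admissible delta nu tau p val S N ->
     (forall i, delta * n%:R <= #|N i|%:R) ->
     Pr (@matrix_law R F p n) (fun x => bounded val tau S Z x /\ exists k : nat,
       [/\ n%:R `^ e <= k%:R, k%:R <= g / 2 * n%:R
         & left_small k.+1 (model_mx val S Z x) (g * (k%:R ^+ 2 / n%:R))]) <= B) ->
  let bad : set T := [set w | exists k : nat, [/\ n%:R `^ e <= k%:R, k%:R <= (g / 2) * n%:R,
          singular_value (structured S (X w) Z) (n - k) < (g / 2) * (k%:R / Num.sqrt n%:R)
        & opnorm (structured S (X w) Z) <= K0 * Num.sqrt n%:R]] in
  (P bad <= (B + n%:R ^+ 2 * expR (- n%:R))%:E)%E.
Proof.
move=> n0 s0 k1 K1 t0 ts tk Kt g0 g1 e0 mxi spr mean0 var1 bc mX lawX indX hB; cbv zeta; set bad := (X in (P X <= _)%E).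
have nR : 0 < n%:R :> R by rewrite ltr0n.
have n1 : 1 <= n%:R :> R by rewrite ler1n.
have hS : forall i j, 0 <= S i j <= 1 by case: bc.
have g20 : 0 < g / 2 by rewrite divr_gt0.
have g21 : g / 2 < 1 by move: g0 g1; clear; lra.
(* The mesh must respect the spread scale [tau] and move the singular value bound, at its smallest
   of order g / n for squares, by a fraction only. *)
pose zeta := Num.min (tau ^+ 2) (g / (4 * n%:R ^+ 3)).
have z0 : 0 < zeta by rewrite lt_min exprn_gt0 // divr_gt0 // mulr_gt0 // exprn_gt0.
pose m := Num.truncn (2 / zeta).
have hm : 2 / m.+1%:R ^+ 2 <= zeta.
  have m1 : 2 / zeta < m.+1%:R by have /andP[] := truncn_itv (divr_ge0 (ler0n R 2) (ltW z0)).
  rewrite ler_pdivrMr ?exprn_gt0 ?ltr0n // mulrC -ler_pdivrMr //.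
  by apply: le_trans (ltW m1) _; rewrite expr2 ler_peMr // ler1n.
have k00 : 0 < kappa by apply: lt_le_trans k1.
have k30 : 0 < 256 * kappa ^+ 3 by apply: mulr_gt0; [rewrite ltr0n|exact: exprn_gt0].
(* By Chebyshev an entry overflows with probability at most L^(-2) <= exp(-n); the other summand is
   the requirement of [grid_spread]. *)
have [L [hL _]] := natr_between (addr_gt0 k30 (expR_gt0 n%:R)).
have L1 : expR n%:R <= L%:R :> R by apply: le_trans hL; rewrite lerDr ltW.
have L2 : 256 * kappa ^+ 3 <= L%:R by apply: le_trans hL; rewrite lerDl expR_ge0.
have L3 : 1 <= L%:R :> R by apply: le_trans L1; rewrite -expR0 ler_expR.
have L0 : (0 < L)%N by rewrite -(ltr_nat R) (lt_le_trans _ L3).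
have LL : L%:R <= L%:R ^+ 2 :> R by rewrite expr2 ler_peMr // (le_trans _ L3).
have mt : 2 / m.+1%:R ^+ 2 <= tau ^+ 2 by apply: le_trans hm _; rewrite ge_min lexx.
have mg : 2 / m.+1%:R ^+ 2 <= g / (4 * n%:R ^+ 3) by apply: le_trans hm _; rewrite ge_min lexx orbT.
pose N := (L * m.+1)%N.
pose p := code_law (@grid R N m) P' xi.
have fp : fdist p by exact: fdist_grid_law.
have law : tau <= Ex (pairw p) (fun z => (spread_pair (@grid_val R N m) tau z)%:R).
  apply: (grid_spread mxi mean0 var1 L0 k1 spr t0 tk mt); exact: le_trans L2 LL.
have [adm hrow] := structured_admissible bc s0 ts fp law.
have tail : Pr p (fun f => f = None) <= expR (- n%:R).
  apply: le_trans; first exact: grid_tail.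
  rewrite expRN lef_pV2 ?posrE ?expR_gt0 ?exprn_gt0 ?ltr0n //; exact: le_trans L1 LL.
have hBp := hB _ p (@grid_val R N m) _ adm hrow.
have mbad := measurable_singular_event (K0 := K0) Z n0 g21 g20 (le_trans ler01 K1) e0 hS mX.
apply: le_trans (mcode_bound (@measurable_grid_fiber R N m) mxi mX lawX indX mbad _ tail) _; last first.
  by rewrite lee_fin mulrA -expr2 lerD2r; exact: hBp.
move=> w [k [h1 h2 h3 h4]].
have [[i [j hij]]|hno] := pselect (exists i j, grid N m (cpair (X w i j)) = None).
  by left; exists i, j.
right; set x := mcode _ _ w; set M := structured S (X w) Z in h3 h4.
set eta := 2 / m.+1%:R ^+ 2 in mt mg.
have close : entry_close M (model_mx (@grid_val R N m) S Z x) eta.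
  have -> : model_mx (@grid_val R N m) S Z x =
     structured S (\matrix_(i, j) grid_val R m (grid N m (cpair (X w i j)))) Z.
    by apply/matrixP => i j; rewrite !mxE !ffunE.
  apply: structured_close => // i j; rewrite mxE -sqnN opprB.
  case E : (grid N m (cpair (X w i j))) => [f|]; last by exfalso; apply: hno; exists i, j.
  exact: grid_val_close E.
have eta0 : 0 <= eta by rewrite divr_ge0 // exprn_ge0.
have kR : 1 <= k%:R :> R.
  apply: le_trans h1; rewrite -[X in X <= _](powRr0 n%:R); apply: ler_powR => //; exact: ltW.
have neta : n%:R ^+ 2 * eta <= g / (4 * n%:R).
  apply: (@le_trans _ _ (n%:R ^+ 2 * (g / (4 * n%:R ^+ 3)))).
    by rewrite ler_wpM2l ?exprn_ge0 // ltW.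
  by rewrite le_eqVlt; apply/orP; left; apply/eqP; field; rewrite gt_eqF.
have sqn2 : Num.sqrt n%:R ^+ 2 = n%:R :> R by rewrite sqr_sqrtr // ltW.
split.
  (* Twice the operator bound plus the rounding error is at most 4 K0^2 n, and 2 K0 tau <= 1 turns
     this into n / tau^2. *)
  move=> v; apply: le_trans (perturb_le v ltr01 close) _.
  have hK : nrm2 (M *m v) <= K0 ^+ 2 * n%:R * nrm2 v.
    rewrite -sqn2 -exprMn; apply: (opnorm_le M _).1 => //.
    by rewrite mulr_ge0 ?sqrtr_ge0 // (le_trans _ K1).
  have hn : n%:R ^+ 2 * eta <= n%:R.
    apply: le_trans neta _; rewrite ler_pdivrMr ?mulr_gt0 //.
    have : 1 <= n%:R * (4 * n%:R) :> R by apply: mulr_ege1 => //; apply: mulr_ege1 => //; rewrite ler1n.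
    by move: g1; clear; lra.
  have hn2 : n%:R ^+ 2 * eta * nrm2 v <= n%:R * nrm2 v by rewrite ler_wpM2r ?nrm2_ge0.
  have K2 : 1 <= K0 ^+ 2 by exact: exprn_ege1.
  have hn3 : n%:R * nrm2 v <= K0 ^+ 2 * (n%:R * nrm2 v).
    by rewrite ler_peMl ?mulr_ge0 ?nrm2_ge0 // ltW.
  have -> : n%:R / tau ^+ 2 * nrm2 v = (n%:R * nrm2 v) / tau ^+ 2 by rewrite mulrAC.
  rewrite ler_pdivlMr ?exprn_gt0 // invr1.
  have K4 : 4 * K0 ^+ 2 * tau ^+ 2 <= 1.
    rewrite [leLHS](_ : _ = (2 * (K0 * tau)) ^+ 2); last by ring.
    by apply: exprn_ile1 => //; do 2! apply: mulr_ge0 => //; [exact: le_trans K1|exact: ltW].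
  rewrite -mulrA in hK; set u := n%:R * nrm2 v in hK hn2 hn3 *.
  have u0 : 0 <= u by rewrite mulr_ge0 ?nrm2_ge0 // ltW.
  apply: (@le_trans _ _ (4 * K0 ^+ 2 * tau ^+ 2 * u)); last by rewrite ler_piMl.
  rewrite [leRHS]mulrAC ler_wpM2r ?exprn_ge0 ?(ltW t0) //.
  move: hK hn2 hn3; rewrite -[4 * _ * u]mulrA.
  by move: (K0 ^+ 2 * u) (nrm2 (M *m v)) (n%:R ^+ 2 * eta * nrm2 v) => a b c; clear; lra.
exists k; split=> //.
have kn : (k < n)%N.
  by rewrite -(ltr_nat R); apply: le_lt_trans h2 _; rewrite gtr_pMl.
have t2 : 0 <= (g / 2) * (k%:R / Num.sqrt n%:R) by rewrite mulr_ge0 ?(ltW g20) // divr_ge0 ?sqrtr_ge0.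
have := left_small_perturb close (left_small_singular kn t2 h3); apply: left_small_mono.
have -> : (g / 2 * (k%:R / Num.sqrt n%:R)) ^+ 2 = (g / 2) ^+ 2 * (k%:R ^+ 2 / n%:R).
  by rewrite exprMn; congr (_ * _); rewrite expr_div_n sqn2.
(* The factor g/2 in the event gives 2 (g/2)^2 r, and rounding adds at most 2 (g/4) r because r >=
   1/n; since g < 1 the total is at most g r. *)
set r := k%:R ^+ 2 / n%:R.
have r0 : n%:R^-1 <= r.
  by rewrite /r -[leLHS]mul1r ler_wpM2r ?invr_ge0 ?(ltW nR) // exprn_ege1.
have e1 : n%:R ^+ 2 * eta <= g / 4 * r.
  apply: le_trans neta _; have -> : g / (4 * n%:R) = g / 4 * n%:R^-1 by field; rewrite gt_eqF.
  by rewrite ler_wpM2l // divr_ge0 // ltW.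
have e2 : g * g * r <= g * r.
  have r00 : 0 <= r by apply: le_trans r0; rewrite invr_ge0 ltW.
  by rewrite -mulrA ler_piMl ?mulr_ge0 ?(ltW g0) // ltW.
rewrite expr_div_n [g ^+ 2]expr2; move: e1 e2; move: (n%:R ^+ 2 * eta) => u.
have -> : g * g / 2 ^+ 2 * r = g * g * r / 4 by field.
have -> : g / 4 * r = g * r / 4 by field.
by move: (g * g * r) (g * r) => a b; clear; lra.
Qed.

(** Polynomial dependence is rendered as a lower bound by a power of sigma0 / (kappa K0), whose
    coefficient and exponent are fixed by [delta] and [nu] before the other parameters. *)
Theorem theorem4p5 (R : realType) (delta nu : R)
    (hdelta : 0 < delta < 1) (hnu : 0 < nu < 1) :
  exists (c : R) (p : nat), 0 < c /\
  forall (sigma0 kappa K0 : R),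
    0 < sigma0 < 1 -> 1 <= kappa -> 1 <= K0 ->
  exists a0 a1 a2 : R,
    [/\ 0 < a0, 0 < a1 & 0 < a2] /\
    [/\ c * (sigma0 / (kappa * K0)) ^+ p <= a0,
        c * (sigma0 / (kappa * K0)) ^+ p <= a1
      & c * (sigma0 / (kappa * K0)) ^+ p <= a2] /\
  forall eps : R, 0 < eps < 1 ->
  exists C : R, 0 < C /\
  forall (n : nat) (d d' : measure_display)
    (T : measurableType d) (T' : measurableType d')
    (P : probability T R) (P' : probability T' R)
    (xi : T' -> R[i]) (S : 'M[R]_n) (Z : 'M[R[i]]_n) (X : T -> 'M[R[i]]_n),
    (0 < n)%N ->
    cmeasurable xi -> spread P' kappa xi -> cmean P' xi = 0 ->
    cvar P' xi = 1%E ->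
    broadly_connected sigma0 delta nu S ->
    (forall i j, cmeasurable (fun w => X w i j)) ->
    (forall i j, same_law P P' (fun w => X w i j) xi) ->
    cindependent P (fun (ij : 'I_n * 'I_n) w => X w ij.1 ij.2) ->
    let bad : set T := [set w | exists k : nat,
      [/\ n%:R `^ (2 * eps) <= k%:R, k%:R <= a1 * n%:R,
          singular_value (structured S (X w) Z) (n - k) <
            a2 * (k%:R / Num.sqrt n%:R)
        & opnorm (structured S (X w) Z) <= K0 * Num.sqrt n%:R]] in
    (P bad <= (C * expR (- a0 * n%:R `^ eps))%:E)%E.
Proof.
have [c [q [/andP[c0 c1] hmain]]] := left_small_bound hdelta hnu.
pose b : R := 64 * 64.
have b0 : 0 < b by rewrite /b mulr_gt0.
have bE : b = 64 * 64 by [].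
have b1 : 1 <= b by rewrite bE; clear; lra.
clearbody b.
exists (c / (4 * b ^+ q)), (3 * q)%N; split; first by rewrite divr_gt0 // mulr_gt0 // exprn_gt0.
move=> sigma0 kappa K0 /andP[s0 s1] k1 K1.
have k0 : 0 < kappa by apply: lt_le_trans k1.
have K00 : 0 < K0 by apply: lt_le_trans K1.
pose w := sigma0 / (kappa * K0).
have w0 : 0 < w by rewrite divr_gt0 // mulr_gt0.
have ws : w <= sigma0.
  by rewrite ler_pdivrMr ?mulr_gt0 // ler_peMr ?(ltW s0) // mulr_ege1.
have wk : w * kappa <= 1.
  rewrite /w (_ : _ * kappa = sigma0 / K0); last by field; rewrite !gt_eqF.
  by rewrite ler_pdivrMr // mul1r; exact: le_trans (ltW s1) K1.
have wK : w * K0 <= 1.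
  rewrite /w (_ : _ * K0 = sigma0 / kappa); last by field; rewrite !gt_eqF.
  by rewrite ler_pdivrMr // mul1r; exact: le_trans (ltW s1) k1.
have w1 : w <= 1 by apply: le_trans ws (ltW s1).
rewrite -/w; clearbody w.
(* As w kappa, w K0 and w / sigma0 are at most 1, this one choice meets 4096 tau kappa^3 <= 1, 2 K0
   tau <= 1 and tau <= sigma0. *)
pose tau := w ^+ 3 / b.
have t0 : 0 < tau by rewrite divr_gt0 // exprn_gt0.
have tb : b * tau = w ^+ 3 by rewrite /tau; field; rewrite gt_eqF.
have tw : b * tau <= w by rewrite tb exprS ler_piMr ?(ltW w0) // exprn_ile1 ?(ltW w0).
have tau_w : tau <= w by apply: le_trans tw; rewrite ler_peMl // ltW.
have tk : 64 * (64 * tau) * kappa ^+ 3 <= 1.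
  have -> : 64 * (64 * tau) * kappa ^+ 3 = (w * kappa) ^+ 3.
    by rewrite exprMn -tb bE; ring.
  by apply: exprn_ile1 => //; rewrite mulr_ge0 // ltW.
have Kt : 2 * (K0 * tau) <= 1.
  apply: le_trans wK; rewrite mulrA mulrAC ler_pM2r //; apply: le_trans tw.
  by rewrite ler_pM2r // bE; clear; lra.
have t1 : tau <= 1 by apply: le_trans tau_w w1.
have t01 : 0 < tau <= 1 by rewrite t0.
pose g := c * tau ^+ q.
have g0 : 0 < g by rewrite mulr_gt0 ?exprn_gt0.
have gE : g = c * tau ^+ q by [].
have g1' : g <= 1.
  by rewrite gE; apply: mulr_ile1; rewrite ?(ltW c0) ?exprn_ge0 ?exprn_ile1 ?(ltW t0).
have [a [C0 [n1 [kk1 [a0 C00 hfin]]]]] := hmain tau t01.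
rewrite -gE in hfin.
(* Halved to be strictly below 1; the witnesses h/2 come from the second halving, in
   [discretized_bad]. *)
pose h := g / 2.
have h0 : 0 < h by rewrite divr_gt0.
have h1 : h < 1 by rewrite /h; move: g1'; clear; lra.
have hE : h = g / 2 by [].
have gc : c / (4 * b ^+ q) * w ^+ (3 * q) = h / 2.
  by rewrite exprM -tb exprMn hE gE; field; rewrite expf_neq0 // gt_eqF.
have hg : h <= g by rewrite hE; move: g0; clear; lra.
clearbody h g.
exists (h / 2), (h / 2), (h / 2).
have h20 : 0 < h / 2 by rewrite divr_gt0.
split; first by split.
split; first by split; rewrite gc.
move=> eps e01; have /andP[e0 e1] := e01.
have ee0 : 0 < 2 * eps by rewrite mulr_gt0.
(* [Ka] absorbs the terms exp(-a n) and exp(-h n^(2 eps)); [Kb] absorbs the overflow term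
   exp(-n). *)
have [Ka [Ka0 hKa]] := poly_exp_decay e01 a0 h20.
have [Kb [Kb0 hKb]] := poly_exp_decay e01 ltr01 h20.
have [n2 hn2] := powR_eventually kk1 ee0.
(* Below this size the bound is trivial: n^eps <= n <= n3, so the summand exp(h n3 / 2) of the
   constant already makes the right side at least 1. *)
pose n3 := (n1 + n2)%N.
exists (C0 * Ka + Ka + Kb + expR (h / 2 * n3%:R)); split.
  by rewrite addr_gt0 ?expR_gt0 // addr_gt0 // ltr_wpDl // mulr_ge0 // ltW.
move=> n d d' T T' P P' xi S Z X n0 mxi spr mean0 var1 bc mX lawX indX; cbv zeta; set bad := (X in (P X <= _)%E).
have hS : forall i j, 0 <= S i j <= 1 by case: bc.
have h21 : h / 2 < 1 by move: h1 h0; clear; lra.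
have mbad : measurable bad := measurable_singular_event Z n0 h21 h20 (ltW K00) ee0 hS mX.
have y0 : 0 <= expR (- (h / 2) * n%:R `^ eps) by exact: expR_ge0.
have ca : 0 <= C0 * Ka + Ka + Kb by rewrite !addr_ge0 ?mulr_ge0 // ltW.
have [nn3|nn3] := ltnP n n3.
  apply: le_trans (probability_le1 P mbad) _; rewrite lee_fin.
  apply: (@le_trans _ _ (expR (h / 2 * n3%:R) * expR (- (h / 2) * n%:R `^ eps))); last first.
    by rewrite ler_wpM2r // lerDr.
  rewrite -expRD -[leLHS]expR0 ler_expR mulNr subr_ge0 ler_pM2l //.
  apply: (@le_trans _ _ n%:R); last by rewrite ler_nat ltnW.
  rewrite -[leRHS]powRr1 //; apply: ler_powR; rewrite ?ler1n //; exact: ltW.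
have n1n : (n1 <= n)%N by move: nn3; rewrite /n3; clear; lia.
have n2n : (n2 <= n)%N by move: nn3; rewrite /n3; clear; lia.
apply: le_trans (discretized_bad (g := h) (tau := tau)
  (B := n%:R ^+ 2 * (C0 * expR (- (a * n%:R)) + expR (- (h * n%:R `^ (2 * eps)))))
  n0 s0 k1 K1 t0 _ tk Kt h0 h1 ee0 mxi spr mean0 var1 bc mX lawX indX _) _.
- exact: le_trans tau_w ws.
- move=> F p val N adm hrow.
  apply: (finite_bad_event h0 h1 C00 adm) => k hk1 hk2.
  have kk : (kk1 <= k)%N by rewrite -(ler_nat R); apply: le_trans hk1; exact: hn2.
  have kg : k%:R <= g * n%:R.
    by apply: le_trans hk2 _; rewrite ler_wpM2r //; move: hg h0; clear; lra.
  have [[fp _ _] _] := adm.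
  apply: (@le_trans _ _ (Pr (@matrix_law R F p n) (fun x => bounded val tau S Z x /\
       left_small k.+1 (model_mx val S Z x) (g * (k%:R ^+ 2 / n%:R))))).
    apply: Pr_sub => [|x [hb hl]]; first exact: fdist_matrix_law.
    split=> //; apply: left_small_mono hl; rewrite ler_wpM2r // divr_ge0 ?exprn_ge0 //.
  apply: le_trans (hfin n k n1n kk kg F p val S Z N adm hrow) _.
  by rewrite ler_wpM2l // lerD2l ler_expR lerN2 ler_wpM2r.
rewrite lee_fin; have [f1 f2] := hKa n n0; have [f3 _] := hKb n n0.
rewrite mul1r in f3; rewrite (_ : 2 * (h / 2) = h) in f2; last by field.
set y := expR (- (h / 2) * _) in y0 f1 f2 f3 *.
have f4 : C0 * (n%:R ^+ 2 * expR (- (a * n%:R))) <= C0 * (Ka * y) by rewrite ler_wpM2l.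
apply: (@le_trans _ _ ((C0 * Ka + Ka + Kb) * y)); last first.
  by rewrite ler_wpM2r // lerDl expR_ge0.
rewrite [leLHS](_ : _ = C0 * (n%:R ^+ 2 * expR (- (a * n%:R))) +
   n%:R ^+ 2 * expR (- (h * n%:R `^ (2 * eps))) + n%:R ^+ 2 * expR (- n%:R)); last by ring.
rewrite [leRHS](_ : _ = C0 * (Ka * y) + Ka * y + Kb * y); last by ring.
by apply: lerD => //; apply: lerD.
Qed.
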